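(* Let $(W,\mathcal S)$ be a Coxeter system, $\underline s\in\mathcal S^n$ a sequence of simple reflections and $x\in W$. The set $\mathbb L^{\beta}_{\underline s}(x)=\{\beta\circ l\;:\;l\in\mathbb L_{\underline s}(x)\}$ (where $l$ runs over the leaves of $\mathbb T_{\underline s}$ colored by $B_{\underline{s^x}}$) is a basis of $\mathrm{Hom}(B_{\underline s},R_x)$ as a right $R$-module.
   Context: Setting. $l$ is the length function of $W$, $m(s,r)$ the order of $sr$. $V$ is the following representation of $W$ over a field $k$. If $W$ is the finite Weyl group of a semisimple split simply connected algebraic group $G\supset B\supset T$ over a field $k$ of characteristic different from $2$, $V=\mathrm{Lie}(T)$, taken to be reflection faithful (i.e. faithful, and $V^w$ has codimension one iff $w$ is a conjugate of an element of $\mathcal S$). If $W$ is an affine Weyl group, $V$ is a realization over $k$ of the affine Cartan matrix, where $k$ has characteristic $0$; if $k$ has positive characteristic $p$ larger than the Coxeter number of the finite Weyl group, only sequences which are reduced expressions of elements of the finite subset $\widehat W^\circ$ (defined below), and $x\in\widehat W^\circ$, are considered. For other Coxeter systems, $k=\mathbb R$ and $V$ is the rootic representation (Bourbaki's ''geometric representation'', with basis $(e_s)_{s\in\mathcal S}$, $s(v)=v-2B(e_s,v)e_s$, $B(e_s,e_r)=-\cos(\pi/m(s,r))$). Definition of $\widehat W^\circ$: for a root system $\Phi$ with Weyl group $W_f$, longest element $w_0$, half sum of positive roots $\rho$, let $\widehat W=W_f\ltimes\mathbb Z\Phi$ act on weights by $w\cdot\lambda=w(\lambda+\rho)-\rho$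 ($w\in W_f$), $\gamma\cdot\lambda=\lambda+p\gamma$ ($\gamma\in\mathbb Z\Phi$), with simple reflections those in the walls of $\{\lambda:0<\langle\lambda+\rho,\alpha^\vee\rangle<p\ \forall\alpha>0\}$; let $\hat w_0$ be the longest element of $w_0\{w:0\le\langle w\cdot0,\alpha^\vee\rangle<p\ \text{for all simple }\alpha\}$; $\widehat W^\circ=\{w\le\hat w_0\}$ (Bruhat order). Bimodules. $R$ is the algebra of regular functions on $V$, graded with $R_2=V^*$ and zero in odd degrees; $M(n)_i=M_{i+n}$; $R^s$ is the ring of $s$-invariants; $B_s=R\otimes_{R^s}R(1)$; tensor products over $R$ are written by juxtaposition; $B_{\underline s}=B_{s_1}\cdots B_{s_n}$ ($R$ for the empty sequence). $\mathrm{Hom}$ is the graded space of $(R,R)$-bimodule morphisms of all degrees. For $x\in W$, $R_x$ is $R$ as a left module with right action twisted: $m\cdot r=m\,x(r)$. One has $R_xR_y\cong R_{xy}$. $\beta:B_s\to R_s$ is $p\otimes q\mapsto p\,s(q)$, and for a reduced expression $\underline x=(x_1,\dots,x_a)$ of $x$, $\beta:B_{\underline x}\to R_{x_1}\cdots R_{x_a}\cong R_x$ is the tensor product of these maps. Basic morphisms. Let $x_s\in V^*$ be an equation of the hyperplane fixed by $s$; $R=R^s\oplus x_sR^s$, $\partial_s(p_1+x_sp_2)=p_2$ for $p_1,p_2\in R^s$. $m_s:B_s\to R$, $p\otimes q\mapsto pq$; $j_s:B_sB_s\to B_s$, $p\otimes q\otimes r\mapsto p\,\partial_s(q)\otimes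 r$; for $m(s,r)<\infty$, $f_{sr}$ is the unique degree $0$ morphism $B_sB_rB_s\cdots\to B_rB_sB_r\cdots$ ($m(s,r)$ factors each) sending $1\otimes\cdots\otimes1$ to $1\otimes\cdots\otimes1$. Choices. In the graph of reduced expressions of an element (edges = braid moves) each directed path gives a composition of morphisms $\mathrm{id}\otimes f_{sr}\otimes\mathrm{id}$. For each $x\in W$ fix a reduced expression $\underline{s^x}$; for each reduced expression $\underline t$ of $x$ fix a path from $\underline t$ to $\underline{s^x}$, giving $F(\underline t,\underline{s^x}):B_{\underline t}\to B_{\underline{s^x}}$; and for each $s\in\mathcal S$ with $l(xs)<l(x)$ fix a path from $\underline t$ to some reduced expression of $x$ ending in $s$, giving $F_s(\underline t)$. The tree $\mathbb T_{\underline s}$, $\underline s=(s_1,\dots,s_n)$. A perfect binary tree of depth $n$; a node of depth $k-1$ is colored by $B_{t_1}\cdots B_{t_i}B_{s_k}\cdots B_{s_n}$ with $\underline t=(t_1,\dots,t_i)$ reduced; the root has $\underline t=\emptyset$. Case 1: $l(t_1\cdots t_is_k)>l(t_1\cdots t_i)$. One child has $\underline t$ unchanged with edge $\mathrm{id}^i\otimes m_{s_k}\otimes\mathrm{id}$; the other has $\underline t$ replaced by $(t_1,\dots,t_i,s_k)$ with edge $\mathrm{id}$. Case 2: $l(t_1\cdots t_is_k)<l(t_1\cdots t_i)$. Let $F_{s_k}(\underline t):B_{\underline t}\to B_{t_1'}\cdots B_{t'_{i-1}}B_{s_k}$, $\varphi=(\mathrm{id}^{i-1}\otimes j_{s_k}\otimes\mathrm{id})\circ(F_{s_k}(\underline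 t)\otimes\mathrm{id})$. One child has $\underline t$ replaced by $(t_1',\dots,t'_{i-1})$ with edge $(\mathrm{id}^{i-1}\otimes m_{s_k}\otimes\mathrm{id})\circ\varphi$; the other has $\underline t$ replaced by $(t'_1,\dots,t'_{i-1},s_k)$ with edge $\varphi$. At the last step $k=n$ each edge is further composed with $F(\underline t,\underline{s^x})$, where $\underline t$ is the reduced expression, of an element $x$, obtained. A leaf colored by $B_{\underline{s^x}}$ is identified with the composition of the edges from the root, an element of $\mathrm{Hom}(B_{\underline s},B_{\underline{s^x}})$. $\mathbb L_{\underline s}(x)$ is the set of leaves colored by $B_{\underline{s^x}}$. *)

(* Defs.v *)
From HB Require Import structures.
From mathcomp Require Import all_boot all_order all_algebra.
From mathcomp Require Import boolp reals trigo.
From mathcomp Require Import -(notations) freeg mpoly.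

Set Implicit Arguments.
Unset Strict Implicit.
Unset Printing Implicit Defensive.

Import Order.TTheory GRing.Theory Num.Theory.
Local Open Scope ring_scope.

Definition least (P : nat -> Prop) : nat :=
  match pselect (exists n, `[< P n >]) with
  | left exP => ex_minn exP
  | right _ => 0%N
  end.

(* Definite description; the default [x0] is taken when nothing satisfies P. *)
Definition the (T : Type) (x0 : T) (P : T -> Prop) : T :=
  match pselect (exists x, P x) with
  | left exP => sval (cid exP)
  | right _ => x0
  end.

(* The additive map characterized by [P] (in practice: by its values on pure
   tensors). *)
Definition the_additive (M N : zmodType) (P : (M -> N) -> Prop) : M -> N :=
  the (fun=> 0) (fun h => (forall x y, h (x + y) = h x + h y) /\ P h).

Section Coxeter.
Variables (W : groupType) (S : finType) (g : S -> W).

Definition wd (t : seq S) : W := \prod_(s <- t) g s.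

(* The presentation by the relations (sr)^m(s,r) = 1 is expressed by the
   universal property of the group it defines. *)
Record coxeter_system : Prop := CoxeterSystem {
  coxeter_inj : injective g;
  coxeter_gen : forall w, exists t, w = wd t;
  coxeter_order2 : forall s, g s <> 1%g /\ (g s * g s = 1)%g;
  coxeter_pres : forall (G : groupType) (f : S -> G),
    (forall s r n, (0 < n)%N ->
       ((g s * g r) ^+ n = 1)%g -> ((f s * f r) ^+ n = 1)%g) ->
    exists2 h : W -> G,
      (forall x y, h (x * y)%g = (h x * h y)%g) & (forall s, h (g s) = f s)
}.

(* [mord s r = 0] stands for an infinite order. *)
Definition mord (s r : S) : nat :=
  least (fun n => (0 < n)%N /\ ((g s * g r) ^+ n = 1)%g).

Definition len (w : W) : nat :=
  least (fun n => exists2 t, size t = n & wd t = w).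

Definition rexpr (t : seq S) : bool := len (wd t) == size t.

Definition reflection_conj (w : W) : Prop :=
  exists y s, w = (y * g s * y^-1)%g.

Inductive bruhat (x : W) : W -> Prop :=
| bruhat_refl : bruhat x x
| bruhat_step y z : bruhat x y -> reflection_conj (y^-1 * z)%g ->
    (len y < len z)%N -> bruhat x z.

Definition longest (P : W -> Prop) (w : W) : Prop :=
  P w /\ forall y, P y -> (len y <= len w)%N.

(* [alt s r n] is s, r, s, ... with n terms. *)
Fixpoint alt (s r : S) (n : nat) : seq S :=
  if n is n'.+1 then s :: alt r s n' else [::].

(* Directed paths in the graph of reduced expressions of an element (braid
   moves preserve reduced expressions). *)
Inductive bpath : seq S -> seq S -> Type :=
| bp_nil t : bpath t t
| bp_step a s r b u : s != r -> (0 < mord s r)%N ->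
    bpath (a ++ (alt r s (mord s r) ++ b)) u ->
    bpath (a ++ (alt s r (mord s r) ++ b)) u.

End Coxeter.

Section Bimodules.
Variable R : comNzRingType.

(* Only the components of the grading are recorded, as predicates. *)
Record bimod := Bimod {
  bcar :> zmodType;
  lact : R -> bcar -> bcar;
  ract : bcar -> R -> bcar;
  gr : int -> bcar -> Prop;
  lact1 : forall x, lact 1 x = x;
  lactM : forall a b x, lact (a * b) x = lact a (lact b x);
  lactDl : forall a b x, lact (a + b) x = lact a x + lact b x;
  lactDr : forall a x y, lact a (x + y) = lact a x + lact a y;
  ract1 : forall x, ract x 1 = x;
  ractM : forall a b x, ract x (a * b) = ract (ract x a) b;
  ractDl : forall a x y, ract (x + y) a = ract x a + ract y a;
  ractDr : forall a b x, ract x (a + b) = ract x a + ract x b;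
  lractA : forall a x b, ract (lact a x) b = lact a (ract x b)
}.

Definition shift (n : int) (M : bimod) : bimod :=
  @Bimod M (@lact M) (@ract M) (fun i => @gr M (i + n))
    (@lact1 M) (@lactM M) (@lactDl M) (@lactDr M)
    (@ract1 M) (@ractM M) (@ractDl M) (@ractDr M) (@lractA M).

Definition bimod_morphism (M N : bimod) (f : M -> N) : Prop :=
  [/\ forall x y, f (x + y) = f x + f y,
      forall a x, f (lact a x) = lact a (f x) &
      forall x a, f (ract x a) = ract (f x) a].

Definition hom_deg (M N : bimod) (d : int) (f : M -> N) : Prop :=
  bimod_morphism f /\ forall i x, gr i x -> gr (i + d) (f x).

(* The graded Hom: finite sums of homogeneous bimodule morphisms. *)
Definition Hom (M N : bimod) (f : M -> N) : Prop :=
  exists (n : nat) (d : 'I_n -> int) (h : 'I_n -> M -> N),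
    (forall i, hom_deg (d i) (h i)) /\ (forall x, f x = \sum_i h i x).

(* [X] is a basis of Hom(M,N) as a right R-module, for (f.a)(x) = f(x).a. *)
Definition right_basis (M N : bimod) (X : (M -> N) -> Prop) : Prop :=
  [/\ forall f, X f -> Hom f,
      forall f, Hom f -> exists (n : nat) (h : 'I_n -> M -> N) (c : 'I_n -> R),
        (forall i, X (h i)) /\ (forall x, f x = \sum_i ract (h i x) (c i)) &
      forall (n : nat) (h : 'I_n -> M -> N) (c : 'I_n -> R),
        (forall i, X (h i)) -> injective h ->
        (forall x, \sum_i ract (h i x) (c i) = 0) -> forall i, c i = 0].

Section Tensor.
Variables (A : R -> Prop) (M N : bimod).

Definition tfree : zmodType := FreegDefs.type_of (Phant int) (Phant (M * N)%type).

Definition tgen (x : M) (y : N) : tfree := Freeg [:: (1 : int, (x, y))].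

Inductive trel : tfree -> Prop :=
| trel0 : trel 0
| trelB u v : trel u -> trel v -> trel (u - v)
| trelDl x x' y : trel (tgen (x + x') y - tgen x y - tgen x' y)
| trelDr x y y' : trel (tgen x (y + y') - tgen x y - tgen x y')
| trelA x a y : A a -> trel (tgen (ract x a) y - tgen x (lact a y)).

Definition trelb : pred tfree := fun u => `[< trel u >].

Lemma trelb_zmod : zmod_closed trelb.
Proof.
split=> [|u v]; first exact/asboolP/trel0.
by move=> /asboolP hu /asboolP hv; exact/asboolP/trelB.
Qed.

HB.instance Definition _ := GRing.isZmodClosed.Build tfree trelb trelb_zmod.

Definition trel_closed : zmodClosed tfree := GRing.ZmodClosed.clone _ trelb _.

(* M ⊗_A N: the free abelian group on M × N modulo biadditivity and
   xa ⊗ y = x ⊗ ay for a in A. *)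
Definition tcar : zmodType := Quotient.quot trel_closed.

Definition tpure (x : M) (y : N) : tcar :=
  \pi_(Quotient.quot trel_closed)%qT (tgen x y).

Lemma tens_eq (u v : tfree) : trel (u - v) ->
  \pi_(Quotient.quot trel_closed)%qT u =
  \pi_(Quotient.quot trel_closed)%qT v.
Proof.
move=> h; apply/eqP; rewrite -Quotient.idealrBE; exact/asboolP.
Qed.

Lemma tpureDl x x' y : tpure (x + x') y = tpure x y + tpure x' y.
Proof.
rewrite /tpure -[RHS]raddfD; apply: tens_eq; rewrite opprD addrA; exact: trelDl.
Qed.

Lemma tpureDr x y y' : tpure x (y + y') = tpure x y + tpure x y'.
Proof.
rewrite /tpure -[RHS]raddfD; apply: tens_eq; rewrite opprD addrA; exact: trelDr.
Qed.

Lemma tpureA x a y : A a -> tpure (ract x a) y = tpure x (lact a y).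
Proof. by move=> Aa; apply: tens_eq; exact: trelA. Qed.

Lemma tcar_ind (P : tcar -> Prop) :
  P 0 -> (forall u v, P u -> P v -> P (u - v)) -> (forall x y, P (tpure x y)) ->
  forall u, P u.
Proof.
move=> P0 PB Pt u.
have PN v : P v -> P (- v) by move=> Pv; rewrite -sub0r; apply: PB.
have PD v w : P v -> P w -> P (v + w).
  by move=> Pv Pw; rewrite -[w]opprK; apply: PB => //; apply: PN.
have PM v n : P v -> P (v *+ n).
  by move=> Pv; elim: n => [|n IHn] //; rewrite mulrS; apply: PD.
have PZ v (z : int) : P v -> P (v *~ z).
  by move=> Pv; case: z => n; [apply: PM | apply/PN/PM].
rewrite -[u]reprK -[repr u]freeg_sumE raddf_sum.
apply: big_ind => // -[x y] _.
rewrite -[coeff _ _]intz -freegU_mulz raddfMz; apply: PZ; exact: Pt.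
Qed.

Definition tlift (P : zmodType) (f : M -> N -> P) (u : tcar) : P :=
  fglift (fun xy : M * N => f xy.1 xy.2 : zmodule P) (repr u).

Section Lift.
Variables (P : zmodType) (f : M -> N -> P).
Hypothesis fDl : forall x x' y, f (x + x') y = f x y + f x' y.
Hypothesis fDr : forall x y y', f x (y + y') = f x y + f x y'.
Hypothesis fA : forall x a y, A a -> f (ract x a) y = f x (lact a y).

Let F (u : tfree) : P := fglift (fun xy : M * N => f xy.1 xy.2 : zmodule P) u.

Let FB u v : F (u - v) = F u - F v.
Proof. exact: (@lift_is_additive int (M * N)%type (zmodule P) _ u v). Qed.

Let Fgen x y : F (tgen x y) = f x y.
Proof. by rewrite /F liftU /= scale1r. Qed.

Let Frel u : trel u -> F u = 0.
Proof.
elim=> [|v w _ Fv _ Fw|x x' y|x y y'|x a y Aa].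
- by rewrite -[X in F X](subrr 0) FB subrr.
- by rewrite FB Fv Fw subrr.
- by rewrite !FB !Fgen fDl [f x y + _]addrC addrK subrr.
- by rewrite !FB !Fgen fDr [f x y + _]addrC addrK subrr.
- by rewrite FB !Fgen fA // subrr.
Qed.

Let tlift_pi u : tlift f (\pi_(Quotient.quot trel_closed)%qT u) = F u.
Proof.
apply/eqP; rewrite -subr_eq0; apply/eqP.
rewrite -[LHS]FB; apply: Frel; apply/asboolP.
have := Quotient.idealrBE trel_closed
  (repr (\pi_(Quotient.quot trel_closed)%qT u)) u.
by rewrite reprK eqxx.
Qed.

Lemma tliftE x y : tlift f (tpure x y) = f x y.
Proof. by rewrite tlift_pi Fgen. Qed.

Lemma tliftD : {morph tlift f : u v / u + v}.
Proof.
move=> u v; rewrite -[u]reprK -[v]reprK -raddfD !tlift_pi.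
by rewrite -{1}[repr v]opprK FB -[- repr v]sub0r FB (Frel trel0) sub0r opprK.
Qed.

End Lift.

Lemma tcar_ext (P : zmodType) (h h' : tcar -> P) :
  {morph h : u v / u + v} -> {morph h' : u v / u + v} ->
  (forall x y, h (tpure x y) = h' (tpure x y)) -> h =1 h'.
Proof.
have morphB (k : tcar -> P) : {morph k : u v / u + v} ->
    k 0 = 0 /\ {morph k : u v / u - v}.
  move=> kD; have k0 : k 0 = 0 by apply: (addrI (k 0)); rewrite -kD !addr0.
  split=> // u v; apply: (addIr (k v)); rewrite -kD !addrNK //.
move=> /morphB[h0 hB] /morphB[h'0 h'B] hh'; elim/tcar_ind.
- by rewrite h0 h'0.
- by move=> u v eu ev; rewrite hB h'B eu ev.
- exact: hh'.
Qed.

Definition tlact (a : R) : tcar -> tcar :=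
  tlift (fun x y => tpure (lact a x) y).
Definition tract (u : tcar) (a : R) : tcar :=
  tlift (fun x y => tpure x (ract y a)) u.

Lemma tlactDr a : {morph tlact a : u v / u + v}.
Proof.
apply: tliftD => [x x' y|x y y'|x b y Ab].
- by rewrite lactDr tpureDl.
- by rewrite tpureDr.
- by rewrite -lractA tpureA.
Qed.

Lemma tlactE a x y : tlact a (tpure x y) = tpure (lact a x) y.
Proof.
rewrite /tlact tliftE // => [x1 x' y1|x1 y1 y'|x1 b y1 Ab].
- by rewrite lactDr tpureDl.
- by rewrite tpureDr.
- by rewrite -lractA tpureA.
Qed.

Lemma tractDl a : {morph tract^~ a : u v / u + v}.
Proof.
apply: tliftD => [x x' y|x y y'|x b y Ab].
- by rewrite tpureDl.
- by rewrite ractDl tpureDr.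
- by rewrite lractA tpureA.
Qed.

Lemma tractE a x y : tract (tpure x y) a = tpure x (ract y a).
Proof.
rewrite /tract tliftE // => [x1 x' y1|x1 y1 y'|x1 b y1 Ab].
- by rewrite tpureDl.
- by rewrite ractDl tpureDr.
- by rewrite lractA tpureA.
Qed.

Definition tgr (i : int) (u : tcar) : Prop :=
  exists (n : nat) (e : 'I_n -> int) (x : 'I_n -> M) (y : 'I_n -> N),
    (forall j, gr (e j) (x j) /\ gr (i - e j) (y j)) /\
    u = \sum_j tpure (x j) (y j).

Lemma tlact1 u : tlact 1 u = u.
Proof.
move: u; apply: tcar_ext => // [|x y]; first exact: tlactDr.
by rewrite tlactE lact1.
Qed.

Lemma tlactM a b u : tlact (a * b) u = tlact a (tlact b u).
Proof.
move: u; apply: tcar_ext => [||x y]; first exact: tlactDr.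
  by move=> u v; rewrite !tlactDr.
by rewrite !tlactE lactM.
Qed.

Lemma tlactDl a b u : tlact (a + b) u = tlact a u + tlact b u.
Proof.
move: u; apply: (tcar_ext (h' := fun u => tlact a u + tlact b u)) => [||x y].
- exact: tlactDr.
- by move=> u v; rewrite !tlactDr addrACA.
- by rewrite !tlactE lactDl tpureDl.
Qed.

Lemma tract1 u : tract u 1 = u.
Proof.
move: u; apply: (tcar_ext (h := tract^~ 1)) => // [|x y].
  exact: tractDl.
by rewrite tractE ract1.
Qed.

Lemma tractM a b u : tract u (a * b) = tract (tract u a) b.
Proof.
move: u; apply: (tcar_ext (h := tract^~ (a * b))
  (h' := fun u => tract (tract u a) b)) => [||x y]; first exact: tractDl.
  by move=> u v; rewrite !tractDl.
by rewrite !tractE ractM.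
Qed.

Lemma tractDr a b u : tract u (a + b) = tract u a + tract u b.
Proof.
move: u; apply: (tcar_ext (h := tract^~ (a + b))
  (h' := fun u => tract u a + tract u b)) => [||x y].
- exact: tractDl.
- by move=> u v; rewrite !tractDl addrACA.
- by rewrite !tractE ractDr tpureDr.
Qed.

Lemma tlractA a u b : tract (tlact a u) b = tlact a (tract u b).
Proof.
move: u; apply: (tcar_ext (h := fun u => tract (tlact a u) b)
  (h' := fun u => tlact a (tract u b))) => [||x y].
- by move=> u v; rewrite tlactDr tractDl.
- by move=> u v; rewrite tractDl tlactDr.
- by rewrite tlactE !tractE tlactE.
Qed.

Definition tens : bimod :=
  @Bimod tcar tlact tract tgr tlact1 tlactM tlactDl tlactDr
    tract1 tractM (fun a => tractDl a) tractDr tlractA.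

End Tensor.
End Bimodules.

Arguments tpure {R} A {M N} x y.

Section Representation.
Variables (W : groupType) (S : finType) (g : S -> W).
Variables (k : fieldType) (d : nat) (rho : W -> 'M[k]_d).

(* V is k^d (column vectors) and R the algebra of polynomial functions on V. *)
Local Notation R := (mpoly d k).

(* The linear form v |-> a v, as an element of R. *)
Definition linear_form (a : 'rV[k]_d) : R :=
  \sum_j a 0 j *: mpolyX k (mnm1 j).

(* (w.p)(v) = p(w^-1 v). *)
Definition act (w : W) (p : R) : R :=
  comp_mpoly [tuple linear_form (row i (rho w^-1%g)) | i < d] p.

Definition invariant (s : S) (p : R) : Prop := act (g s) p = p.

(* V^* is in degree 2. *)
Definition poly_gr (i : int) (p : R) : Prop :=
  forall mm, mm \in msupp p -> i = (2 * mdeg mm)%N%:Z.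

Definition twist_ract (x : W) (p a : R) : R := p * act x a.

Lemma twist_ract1 x p : twist_ract x p 1 = p.
Proof. by rewrite /twist_ract /act rmorph1 mulr1. Qed.

Lemma twist_ractM x a b p :
  twist_ract x p (a * b) = twist_ract x (twist_ract x p a) b.
Proof. by rewrite /twist_ract /act rmorphM mulrA. Qed.

Lemma twist_ractDr x a b p :
  twist_ract x p (a + b) = twist_ract x p a + twist_ract x p b.
Proof. by rewrite /twist_ract /act rmorphD mulrDr. Qed.

Definition Rx (x : W) : bimod R :=
  @Bimod _ R *%R (twist_ract x) poly_gr
    (@mul1r R) (fun a b p => esym (mulrA a b p))
    (fun a b p => mulrDl a b p) (@mulrDr R)
    (twist_ract1 x) (twist_ractM x)
    (fun a p q => mulrDl p q _) (twist_ractDr x)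
    (fun a p b => esym (mulrA a p _)).

Definition Rb : bimod R :=
  @Bimod _ R *%R *%R poly_gr
    (@mul1r R) (fun a b p => esym (mulrA a b p))
    (fun a b p => mulrDl a b p) (@mulrDr R)
    (@mulr1 R) (fun a b p => mulrA p a b)
    (fun a p q => mulrDl p q a) (fun a b p => mulrDr p a b)
    (fun a p b => esym (mulrA a p b)).

Definition Bs (s : S) : bimod R := shift 1 (tens (invariant s) Rb Rb).

Definition pures (s : S) (p q : R) : Bs s :=
  @tpure R (invariant s) Rb Rb p q.

Definition tensR (M N : bimod R) : bimod R := tens (fun=> True) M N.

Definition pureR (M N : bimod R) (x : M) (y : N) : tensR M N :=
  tpure (fun=> True) x y.

(* B_(s_1) ⊗ (B_(s_2) ⊗ ... (B_(s_n) ⊗ R)), i.e. B_(s_1)...B_(s_n) up to the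
   unit isomorphism M ⊗ R = M. *)
Fixpoint B (t : seq S) : bimod R :=
  if t is s :: t' then tensR (Bs s) (B t') else Rb.

Fixpoint one (t : seq S) : B t :=
  match t with
  | [::] => 1
  | s :: t' => pureR (pures s 1 1) (one t')
  end.

Definition castB (t u : seq S) (e : t = u) : B t -> B u :=
  fun b => eq_rect t (fun v => B v) b u e.

(* The canonical isomorphism B_t ⊗ B_u = B_(t ++ u), as a function of two
   arguments. *)
Fixpoint catB (t u : seq S) : B t -> B u -> B (t ++ u) :=
  match t return B t -> B u -> B (t ++ u) with
  | [::] => fun a c => lact a c
  | s :: t' => fun b c =>
      the_additive (fun h : B (s :: t') -> B (s :: t' ++ u) =>
        forall e b', h (pureR e b') = pureR e (catB b' c)) b
  end.

(* id_(B_t) ⊗ phi ⊗ id_(B_u). *)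
Definition whisker (t u a c : seq S) (phi : B a -> B c) :
    B (t ++ (a ++ u)) -> B (t ++ (c ++ u)) :=
  the_additive (fun h =>
    forall x y z, h (catB x (catB y z)) = catB x (catB (phi y) z)).

Section BasicMorphisms.
(* [xs s] in V^* is an equation of the hyperplane fixed by s. *)
Variable xs : S -> 'rV[k]_d.

Definition demazure (s : S) (p : R) : R :=
  the 0 (fun p2 => invariant s p2 /\
    exists2 p1, invariant s p1 & p = p1 + linear_form (xs s) * p2).

Definition mult (s : S) : Bs s -> R :=
  the_additive (fun h => forall p q, h (pures s p q) = p * q).

Definition m_ (s : S) : B [:: s] -> B [::] :=
  the_additive (fun h => forall b (c : B [::]), h (pureR b c) = mult b * c).

(* j_s : B_s B_s -> B_s; the tensor (p ⊗ q) ⊗ (q' ⊗ r) is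
   p ⊗ qq' ⊗ r. *)
Definition j_ (s : S) : B [:: s; s] -> B [:: s] :=
  the_additive (fun h => forall p q q' r (c : B [::]),
    h (pureR (pures s p q) (pureR (pures s q' r) c)) =
    pureR (pures s (p * demazure s (q * q')) r) c).

Definition beta1 (s : S) : Bs s -> Rx (g s) :=
  the_additive (fun h => forall p q, h (pures s p q) = p * act (g s) q).

(* The tensor product of the maps [beta1], followed by the isomorphisms
   R_x ⊗ R_y = R_xy, p ⊗ q |-> p x(q). *)
Fixpoint beta (t : seq S) : B t -> Rx (wd g t) :=
  match t return B t -> Rx (wd g t) with
  | [::] => fun a => a
  | s :: t' =>
      the_additive (fun h : B (s :: t') -> Rx (wd g (s :: t')) =>
        forall e b, h (pureR e b) = beta1 e * act (g s) (beta b))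
  end.

Local Notation mord := (mord g).
Local Notation bp := (bpath g).
Local Notation len := (len g).
Local Notation rexpr := (rexpr g).
Local Notation wd := (wd g).

Variable f : forall s r, B (alt s r (mord s r)) -> B (alt r s (mord s r)).

Definition braid_morphisms : Prop :=
  forall s r, s != r -> (0 < mord s r)%N ->
    hom_deg 0 (f (s := s) (r := r)) /\
    f (one (alt s r (mord s r))) = one (alt r s (mord s r)).

Fixpoint path_mor (t u : seq S) (p : bp t u) : B t -> B u :=
  match p in bpath _ t u return B t -> B u with
  | bp_nil t => id
  | bp_step a s r b u _ _ p' => path_mor p' \o whisker (f (s := s) (r := r))
  end.

(* sx w is the fixed reduced expression of w, F the paths ending at it,
   Fs t s the path from t to a reduced expression ending in s. *)
Variable sx : W -> seq S.
Variable F : forall t, rexpr t -> bp t (sx (wd t)).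
Variable Fs : forall t s, rexpr t -> (len (wd t * g s)%g < len (wd t))%N ->
  {t' : seq S & bp t (rcons t' s)}.

(* Descent case, with e = (t'_1, ..., t'_(i-1)) and [Fs t s] going from t to
   (t'_1, ..., t'_(i-1), s). *)
Definition phi (t u : seq S) (s : S) (e : {t' : seq S & bp t (rcons t' s)}) :
    B (t ++ s :: u) -> B (tag e ++ s :: u) :=
  whisker (t := tag e) (u := u) (j_ (s := s))
  \o castB (cat_rcons s (tag e) (s :: u))
  \o whisker (t := [::]) (u := s :: u) (path_mor (tagged e)).

(* [node su t u l]: the tree of su has a node colored by B_t B_u (t the reduced
   expression built so far, u the letters not yet read) such that the
   composition of the edges from the root to it is l. *)
Inductive node (su : seq S) :
    forall t u : seq S, (B su -> B (t ++ u)) -> Prop :=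
| node_root : @node su [::] su id
| node_up0 t s u l :
    (len (wd t) < len (wd t * g s)%g)%N -> @node su t (s :: u) l ->
    @node su t u (whisker (t := t) (u := u) (m_ (s := s)) \o l)
| node_up1 t s u l :
    (len (wd t) < len (wd t * g s)%g)%N -> @node su t (s :: u) l ->
    @node su (rcons t s) u (castB (esym (cat_rcons s t u)) \o l)
| node_down0 t s u l (ht : rexpr t)
    (hs : (len (wd t * g s)%g < len (wd t))%N) :
    let e := Fs ht hs in @node su t (s :: u) l ->
    @node su (tag e) u
      (whisker (t := tag e) (u := u) (m_ (s := s)) \o phi (u := u) e \o l)
| node_down1 t s u l (ht : rexpr t)
    (hs : (len (wd t * g s)%g < len (wd t))%N) :
    let e := Fs ht hs in @node su t (s :: u) l ->
    @node su (rcons (tag e) s) u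
      (castB (esym (cat_rcons s (tag e) u)) \o phi (u := u) e \o l).

(* The leaves colored by B_(sx x); for the empty sequence the tree is reduced
   to its root and [F] is the identity. *)
Inductive leaf (su : seq S) : forall x : W, (B su -> B (sx x)) -> Prop :=
| leaf_intro t l (ht : rexpr t) : @node su t [::] l ->
    @leaf su (wd t) (path_mor (F ht) \o castB (cats0 t) \o l).

Definition beta_leaf (su : seq S) (x : W) (h : B su -> Rx x) : Prop :=
  exists2 l, @leaf su x l & h = (fun b => beta (l b)).

End BasicMorphisms.
End Representation.

Section RootSystems.
Variables (r : nat) (I : finType).

(* A reduced root system in rat^r, with a base indexed by I; [coroot a] is
   the linear form b |-> <b, a^vee>. *)
Record root_datum := RootDatum {
  roots : seq 'rV[rat]_r;
  coroot : 'rV[rat]_r -> 'cV[rat]_r;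
  simple : I -> 'rV[rat]_r
}.

Definition pairing (Phi : root_datum) (b a : 'rV[rat]_r) : rat :=
  (b *m coroot Phi a) 0 0.

Definition nonneg_root (Phi : root_datum) (a : 'rV[rat]_r) : Prop :=
  exists c : I -> nat, a = \sum_i (c i)%:R *: simple Phi i.

Record root_system (Phi : root_datum) : Prop := RootSystem {
  roots_uniq : uniq (roots Phi);
  roots_span : (<<roots Phi>>)%VS = fullv;
  roots_neq0 : 0 \notin roots Phi;
  roots_pair2 : forall a, a \in roots Phi -> pairing Phi a a = 2%:R;
  roots_refl : forall a b, a \in roots Phi -> b \in roots Phi ->
    b - pairing Phi b a *: a \in roots Phi;
  roots_int : forall a b, a \in roots Phi -> b \in roots Phi ->
    pairing Phi b a \is a Num.int;
  roots_reduced : forall a c, a \in roots Phi -> c *: a \in roots Phi ->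
    c = 1 \/ c = -1;
  simple_roots : forall i, simple Phi i \in roots Phi;
  simple_free : forall c : I -> rat,
    \sum_i c i *: simple Phi i = 0 -> forall i, c i = 0;
  simple_base : forall a, a \in roots Phi ->
    nonneg_root Phi a \/ nonneg_root Phi (- a)
}.

Variable Phi : root_datum.

Local Notation E := 'rV[rat]_r.
Local Notation "<| b , a |>" := (pairing Phi b a).

Definition irreducible_roots : Prop :=
  roots Phi <> [::] /\
  forall Q : pred E,
    (exists2 a, a \in roots Phi & Q a) ->
    (exists2 b, b \in roots Phi & ~~ Q b) ->
  exists a b, [/\ a \in roots Phi, b \in roots Phi, Q a, ~~ Q b &
    <|a, b|> <> 0].

(* a_ij = <alpha_j, alpha_i^vee>, an integer. *)
Definition cartan (i j : I) : int := numq <|simple Phi j, simple Phi i|>.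

Definition refl (a b : E) : E := b - <|b, a|> *: a.

Definition pos_root (a : E) : Prop := a \in roots Phi /\ nonneg_root Phi a.

Definition half_sum : E :=
  2%:R^-1 *: \sum_(a <- roots Phi | `[< nonneg_root Phi a >]) a.

Definition finite_weyl_elt (w : E -> E) : Prop :=
  exists l : seq E, all (mem (roots Phi)) l /\
    forall b, w b = foldr refl b l.

Definition in_root_lattice (c : E) : Prop :=
  exists z : E -> int, c = \sum_(a <- roots Phi) (z a)%:~R *: a.

(* The order of a Coxeter element. *)
Definition coxeter_number : nat :=
  least (fun n => (0 < n)%N /\ forall b,
    iter n (fun c => foldr (fun i => refl (simple Phi i)) c (enum I)) b = b).

Definition dot (w : E -> E) (b : E) : E := w (b + half_sum) - half_sum.

Variable p : nat.

Definition affine_weyl_elt (w : E -> E) : Prop :=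
  exists w0 c, [/\ finite_weyl_elt w0, in_root_lattice c &
    forall b, w b = dot w0 b + p%:R *: c].

(* The hyperplane <b + rho, a^vee> = n p is a wall of the alcove
   0 < <b + rho, a^vee> < p (a > 0) when it contains a point at which all the
   inequalities for the other positive roots hold. *)
Definition wall (a : E) (n : nat) : Prop :=
  [/\ pos_root a, (n <= 1)%N & exists b,
    <|b + half_sum, a|> = (n * p)%:R /\
    forall a', pos_root a' -> a' <> a -> 0 < <|b + half_sum, a'|> < p%:R].

Definition wall_refl (a : E) (n : nat) (b : E) : E :=
  b - (<|b + half_sum, a|> - (n * p)%:R) *: a.

Section Affine.
Variables (W : groupType) (S : finType) (g : S -> W).

(* [tau] identifies W with W_f ⋉ ZΦ acting by the dot action on rat^r
   (equivalently, on the weights, since they span rat^r and the action is by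
   affine maps), and [g] with the reflections in the walls. *)
Record affine_identification (tau : W -> E -> E) : Prop := AffineId {
  aff_mul : forall x y b, tau (x * y)%g b = tau x (tau y b);
  aff_faithful : forall x, (forall b, tau x b = b) -> x = 1%g;
  aff_elt : forall x, affine_weyl_elt (tau x);
  aff_surj : forall w, affine_weyl_elt w -> exists x, tau x =1 w;
  aff_simple : forall s, exists a n, wall a n /\ tau (g s) =1 wall_refl a n;
  aff_walls : forall a n, wall a n -> exists s, tau (g s) =1 wall_refl a n
}.

Variable tau : W -> E -> E.

Definition in_finite_weyl (x : W) : Prop :=
  exists2 w, finite_weyl_elt w & tau x =1 dot w.

Definition restricted (x : W) : Prop :=
  forall i, 0 <= <|tau x 0, simple Phi i|> < p%:R.

Definition is_hat_w0 (h : W) : Prop :=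
  exists2 w0, longest g in_finite_weyl w0 &
    longest g (fun y => exists2 w, restricted w & y = (w0 * w)%g) h.

(* x in hat W^o. *)
Definition in_hatWo (x : W) : Prop :=
  exists2 h, is_hat_w0 h & bruhat g x h.

End Affine.
End RootSystems.

Section Standing.
Variables (W : groupType) (S : finType) (g : S -> W).

Definition weyl_group (r : nat) (Phi : root_datum r S) : Prop :=
  root_system Phi /\
  exists tau : W -> 'rV[rat]_r -> 'rV[rat]_r,
    [/\ forall x y b, tau (x * y)%g b = tau x (tau y b),
        forall x, (forall b, tau x b = b) -> x = 1%g &
        forall s, tau (g s) =1 refl Phi (simple Phi s)].

(* Indecomposable generalized Cartan matrices of affine type, i.e. with A c = 0
   for some c > 0 (Kac, Infinite dimensional Lie algebras, Corollary 4.3). *)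
Record affine_cartan (A : S -> S -> int) : Prop := AffineCartan {
  gcm_diag : forall s, A s s = 2;
  gcm_off : forall s r, s != r -> A s r <= 0;
  gcm_sym0 : forall s r, A s r = 0 -> A r s = 0;
  gcm_indec : (0 < #|S|)%N /\ forall Q : pred S,
    (exists s, Q s) -> (exists r, ~~ Q r) ->
    exists s r, [/\ Q s, ~~ Q r & A s r <> 0];
  gcm_affine : exists2 c : S -> rat, (forall s, 0 < c s) &
    forall s, \sum_r (A s r)%:~R * c r = 0
}.

Definition weyl_order (c : int) : nat :=
  match c with
  | Posz 0 => 2 | Posz 1 => 3 | Posz 2 => 4 | Posz 3 => 6 | _ => 0
  end%N.

(* (W,S) is the Weyl group of the affine Cartan matrix A. *)
Definition affine_weyl_group (A : S -> S -> int) : Prop :=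
  affine_cartan A /\
  forall s r, s != r -> mord g s r = weyl_order (A s r * A r s).

Section Reps.
Variables (k : fieldType) (d : nat) (rho : W -> 'M[k]_d).

Definition representation : Prop :=
  rho 1%g = 1%:M /\ forall x y, rho (x * y)%g = rho x *m rho y.

(* s(v) = v - <al s, v> alv s. *)
Definition reflection_representation
    (alv : S -> 'cV[k]_d) (al : S -> 'rV[k]_d) : Prop :=
  representation /\ forall s, rho (g s) = 1%:M - alv s *m al s.

Definition free_rows (al : S -> 'rV[k]_d) : Prop :=
  forall c : S -> k, \sum_s c s *: al s = 0 -> forall s, c s = 0.

(* A realization in the sense of Kac: al = roots, alv = coroots, both linearly
   independent, <al r, alv s> = a_sr and dim V = 2|S| - rank A. *)
Record realization (A : S -> S -> int)
    (alv : S -> 'cV[k]_d) (al : S -> 'rV[k]_d) : Prop := Realization {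
  real_roots : free_rows al;
  real_coroots : free_rows (fun s => (alv s)^T);
  real_pairing : forall s r, al r *m alv s = (A s r)%:~R%:M;
  real_dim : (d + \rank (\matrix_(i < #|S|, j < #|S|)
    ((A (enum_val i) (enum_val j))%:~R : k)) = 2 * #|S|)%N
}.

Definition realization_of (A : S -> S -> int) : Prop :=
  exists alv al, realization A alv al /\ reflection_representation alv al.

(* dim V^w = d - 1; the transpose is there because [kermx] is a kernel on row
   vectors. *)
Definition fixes_hyperplane (w : W) : Prop :=
  (\rank (kermx (rho w - 1%:M)^T)).+1 = d.

Definition reflection_faithful : Prop :=
  (forall w, rho w = 1%:M -> w = 1%g) /\
  (forall w, fixes_hyperplane w <-> reflection_conj g w).

Definition hyperplane_equation (s : S) (a : 'rV[k]_d) : Prop :=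
  forall v : 'cV[k]_d, a *m v = 0 <-> rho (g s) *m v = v.

End Reps.

Definition basis_vector (k : fieldType) (s : S) : 'cV[k]_#|S| :=
  delta_mx (enum_rank s) 0.

(* V = Lie(T) is the coroot lattice tensored with k (G being simply connected),
   with basis the simple coroots. *)
Definition lieT_root (k : fieldType) r (Phi : root_datum r S) (s : S) :
    'rV[k]_#|S| :=
  \row_j (cartan Phi (enum_val j) s)%:~R.

(* B(e_s, e_r), with -cos(pi/oo) = -1. *)
Definition rootic_form (K : realType) (s r : S) : K :=
  if mord g s r is n.+1 then - cos (pi / n.+1%:R) else -1.

Definition rootic_root (K : realType) (s : S) : 'rV[K]_#|S| :=
  \row_j (2%:R * rootic_form K s (enum_val j)).

(* The representations V that are considered, together with the sequences su
   and the elements x that are considered for each of them. *)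
Inductive standing : forall (k : fieldType) (d : nat),
    (W -> 'M[k]_d) -> seq S -> W -> Prop :=
| standing_finite (k : fieldType) r (Phi : root_datum r S)
    (rho : W -> 'M[k]_#|S|) su x :
    weyl_group Phi -> 2%N \notin [pchar k] ->
    reflection_representation rho (@basis_vector k) (lieT_root k Phi) ->
    reflection_faithful rho ->
    standing rho su x
| standing_affine0 (k : fieldType) d (A : S -> S -> int)
    (rho : W -> 'M[k]_d) su x :
    affine_weyl_group A -> [pchar k] =i pred0 -> realization_of rho A ->
    standing rho su x
| standing_affinep (k : fieldType) d (A : S -> S -> int) (p : nat)
    r (I : finType) (Phi : root_datum r I) tau
    (rho : W -> 'M[k]_d) su x :
    affine_weyl_group A -> p \in [pchar k] ->
    root_system Phi -> irreducible_roots Phi -> (coxeter_number Phi < p)%N ->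
    affine_identification Phi p g tau -> realization_of rho A ->
    rexpr g su -> in_hatWo Phi p g tau (wd g su) -> in_hatWo Phi p g tau x ->
    standing rho su x
| standing_rootic (K : realType) (rho : W -> 'M[K]_#|S|) su x :
    (forall r (Phi : root_datum r S), ~ weyl_group Phi) ->
    (forall A, ~ affine_weyl_group A) ->
    reflection_representation rho (@basis_vector K) (rootic_root K) ->
    standing rho su x.

End Standing.

(* Main.v *)
(* The right R-module of bimodule morphisms from B_su to R_x is computed by
   induction on su.  A morphism h out of B_pre B_s is determined by its values
   h0 at b (x) 1 (x) 1, and composing with the twisted elements
   xs (x) 1 + 1 (x) xs and xs (x) 1 - 1 (x) xs gives morphisms u : B_pre -> R_x
   and v : B_pre -> R_(xs); u (resp. v) vanishes exactly when h0 itself is a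
   morphism B_pre -> R_(xs) (resp. R_x).  In each case of the construction of
   the tree the two children of a node realize one of these two extensions, so
   bases for all x over pre give bases over pre s.  Reduced expressions matter
   only through beta: a morphism from B_t to R_x, t reduced with product x, is
   a multiple of beta as soon as no proper subword of t has the same image as x
   in GL(V), hence beta is preserved by the braid morphisms.

   What remains is that V separates x from the subwords of su.  When V is
   faithful this is immediate; faithfulness of the rootic representation and of
   realizations in characteristic 0 follows from the sign of w(alpha_s).  In
   characteristic p the roots are, up to scaling, reductions modulo p of the
   affine functions on the walls of an alcove.  A kernel element of W
   is then a translation by p gamma, and the unipotent elements
   s_0 r_theta force gamma to be divisible by p in the coweight lattice, hence
   in the root lattice since p > h.  Such a translation cannot relate two
   elements of hat W^o: their alcoves are obtained from that of hat w_0 by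
   reflections towards the fundamental alcove, which bounds the coordinates of
   their images of rho by (p + 1)(h - 1) < p^2. *)

Require Import Defs.
From mathcomp Require Import all_boot all_order all_algebra.
From mathcomp Require Import fingroup perm.
From mathcomp Require Import boolp reals trigo.
From mathcomp Require Import -(notations) freeg mpoly.
From mathcomp Require Import zify ring lra.
Import Defs.

Set Implicit Arguments.
Unset Strict Implicit.
Unset Printing Implicit Defensive.

Import Order.TTheory GRing.Theory Num.Theory.
Local Open Scope ring_scope.

(** * Words and lengths *)

(** The two evaluations are triangular. Let z be the longer of x and x s. Children of nodes of
    weight z give back the old map at the twisted element; children of nodes of weight z s vanish
    there and are recovered at 1 ⊗ 1. Spanning and freeness then both follow by elimination. In
    characteristic p the obstacle is that A and Phi are linked only through their Coxeter group, so
    A may be a twisted form of the affine matrix of Phi. The orders m(s,r) give only products of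
    opposite entries. The missing proportion comes from positive null vectors of A and of the wall
    normals: equality in the arithmetic-geometric inequality makes the two matrices conjugate by a
    positive diagonal one ([kappa_ex]). The element s_0 r_theta adds to the root of the affine wall
    a nonzero vector that it fixes, so its j-th power is trivial on V only if p divides j;
    irreducibility carries this from theta to all roots. In (p + 1)(h - 1), p is the size of the
    restricted box, 1 the shift by rho, and h - 1 the bound for rho on coroots. *)

Lemma leastP (P : nat -> Prop) : (exists n, P n) -> P (least P).
Proof.
move=> [n Pn]; rewrite /least; case: pselect => [e|[]]; last first.
  by exists n; apply/asboolP.
by case: ex_minnP => m /asboolP.
Qed.

Lemma least_le (P : nat -> Prop) n : P n -> (least P <= n)%N.
Proof.
move=> Pn; rewrite /least; case: pselect => // e.
by case: ex_minnP => m _; apply; apply/asboolP.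
Qed.

Lemma theP (T : Type) (x0 : T) (P : T -> Prop) :
  (exists x, P x) -> P (the x0 P).
Proof.
move=> e; rewrite /the; case: pselect => [e'|//]; exact: (svalP (cid e')).
Qed.

Section Length.
Variables (W : groupType) (S : finType) (g : S -> W).
Hypothesis coxW : coxeter_system g.

Local Notation wd := (wd g).
Local Notation len := (len g).
Local Notation rexpr := (rexpr g).

Lemma wd_nil : wd [::] = 1%g.
Proof. by rewrite /wd big_nil. Qed.

Lemma wd_cons s t : wd (s :: t) = (g s * wd t)%g.
Proof. by rewrite /wd big_cons. Qed.

Lemma wd_cat t u : wd (t ++ u) = (wd t * wd u)%g.
Proof. by rewrite /wd big_cat. Qed.

Lemma wd1 s : wd [:: s] = g s.
Proof. by rewrite /wd big_seq1. Qed.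

Lemma wd_rcons t s : wd (rcons t s) = (wd t * g s)%g.
Proof. by rewrite -cats1 wd_cat wd1. Qed.

Lemma gen_sq s : (g s * g s = 1)%g.
Proof. by case: (coxeter_order2 coxW s). Qed.

Lemma genV s : ((g s)^-1 = g s)%g.
Proof. by apply: (mulgI (g s)); rewrite gen_sq mulgV. Qed.

Lemma genK s w : (w * g s * g s = w)%g.
Proof. by rewrite -mulgA gen_sq mulg1. Qed.

Lemma genKl s w : (g s * (g s * w) = w)%g.
Proof. by rewrite mulgA gen_sq mul1g. Qed.

Lemma wd_rev t : wd (rev t) = ((wd t)^-1)%g.
Proof.
elim: t => [|s t IH]; first by rewrite /rev /= wd_nil invg1.
by rewrite rev_cons wd_rcons IH wd_cons invgM genV.
Qed.

Lemma len_wd t : (len (wd t) <= size t)%N.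
Proof. by apply: least_le; exists t. Qed.

Lemma lenP w : exists2 t, size t = len w & wd t = w.
Proof.
apply: (@leastP (fun n => exists2 t, size t = n & wd t = w)).
by have [t ->] := coxeter_gen coxW w; exists (size t), t.
Qed.

Lemma rexpr_ex w : exists2 t, rexpr t & wd t = w.
Proof. by have [t st wt] := lenP w; exists t; rewrite // /rexpr wt st. Qed.

Lemma len1 : len 1%g = 0%N.
Proof. by apply/eqP; rewrite -leqn0 -wd_nil len_wd. Qed.

Lemma lenM x y : (len (x * y)%g <= len x + len y)%N.
Proof.
have [t <- <-] := lenP x; have [u <- <-] := lenP y.
by rewrite -wd_cat -size_cat len_wd.
Qed.

Lemma lenV w : len (w^-1)%g = len w.
Proof.
suff le v : (len (v^-1)%g <= len v)%N by apply/eqP; rewrite eqn_leq le -{1}[w]invgK le.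
by have [t st e] := lenP v; rewrite -st -{1}e -wd_rev -(size_rev t) len_wd.
Qed.

Lemma len_gen s : (len (g s) <= 1)%N.
Proof. by rewrite -wd1 -[1%N]/(size [:: s]) len_wd. Qed.

(** The presentation provides a sign character: sending every generator to the transposition of 'S_2
    respects all relations. *)
Lemma len_parity t : odd (len (wd t)) = odd (size t).
Proof.
pose tau : 'S_2 := tperm ord0 ord_max.
have tau2 : (tau * tau = 1)%g by rewrite /tau tperm2.
have tauo : odd_perm tau by rewrite odd_tperm.
have [|h hM hg] := coxeter_pres coxW (G := 'S_2) (f := fun=> tau).
  by move=> s r n _ _; rewrite tau2 expg1n.
have h1 : h 1%g = 1%g by apply: (mulgI (h 1%g)); rewrite -hM !mulg1.
have ho u : odd_perm (h (wd u)) = odd (size u).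
  elim: u => [|s u IH]; first by rewrite wd_nil h1 odd_perm1.
  by rewrite wd_cons hM hg odd_permM tauo IH.
have [u <- e] := lenP (wd t).
by rewrite -ho -ho e.
Qed.

Lemma len_mulr_odd w s : odd (len (w * g s)%g) = ~~ odd (len w).
Proof.
have [t e <-] := lenP w.
by rewrite -wd_rcons !len_parity size_rcons.
Qed.

Lemma len_mulr w s : len (w * g s)%g = (len w).+1 \/ len w = (len (w * g s)%g).+1.
Proof.
have := len_mulr_odd w s.
have := lenM w (g s); have := lenM (w * g s)%g (g s).
rewrite genK; have := len_gen s.
move: (len _) (len w) (len (w * g s)%g) => a b c a1 h1 h2 par.
have {}h1 : (b <= c.+1)%N by rewrite -addn1 (leq_trans h1) // leq_add2l.
have {}h2 : (c <= b.+1)%N by rewrite -addn1 (leq_trans h2) // leq_add2l.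
case: (ltngtP b c) => [bc|cb|e].
- by left; apply/eqP; rewrite eqn_leq h2.
- by right; apply/eqP; rewrite eqn_leq h1.
- by move: par; rewrite e; case: (odd c).
Qed.

Lemma len_up w s : (len w < len (w * g s)%g)%N -> len (w * g s)%g = (len w).+1.
Proof. by case: (len_mulr w s) => -> // /ltnW; rewrite ltnn. Qed.

Lemma len_down w s : (len (w * g s)%g < len w)%N -> len w = (len (w * g s)%g).+1.
Proof. by case: (len_mulr w s) => [->|//] /ltnW; rewrite ltnn. Qed.

Lemma len_updown w s :
  (len w < len (w * g s)%g)%N \/ (len (w * g s)%g < len w)%N.
Proof. by case: (len_mulr w s) => ->; [left|right]. Qed.

Lemma rexpr_catl t u : rexpr (t ++ u) -> rexpr t.
Proof.
rewrite /rexpr size_cat wd_cat => /eqP e.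
rewrite eqn_leq len_wd /= -(leq_add2r (size u)) -e.
by rewrite (leq_trans (lenM _ _)) // leq_add2l len_wd.
Qed.

Lemma rexpr_rcons t s :
  rexpr t -> (len (wd t) < len (wd t * g s)%g)%N -> rexpr (rcons t s).
Proof.
by move=> /eqP e /len_up l; rewrite /rexpr wd_rcons l e size_rcons.
Qed.

Lemma size_alt (s r : S) n : size (alt s r n) = n.
Proof. by elim: n s r => [|n IH] s r //=; rewrite IH. Qed.

Lemma altS (s r : S) n : alt s r n.+1 = rcons (alt s r n) (if odd n then r else s).
Proof.
elim: n s r => [|n IH] s r //.
rewrite -[LHS]/(s :: alt r s n.+1) IH -rcons_cons /=.
by case: (odd n).
Qed.

Lemma mordP s r : (0 < mord g s r)%N -> ((g s * g r) ^+ mord g s r = 1)%g.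
Proof.
move=> m0; rewrite /mord /least; case: pselect => [e|ne].
  by case: ex_minnP => m /asboolP[].
by move: m0; rewrite /mord /least; case: pselect.
Qed.

Lemma mord_min s r n :
  (0 < n)%N -> ((g s * g r) ^+ n = 1)%g -> (0 < mord g s r <= n)%N.
Proof.
move=> n0 e; rewrite least_le // andbT.
by case: (leastP (P := fun n => (0 < n)%N /\ ((g s * g r) ^+ n = 1)%g) (ex_intro _ n (conj n0 e))).
Qed.

Lemma wd_alt_double s r n : wd (alt s r n.*2) = ((g s * g r) ^+ n)%g.
Proof.
elim: n => [|n IH]; first by rewrite wd_nil.
by rewrite doubleS /= !wd_cons IH mulgA -expgS.
Qed.

Lemma wd_alt_cat s r m n :
  wd (alt s r (m + n)) = (wd (alt s r m) * wd (if odd m then alt r s n else alt s r n))%g.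
Proof.
elim: m s r => [|m IH] s r; first by rewrite wd_nil mul1g.
by rewrite addSn /= !wd_cons IH mulgA; case: (odd m).
Qed.

Lemma wd_alt_inv s r n :
  ((wd (alt s r n))^-1)%g = wd (if odd n then alt s r n else alt r s n).
Proof.
elim: n s r => [|n IH] s r; first by rewrite wd_nil invg1.
rewrite [in LHS]/= wd_cons invgM IH genV -wd_rcons 2!altS /=.
by case: (odd n).
Qed.

(** The word (s r)^m has 2m letters, and its two halves are inverse to each other; the inverse of an
    alternating word is the alternating word read backwards. *)
Lemma wd_alt_mord s r : (0 < mord g s r)%N ->
  wd (alt s r (mord g s r)) = wd (alt r s (mord g s r)).
Proof.
move=> m0; set m := mord g s r.
have e : wd (alt s r (m + m)) = 1%g by rewrite addnn wd_alt_double mordP.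
move: e; rewrite wd_alt_cat => e.
apply: (mulIg (wd (if odd m then alt r s m else alt s r m))); rewrite e.
by rewrite -(wd_alt_inv r s) mulgV.
Qed.

Lemma bpath_wd t u : bpath g t u -> wd u = wd t.
Proof.
elim=> // a s r b {}u _ m0 _ ->.
by rewrite !wd_cat (wd_alt_mord m0).
Qed.

Lemma bpath_size t u : bpath g t u -> size u = size t.
Proof.
elim=> // a s r b {}u _ m0 _ ->.
by rewrite !size_cat !size_alt.
Qed.

Lemma bpath_rexpr t u : bpath g t u -> rexpr t -> rexpr u.
Proof. by move=> p; rewrite /rexpr (bpath_wd p) (bpath_size p). Qed.

End Length.

(** * Bimodules and tensor products *)

Definition is_add (M N : zmodType) (h : M -> N) : Prop :=
  forall x y, h (x + y) = h x + h y.

Section Additive.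
Variables (M N : zmodType) (h : M -> N).
Hypothesis hD : is_add h.

Lemma is_add0 : h 0 = 0.
Proof. by apply: (addrI (h 0)); rewrite -hD !addr0. Qed.

Lemma is_add_sum (I : Type) (r : seq I) (P : pred I) (F : I -> M) :
  h (\sum_(i <- r | P i) F i) = \sum_(i <- r | P i) h (F i).
Proof. exact: (big_morph h hD is_add0). Qed.

End Additive.

(** Existence is all that the description needs. In practice P fixes the values on generators, and
    [tens_ext] or a variant of it compares two such maps. *)
Lemma the_additiveP (M N : zmodType) (P : (M -> N) -> Prop) :
  (exists h, is_add h /\ P h) -> is_add (the_additive P) /\ P (the_additive P).
Proof. by move=> e; apply: (@theP _ _ (fun h => is_add h /\ P h)). Qed.

Section Bimodule.
Variable R : comNzRingType.

Lemma ract_suml (M : bimod R) (a : R) (I : Type) (r : seq I) (P : pred I) (F : I -> M) :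
  ract (\sum_(i <- r | P i) F i) a = \sum_(i <- r | P i) ract (F i) a.
Proof. by apply: (is_add_sum (h := (@ract R M)^~ a)); apply: ractDl. Qed.

Lemma tens_lift (A : R -> Prop) (M N : bimod R) (P : zmodType)
    (f : M -> N -> P) :
  (forall x x' y, f (x + x') y = f x y + f x' y) ->
  (forall x y y', f x (y + y') = f x y + f x y') ->
  (forall x a y, A a -> f (ract x a) y = f x (lact a y)) ->
  exists h : tens A M N -> P, is_add h /\ forall x y, h (tpure A x y) = f x y.
Proof.
move=> fDl fDr fA; exists (tlift f); split=> [u v|x y].
  exact: tliftD.
exact: tliftE.
Qed.

Lemma tens_ext (A : R -> Prop) (M N : bimod R) (P : zmodType)
    (h h' : tens A M N -> P) :
  is_add h -> is_add h' -> (forall x y, h (tpure A x y) = h' (tpure A x y)) ->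
  h =1 h'.
Proof. by move=> hD h'D; apply: tcar_ext. Qed.

Lemma lact_tpure (A : R -> Prop) (M N : bimod R) a (x : M) (y : N) :
  lact a (tpure A x y : tens A M N) = tpure A (lact a x) y.
Proof. exact: tlactE. Qed.

Lemma ract_tpure (A : R -> Prop) (M N : bimod R) a (x : M) (y : N) :
  ract (tpure A x y : tens A M N) a = tpure A x (ract y a).
Proof. exact: tractE. Qed.

Lemma mor_comp (M N P : bimod R) (h : N -> P) (k : M -> N) :
  bimod_morphism h -> bimod_morphism k -> bimod_morphism (h \o k).
Proof.
move=> [h1 h2 h3] [k1 k2 k3]; split=> [x y|a x|x a] /=.
- by rewrite k1 h1.
- by rewrite k2 h2.
- by rewrite k3 h3.
Qed.

Lemma hom_comp (M N P : bimod R) (d e : int) (h : N -> P) (k : M -> N) :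
  hom_deg d h -> hom_deg e k -> hom_deg (e + d) (h \o k).
Proof.
move=> [h1 h2] [k1 k2]; split; first exact: mor_comp.
by move=> i x gx; rewrite addrA; apply/h2/k2.
Qed.

Lemma hom_id (M : bimod R) : hom_deg 0 (@id M).
Proof. by split=> // i x; rewrite addr0. Qed.

Lemma hom_degP (M N : bimod R) d (h : M -> N) : hom_deg d h -> Defs.Hom h.
Proof.
move=> hd; exists 1%N, (fun=> d), (fun=> h); split=> // x.
by rewrite big_ord1.
Qed.

Lemma Hom_mor (M N : bimod R) (h : M -> N) : Defs.Hom h -> bimod_morphism h.
Proof.
move=> [n [d [l [ld e]]]]; split=> [x y|a x|x a]; rewrite !e.
- rewrite -big_split; apply: eq_bigr => i _.
  by case: (ld i) => -[-> _ _].
- rewrite (is_add_sum (h := lact a)); last exact: lactDr.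
  by apply: eq_bigr => i _; case: (ld i) => -[_ -> _].
- by rewrite ract_suml; apply: eq_bigr => i _; case: (ld i) => -[_ _ ->].
Qed.

End Bimodule.

(** * Concatenation of words as tensor product over R *)

Section Cat.
Variables (W : groupType) (S : finType) (g : S -> W).
Variables (k : fieldType) (d : nat) (rho : W -> 'M[k]_d).
Local Notation B := (B g rho).
Local Notation Bs := (Bs g rho).

Lemma pureRDl s t (e e' : Bs s) (b : B t) :
  pureR (e + e') b = pureR e b + pureR e' b.
Proof. exact: tpureDl. Qed.

Lemma pureRDr s t (e : Bs s) (b b' : B t) :
  pureR e (b + b') = pureR e b + pureR e b'.
Proof. exact: tpureDr. Qed.

Lemma pureRA s t (e : Bs s) (b : B t) a :
  pureR (ract e a) b = pureR e (lact a b).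
Proof. exact: tpureA. Qed.

Lemma lact_pureR s t (e : Bs s) (b : B t) a :
  lact a (pureR e b : B (s :: t)) = pureR (lact a e) b.
Proof. exact: lact_tpure. Qed.

Lemma ract_pureR s t (e : Bs s) (b : B t) a :
  ract (pureR e b : B (s :: t)) a = pureR e (ract b a).
Proof. exact: ract_tpure. Qed.

Lemma B_ext s t (P : zmodType) (h h' : B (s :: t) -> P) :
  is_add h -> is_add h' -> (forall e b, h (pureR e b) = h' (pureR e b)) ->
  h =1 h'.
Proof. exact: tens_ext. Qed.

Lemma B_lift s t (P : zmodType) (f : Bs s -> B t -> P) :
  (forall x x' y, f (x + x') y = f x y + f x' y) ->
  (forall x y y', f x (y + y') = f x y + f x y') ->
  (forall x a y, f (ract x a) y = f x (lact a y)) ->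
  exists h : B (s :: t) -> P, is_add h /\ forall x y, h (pureR x y) = f x y.
Proof. by move=> h1 h2 h3; apply: tens_lift => // *; apply: h3. Qed.

(** On s :: t, [catB] is a definite description whose existence uses additivity and left linearity
    of [catB] on t, so these properties are carried together through one induction. *)
Definition catB_ok t u := [/\ forall (b b' : B t) (c : B u), catB (b + b') c = catB b c + catB b' c,
  forall (b : B t) (c c' : B u), catB b (c + c') = catB b c + catB b c',
  forall a (b : B t) (c : B u), catB (lact a b) c = lact a (catB b c),
  forall (b : B t) (c : B u) a, catB b (ract c a) = ract (catB b c) a &
  forall (b : B t) a (c : B u), catB (ract b a) c = catB b (lact a c)].

Lemma catB_cons_def s t u (c : B u) : catB_ok t u ->
  is_add (fun b : B (s :: t) => catB b c) /\
  forall (e : Bs s) (b : B t), catB (pureR e b : B (s :: t)) c = pureR e (catB b c).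
Proof.
move=> [h1 h2 h3 h4 h5]; apply: the_additiveP.
apply: B_lift => [x x' y|x y y'|x a y].
- exact: (@pureRDl s (t ++ u)).
- rewrite -[RHS](@pureRDr s (t ++ u)); congr pureR; exact: h1.
- rewrite -[LHS]/(pureR (ract x a) (catB y c)) (@pureRA s (t ++ u)).
  congr pureR; exact/esym/h3.
Qed.

Lemma catB_okP t u : catB_ok t u.
Proof.
elim: t => [|s t IH].
  split=> [b b' c|b c c'|a b c|b c a|b a c].
  - exact: lactDl.
  - exact: lactDr.
  - exact: lactM.
  - by rewrite /= lractA.
  - exact: lactM.
have cD c := (catB_cons_def s c IH).1.
have cE c := (catB_cons_def s c IH).2.
case: IH => h1 h2 h3 h4 h5.
split=> [b b' c|b c c'|a b c|b c a|b a c].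
- exact: cD.
- move: b; apply: (B_ext (h := fun b => catB b (c + c'))
    (h' := fun b => catB b c + catB b c')) => [|x y|e b]; first exact: cD.
    by rewrite !cD addrACA.
  by rewrite !cE h2; apply: (@pureRDr s (t ++ u)).
- move: b; apply: (B_ext (h := fun b => catB (lact a b) c)
    (h' := fun b => lact a (catB b c))) => [x y|x y|e b].
  + by rewrite lactDr cD.
  + by rewrite cD lactDr.
  + by rewrite lact_pureR !cE (@lact_pureR s (t ++ u)).
- move: b; apply: (B_ext (h := fun b => catB b (ract c a))
    (h' := fun b => ract (catB b c) a)) => [|x y|e b]; first exact: cD.
    by rewrite cD ractDl.
  by rewrite !cE h4 (@ract_pureR s (t ++ u)).
- move: b; apply: (B_ext (h := fun b => catB (ract b a) c)
    (h' := fun b => catB b (lact a c))) => [x y||e b].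
  + by rewrite ractDl cD.
  + exact: cD.
  + by rewrite ract_pureR !cE h5.
Qed.

Lemma catBDl t u (b b' : B t) (c : B u) : catB (b + b') c = catB b c + catB b' c.
Proof. by case: (catB_okP t u). Qed.

Lemma catBDr t u (b : B t) (c c' : B u) : catB b (c + c') = catB b c + catB b c'.
Proof. by case: (catB_okP t u). Qed.

Lemma lact_catB t u a (b : B t) (c : B u) : lact a (catB b c) = catB (lact a b) c.
Proof. by case: (catB_okP t u). Qed.

Lemma ract_catB t u a (b : B t) (c : B u) : ract (catB b c) a = catB b (ract c a).
Proof. by case: (catB_okP t u). Qed.

Lemma catBA t u (b : B t) a (c : B u) : catB (ract b a) c = catB b (lact a c).
Proof. by case: (catB_okP t u). Qed.

Lemma catB_cons s t u (e : Bs s) (b : B t) (c : B u) :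
  catB (pureR e b : B (s :: t)) c = pureR e (catB b c).
Proof. exact: (catB_cons_def s c (catB_okP t u)).2. Qed.

Lemma catB_ext t u (P : zmodType) (h h' : B (t ++ u) -> P) :
  is_add h -> is_add h' -> (forall (b : B t) (c : B u), h (catB b c) = h' (catB b c)) ->
  h =1 h'.
Proof.
elim: t h h' => [|s t IH] h h' hD h'D hh' w.
  by have := hh' 1 w; rewrite /= !lact1.
move: w; apply: (@B_ext s (t ++ u)) => // e.
apply: IH => [x y|x y|b c].
- by rewrite (@pureRDr s (t ++ u)) hD.
- by rewrite (@pureRDr s (t ++ u)) h'D.
- by rewrite -catB_cons hh'.
Qed.

(** Universal property of B_t ⊗ B_u, transported to B (t ++ u). The induction fixes the leftmost
    factor e, lifts the rest to a map H e, and then checks that H is additive in e and balanced. *)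
Lemma catB_lift t u (P : zmodType) (f : B t -> B u -> P) :
  (forall x x' y, f (x + x') y = f x y + f x' y) ->
  (forall x y y', f x (y + y') = f x y + f x y') ->
  (forall x a y, f (ract x a) y = f x (lact a y)) ->
  exists h : B (t ++ u) -> P, is_add h /\ forall (x : B t) (y : B u), h (catB x y) = f x y.
Proof.
elim: t f => [|s t IH] f f1 f2 f3.
  exists (f 1); split=> [x y|x y]; first exact: f2.
  by rewrite -f3 /= mul1r.
have IHe (e : Bs s) : exists h : B (t ++ u) -> P,
    is_add h /\ forall (x : B t) (y : B u), h (catB x y) = f (pureR e x) y.
  apply: IH => [x x' y|x y y'|x a y].
  - by rewrite pureRDr f1.
  - exact: f2.
  - by rewrite -f3 ract_pureR.
have [H HP] := boolp.choice IHe.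
have HD e := (HP e).1; have HE e := (HP e).2.
have [h [hD hE]] : exists h : B (s :: (t ++ u)) -> P, is_add h /\ forall e y, h (pureR e y) = H e y.
  apply: (@B_lift s (t ++ u)) => [x x' y|x y y'|x a y].
  - move: y; apply: catB_ext => [//|y y'|b c].
      by rewrite !HD addrACA.
    by rewrite !HE pureRDl f1.
  - exact: HD.
  - move: y; apply: (catB_ext (h := H _) (h' := fun y => H _ (lact _ y))) => [//|y y'|b c].
      by rewrite lactDr HD.
    by rewrite lact_catB !HE pureRA.
exists h; split=> // x y; move: x.
apply: (B_ext (h := fun x => h (catB x y))) => [x x'|x x'|e b].
- by rewrite catBDl hD.
- exact: f1.
- by rewrite catB_cons hE HE.
Qed.

End Cat.

(** * Polynomials and Demazure operators *)

Section Poly.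
Variables (W : groupType) (S : finType) (g : S -> W).
Hypothesis coxW : coxeter_system g.
Variables (k : fieldType) (d : nat) (rho : W -> 'M[k]_d).
Hypothesis repr : representation rho.
Local Notation R := (mpoly d k).
Local Notation act := (act rho).
Local Notation X i := (mpolyX k (mnm1 i) : R).

Lemma mpoly_gen_ind (P : R -> Prop) :
  (forall c, P (mpolyC d c)) -> (forall i, P (X i)) ->
  (forall p q, P p -> P q -> P (p + q)) ->
  (forall p q, P p -> P q -> P (p * q)) -> forall p, P p.
Proof.
move=> PC PX PD PM; apply: mpolyind => [|c m p _ _ Pp]; first by rewrite -mpolyC0.
apply: (PD) => //; rewrite -mul_mpolyC; apply: (PM) => //.
rewrite mpolyXE_id; apply: (big_ind P) => [||i _] //; first by rewrite -mpolyC1.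
elim: (m i) => [|n IH]; first by rewrite expr0 -mpolyC1.
by rewrite exprS; apply: PM.
Qed.

Lemma linear_formD a b : linear_form (a + b) = linear_form a + linear_form b :> R.
Proof.
by rewrite /linear_form -big_split; apply: eq_bigr => j _; rewrite mxE scalerDl.
Qed.

Lemma linear_formZ c a : linear_form (c *: a) = c *: (linear_form a : R).
Proof.
by rewrite /linear_form scaler_sumr; apply: eq_bigr => j _; rewrite mxE scalerA.
Qed.

Lemma linear_formN a : linear_form (- a) = - linear_form a :> R.
Proof. by rewrite -scaleN1r linear_formZ scaleN1r. Qed.

Lemma linear_form_sum (I : Type) (r : seq I) (P : pred I) (F : I -> 'rV[k]_d) :
  linear_form (\sum_(i <- r | P i) F i) = \sum_(i <- r | P i) (linear_form (F i) : R).
Proof.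
apply: (big_morph (fun a => linear_form a : R)); first exact: linear_formD.
by rewrite /linear_form big1 // => j _; rewrite mxE scale0r.
Qed.

Lemma linear_form_delta i : linear_form (delta_mx 0 i) = X i.
Proof.
rewrite /linear_form (bigD1 i) //= mxE !eqxx scale1r big1 ?addr0 // => j ji.
by rewrite mxE (negbTE ji) andbF scale0r.
Qed.

Lemma linear_form_inj : injective (fun a => linear_form a : R).
Proof.
move=> a b /= e; apply/rowP => j; have := congr1 (mcoeff (mnm1 j)) e.
rewrite /linear_form !raddf_sum /= !(bigD1 j (P := predT)) //= !mcoeffZ !mcoeffX eqxx !mulr1.
rewrite !big1 ?addr0 // => i ij; rewrite mcoeffZ mcoeffX;
by rewrite eq_mnm1 (negbTE ij) mulr0.
Qed.

Lemma repr1 : rho 1%g = 1%:M.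
Proof. by case: repr. Qed.

Lemma reprM x y : rho (x * y)%g = rho x *m rho y.
Proof. by case: repr. Qed.

Lemma reprV x : rho x *m rho (x^-1)%g = 1%:M.
Proof. by rewrite -reprM mulgV repr1. Qed.

Lemma actD w : {morph act w : p q / p + q}.
Proof. exact: raddfD. Qed.

Lemma actB w : {morph act w : p q / p - q}.
Proof. exact: raddfB. Qed.

Lemma actN w : {morph act w : p / - p}.
Proof. exact: raddfN. Qed.

Lemma act0 w : act w 0 = 0.
Proof. exact: raddf0. Qed.

Lemma actM w : {morph act w : p q / p * q}.
Proof. exact: rmorphM. Qed.

Lemma act_1 w : act w 1 = 1.
Proof. exact: rmorph1. Qed.

Lemma actZ w c p : act w (c *: p) = c *: act w p.
Proof. exact: comp_mpolyZ. Qed.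

Lemma actC w c : act w (mpolyC d c) = mpolyC d c.
Proof. exact: comp_mpolyC. Qed.

Lemma act_X w i : act w (X i) = linear_form (row i (rho (w^-1)%g)).
Proof. by rewrite /act comp_mpolyXU -tnth_nth tnth_mktuple. Qed.

Lemma act_linear w a : act w (linear_form a) = linear_form (a *m rho (w^-1)%g).
Proof.
rewrite [in LHS]/linear_form /act raddf_sum mulmx_sum_row linear_form_sum.
by apply: eq_bigr => j _; rewrite -[LHS]/(act w _) actZ act_X linear_formZ.
Qed.

Lemma act_mulg x y p : act (x * y)%g p = act x (act y p).
Proof.
elim/mpoly_gen_ind: p => [c|i|p q Ep Eq|p q Ep Eq].
- by rewrite !actC.
- by rewrite !act_X act_linear invgM reprM row_mul.
- by rewrite !actD Ep Eq.
- by rewrite !actM Ep Eq.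
Qed.

Lemma act_one p : act 1%g p = p.
Proof.
elim/mpoly_gen_ind: p => [c|i|p q Ep Eq|p q Ep Eq].
- by rewrite actC.
- by rewrite act_X invg1 repr1 row1 linear_form_delta.
- by rewrite actD Ep Eq.
- by rewrite actM Ep Eq.
Qed.

Lemma act_inj w : injective (act w).
Proof. by apply: (can_inj (g := act (w^-1)%g)) => p; rewrite -act_mulg mulVg act_one. Qed.

Lemma act_faithful w : (forall p, act w p = p) -> rho w = 1%:M.
Proof.
move=> e; suff E : rho (w^-1)%g = 1%:M by rewrite -(mulmx1 (rho w)) -{1}E reprV.
apply/row_matrixP => i; rewrite row1; apply: linear_form_inj => /=.
by rewrite -act_X e linear_form_delta.
Qed.

Lemma act_gen2 s p : act (g s) (act (g s) p) = p.
Proof. by rewrite -act_mulg (gen_sq coxW) act_one. Qed.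

Section Degree.

Lemma poly_gr0 i : poly_gr i (0 : R).
Proof. by move=> m; rewrite msupp0. Qed.

Lemma poly_grD i (p q : R) : poly_gr i p -> poly_gr i q -> poly_gr i (p + q).
Proof. by move=> hp hq m /msuppD_le; rewrite mem_cat => /orP[/hp|/hq]. Qed.

Lemma poly_grM i j (p q : R) : poly_gr i p -> poly_gr j q -> poly_gr (i + j) (p * q).
Proof.
move=> hp hq m /msuppM_le/allpairsP[[m1 m2] /= [/hp-> /hq-> ->]].
by rewrite mdegD mulnDr.
Qed.

Lemma poly_grC c : poly_gr 0 (mpolyC d c : R).
Proof.
move=> m; rewrite msuppC; case: ifP => // _; rewrite inE => /eqP->.
by rewrite mdeg0 muln0.
Qed.

Lemma poly_gr1 : poly_gr 0 (1 : R).
Proof. by rewrite -mpolyC1; apply: poly_grC. Qed.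

Lemma poly_grZ i c (p : R) : poly_gr i p -> poly_gr i (c *: p).
Proof. by move=> h; rewrite -mul_mpolyC -[i]add0r; apply: poly_grM => //; apply: poly_grC. Qed.

Lemma poly_grX i : poly_gr 2 (X i).
Proof. by move=> m; rewrite msuppX inE => /eqP->; rewrite mdeg1. Qed.

Lemma poly_gr_sum i (I : Type) (r : seq I) (P : pred I) (F : I -> R) :
  (forall j, P j -> poly_gr i (F j)) -> poly_gr i (\sum_(j <- r | P j) F j).
Proof.
move=> h; apply: big_ind => //; first exact: poly_gr0.
by move=> *; apply: poly_grD.
Qed.

Lemma poly_gr_linear a : poly_gr 2 (linear_form a : R).
Proof. by apply: poly_gr_sum => j _; apply/poly_grZ/poly_grX. Qed.

Lemma homog_ind (Q : int -> R -> Prop) :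
  Q 0 1 -> (forall i, Q 2 (X i)) ->
  (forall i j p q, Q i p -> Q j q -> Q (i + j) (p * q)) ->
  (forall i, Q i 0) -> (forall i p q, Q i p -> Q i q -> Q i (p + q)) ->
  (forall i c p, Q i p -> Q i (c *: p)) ->
  forall i p, poly_gr i p -> Q i p.
Proof.
move=> Q1 QX QM Q0 QD QZ i p hp; rewrite [p]mpolyE.
have QXm m : Q (2 * mdeg m)%N%:Z (mpolyX k m).
  rewrite mpolyXE_id mdegE.
  elim/big_rec2: _ => [|j q e _]; first by rewrite muln0.
  rewrite mulnDr PoszD; apply: (QM).
  elim: (m j) => [|n IH]; first by rewrite muln0 expr0.
  by rewrite exprS mulnS PoszD; apply: QM.
rewrite big_seq; apply: big_ind => [//|q q'|m hm]; first exact: QD.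
by rewrite (hp m hm); apply: QZ.
Qed.

Lemma poly_gr_act w i p : poly_gr i p -> poly_gr i (act w p).
Proof.
move: i p; apply: (homog_ind (Q := fun i p => poly_gr i (act w p)))
  => [|i|i j p q hp hq|i|i p q hp hq|i c p hp].
- by rewrite act_1; apply: poly_gr1.
- by rewrite act_X; apply: poly_gr_linear.
- by rewrite actM; apply: poly_grM.
- by rewrite act0; apply: poly_gr0.
- by rewrite actD; apply: poly_grD.
- by rewrite actZ; apply: poly_grZ.
Qed.

End Degree.

Section Demazure.
Variables (xs : S -> 'rV[k]_d) (xv : S -> 'cV[k]_d).
Hypothesis two_neq0 : 2%:R != 0 :> k.
Hypothesis xvP : forall s, rho (g s) = 1%:M - xv s *m xs s /\ xs s *m xv s = 2%:R%:M.
Local Notation x_ s := (linear_form (xs s) : R).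
Local Notation inv := (invariant g rho).
Local Notation demazure := (demazure g rho xs).

Lemma act_gen_linear s a :
  act (g s) (linear_form a) = linear_form a - (a *m xv s) 0 0 *: x_ s.
Proof.
rewrite act_linear (genV coxW) (xvP s).1 mulmxBr mulmx1 linear_formD linear_formN.
by congr (_ - _); rewrite mulmxA [a *m _]mx11_scalar mul_scalar_mx linear_formZ -mx11_scalar.
Qed.

Lemma act_xs s : act (g s) (x_ s) = - x_ s.
Proof.
by rewrite act_gen_linear (xvP s).2 mxE eqxx mulr1n scaler_nat mulr2n opprD addrA subrr add0r.
Qed.

Lemma xs_neq0 s : x_ s != 0.
Proof.
apply/eqP => x0; have : xs s = 0.
  by apply: linear_form_inj; rewrite /= x0 -[0 in RHS](scale0r 0) linear_formZ scale0r.
move=> e; have := (xvP s).2; rewrite e mul0mx => /esym/eqP.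
rewrite -scalemx1 scaler_eq0 (negbTE two_neq0) /= => /eqP/matrixP/(_ 0 0).
by rewrite !mxE => /eqP; rewrite oner_eq0.
Qed.

Lemma two_neq0R : 2%:R != 0 :> R.
Proof. by rewrite -mpolyC_nat mpolyC_eq0. Qed.

(** On linear forms this is the reflection formula; products follow from p q - s(p) s(q) = (p -
    s(p)) q + s(p) (q - s(q)). *)
Lemma act_diff s p : exists q, p - act (g s) p = x_ s * q.
Proof.
elim/mpoly_gen_ind: p => [c|i|p q [p' Ep] [q' Eq]|p q [p' Ep] [q' Eq]].
- by exists 0; rewrite actC subrr mulr0.
- exists (mpolyC d (((delta_mx 0 i : 'rV[k]_d) *m xv s) 0 0)).
  rewrite -linear_form_delta act_gen_linear opprB addrC subrK.
  by rewrite mulrC mul_mpolyC.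
- by exists (p' + q'); rewrite actD opprD addrACA Ep Eq mulrDr.
- exists (p' * q + act (g s) p * q'); rewrite actM.
  rewrite mulrDr mulrA -Ep mulrCA -Eq mulrBl mulrBr; ring.
Qed.

Lemma demazure_uniq s p1 p2 q1 q2 : inv s p1 -> inv s p2 -> inv s q1 -> inv s q2 ->
  p1 + x_ s * p2 = q1 + x_ s * q2 -> p2 = q2.
Proof.
move=> h1 h2 h3 h4 e; have := congr1 (act (g s)) e.
rewrite !actD !actM h1 h2 h3 h4 act_xs => e'.
have : 2%:R * x_ s * (p2 - q2) = 0.
  transitivity ((p1 + x_ s * p2) - (q1 + x_ s * q2) -
    ((p1 + - x_ s * p2) - (q1 + - x_ s * q2))); first by ring.
  by rewrite e e'; ring.
move/eqP; rewrite !mulf_eq0 (negbTE two_neq0R) (negbTE (xs_neq0 s)) /=.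
by rewrite subr_eq0 => /eqP.
Qed.

(** p is the sum of (p + s(p)) / 2 and (p - s(p)) / 2. The second half is x_s times a quotient that
    is s-invariant because x_s is anti-invariant. *)
Lemma demazure_spec s p :
  inv s (demazure s p) /\ exists2 p1, inv s p1 & p = p1 + x_ s * demazure s p.
Proof.
apply: (@theP _ 0 (fun p2 => inv s p2 /\ exists2 p1, inv s p1 & p = p1 + x_ s * p2)).
have [q Eq] := act_diff s p.
pose h : R := mpolyC d (2%:R^-1).
have h2 : h * 2%:R = 1 by rewrite -mpolyC_nat -mpolyCM mulVf // mpolyC1.
have hA : act (g s) h = h by apply: actC.
have qI : act (g s) q = q.
  apply: (mulfI (xs_neq0 s)); apply: oppr_inj.
  by rewrite -Eq -mulNr -act_xs -actM -Eq actB act_gen2 opprB.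
exists (h * q); split; first by rewrite /invariant actM hA qI.
exists (h * (p + act (g s) p)).
  by rewrite /invariant actM hA actD act_gen2 addrC.
rewrite mulrCA -Eq -mulrDr.
have -> : p + act (g s) p + (p - act (g s) p) = 2%:R * p by ring.
by rewrite mulrA h2 mul1r.
Qed.

Lemma demazure_eq s p p1 p2 : inv s p1 -> inv s p2 -> p = p1 + x_ s * p2 ->
  demazure s p = p2.
Proof.
move=> h1 h2 e; have [h3 [p3 h4 e']] := demazure_spec s p.
by apply: (demazure_uniq h4 h3 h1 h2); rewrite -e' -e.
Qed.

Lemma demazureD s : is_add (demazure s).
Proof.
move=> p q; have [h1 [p1 h2 e]] := demazure_spec s p.
have [h3 [q1 h4 e']] := demazure_spec s q.
apply: (demazure_eq (p1 := p1 + q1)).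
- by rewrite /invariant actD h2 h4.
- by rewrite /invariant actD h1 h3.
- by rewrite {1}e {1}e' mulrDr addrACA.
Qed.

Lemma demazureMl s p q : inv s p -> demazure s (p * q) = p * demazure s q.
Proof.
move=> hp; have [h3 [q1 h4 e']] := demazure_spec s q.
apply: (demazure_eq (p1 := p * q1)).
- by rewrite /invariant actM hp h4.
- by rewrite /invariant actM hp h3.
- by rewrite {1}e' mulrDr mulrCA.
Qed.

Lemma demazure_act s p : x_ s * (2%:R * demazure s p) = p - act (g s) p.
Proof.
have [h1 [p1 h2 e]] := demazure_spec s p.
rewrite {2 3}e actD actM h1 h2 act_xs; ring.
Qed.

Lemma demazure_leibniz s p q :
  demazure s (p * q) = demazure s p * q + act (g s) p * demazure s q.
Proof.
apply: (mulfI two_neq0R); apply: (mulfI (xs_neq0 s)).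
rewrite demazure_act actM.
transitivity ((x_ s * (2%:R * demazure s p)) * q + act (g s) p * (x_ s * (2%:R * demazure s q))).
  by rewrite !demazure_act; ring.
by ring.
Qed.

Lemma demazure0 s : demazure s 0 = 0.
Proof. exact/is_add0/demazureD. Qed.

Lemma demazure_1 s : demazure s 1 = 0.
Proof.
apply: (demazure_eq (p1 := 1)); rewrite /invariant ?act_1 ?act0 //.
by rewrite mulr0 addr0.
Qed.

(** With p = p1 + x_s p2 the left side is p1 - x_s p2. This identity is what lets the twisted
    elements undo [j_] in [j_plus] and [j_minus]. *)
Lemma demazure_xs s p : demazure s (p * x_ s) - x_ s * demazure s p = act (g s) p.
Proof.
have [h1 [p1 h2 e]] := demazure_spec s p.
have -> : demazure s (p * x_ s) = p1.
  apply: (demazure_eq (p1 := x_ s ^+ 2 * demazure s p)) => //.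
    by rewrite /invariant actM h1 expr2 actM act_xs mulrNN.
  by rewrite {1}e; ring.
by rewrite {2}e actD actM h1 h2 act_xs; ring.
Qed.

Lemma demazure_gr s i p : poly_gr i p -> poly_gr (i - 2) (demazure s p).
Proof.
move=> hp; suff [] : poly_gr i p /\ poly_gr (i - 2) (demazure s p) by [].
move: i p hp; apply: (homog_ind (Q := fun i p => poly_gr i p /\ poly_gr (i - 2) (demazure s p)))
  => [|i|i j p q [hp h] [hq h']|i|i p q [hp h] [hq h']|i c p [hp h]].
- by rewrite demazure_1; split; [apply: poly_gr1 | apply: poly_gr0].
- split; first exact: poly_grX.
  suff [c ->] : exists c, demazure s (X i) = mpolyC d c by rewrite subrr; apply: poly_grC.
  pose c := ((delta_mx 0 i : 'rV[k]_d) *m xv s) 0 0.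
  exists (c / 2%:R).
  apply: (mulfI two_neq0R); apply: (mulfI (xs_neq0 s)); rewrite demazure_act.
  rewrite -linear_form_delta act_gen_linear opprB addrC subrK.
  by rewrite -mpolyC_nat -mpolyCM mulrC [2%:R * _]mulrC divfK // mul_mpolyC.
- split; first exact: poly_grM.
  rewrite demazure_leibniz; apply: poly_grD.
    by rewrite addrAC; apply: poly_grM.
  by rewrite -addrA; apply: poly_grM => //; apply: poly_gr_act.
- by rewrite demazure0; split; apply: poly_gr0.
- by rewrite demazureD; split; apply: poly_grD.
- split; first exact: poly_grZ.
  by rewrite -mul_mpolyC demazureMl ?mul_mpolyC; [apply: poly_grZ | apply: actC].
Qed.

End Demazure.
End Poly.

(** * The basic morphisms *)

Section GradedTensor.
Variable R : comNzRingType.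

(** The record [bimod] does not ask that the graded pieces be subgroups, so closure is proved for
    the bimodules at hand. *)
Definition gr_closed (M : bimod R) :=
  (forall i, gr i (0 : M)) /\ (forall i (x y : M), gr i x -> gr i y -> gr i (x + y)).

Definition gr_lact_closed (M : bimod R) (P : int -> R -> Prop) :=
  forall i j a (x : M), P i a -> gr j x -> gr (i + j) (lact a x).

Variables (A : R -> Prop) (M N : bimod R).

Lemma tens_gr_pure i j (x : M) (y : N) :
  gr i x -> gr j y -> gr (i + j) (tpure A x y : tens A M N).
Proof.
move=> hx hy; exists 1%N, (fun=> i), (fun=> x), (fun=> y); split=> [_|].
  by rewrite addrC addKr.
by rewrite big_ord1.
Qed.

Lemma tens_gr_closed : gr_closed (tens A M N).
Proof.
split=> [i|i u v].
  by exists 0%N, (fun=> 0), (fun=> 0), (fun=> 0); rewrite big_ord0; split=> // -[].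
move=> [n [e [x [y [h ->]]]]] [n' [e' [x' [y' [h' ->]]]]].
pose F T (a : 'I_n -> T) (b : 'I_n' -> T) i :=
  match split i with inl j => a j | inr j => b j end.
exists (n + n')%N, (F _ e e'), (F _ x x'), (F _ y y'); split=> [j|].
  by rewrite /F; case: (split j) => j'; [apply: h | apply: h'].
rewrite big_split_ord /=; congr (_ + _); apply: eq_bigr => i' _; rewrite /F.
- by rewrite (unsplitK (inl _ i')).
- by rewrite (unsplitK (inr _ i')).
Qed.

Lemma gr_sum (P : bimod R) i (I : Type) (r : seq I) (Q : pred I) (F : I -> P) :
  gr_closed P -> (forall j, Q j -> gr i (F j)) -> gr i (\sum_(j <- r | Q j) F j).
Proof. by move=> [h0 hD] h; apply: big_ind => // *; apply: hD. Qed.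

Lemma tens_gr_map (P : bimod R) (h : tens A M N -> P) (d : int) :
  is_add h -> gr_closed P ->
  (forall i j x y, gr i x -> gr j y -> gr (i + j + d) (h (tpure A x y))) ->
  forall i u, gr i u -> gr (i + d) (h u).
Proof.
move=> hD hP hh i u [n [e [x [y [hxy ->]]]]].
rewrite (is_add_sum hD); apply: gr_sum => // j _.
have [h1 h2] := hxy j; have := hh _ _ _ _ h1 h2.
by rewrite addrCA subrr addr0.
Qed.

Lemma tens_gr_lact (P : int -> R -> Prop) :
  gr_lact_closed M P -> gr_lact_closed (tens A M N) P.
Proof.
move=> hM i j a u Pa; rewrite addrC.
apply: (tens_gr_map (h := lact a)) => [||i' j' x y hx hy].
- exact: lactDr.
- exact: tens_gr_closed.
- by rewrite lact_tpure addrAC; apply: tens_gr_pure => //; rewrite addrC; apply: hM.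
Qed.

End GradedTensor.

Section Maps.
Variables (W : groupType) (S : finType) (g : S -> W).
Hypothesis coxW : coxeter_system g.
Variables (k : fieldType) (d : nat) (rho : W -> 'M[k]_d).
Hypothesis repr : representation rho.
Local Notation R := (mpoly d k).
Local Notation act := (act rho).
Local Notation B := (B g rho).
Local Notation Bs := (Bs g rho).
Local Notation pures := (pures g rho).
Local Notation inv := (invariant g rho).

Lemma Rb_gr_closed : gr_closed (Rb k d).
Proof. by split=> [i|i x y]; [apply: poly_gr0 | apply: poly_grD]. Qed.

Lemma B_gr_closed t : gr_closed (B t).
Proof. by case: t => [|s t]; [apply: Rb_gr_closed | apply: tens_gr_closed]. Qed.

Lemma Bs_gr_lact s : gr_lact_closed (Bs s) (@poly_gr k d).
Proof.
move=> i j a x ha hx; rewrite /gr /= -addrA.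
apply: (@tens_gr_lact _ (inv s) (Rb k d) (Rb k d) (@poly_gr k d)) => // i' j' b y.
exact: poly_grM.
Qed.

Lemma B_gr_lact t : gr_lact_closed (B t) (@poly_gr k d).
Proof.
case: t => [|s t]; first by move=> i j a x; apply: poly_grM.
by apply: tens_gr_lact; apply: Bs_gr_lact.
Qed.

Lemma gr_pureR s t i j (e : Bs s) (b : B t) :
  gr i e -> gr j b -> gr (i + j) (pureR e b : B (s :: t)).
Proof. exact: tens_gr_pure. Qed.

Lemma gr_pures s i j (p q : R) :
  poly_gr i p -> poly_gr j q -> gr (i + j - 1) (pures s p q).
Proof.
by move=> hp hq; rewrite /gr /= subrK; exact: (@tens_gr_pure _ _ (Rb k d) (Rb k d)).
Qed.

Lemma gr_catB t u i j (b : B t) (c : B u) : gr i b -> gr j c -> gr (i + j) (catB b c).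
Proof.
elim: t i b => [|s t IH] i b hb hc; first exact: B_gr_lact.
move: hb; apply: (tens_gr_map (h := fun b : B (s :: t) => catB b c)) => [x y||i' j' x y hx hy].
- exact: catBDl.
- exact: (@B_gr_closed (s :: (t ++ u))).
- rewrite -/(pureR x y) catB_cons -addrA; apply: (@gr_pureR s (t ++ u)) => //.
  exact: IH.
Qed.

Lemma catB_gr_map t u (P : bimod R) (h : B (t ++ u) -> P) (e : int) :
  is_add h -> gr_closed P ->
  (forall i j (b : B t) (c : B u), gr i b -> gr j c -> gr (i + j + e) (h (catB b c))) ->
  forall i w, gr i w -> gr (i + e) (h w).
Proof.
elim: t h e => [|s t IH] h e hD hP hh i w hw.
  by have := hh 0 i 1 w (@poly_gr1 k d) hw; rewrite add0r /= lact1.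
move: i w hw; apply: (tens_gr_map hD hP) => i j x y hx hy.
have -> : i + j + e = j + (i + e) by ring.
pose h' y' := h (pureR x (y' : B (t ++ u)) : B (s :: t ++ u)).
apply: (IH h' _ _ hP) => // [y1 y2|i' j' b c hb hc]; rewrite /h'.
- by rewrite (@pureRDr _ _ _ _ _ _ s (t ++ u)) hD.
- rewrite -catB_cons; have -> : i' + j' + (i + e) = i + i' + j' + e by ring.
  by apply: hh => //; apply: gr_pureR.
Qed.

Lemma puresDl s p p' q : pures s (p + p') q = pures s p q + pures s p' q.
Proof. exact: (@tpureDl _ _ (Rb k d) (Rb k d)). Qed.

Lemma puresDr s p q q' : pures s p (q + q') = pures s p q + pures s p q'.
Proof. exact: (@tpureDr _ _ (Rb k d) (Rb k d)). Qed.

Lemma puresA s p a q : inv s a -> pures s (p * a) q = pures s p (a * q).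
Proof. exact: (@tpureA _ _ (Rb k d) (Rb k d)). Qed.

Lemma lact_pures s a p q : lact a (pures s p q) = pures s (a * p) q.
Proof. exact: (@lact_tpure _ _ (Rb k d) (Rb k d)). Qed.

Lemma ract_pures s a p q : ract (pures s p q) a = pures s p (q * a).
Proof. exact: (@ract_tpure _ _ (Rb k d) (Rb k d)). Qed.

Lemma Bs_ext s (P : zmodType) (h h' : Bs s -> P) :
  is_add h -> is_add h' -> (forall p q, h (pures s p q) = h' (pures s p q)) -> h =1 h'.
Proof. exact: (@tens_ext _ _ (Rb k d) (Rb k d)). Qed.

Lemma Bs_lift s (P : zmodType) (f : R -> R -> P) :
  (forall x x' y, f (x + x') y = f x y + f x' y) ->
  (forall x y y', f x (y + y') = f x y + f x y') ->
  (forall x a y, inv s a -> f (x * a) y = f x (a * y)) ->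
  exists h : Bs s -> P, is_add h /\ forall x y, h (pures s x y) = f x y.
Proof. exact: (@tens_lift _ _ (Rb k d) (Rb k d)). Qed.

Lemma Bs_gr_map s (P : bimod R) (h : Bs s -> P) (e : int) :
  is_add h -> gr_closed P ->
  (forall i j p q, poly_gr i p -> poly_gr j q -> gr (i + j - 1 + e) (h (pures s p q))) ->
  forall i u, gr i u -> gr (i + e) (h u).
Proof.
move=> hD hP hh i u hu.
rewrite -[i](addrK 1) -addrA.
apply: (@tens_gr_map _ (inv s) (Rb k d) (Rb k d) _ h _ hD hP) => // i' j' x y hx hy.
by rewrite addrA; apply: hh.
Qed.

Lemma multP s : is_add (@mult _ _ g k d rho s) /\
  forall p q, mult (pures s p q) = p * q.
Proof.
apply: the_additiveP; apply: Bs_lift => [x x' y|x y y'|x a y _].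
- exact: mulrDl.
- exact: mulrDr.
- by rewrite mulrA.
Qed.

Lemma mult_lact s a (b : Bs s) : mult (lact a b) = a * mult b.
Proof.
have [hD hE] := multP s.
move: b; apply: Bs_ext => [x y|x y|p q]; rewrite ?lactDr ?hD ?mulrDr //.
by rewrite lact_pures !hE mulrA.
Qed.

Lemma mult_ract s a (b : Bs s) : mult (ract b a) = mult b * a.
Proof.
have [hD hE] := multP s.
move: b; apply: Bs_ext => [x y|x y|p q]; rewrite ?ractDl ?hD ?mulrDl //.
by rewrite ract_pures !hE mulrA.
Qed.

Lemma mult_gr s i (b : Bs s) : gr i b -> poly_gr (i + 1) (mult b).
Proof.
have [hD hE] := multP s.
apply: (Bs_gr_map (P := Rb k d) hD Rb_gr_closed) => i' j p q hp hq.
by rewrite hE subrK; apply: poly_grM.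
Qed.

Lemma m_P s : is_add (@m_ _ _ g k d rho s) /\
  forall (b : Bs s) (c : B [::]), m_ (pureR b c : B [:: s]) = mult b * c.
Proof.
apply: the_additiveP; apply: B_lift => [x x' y|x y y'|x a y].
- by rewrite (multP s).1 mulrDl.
- exact: mulrDr.
- by rewrite mult_ract mulrA.
Qed.

Lemma m_hom s : hom_deg 1 (@m_ _ _ g k d rho s).
Proof.
have [hD hE] := m_P s.
split; first split=> [|a|x a] //.
- apply: B_ext => [x y|x y|e b]; rewrite ?lactDr ?hD ?lactDr //.
  by rewrite lact_pureR !hE mult_lact -mulrA.
- move: x; apply: B_ext => [x y|x y|e b]; rewrite ?ractDl ?hD ?ractDl //.
  by rewrite ract_pureR !hE mulrA.
- apply: (tens_gr_map hD (B_gr_closed [::])) => i j x y hx hy.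
  rewrite -[tpure _ _ _]/(pureR x (y : B [::]) : B [:: s]) hE addrAC.
  by apply: poly_grM => //; apply: mult_gr.
Qed.

Lemma beta1P s : is_add (@beta1 _ _ g k d rho s) /\
  forall p q, beta1 (pures s p q) = p * act (g s) q.
Proof.
apply: the_additiveP; apply: Bs_lift => [x x' y|x y y'|x a y sa].
- exact: mulrDl.
- by rewrite actD mulrDr.
- by rewrite actM sa mulrA.
Qed.

Lemma beta1_lact s a (b : Bs s) : beta1 (lact a b) = a * beta1 b.
Proof.
have [hD hE] := beta1P s.
move: b; apply: Bs_ext => [x y|x y|p q]; rewrite ?lactDr ?hD ?mulrDr //.
by rewrite lact_pures !hE mulrA.
Qed.

Lemma beta1_ract s a (b : Bs s) : beta1 (ract b a) = beta1 b * act (g s) a.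
Proof.
have [hD hE] := beta1P s.
move: b; apply: Bs_ext => [x y|x y|p q]; rewrite ?ractDl ?hD ?mulrDl //.
by rewrite ract_pures !hE actM mulrA.
Qed.

Lemma beta1_gr s i (b : Bs s) : gr i b -> poly_gr (i + 1) (beta1 b).
Proof.
have [hD hE] := beta1P s.
apply: (Bs_gr_map (P := Rb k d) hD Rb_gr_closed) => i' j p q hp hq.
by rewrite hE subrK; apply: poly_grM => //; apply: poly_gr_act.
Qed.

(** As for [catB_ok]: [beta] on s :: t exists because [beta] on t is additive and left linear, hence
    a joint induction. *)
Definition beta_ok t (h : B t -> R) := [/\ is_add h,
  forall a b, h (lact a b) = a * h b,
  forall a b, h (ract b a) = h b * act (wd g t) a &
  forall i (b : B t), gr i b -> poly_gr (i + (size t)%:Z) (h b)].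

Lemma beta_ok_cons s t (h : B t -> R) (h' : B (s :: t) -> R) : beta_ok h ->
  is_add h' -> (forall e b, h' (pureR e b) = (beta1 e : R) * act (g s) (h b)) ->
  beta_ok h'.
Proof.
move=> [IH1 IH2 IH3 IH4] hD hE; split=> // [a b|a b|i b].
- move: b; apply: (B_ext (h := fun b => h' (lact a b)) (h' := fun b => a * h' b))
    => [x y|x y|e b].
  + by rewrite lactDr hD.
  + by rewrite hD mulrDr.
  + by rewrite lact_pureR !hE beta1_lact mulrA.
- move: b; apply: (B_ext (h := fun b => h' (ract b a))
    (h' := fun b => h' b * act (wd g (s :: t)) a)) => [x y|x y|e b].
  + by rewrite ractDl hD.
  + by rewrite hD mulrDl.
  + rewrite ract_pureR !hE IH3 wd_cons.
    by rewrite -[act (_ * _)%g a]/(act _ a) (act_mulg repr) actM mulrA.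
- apply: (tens_gr_map (P := Rb k d) hD Rb_gr_closed) => i' j' x y hx hy.
  rewrite -[tpure _ _ _]/(pureR x y : B (s :: t)) hE intS addrACA.
  by apply: poly_grM; [apply: beta1_gr | apply/poly_gr_act/IH4].
Qed.

Lemma beta_cons_ex s t (h : B t -> R) : beta_ok h ->
  exists h' : B (s :: t) -> R, is_add h' /\
    forall e b, h' (pureR e b) = (beta1 e : R) * act (g s) (h b).
Proof.
move=> [IH1 IH2 _ _].
have b1D (e e' : Bs s) : (beta1 (e + e') : R) = (beta1 e : R) + beta1 e'.
  exact: (beta1P s).1.
apply: B_lift => [x x' y|x y y'|x a y].
- by rewrite b1D mulrDl.
- by rewrite IH1 actD mulrDr.
- by rewrite IH2 actM beta1_ract mulrA.
Qed.

Lemma beta_consP s t : beta_ok (@beta _ _ g k d rho t : B t -> R) ->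
  is_add (@beta _ _ g k d rho (s :: t) : B (s :: t) -> R) /\
  forall (e : Bs s) (b : B t),
    (beta (pureR e b : B (s :: t)) : R) = (beta1 e : R) * act (g s) (beta b : R).
Proof.
move=> ok; have [h hP] := beta_cons_ex s ok.
by apply: the_additiveP; exists h.
Qed.

Lemma beta_okP t : beta_ok (@beta _ _ g k d rho t : B t -> R).
Proof.
elim: t => [|s t IH].
  split=> //; last by move=> i b; rewrite addr0.
  move=> a b; rewrite -[LHS]/((b : R) * a); congr (_ * _).
  by rewrite wd_nil act_one.
have [hD hE] := beta_consP s IH.
exact: beta_ok_cons IH hD hE.
Qed.

Lemma betaD t (b b' : B t) : (beta (b + b') : R) = (beta b : R) + beta b'.
Proof. by case: (beta_okP t). Qed.

Lemma beta_lact t a (b : B t) : (beta (lact a b) : R) = a * beta b.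
Proof. by case: (beta_okP t). Qed.

Lemma beta_ract t a (b : B t) : (beta (ract b a) : R) = (beta b : R) * act (wd g t) a.
Proof. by case: (beta_okP t). Qed.

Lemma beta_cons s t (e : Bs s) (b : B t) :
  (beta (pureR e b : B (s :: t)) : R) = (beta1 e : R) * act (g s) (beta b : R).
Proof. exact: (beta_consP s (beta_okP t)).2. Qed.

Lemma beta_hom t : hom_deg (size t) (@beta _ _ g k d rho t).
Proof.
split; last by case: (beta_okP t).
by split; [exact: betaD | exact: beta_lact | move=> x a; exact: beta_ract].
Qed.

Lemma beta_catB t u (b : B t) (c : B u) :
  (beta (catB b c) : R) = (beta b : R) * act (wd g t) (beta c : R).
Proof.
elim: t b => [|s t IH] b.
  rewrite [LHS](@beta_lact u); congr (_ * _); rewrite wd_nil; exact/esym/act_one.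
move: b; apply: (B_ext (P := R) (h := fun b => (beta (catB b c) : R))
   (h' := fun b => (beta b : R) * act (wd g (s :: t)) (beta c : R))) => [x y|x y|e b].
- rewrite catBDl; exact: (@betaD (s :: (t ++ u))).
- rewrite betaD; exact: mulrDl.
- rewrite catB_cons (@beta_cons s (t ++ u)) IH beta_cons actM wd_cons act_mulg //.
  exact: mulrA.
Qed.

Lemma beta_one t : (beta (one g rho t) : R) = 1.
Proof.
elim: t => [|s t IH] //.
by rewrite [LHS](@beta_cons s t) IH (beta1P s).2 !act_1 !mulr1.
Qed.

End Maps.

(** * Transport along equalities of words, and the maps id ⊗ phi ⊗ id *)

Section Whisker.
Variables (W : groupType) (S : finType) (g : S -> W).
Hypothesis coxW : coxeter_system g.
Variables (k : fieldType) (d : nat) (rho : W -> 'M[k]_d).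
Hypothesis repr : representation rho.
Local Notation R := (mpoly d k).
Local Notation B := (B g rho).
Local Notation Bs := (Bs g rho).

Lemma castB_id t (e : t = t) (b : B t) : castB e b = b.
Proof. by rewrite (eq_irrelevance e erefl). Qed.

Lemma castB_trans t u v (e : t = u) (e' : u = v) (b : B t) :
  castB e' (castB e b) = castB (etrans e e') b.
Proof. by subst v u. Qed.

Lemma castBK t u (e : t = u) (e' : u = t) (b : B t) : castB e' (castB e b) = b.
Proof. by rewrite castB_trans castB_id. Qed.

Lemma castB_irr t u (e e' : t = u) (b : B t) : castB e b = castB e' b.
Proof. by rewrite (eq_irrelevance e e'). Qed.

Lemma castB_hom t u (e : t = u) : hom_deg 0 (@castB _ _ g k d rho t u e).
Proof. by subst u; apply: hom_id. Qed.

Lemma castBD t u (e : t = u) : is_add (@castB _ _ g k d rho t u e).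
Proof. by subst u. Qed.

Lemma castB_catB t t' u u' (et : t = t') (eu : u = u') (e : t ++ u = t' ++ u')
  (b : B t) (c : B u) : castB e (catB b c) = catB (castB et b) (castB eu c).
Proof. by subst t' u'; rewrite castB_id. Qed.

Lemma castB_catl t t' u (et : t = t') (e : t ++ u = t' ++ u)
  (b : B t) (c : B u) : castB e (catB b c) = catB (castB et b) c.
Proof. exact: (castB_catB et erefl). Qed.

Lemma beta_castB t u (e : t = u) (b : B t) : beta (castB e b) = beta b :> R.
Proof. by subst u. Qed.

Lemma castB_cons s t u (e : t = u) (e' : s :: t = s :: u) (x : Bs s) (b : B t) :
  castB e' (pureR x b : B (s :: t)) = pureR x (castB e b).
Proof. by subst u; rewrite castB_id. Qed.

Lemma catB_assoc t u v (e : (t ++ u) ++ v = t ++ (u ++ v)) (a : B t) (b : B u) (c : B v) :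
  castB e (catB (catB a b) c) = catB a (catB b c).
Proof.
elim: t e a => [|s t IH] e a; first by rewrite castB_id /= lact_catB.
move: a; apply: (B_ext (h := fun a => castB e (catB (catB a b) c))
  (h' := fun a => catB a (catB b c))) => [x y|x y|x a].
- by rewrite !catBDl castBD.
- exact: catBDl.
- rewrite !catB_cons (@castB_cons s _ (t ++ (u ++ v)) (esym (catA t u v))).
  by rewrite IH.
Qed.

Lemma catB_nil t (e : t ++ [::] = t) (b : B t) (c : B [::]) : castB e (catB b c) = ract b c.
Proof.
elim: t e b => [|s t IH] e b; first by rewrite castB_id.
move: b; apply: (B_ext (h := fun b => castB e (catB b c))
  (h' := fun b => ract b c)) => [x y|x y|x b].
- by rewrite catBDl castBD.
- exact: ractDl.
- by rewrite catB_cons (@castB_cons s _ t (cats0 t)) IH ract_pureR.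
Qed.

Lemma catB_ext3 t u v (P : zmodType) (h h' : B (t ++ (u ++ v)) -> P) :
  is_add h -> is_add h' ->
  (forall (x : B t) (y : B u) (z : B v), h (catB x (catB y z)) = h' (catB x (catB y z))) ->
  h =1 h'.
Proof.
move=> hD h'D e; apply: catB_ext => // x; apply: catB_ext => // [y y'|y y'].
- by rewrite catBDr hD.
- by rewrite catBDr h'D.
Qed.

Section WhiskerMor.
Variables (t u a c : seq S) (phi : B a -> B c).
Hypothesis phiM : bimod_morphism phi.

(** Two successive lifts: right linearity of phi makes the inner one balanced against the factor on
    the right, left linearity makes the outer one balanced against the factor on the left. *)
Lemma whiskerP : is_add (whisker (t := t) (u := u) phi) /\
  forall x y z, whisker phi (catB x (catB y z)) = catB x (catB (phi y) z) :> B (t ++ (c ++ u)).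
Proof.
case: phiM => phiD phil phir.
apply: the_additiveP.
have H1 (x : B t) : exists h : B (a ++ u) -> B (t ++ (c ++ u)),
    is_add h /\ forall y z, h (catB y z) = catB x (catB (phi y) z).
  apply: catB_lift => [y y' z|y z z'|y b z].
  - by rewrite phiD catBDl catBDr.
  - by rewrite !catBDr.
  - by rewrite phir catBA.
have [H HP] := boolp.choice H1.
have HD x := (HP x).1; have HE x := (HP x).2.
have [h [hD hE]] : exists h : B (t ++ (a ++ u)) -> B (t ++ (c ++ u)),
    is_add h /\ forall x w, h (catB x w) = H x w.
  apply: catB_lift => [x x' w|x|x b w].
  - move: w; apply: catB_ext => [//|w w'|y z]; first by rewrite !HD addrACA.
    by rewrite !HE catBDl.
  - exact: HD.
  - move: w; apply: (catB_ext (h := H _) (h' := fun w => H x (lact b w))) => [//|w w'|y z].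
      by rewrite lactDr HD.
    by rewrite lact_catB !HE phil catBA lact_catB.
by exists h; split=> // x y z; rewrite hE HE.
Qed.

Lemma whisker_mor : bimod_morphism (whisker (t := t) (u := u) phi).
Proof.
have [hD hE] := whiskerP; split=> // [b|x b].
- apply: catB_ext3 => [x y|x y|x y z].
  + by rewrite lactDr hD.
  + by rewrite hD lactDr.
  + by rewrite lact_catB !hE lact_catB.
- move: x; apply: (catB_ext3 (h := fun x => whisker phi (ract x b))
    (h' := fun x => ract (whisker phi x) b)) => [x y|x y|x y z].
  + by rewrite ractDl hD.
  + by rewrite hD ractDl.
  + by rewrite !ract_catB !hE !ract_catB.
Qed.

Lemma whisker_hom e : hom_deg e phi -> hom_deg e (whisker (t := t) (u := u) phi).
Proof.
move=> [_ he]; split; first exact: whisker_mor.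
have [hD hE] := whiskerP.
apply: catB_gr_map => //; first exact: B_gr_closed.
move=> i j x w hx; have -> : i + j + e = j + (i + e) by ring.
move: j w; apply: (catB_gr_map (h := fun w => whisker phi (catB x w))) => [y y'||i' j' y z hy hz].
- by rewrite catBDr hD.
- exact: B_gr_closed.
rewrite hE; have -> : i' + j' + (i + e) = i + (i' + e + j') by ring.
by apply: gr_catB => //; apply: gr_catB => //; apply: he.
Qed.

End WhiskerMor.

Lemma whisker_catl t u c (phi : B t -> B c) (x : B t) (z : B u) :
  bimod_morphism phi ->
  whisker (t := [::]) (u := u) phi (catB x z) = catB (phi x) z :> B (c ++ u).
Proof.
move=> pM; have [_ hE] := whiskerP [::] u pM.
by have := hE 1 x z; rewrite /= !lact1.
Qed.

End Whisker.

(** * The morphism j_s *)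

Section Trivalent.
Variables (W : groupType) (S : finType) (g : S -> W).
Hypothesis coxW : coxeter_system g.
Variables (k : fieldType) (d : nat) (rho : W -> 'M[k]_d).
Hypothesis repr : representation rho.
Local Notation R := (mpoly d k).
Local Notation B := (B g rho).
Local Notation Bs := (Bs g rho).
Local Notation pures := (pures g rho).
Local Notation inv := (invariant g rho).
Variables (xs : S -> 'rV[k]_d) (xv : S -> 'cV[k]_d).
Hypothesis two_neq0 : 2%:R != 0 :> k.
Hypothesis xvP : forall s, rho (g s) = 1%:M - xv s *m xs s /\ xs s *m xv s = 2%:R%:M.
Local Notation dem := (demazure g rho xs).

Let demD s p q : dem s (p + q) = dem s p + dem s q.
Proof. exact: demazureD. Qed.
Let demM s p q : inv s p -> dem s (p * q) = p * dem s q.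
Proof. exact: demazureMl. Qed.
Lemma Bs2_ext s (P : zmodType) (h h' : B [:: s; s] -> P) :
  is_add h -> is_add h' ->
  (forall p q q' r (c : B [::]),
    h (pureR (pures s p q) (pureR (pures s q' r) c : B [:: s]) : B [:: s; s]) =
    h' (pureR (pures s p q) (pureR (pures s q' r) c : B [:: s]) : B [:: s; s])) -> h =1 h'.
Proof.
move=> hD h'D e; apply: B_ext => // b1 b2; move: b1.
apply: (Bs_ext (h := fun b1 => h (pureR b1 b2 : B [:: s; s]))
  (h' := fun b1 => h' (pureR b1 b2 : B [:: s; s]))) => [x y|x y|p q].
- by rewrite (@pureRDl _ _ _ _ _ _ s [:: s]) hD.
- by rewrite (@pureRDl _ _ _ _ _ _ s [:: s]) h'D.
move: b2; apply: (B_ext (h := fun b2 => h (pureR (pures s p q) (b2 : B [:: s]) : B [:: s; s]))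
  (h' := fun b2 => h' (pureR (pures s p q) (b2 : B [:: s]) : B [:: s; s]))) => [x y|x y|b2 c].
- by rewrite (@pureRDr _ _ _ _ _ _ s [:: s]) hD.
- by rewrite (@pureRDr _ _ _ _ _ _ s [:: s]) h'D.
move: b2; apply: (Bs_ext (h := fun b2 => h (pureR (pures s p q) (pureR b2 c : B [:: s]) : B [:: s; s]))
  (h' := fun b2 => h' (pureR (pures s p q) (pureR b2 c : B [:: s]) : B [:: s; s]))) => [x y|x y|q' r].
- by rewrite (@pureRDl _ _ _ _ _ _ s [::]) (@pureRDr _ _ _ _ _ _ s [:: s]) hD.
- by rewrite (@pureRDl _ _ _ _ _ _ s [::]) (@pureRDr _ _ _ _ _ _ s [:: s]) h'D.
- exact: e.
Qed.

(** The four polynomial slots are lifted in two stages, (q', r) for fixed (p, q) and then (p, q);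
    invariants pass through the Demazure operator. *)
Lemma j_ex s : exists J : Bs s -> Bs s -> Bs s,
  [/\ forall b, is_add (J b), forall b b' c, J (b + b') c = J b c + J b' c &
  forall p q q' r, J (pures s p q) (pures s q' r) = pures s (p * dem s (q * q')) r].
Proof.
have H1 (pq : R * R) : exists h : Bs s -> Bs s, is_add h /\
    forall q' r, h (pures s q' r) = pures s (pq.1 * dem s (pq.2 * q')) r.
  apply: Bs_lift => [x x' y|x y y'|x a y sa].
  - by rewrite mulrDr demD mulrDr puresDl.
  - by rewrite puresDr.
  - by rewrite -puresA // [x * a]mulrC mulrCA (demM _ sa) mulrCA mulrC.
have [K KP] := boolp.choice H1.
have KD pq := (KP pq).1; have KE p q := (KP (p, q)).2.
have H2 (b2 : Bs s) : exists h : Bs s -> Bs s, is_add h /\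
    forall p q, h (pures s p q) = K (p, q) b2.
  apply: Bs_lift => [x x' y|x y y'|x a y sa].
  - move: b2; apply: (Bs_ext (h := K _) (h' := fun b2 => K _ b2 + K _ b2)) => [//|b b'|q' r].
      by rewrite !KD addrACA.
    by rewrite !KE /= mulrDl puresDl.
  - move: b2; apply: (Bs_ext (h := K _) (h' := fun b2 => K _ b2 + K _ b2)) => [//|b b'|q' r].
      by rewrite !KD addrACA.
    by rewrite !KE /= mulrDl demD mulrDr puresDl.
  - move: b2; apply: Bs_ext => // q' r.
    by rewrite !KE /= -[a * y * q']mulrA (demM _ sa) mulrA.
have [J JP] := boolp.choice H2.
exists (fun b1 b2 => J b2 b1); split=> [b|b b' c|p q q' r].
- move=> x y; move: b; apply: (Bs_ext (h' := fun b => J x b + J y b)).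
  + exact: (JP _).1.
  + by move=> b b'; rewrite !(JP _).1 addrACA.
  + by move=> p q; rewrite !(JP _).2 KD.
- exact: (JP _).1.
- by rewrite (JP _).2 KE.
Qed.

Lemma j_P s : is_add (@j_ _ _ g k d rho xs s) /\
  forall p q q' r (c : B [::]),
    j_ xs (pureR (pures s p q) (pureR (pures s q' r) c : B [:: s]) : B [:: s; s]) =
    pureR (pures s (p * dem s (q * q')) r) c.
Proof.
apply: the_additiveP.
have [J [JD JDl JE]] := j_ex s.
have Jl a b c : J (lact a b) c = lact a (J b c).
  move: b; apply: (Bs_ext (h := fun b => J (lact a b) c) (h' := fun b => lact a (J b c))) => [x y|x y|p q].
  - by rewrite lactDr JDl.
  - by rewrite JDl lactDr.
  move: c; apply: (Bs_ext (h' := fun c => lact a (J _ c))) => [//|x y|q' r].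
  - by rewrite JD lactDr.
  - by rewrite lact_pures !JE lact_pures mulrA.
have Jr a b c : J b (ract c a) = ract (J b c) a.
  move: b; apply: (Bs_ext (h := fun b => J b (ract c a)) (h' := fun b => ract (J b c) a)) => [x y|x y|p q].
  - by rewrite JDl.
  - by rewrite JDl ractDl.
  move: c; apply: (Bs_ext (h := fun c => J _ (ract c a)) (h' := fun c => ract (J _ c) a)) => [x y|x y|q' r].
  - by rewrite ractDl JD.
  - by rewrite JD ractDl.
  - by rewrite ract_pures !JE ract_pures.
have Jm a b c : J (ract b a) c = J b (lact a c).
  move: b; apply: (Bs_ext (h := fun b => J (ract b a) c) (h' := fun b => J b (lact a c))) => [x y|x y|p q].
  - by rewrite ractDl JDl.
  - by rewrite JDl.
  move: c; apply: (Bs_ext (h' := fun c => J _ (lact a c))) => [//|x y|q' r].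
  - by rewrite lactDr JD.
  - by rewrite lact_pures ract_pures !JE mulrA.
have H1 (b : Bs s) : exists h : B [:: s] -> B [:: s], is_add h /\
    forall b' (c : B [::]), h (pureR b' c) = pureR (J b b') c.
  apply: B_lift => [x x' y|x y y'|x a y].
  - by rewrite JD (@pureRDl _ _ _ _ _ _ s [::]).
  - by rewrite (@pureRDr _ _ _ _ _ _ s [::]).
  - by rewrite Jr (@pureRA _ _ _ _ _ _ s [::]).
have [K KP] := boolp.choice H1.
have KD b := (KP b).1; have KE b := (KP b).2.
have [h [hD hE]] : exists h : B [:: s; s] -> B [:: s], is_add h /\
    forall b (w : B [:: s]), h (pureR b w) = K b w.
  apply: B_lift => [x x' y|x|x a y].
  - move: y; apply: (B_ext (h := K _) (h' := fun y => K x y + K x' y)) => [//|y y'|b c].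
      by rewrite !KD addrACA.
    by rewrite !KE JDl (@pureRDl _ _ _ _ _ _ s [::]).
  - exact: KD.
  - move: y; apply: (B_ext (h' := fun y => K _ (lact a y))) => [//|y y'|b c].
      by rewrite lactDr KD.
    by rewrite lact_pureR !KE Jm.
by exists h; split=> // p q q' r c; rewrite hE KE JE.
Qed.

Lemma j_hom s : hom_deg (-1) (@j_ _ _ g k d rho xs s).
Proof.
have [jD jE] := j_P s.
split; first split=> // [a|x a].
- apply: Bs2_ext => [x y|x y|p q q' r c].
  + by rewrite lactDr jD.
  + by rewrite jD lactDr.
  + rewrite (@lact_pureR _ _ _ _ _ _ s [:: s]) lact_pures !jE.
    by rewrite (@lact_pureR _ _ _ _ _ _ s [::]) lact_pures mulrA.
- move: x; apply: (Bs2_ext (h := fun x => j_ xs (ract x a)) (h' := fun x => ract (j_ xs x) a)) => [x y|x y|p q q' r c].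
  + by rewrite ractDl jD.
  + by rewrite jD ractDl.
  + rewrite (@ract_pureR _ _ _ _ _ _ s [:: s]) (@ract_pureR _ _ _ _ _ _ s [::]) !jE.
    by rewrite (@ract_pureR _ _ _ _ _ _ s [::]).
have cl := @B_gr_closed _ _ g _ _ rho [:: s].
apply: (tens_gr_map jD cl) => i j b w hb hw.
rewrite -[tpure _ _ _]/(pureR b (w : B [:: s]) : B [:: s; s]).
have -> : i + j - 1 = j + (i - 1) by ring.
move: j w hw; apply: (tens_gr_map (h := fun w => j_ xs (pureR b (w : B [:: s]) : B [:: s; s])) _ cl).
  by move=> x y; rewrite (@pureRDr _ _ _ _ _ _ s [:: s]) jD.
move=> i' j' b' c hb' hc.
rewrite -[tpure _ _ _]/(pureR b' (c : B [::]) : B [:: s]).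
have -> : i' + j' + (i - 1) = i + (i' + j' - 1) by ring.
move: i b hb; apply: (Bs_gr_map (h := fun b => j_ xs (pureR b (pureR b' c : B [:: s]) : B [:: s; s])) _ cl).
  by move=> x y; rewrite (@pureRDl _ _ _ _ _ _ s [:: s]) jD.
move=> e e' p q hp hq.
have -> : e + e' - 1 + (i' + j' - 1) = i' + (e + e' - 1 + (j' - 1)) by ring.
move: i' b' hb'; apply: (Bs_gr_map (h := fun b' => j_ xs (pureR (pures s p q) (pureR b' c : B [:: s]) : B [:: s; s])) _ cl).
  by move=> x y; rewrite (@pureRDl _ _ _ _ _ _ s [::]) (@pureRDr _ _ _ _ _ _ s [:: s]) jD.
move=> f f' q' r hq' hr; rewrite jE.
have -> : f + f' - 1 + (e + e' - 1 + (j' - 1)) = (e + (e' + f - 2) + f' - 1) + j' by ring.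
apply: (@gr_pureR _ _ _ _ _ _ s [::]) => //; apply: gr_pures => //.
by apply: poly_grM => //; apply: (demazure_gr coxW repr two_neq0 xvP); apply: poly_grM.
Qed.

Lemma catB1_ext s (P : zmodType) (h h' : B [:: s] -> P) :
  is_add h -> is_add h' ->
  (forall p q (c : B [::]), h (pureR (pures s p q) c : B [:: s]) = h' (pureR (pures s p q) c : B [:: s])) ->
  h =1 h'.
Proof.
move=> hD h'D e; apply: B_ext => // b c; move: b.
apply: (Bs_ext (h := fun b => h (pureR b c : B [:: s])) (h' := fun b => h' (pureR b c : B [:: s]))) => [x y|x y|p q] //.
- by rewrite (@pureRDl _ _ _ _ _ _ s [::]) hD.
- by rewrite (@pureRDl _ _ _ _ _ _ s [::]) h'D.
Qed.

End Trivalent.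

(** * Light leaves *)

Section Morphisms.
Variables (W : groupType) (S : finType) (g : S -> W).
Hypothesis coxW : coxeter_system g.
Variables (k : fieldType) (d : nat) (rho : W -> 'M[k]_d).
Hypothesis repr : representation rho.
Local Notation R := (mpoly d k).
Local Notation act := (act rho).
Local Notation B := (B g rho).
Local Notation Bs := (Bs g rho).
Local Notation pures := (pures g rho).
Local Notation inv := (invariant g rho).
Local Notation wd := (wd g).
Variables (xs : S -> 'rV[k]_d) (xv : S -> 'cV[k]_d).
Hypothesis two_neq0 : 2%:R != 0 :> k.
Hypothesis xvP : forall s, rho (g s) = 1%:M - xv s *m xs s /\ xs s *m xv s = 2%:R%:M.
Local Notation dem := (demazure g rho xs).
Local Notation x_ s := (linear_form (xs s) : R).
Let act_x s : act (g s) (x_ s) = - x_ s.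
Proof. exact: act_xs. Qed.
Let x_neq0 s : x_ s != 0.
Proof. exact: xs_neq0. Qed.

Let betD t (b b' : B t) : (beta (b + b') : R) = (beta b : R) + (beta b' : R).
Proof. exact: betaD. Qed.
Let betl t a (b : B t) : (beta (lact a b) : R) = a * (beta b : R).
Proof. exact: beta_lact. Qed.
Let betr t a (b : B t) : (beta (ract b a) : R) = (beta b : R) * act (wd t) a.
Proof. exact: beta_ract. Qed.
Let betc s t (e : Bs s) (b : B t) :
  (beta (pureR e b : B (s :: t)) : R) = (beta1 e : R) * act (g s) (beta b : R).
Proof. exact: beta_cons. Qed.
Let bet1 s p q : (beta1 (pures s p q) : R) = p * act (g s) q.
Proof. exact: (beta1P g rho s).2. Qed.

(** Morphisms to R_x of all degrees, taken with values in R so that the targets for different x have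
    the same type. *)
Definition mor_to (x : W) t (h : B t -> R) : Prop :=
  [/\ is_add h, forall a b, h (lact a b) = a * h b &
      forall a b, h (ract b a) = h b * act x a].

Lemma mor_toP x t (h : B t -> R) : mor_to x h <-> bimod_morphism (h : B t -> Rx rho x).
Proof. by split=> -[h1 h2 h3]; split=> // a b; apply: h3. Qed.

Lemma beta_mor t : mor_to (wd t) (@beta _ _ g k d rho t : B t -> R).
Proof. by split; [exact: betaD | exact: beta_lact | exact: beta_ract]. Qed.

Lemma mor_comp_to x t u (h : B u -> R) (l : B t -> B u) :
  mor_to x h -> bimod_morphism l -> mor_to x (h \o l).
Proof.
move=> [h1 h2 h3] [l1 l2 l3]; split=> [a b|a b|a b] /=.
- by rewrite l1 h1.
- by rewrite l2 h2.
- by rewrite l3 h3.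
Qed.

Lemma mor_toZ x t (h : B t -> R) a : mor_to x h -> mor_to x (fun b => h b * a).
Proof.
move=> [h1 h2 h3]; split=> [b c|b c|b c].
- by rewrite h1 mulrDl.
- by rewrite h2 mulrA.
- by rewrite h3 mulrAC.
Qed.

Lemma mor_toD x t (h h' : B t -> R) :
  mor_to x h -> mor_to x h' -> mor_to x (fun b => h b + h' b).
Proof.
move=> [h1 h2 h3] [h1' h2' h3']; split=> [b c|b c|b c].
- by rewrite h1 h1' addrACA.
- by rewrite h2 h2' mulrDr.
- by rewrite h3 h3' mulrDl.
Qed.

Lemma mor_toN x t (h : B t -> R) : mor_to x h -> mor_to x (fun b => - h b).
Proof.
move=> [h1 h2 h3]; split=> [b c|b c|b c].
- by rewrite h1 opprD.
- by rewrite h2 mulrN.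
- by rewrite h3 mulNr.
Qed.

Lemma mor_to_sum x t (I : Type) (r : seq I) (P : pred I) (F : I -> B t -> R) :
  (forall i, P i -> mor_to x (F i)) -> mor_to x (fun b => \sum_(i <- r | P i) F i b).
Proof.
move=> h; split=> [b c|a b|a b].
- by rewrite -big_split; apply: eq_bigr => i /h[-> _ _].
- by rewrite mulr_sumr; apply: eq_bigr => i /h[_ -> _].
- by rewrite mulr_suml; apply: eq_bigr => i /h[_ _ ->].
Qed.

Section LeftRestriction.
Variables (s : S) (t : seq S) (x : W) (h : B (s :: t) -> R).
Hypothesis hM : mor_to x h.
Let hD : is_add h. Proof. by case: hM. Qed.
Let hl a b : h (lact a b) = a * h b. Proof. by case: hM. Qed.
Let hr a b : h (ract b a) = h b * act x a. Proof. by case: hM. Qed.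

Let h0 (b : B t) := h (pureR (pures s 1 1) b).

Let h0D : is_add h0.
Proof. by move=> b b'; rewrite /h0 pureRDr hD. Qed.

Let h0r a b : h0 (ract b a) = h0 b * act x a.
Proof. by rewrite /h0 -ract_pureR hr. Qed.

Let h0l a b : inv s a -> h0 (lact a b) = a * h0 b.
Proof.
move=> sa; rewrite /h0 -pureRA ract_pures mul1r -[X in pures _ _ X]mulr1 -puresA // mul1r.
by rewrite -[X in pures _ X _]mulr1 -lact_pures -lact_pureR hl.
Qed.

Let hE p q b : h (pureR (pures s p q) b) = p * h0 (lact q b).
Proof.
by rewrite /h0 -pureRA ract_pures mul1r -hl lact_pureR lact_pures mulr1.
Qed.

(** On the left h0 commutes only with s-invariants. Multiplication by x_s interchanges the two
    summands up to the invariant x_s^2, so their sum commutes with all of R = R^s + x_s R^s. *)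
Lemma mor_left_sum : mor_to x (fun b => h0 (lact (x_ s) b) + x_ s * h0 b).
Proof.
split=> [b c|a b|a b].
- by rewrite lactDr !h0D mulrDr addrACA.
- have [ha [a1 ha1 ->]] := demazure_spec coxW repr two_neq0 xvP s a.
  set a2 := dem s a in ha *.
  have hx2 : inv s (x_ s * x_ s) by rewrite /invariant actM act_x mulrNN.
  have e1 c : h0 (lact (x_ s) (lact a1 c)) = a1 * h0 (lact (x_ s) c).
    by rewrite -lactM mulrC lactM h0l.
  have e2 c : h0 (lact (x_ s) (lact (x_ s * a2) c)) = x_ s * x_ s * a2 * h0 c.
    rewrite -lactM mulrA h0l // /invariant actM ha.
    by rewrite (_ : act _ _ = x_ s * x_ s).
  have e3 c : h0 (lact (x_ s * a2) c) = a2 * h0 (lact (x_ s) c).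
    by rewrite mulrC lactM h0l.
  by rewrite !lactDl !lactDr !h0D e1 e2 e3 (h0l _ ha1); ring.
- by rewrite -lractA !h0r mulrDl mulrA.
Qed.

(** The vanishing reads h0 (x_s b) = - x_s h0 b, so h0 is semilinear for s; composing with s
    restores linearity and moves the target from R_x to R_(s x). *)
Lemma mor_left_twist :
  (forall b, h0 (lact (x_ s) b) + x_ s * h0 b = 0) ->
  mor_to (g s * x)%g (fun b => act (g s) (h0 b)).
Proof.
move=> h00; split=> [b c|a b|a b].
- by rewrite h0D actD.
- have [ha [a1 ha1 ->]] := demazure_spec coxW repr two_neq0 xvP s a.
  set a2 := dem s a in ha *.
  have e : h0 (lact (x_ s) b) = - x_ s * h0 b.
    by apply: (addIr (x_ s * h0 b)); rewrite h00 mulNr addNr.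
  rewrite lactDl h0D (h0l _ ha1) [_ * a2]mulrC lactM (h0l _ ha) e.
  by rewrite !(actD, actM, actN) ha ha1 act_x opprK; ring.
- by rewrite h0r actM act_mulg.
Qed.

Lemma mor_left_eq0 : (forall b, h0 (lact (x_ s) b) + x_ s * h0 b = 0) ->
  (forall b, h0 b = 0) -> forall b, h b = 0.
Proof.
move=> _ e; apply: B_ext => // [b c|b c]; first by rewrite addr0.
move: b; apply: Bs_ext => [b b'|b b'|p q].
- by rewrite pureRDl hD.
- by rewrite addr0.
- by rewrite hE e mulr0.
Qed.

Lemma mor_left_beta c : (forall b, h0 b = c * act (g s) (beta b : R)) ->
  forall b, h b = c * (beta b : R).
Proof.
move=> e; apply: (B_ext (P := R) (h' := fun b => c * (beta b : R))) => // [b b'|b b'].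
  by cbv beta; rewrite betD mulrDr.
move: b; apply: (Bs_ext (P := R) (h' := fun b => c * (beta (pureR b b' : B (s :: t)) : R)))
  => [b b1|b b1|p q].
- by rewrite pureRDl hD.
- by cbv beta; rewrite pureRDl betD mulrDr.
- by rewrite hE e betc bet1 betl actM; ring.
Qed.

End LeftRestriction.

(** On B_∅ = R the two actions agree, so h(1) (x(a) - a) = 0 for all a, in a domain. *)
Lemma mor_to_nil x (h : B [::] -> R) : mor_to x h ->
  rho x <> 1%:M -> forall b, h b = 0.
Proof.
move=> [h1 h2 h3] nx b.
have e a : h a = a * h 1 by rewrite -h2; congr h; rewrite /lact /= mulr1.
rewrite e; have [->|n0] := eqVneq (h 1) 0; first by rewrite mulr0.
case: nx; apply: (act_faithful repr) => p.
apply: (mulfI n0); rewrite -h3 mulrC -e; congr h.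
by rewrite /ract /= mul1r.
Qed.

(** The hypothesis on subwords that omit the first letter kills [mor_left_sum]; on those that keep
    it, it then kills [mor_left_twist]. *)
Lemma mor_to_zero t x (h : B t -> R) :
  (forall t', subseq t' t -> rho (wd t') <> rho x) -> mor_to x h -> forall b, h b = 0.
Proof.
elim: t x h => [|s t IH] x h ht hM.
  by apply: (mor_to_nil hM); have := ht [::] isT; rewrite wd_nil repr1 // => /nesym.
have u0 b : h (pureR (pures s 1 1) (lact (x_ s) b)) + x_ s * h (pureR (pures s 1 1) b) = 0.
  apply: (IH _ _ _ (mor_left_sum hM)) => t' t't; apply: ht.
  exact: subseq_trans t't (subseq_cons t s).
apply: (mor_left_eq0 hM u0) => b; apply: (act_inj repr (w := g s)); rewrite act0.
apply: (IH _ _ _ (mor_left_twist hM u0)) => t' t't e.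
apply: (ht (s :: t')); first by rewrite /= eqxx.
by rewrite wd_cons reprM // e -reprM // (genKl coxW).
Qed.

(** Omitting the first letter leaves proper subwords, so [mor_left_sum] vanishes by [mor_to_zero].
    At every letter only the choice that keeps it survives, which is the choice made by beta. *)
Lemma mor_to_unique t (h : B t -> R) :
  (forall t', subseq t' t -> t' <> t -> rho (wd t') <> rho (wd t)) ->
  mor_to (wd t) h -> forall b, h b = h (one g rho t) * (beta b : R).
Proof.
elim: t h => [|s t IH] h ht hM.
  move: hM => [h1 h2 h3] b.
  rewrite mulrC -[RHS]h2; congr h; by rewrite /lact /= mulr1.
have u0 b : h (pureR (pures s 1 1) (lact (x_ s) b)) + x_ s * h (pureR (pures s 1 1) b) = 0.
  apply: (mor_to_zero _ (mor_left_sum hM)) => t' t't; apply: ht.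
    exact: subseq_trans t't (subseq_cons t s).
  by move=> e; have := size_subseq t't; rewrite e ltnn.
have tw := mor_left_twist hM u0.
rewrite wd_cons (genKl coxW) in tw.
apply: (mor_left_beta hM) => b; apply: (act_inj repr (w := g s)).
rewrite (IH _ _ tw) ?actM ?(act_gen2 coxW repr) //.
move=> t' t't ne e; apply: (ht (s :: t')); first by rewrite /= eqxx.
  by case.
by rewrite !wd_cons !reprM // e.
Qed.

End Morphisms.

(** * Braid morphisms and the one-letter step *)

Section Tree.
Variables (W : groupType) (S : finType) (g : S -> W).
Hypothesis coxW : coxeter_system g.
Variables (k : fieldType) (d : nat) (rho : W -> 'M[k]_d).
Hypothesis repr : representation rho.
Local Notation R := (mpoly d k).
Local Notation act := (act rho).
Local Notation B := (B g rho).
Local Notation Bs := (Bs g rho).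
Local Notation pures := (pures g rho).
Local Notation inv := (invariant g rho).
Local Notation wd := (wd g).
Local Notation rexpr := (rexpr g).
Local Notation mord := (mord g).
Variables (xs : S -> 'rV[k]_d) (xv : S -> 'cV[k]_d).
Hypothesis two_neq0 : 2%:R != 0 :> k.
Hypothesis xvP : forall s, rho (g s) = 1%:M - xv s *m xs s /\ xs s *m xv s = 2%:R%:M.
Local Notation dem := (demazure g rho xs).
Local Notation x_ s := (linear_form (xs s) : R).
Variable f : forall s r, B (alt s r (mord s r)) -> B (alt r s (mord s r)).
Hypothesis fP : braid_morphisms f.

Let act_x s : act (g s) (x_ s) = - x_ s.
Proof. exact: act_xs. Qed.
Let betD t (b b' : B t) : (beta (b + b') : R) = (beta b : R) + (beta b' : R).
Proof. exact: betaD. Qed.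
Let betl t a (b : B t) : (beta (lact a b) : R) = a * (beta b : R).
Proof. exact: beta_lact. Qed.
Let betr t a (b : B t) : (beta (ract b a) : R) = (beta b : R) * act (wd t) a.
Proof. exact: beta_ract. Qed.
Let betc s t (e : Bs s) (b : B t) :
  (beta (pureR e b : B (s :: t)) : R) = (beta1 e : R) * act (g s) (beta b : R).
Proof. exact: beta_cons. Qed.
Let bet1 s p q : (beta1 (pures s p q) : R) = p * act (g s) q.
Proof. exact: (beta1P g rho s).2. Qed.
Let betcat t u (b : B t) (c : B u) :
  (beta (catB b c) : R) = (beta b : R) * act (wd t) (beta c : R).
Proof. exact: beta_catB. Qed.
Let m_E s (b : Bs s) (c : B [::]) : m_ (pureR b c : B [:: s]) = mult b * c.
Proof. exact: (m_P g rho s).2. Qed.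
Let j_E s p q q' r (c : B [::]) :
    j_ xs (pureR (pures s p q) (pureR (pures s q' r) c : B [:: s]) : B [:: s; s]) =
    pureR (pures s (p * dem s (q * q')) r) c.
Proof. exact: (j_P coxW repr two_neq0 xvP s).2. Qed.
Let m_M s : bimod_morphism (@m_ _ _ g k d rho s).
Proof. exact: (m_hom g rho s).1. Qed.
Let j_M s : bimod_morphism (@j_ _ _ g k d rho xs s).
Proof. exact: (j_hom coxW repr two_neq0 xvP s).1. Qed.

Lemma path_hom t u (p : bpath g t u) : hom_deg 0 (path_mor f p).
Proof.
elim: p => [t'|a s r b {}u sr m0 p IH] /=; first exact: hom_id.
have [fh _] := fP sr m0.
by have := hom_comp IH (whisker_hom a b fh.1 fh); rewrite addr0.
Qed.

Lemma path_morM t u (p : bpath g t u) : bimod_morphism (path_mor f p).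
Proof. by case: (path_hom p). Qed.

(** The condition under which braid morphisms between reduced expressions of w are compatible with
    beta; it is automatic when V is faithful. *)
Definition rho_separated (w : W) := forall t, rexpr t -> wd t = w ->
  forall t', subseq t' t -> rho (wd t') = rho w -> wd t' = w.

(** Both sides of a braid move have the same product, so beta after f is a morphism of the kind
    treated in [mor_to_unique]; its scalar is 1 since f preserves 1 ⊗ ... ⊗ 1. *)
Lemma path_beta t u (p : bpath g t u) : rexpr t -> rho_separated (wd t) ->
  forall b, (beta (path_mor f p b) : R) = beta b.
Proof.
elim: p => [//|a s r b {}u sr m0 p IH] rt sep w.
set m := mord s r in w rt sep p IH *.
have ewd : wd (alt s r m) = wd (alt r s m) by apply: wd_alt_mord.
have et : wd (a ++ (alt r s m ++ b)) = wd (a ++ (alt s r m ++ b)) by rewrite !wd_cat ewd.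
have rt' : rexpr (a ++ (alt r s m ++ b)).
  by move: rt; rewrite /Defs.rexpr et !size_cat !size_alt.
rewrite /= IH // ?et //; have [[fM _] f1] := fP sr m0.
have fb : forall y : B (alt s r m), (beta (f (s := s) (r := r) y) : R) = beta y.
  move=> y; have hM : mor_to (wd (alt s r m)) (fun y => (beta (f (s := s) (r := r) y) : R)).
    by rewrite ewd; exact: (mor_comp_to (beta_mor g repr (alt r s m)) fM).
  rewrite (mor_to_unique coxW repr two_neq0 xvP _ hM) ?f1 ?beta_one ?mul1r //.
  (* Separation is given for the whole expression only, so the subword t' is completed by a and b; a
     word shorter than a reduced one cannot have the same product. *)
  move=> t' t's ne e.
  have := sep _ rt (erefl _) (a ++ (t' ++ b)).
  rewrite !wd_cat !(reprM repr) e => /(_ _ erefl) h.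
  have {}h : wd (a ++ (t' ++ b)) = wd (a ++ (alt s r m ++ b)).
    rewrite !wd_cat; apply: h.
    exact: (cat_subseq (subseq_refl a) (cat_subseq t's (subseq_refl b))).
  have := len_wd g (a ++ (t' ++ b)); rewrite h; move/eqP: rt => ->.
  rewrite !size_cat leq_add2l leq_add2r => le.
  case: ne; apply/eqP; case: (size_subseq_leqif t's) => l1 <-.
  by rewrite eqn_leq l1.
have wM := whiskerP a b fM.
move: w; apply: (catB_ext3 (P := R) (h := fun w => (beta (whisker (f (s := s) (r := r)) w) : R))
  (h' := fun w => (beta w : R))) => [x y|x y|x y z].
- by rewrite wM.1 betD.
- exact: betD.
- by rewrite wM.2 !betcat fb ewd.
Qed.

Section Step.
Variable (s : S).

(* a X = X a' for X = x (x) 1 + 1 (x) y, where a' = a if y = x and a' = s(a)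
   if y = - x. *)
Definition Etw (y : R) : B [:: s] :=
  pureR (pures s (x_ s) 1 + pures s 1 y) (1 : B [::]).
Definition Eone : B [:: s] := pureR (pures s 1 1) (1 : B [::]).

Let pure1 (e : Bs s) a : ract (pureR e (1 : B [::]) : B [:: s]) a = pureR (ract e a) (1 : B [::]).
Proof. by rewrite ract_pureR pureRA; congr pureR; rewrite /ract /lact /= mul1r mulr1. Qed.

Lemma Eone_inv a : inv s a -> lact a Eone = ract Eone a.
Proof.
move=> sa. rewrite /Eone.
rewrite (@lact_pureR _ _ _ _ _ _ s [::]).
rewrite pure1.
rewrite lact_pures ract_pures mulr1 mul1r.
by have := puresA 1 1 sa; rewrite mul1r mulr1 => ->.
Qed.

Let inv_x2 : inv s (x_ s * x_ s).
Proof. by rewrite /invariant actM act_x mulrNN. Qed.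

Let ldec a : exists a1 a2, [/\ inv s a1, inv s a2 & a = a1 + x_ s * a2].
Proof.
have [h2 [a1 h1 e]] := demazure_spec coxW repr two_neq0 xvP s a.
by exists a1, (dem s a).
Qed.

Lemma Etw_comm y a1 a2 : y * y = x_ s * x_ s -> inv s a1 -> inv s a2 ->
  lact (a1 + x_ s * a2) (Etw y) = ract (Etw y) (a1 + y * a2).
Proof.
move=> yy h1 h2; rewrite /Etw (@lact_pureR _ _ _ _ _ _ s [::]) pure1.
apply: (congr1 (fun e => pureR e (1 : B [::]) : B [:: s])).
set X : Bs s := pures s (x_ s) 1 + pures s 1 y.
have hi b : inv s b -> lact b X = ract X b.
  move=> sb; rewrite lactDr ractDl !lact_pures !ract_pures mulr1 mul1r.
  rewrite [b * x_ s]mulrC (puresA _ _ sb) mulr1; congr (_ + _).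
  by have := puresA 1 y sb; rewrite mul1r mulrC.
have hx : lact (x_ s) X = ract X y.
  rewrite lactDr ractDl !lact_pures !ract_pures mulr1 mul1r addrC; congr (_ + _).
  by have := puresA 1 1 inv_x2; rewrite mul1r mulr1 yy.
rewrite lactDl ractDr (hi _ h1) lactM (hi _ h2) -(lractA (x_ s) X a2) hx.
by rewrite -(ractM y a2 X).
Qed.

Lemma EtwE y : Etw y = lact (x_ s) Eone + ract Eone y.
Proof.
rewrite /Eone (@lact_pureR _ _ _ _ _ _ s [::]) pure1 lact_pures ract_pures mulr1 mul1r.
exact: (@pureRDl _ _ _ _ _ _ s [::]).
Qed.

(** The sign of y decides whether evaluation at the twisted element leads to R_x or to R_(x s). In
    [child_basis] z is the longer of x and x s. *)
Definition twisted (x z : W) (y : R) :=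
  (z = x /\ y = x_ s) \/ (z = x * g s /\ y = - x_ s)%g.

Lemma twisted_sq x z y : twisted x z y -> y * y = x_ s * x_ s.
Proof. by case=> -[_ ->]; rewrite ?mulrNN. Qed.

Lemma twisted_act x z y a1 a2 : twisted x z y -> inv s a1 -> inv s a2 ->
  act x (a1 + y * a2) = act z (a1 + x_ s * a2).
Proof.
move=> [[-> ->] _ _|[-> ->] h1 h2]; first exact: erefl.
by rewrite (act_mulg repr) [act (g s) _]actD actM h1 h2 act_x.
Qed.

Lemma twisted_act' x z y a1 a2 : twisted x z y -> inv s a1 -> inv s a2 ->
  act x (a1 - y * a2) = act (z * g s)%g (a1 + x_ s * a2).
Proof.
move=> tw h1 h2; rewrite (act_mulg repr) [act (g s) _]actD actM h1 h2 act_x.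
case: tw => [[-> ->]|[-> ->]]; first by rewrite mulNr.
by rewrite (act_mulg repr) !mulNr opprK [act (g s) _]actB actM h1 h2 act_x mulNr opprK.
Qed.

Section Restriction.
Variables (pre : seq S) (x z : W) (y : R) (h : B (pre ++ [:: s]) -> R).
Hypothesis hM : mor_to x h.
Hypothesis tw : twisted x z y.
Let hD : is_add h. Proof. by case: hM. Qed.
Let hl a b : h (lact a b) = a * h b. Proof. by case: hM. Qed.
Let hr a b : h (ract b a) = h b * act x a. Proof. by case: hM. Qed.
Let h1 (b : B pre) := h (catB b Eone).

Lemma step_tw : mor_to z (fun b : B pre => h (catB b (Etw y))).
Proof.
split=> [b c|a b|a b].
- by rewrite catBDl hD.
- by rewrite -lact_catB hl.
- have [a1 [a2 [i1 i2 ->]]] := ldec a.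
  rewrite (catBA b _ (Etw y)) (Etw_comm (twisted_sq tw) i1 i2) -(ract_catB _ b (Etw y)) hr.
  by rewrite (twisted_act tw i1 i2).
Qed.

(** Vanishing at the twisted element says that right multiplication of b by x_s becomes
    multiplication by - x(y), which is the action of x_s on R_(z s). *)
Lemma step_res : (forall b : B pre, h (catB b (Etw y)) = 0) -> mor_to (z * g s)%g h1.
Proof.
move=> h0; have e (b : B pre) : h1 (ract b (x_ s)) = - (h1 b * act x y).
  have e1 : h (catB b (ract Eone y)) = h1 b * act x y.
    exact: (etrans (congr1 h (esym (ract_catB y b Eone))) (hr y (catB b Eone))).
  have e2 : h (catB b (lact (x_ s) Eone)) = h1 (ract b (x_ s)).
    exact: (congr1 h (esym (catBA b (x_ s) Eone))).
  have e3 : h (catB b (Etw y)) = h (catB b (lact (x_ s) Eone)) + h (catB b (ract Eone y)).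
    by rewrite -hD -catBDr; exact: (congr1 (fun c => h (catB b c)) (EtwE y)).
  apply: (addIr (h1 b * act x y)); rewrite addNr.
  exact: (etrans (esym (f_equal2 +%R e2 e1)) (etrans (esym e3) (h0 b))).
have hi a (b : B pre) : inv s a -> h1 (ract b a) = h1 b * act x a.
  by move=> ia; rewrite /h1 (catBA b a Eone) (Eone_inv ia) -(ract_catB a b Eone) hr.
have h1D : is_add h1 by move=> b c; rewrite /h1 catBDl hD.
split=> // [a b|a b].
- by rewrite /h1 -(lact_catB a b Eone) hl.
- have [a1 [a2 [i1 i2 ->]]] := ldec a.
  rewrite -(twisted_act' tw i1 i2) actB actM ractDr h1D (hi _ _ i1) ractM (hi _ _ i2) e.
  by ring.
Qed.

Lemma step_eq0 : (forall b, h1 b = 0) -> forall w, h w = 0.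
Proof.
move=> h0; apply: catB_ext => // [b c|b c]; first by rewrite addr0.
move: c; apply: (catB1_ext (h := fun c => h (catB b c)) (h' := fun=> 0)) => [c c'|c c'|p q c].
- by rewrite catBDr hD.
- by rewrite addr0.
have -> : pureR (pures s p q) c = ract (lact p Eone) (q * c) :> B [:: s].
  rewrite /Eone (@lact_pureR _ _ _ _ _ _ s [::]) pure1 lact_pures ract_pures mulr1 mul1r.
  have e1 := @pureRA _ _ _ _ _ _ s [::] (pures s p q) (1 : B [::]) c.
  rewrite ract_pures in e1; rewrite e1.
  by apply: (congr1 (fun c : B [::] => pureR (pures s p q) c : B [:: s])); exact/esym/(mulr1 (c : R)).
by rewrite -(ract_catB _ b (lact p Eone)) hr -(catBA b p Eone) -/(h1 _) h0 mul0r.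
Qed.

End Restriction.

Section BasisStep.
Local Opaque Etw Eone Defs.act.
Variables (pre : seq S) (x z : W) (y : R) (I : finType) (wt : I -> W).
Variables (h0 : I -> B pre -> R) (h1 : I -> B (pre ++ [:: s]) -> R).
Local Notation z' := (z * g s)%g.
Hypothesis tw : twisted x z y.
Hypothesis h1M : forall i, wt i = z \/ wt i = z' -> mor_to x (h1 i).
Hypothesis h1z : forall i, wt i = z -> forall b, h1 i (catB b (Etw y)) = h0 i b.
Hypothesis h1z' : forall i, wt i = z' ->
  forall b, h1 i (catB b (Etw y)) = 0 /\ h1 i (catB b Eone) = h0 i b.

Let z'z : z' != z.
Proof.
apply/eqP => e; case: (coxeter_order2 coxW s) => ne _; apply: ne.
by apply: (mulgI z); rewrite e mulg1.
Qed.

Lemma twisted_sum (F : I -> R) :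
  \sum_(i | (wt i == z) || (wt i == z')) F i =
  \sum_(i | wt i == z) F i + \sum_(i | wt i == z') F i.
Proof.
rewrite (bigID (fun i => wt i == z)) /=; congr (_ + _); apply: eq_bigl => i.
  by case: (wt i == z); rewrite ?andbF.
by have [->|] := eqVneq (wt i) z; rewrite /= ?andbT // eq_sym (negbTE z'z).
Qed.

(** Triangular elimination: the coefficients at z are read off at the twisted element, where the
    family at z s vanishes. The remainder, evaluated at 1 ⊗ 1, is a morphism to R_(z s) and yields
    the other coefficients; what is left vanishes at 1 ⊗ 1, hence everywhere. *)
Lemma span_step :
  (forall w h, w = z \/ w = z' -> mor_to w h -> exists c : I -> R,
     forall b : B pre, h b = \sum_(i | wt i == w) h0 i b * act w (c i)) ->
  forall h, mor_to x h -> exists c : I -> R,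
     forall b, h b = \sum_(i | (wt i == z) || (wt i == z')) h1 i b * act x (c i).
Proof.
move=> sp h hM.
(* A coefficient c acts on R_w by w(c), and x^-1 w (c) acts in the same way on R_x; hence the twists
   of the coefficients below. *)
have actx w p : act x (act (x^-1 * w)%g p) = act w p.
  by rewrite -(act_mulg repr) mulKVg.
have [c cP] := sp z _ (or_introl erefl) (step_tw hM tw).
pose k1 b := h b - \sum_(i | wt i == z) h1 i b * act x (act (x^-1 * z)%g (c i)).
have k1M : mor_to x k1.
  apply: mor_toD => //; apply: mor_toN; apply: mor_to_sum => i /eqP wi.
  by apply: mor_toZ; apply: h1M; left.
have k10 b : k1 (catB b (Etw y)) = 0.
  rewrite /k1 cP -sumrB big1 // => i /eqP wi.
  by rewrite (h1z wi) actx subrr.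
have [e eP] := sp z' _ (or_intror erefl) (step_res k1M tw k10).
pose k2 b := k1 b - \sum_(i | wt i == z') h1 i b * act x (act (x^-1 * z')%g (e i)).
have k2M : mor_to x k2.
  apply: mor_toD => //; apply: mor_toN; apply: mor_to_sum => i /eqP wi.
  by apply: mor_toZ; apply: h1M; right.
have k20 b : k2 (catB b Eone) = 0.
  rewrite /k2 eP -sumrB big1 // => i /eqP wi.
  by rewrite (h1z' wi _).2 actx subrr.
exists (fun i => if wt i == z then act (x^-1 * z)%g (c i) else act (x^-1 * z')%g (e i)) => b.
have /eqP := step_eq0 k2M k20 b; rewrite /k2 /k1 -addrA -opprD subr_eq0 => /eqP ->.
rewrite twisted_sum; apply: (f_equal2 +%R); apply: eq_bigr => i /eqP ->.
  by rewrite eqxx.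
by rewrite (negbTE z'z).
Qed.

(** Same triangular order: the twisted element isolates the coefficients at z, and once these are 0
    the element 1 ⊗ 1 isolates those at z s. *)
Lemma free_step :
  (forall w (c : I -> R), w = z \/ w = z' ->
     (forall b : B pre, \sum_(i | wt i == w) h0 i b * act w (c i) = 0) ->
     forall i, wt i = w -> c i = 0) ->
  forall c : I -> R,
    (forall b, \sum_(i | (wt i == z) || (wt i == z')) h1 i b * act x (c i) = 0) ->
    forall i, wt i = z \/ wt i = z' -> c i = 0.
Proof.
move=> fr c c0.
have actw w p : act w (act (w^-1 * x)%g p) = act x p.
  by rewrite -(act_mulg repr) mulKVg.
have cz i : wt i = z -> c i = 0.
  move=> wi; apply: (act_inj repr (w := (z^-1 * x)%g)); rewrite act0.
  apply: (fr z (fun i => act (z^-1 * x)%g (c i))) => //; first by left.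
  move=> b; apply: (etrans _ (c0 (catB b (Etw y)))); rewrite twisted_sum.
  rewrite [X in _ + X]big1 ?addr0 => [|j /eqP wj]; last by rewrite (h1z' wj _).1 mul0r.
  by apply: eq_bigr => j /eqP wj; rewrite (h1z wj) actw.
move=> i [/cz//|wi]; apply: (act_inj repr (w := (z'^-1 * x)%g)); rewrite act0.
apply: (fr z' (fun i => act (z'^-1 * x)%g (c i))) => //; first by right.
move=> b; apply: (etrans _ (c0 (catB b Eone))); rewrite twisted_sum.
rewrite [X in X + _]big1 ?add0r => [|j /eqP wj]; last by rewrite (cz _ wj) act0 mulr0.
by apply: eq_bigr => j /eqP wj; rewrite (h1z' wj _).2 actw.
Qed.

End BasisStep.
End Step.


Section Children.
Variable s : S.
Local Notation X := (x_ s).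
Let m := @m_ _ _ g k d rho s.
Let j := @j_ _ _ g k d rho xs s.
Let mM : bimod_morphism m. Proof. exact: m_M. Qed.
Let jM : bimod_morphism j. Proof. exact: j_M. Qed.

Let mE (b : Bs s) (c : B [::]) : m (pureR b c : B [:: s]) = mult b * c.
Proof. exact: m_E. Qed.
Let jE p q q' r (c : B [::]) :
    j (pureR (pures s p q) (pureR (pures s q' r) c : B [:: s]) : B [:: s; s]) =
    pureR (pures s (p * dem s (q * q')) r) c.
Proof. exact: j_E. Qed.

Let castM t u (e : t = u) : bimod_morphism (@castB _ _ g k d rho t u e).
Proof. by case: (castB_hom g rho e). Qed.

Definition tens_id pre t (l : B pre -> B t) : B (pre ++ [:: s]) -> B (t ++ [:: s]) :=
  whisker (t := [::]) (u := [:: s]) l.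

Lemma tens_idM pre t (l : B pre -> B t) : bimod_morphism l -> bimod_morphism (tens_id l).
Proof. exact: (whisker_mor [::] [:: s]). Qed.

Lemma tens_idE pre t (l : B pre -> B t) b c : bimod_morphism l ->
  tens_id l (catB b c) = catB (l b) c.
Proof. exact: whisker_catl. Qed.

(** [close], and [fuse] below, are the edge maps with no unread letter. Edges act as the identity on
    unread factors, so [close_node] and [fuse_node] recover the general case. *)
Definition close t : B (t ++ [:: s]) -> B t :=
  castB (cats0 t) \o whisker (t := t) (u := [::]) m.

Lemma closeM t : bimod_morphism (@close t).
Proof. exact: (mor_comp (castM _) (whisker_mor t [::] mM)). Qed.

Let catB1 t u (y : B t) (e : t ++ [::] = t) : u = 1 :> R -> castB e (catB y (u : B [::])) = y.
Proof. by move=> ->; rewrite catB_nil ract1. Qed.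

Let catBs (c : B [:: s]) : c = catB c (1 : B [::]).
Proof. by have := @catB1 [:: s] 1 c erefl erefl. Qed.

Lemma closeE t (x : B t) c : close (catB x c) = ract x (m c).
Proof.
rewrite {1}[c]catBs /close /=.
have -> := (whiskerP t [::] mM).2 x c (1 : B [::]).
by rewrite (@catB_nil _ _ g _ _ rho t (cats0 t)) /= (mulr1 (m c : R)).
Qed.

Lemma close_node t u (x : B t) c (c' : B u) :
  whisker (t := t) (u := u) m (catB x (catB c c')) = catB (close (catB x c)) c'.
Proof. by rewrite closeE catBA (whiskerP t u mM).2. Qed.

Definition fuse t' : B (rcons t' s ++ [:: s]) -> B (t' ++ [:: s]) :=
  whisker (t := t') (u := [::]) j \o castB (cat_rcons s t' [:: s]).

Lemma fuseM t' : bimod_morphism (@fuse t').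
Proof. exact: (mor_comp (whisker_mor t' [::] jM) (castM _)). Qed.

Lemma rcons_ext t (P : zmodType) (h h' : B (rcons t s) -> P) :
  is_add h -> is_add h' ->
  (forall x (y : B [:: s]), h (castB (cats1 t s) (catB x y)) = h' (castB (cats1 t s) (catB x y))) ->
  h =1 h'.
Proof.
move=> hD h'D e w; rewrite -[w](castBK (esym (cats1 t s)) (cats1 t s)).
move: (castB _ w); apply: catB_ext => [x y|x y|x y]; rewrite ?castBD ?hD ?h'D //.
Qed.

Let catrc t' v (x : B t') (y : B [:: s]) (c : B v) :
  castB (cat_rcons s t' v) (catB (castB (cats1 t' s) (catB x y)) c) = catB x (catB y c).
Proof.
rewrite -(castB_catl (cats1 t' s) (congr1 (cat^~ v) (cats1 t' s))) castB_trans.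
exact: (@catB_assoc _ _ g _ _ rho t' [:: s] v).
Qed.

Lemma fuseE t' (x : B t') (y c : B [:: s]) :
  fuse (catB (castB (cats1 t' s) (catB x y)) c) = catB x (j (catB y c)).
Proof.
rewrite /fuse /= catrc.
have e : catB y c = catB (catB y c) (1 : B [::]) by have := @catB1 [:: s; s] 1 (catB y c) erefl erefl.
rewrite [in LHS]e; have -> := (whiskerP t' [::] jM).2 x (catB y c) (1 : B [::]).
by rewrite -(catBs (j _)).
Qed.

Lemma fuse_node t' u (w : B (rcons t' s)) (c : B [:: s]) (c' : B u) :
  whisker (t := t') (u := u) j (castB (cat_rcons s t' (s :: u)) (catB w (catB c c'))) =
  castB (esym (catA t' [:: s] u)) (catB (fuse (catB w c)) c').
Proof.
have [fD _ _] := fuseM t'; have [wD _ _] := whisker_mor t' u jM.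
move: w; apply: (rcons_ext
  (h := fun w => whisker (t := t') (u := u) j (castB (cat_rcons s t' (s :: u)) (catB w (catB c c'))))
  (h' := fun w => castB (esym (catA t' [:: s] u)) (catB (fuse (catB w c)) c'))) => [x y|x y|x y].
- by rewrite catBDl castBD wD.
- by rewrite catBDl fD catBDl castBD.
- rewrite fuseE (catrc x y (catB c c' : B (s :: u))).
  rewrite (@catB_assoc _ _ g _ _ rho t' [:: s] u).
  have <- : catB (catB y c) c' = catB y (catB c c').
    by have := @catB_assoc _ _ g _ _ rho [:: s] [:: s] u erefl y c c'.
  by rewrite (whiskerP t' u jM).2.
Qed.


Let jD : is_add j. Proof. by case: jM. Qed.
Let mD : is_add m. Proof. by case: mM. Qed.

Lemma m_Eone : m (Eone s) = 1 :> R.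
Proof. by rewrite /Eone mE (multP g rho s).2 !mulr1. Qed.

Lemma m_Etw y : m (Etw s y) = X + y :> R.
Proof.
by rewrite /Etw mE (multP g rho s).1 !(multP g rho s).2 !mulr1 mul1r.
Qed.

Let beta_nil (a : B [::]) : (beta a : R) = (a : R).
Proof. by []. Qed.

Lemma beta_Eone : (beta (Eone s) : R) = 1.
Proof. by rewrite /Eone betc bet1 beta_nil !act_1 !mulr1. Qed.

Lemma beta_Etw y : (beta (Etw s y) : R) = X + act (g s) y.
Proof.
rewrite /Etw betc beta_nil act_1 mulr1.
by rewrite [LHS](beta1P g rho s).1 !bet1 act_1 mulr1 mul1r.
Qed.

Let catB_Etw p q (a : B [::]) y : catB (pureR (pures s p q) a : B [:: s]) (Etw s y) =
  pureR (pures s p q) (pureR (pures s (a * X) 1) (1 : B [::]) : B [:: s]) +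
  pureR (pures s p q) (pureR (pures s a y) (1 : B [::]) : B [:: s]) :> B [:: s; s].
Proof.
rewrite (@catB_cons _ _ g _ _ rho s [::] [:: s]) /Etw.
rewrite -[catB a _]/(lact (a : R) (pureR _ (1 : B [::]) : B [:: s])).
rewrite (@lact_pureR _ _ _ _ _ _ s [::]) lactDr !lact_pures mulr1.
by rewrite (@pureRDl _ _ _ _ _ _ s [::]) (@pureRDr _ _ _ _ _ _ s [:: s]).
Qed.

Let beta_pure1 p q : (beta (pureR (pures s p q) (1 : B [::]) : B [:: s]) : R) = p * act (g s) q.
Proof. by rewrite betc beta_nil act_1 mulr1 bet1. Qed.

Let m_pure1 p q : m (pureR (pures s p q) (1 : B [::]) : B [:: s]) = p * q :> R.
Proof. by rewrite mE (multP g rho s).2 mulr1. Qed.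

(** Here and in [j_minus] the claim reduces to [demazure_xs]: the second summand of the twisted
    element contributes - x_s, here because beta applies s to x_s, there because y = - x_s. *)
Lemma j_plus (y : B [:: s]) : (beta (j (catB y (Etw s X))) : R) = beta y.
Proof.
move: y; apply: (catB1_ext (P := R) (h := fun y => (beta (j (catB y (Etw s X))) : R))
  (h' := fun y => (beta y : R))) => [x y|x y|p q a].
- by rewrite catBDl jD betD.
- exact: betD.
- rewrite catB_Etw jD betD !jE !beta_pure1 act_1 act_x betc bet1 beta_nil.
  rewrite -[RHS]mulrA -actM -(demazure_xs coxW repr two_neq0 xvP) mulrA; ring.
Qed.

Lemma j_minus (y : B [:: s]) : m (j (catB y (Etw s (- X)))) = (beta y : R).
Proof.
move: y; apply: (catB1_ext (P := R) (h := fun y => (m (j (catB y (Etw s (- X)))) : R))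
  (h' := fun y => (beta y : R))) => [x y|x y|p q a].
- by rewrite catBDl jD mD.
- exact: betD.
- rewrite catB_Etw jD mD !jE !m_pure1 betc bet1 beta_nil.
  rewrite -[RHS]mulrA -actM -(demazure_xs coxW repr two_neq0 xvP) mulrA; ring.
Qed.

Lemma beta_close t (x : B t) c :
  (beta (close (catB x c)) : R) = (beta x : R) * act (wd t) (m c : R).
Proof. by rewrite closeE betr. Qed.

Lemma beta_fuse_plus t' (w : B (rcons t' s)) :
  (beta (castB (cats1 t' s) (fuse (catB w (Etw s X)))) : R) = beta w.
Proof.
have [fD _ _] := fuseM t'.
move: w; apply: (rcons_ext (P := R)
  (h := fun w => (beta (castB (cats1 t' s) (fuse (catB w (Etw s X)))) : R))
  (h' := fun w => (beta w : R))) => [x y|x y|x y].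
- by rewrite catBDl fD castBD betD.
- exact: betD.
- by rewrite fuseE !beta_castB !betcat j_plus.
Qed.

Lemma beta_fuse_minus t' (w : B (rcons t' s)) :
  (beta (close (fuse (catB w (Etw s (- X))))) : R) = beta w.
Proof.
have [fD _ _] := fuseM t'; have [cD _ _] := closeM t'.
move: w; apply: (rcons_ext (P := R)
  (h := fun w => (beta (close (fuse (catB w (Etw s (- X))))) : R))
  (h' := fun w => (beta w : R))) => [x y|x y|x y].
- by rewrite catBDl fD cD betD.
- exact: betD.
- by rewrite fuseE beta_close beta_castB betcat j_minus.
Qed.

End Children.

End Tree.

(** * Families of nodes indexed by the prefix already read *)

Section Family.
Variables (W : groupType) (S : finType) (g : S -> W).
Hypothesis coxW : coxeter_system g.
Variables (k : fieldType) (d : nat) (rho : W -> 'M[k]_d).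
Hypothesis repr : representation rho.
Local Notation R := (mpoly d k).
Local Notation act := (act rho).
Local Notation B := (B g rho).
Local Notation wd := (wd g).
Local Notation len := (len g).
Local Notation rexpr := (rexpr g).
Local Notation mord := (mord g).
Variables (xs : S -> 'rV[k]_d) (xv : S -> 'cV[k]_d).
Hypothesis two_neq0 : 2%:R != 0 :> k.
Hypothesis xvP : forall s, rho (g s) = 1%:M - xv s *m xs s /\ xs s *m xv s = 2%:R%:M.
Local Notation x_ s := (linear_form (xs s) : R).
Variable f : forall s r, B (alt s r (mord s r)) -> B (alt r s (mord s r)).
Hypothesis fP : braid_morphisms f.
Variable sx : W -> seq S.
Variable F : forall t, rexpr t -> bpath g t (sx (wd t)).
Variable Fs : forall t s, rexpr t -> (len (wd t * g s)%g < len (wd t))%N ->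
  {t' : seq S & bpath g t (rcons t' s)}.
Local Notation node su t u L := (@Defs.node _ _ g k d rho xs f Fs su t u L).
Local Notation m s := (@m_ _ _ g k d rho s).
Local Notation j s := (@j_ _ _ g k d rho xs s).
Local Notation sep := (rho_separated g rho).
Let mM s : bimod_morphism (m s). Proof. by case: (m_hom g rho s). Qed.
Let jM s : bimod_morphism (j s).
Proof. by case: (j_hom coxW repr two_neq0 xvP s). Qed.
Let castM t u (e : t = u) : bimod_morphism (@castB _ _ g k d rho t u e).
Proof. by case: (castB_hom g rho e). Qed.
Let pathM t u (p : bpath g t u) : bimod_morphism (path_mor f p).
Proof. exact: path_morM. Qed.

Lemma phi_hom t u s (e : {t' : seq S & bpath g t (rcons t' s)}) :
  hom_deg (-1) (phi xs f (u := u) e).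
Proof.
rewrite /phi.
have h1 := whisker_hom (tag e) u (jM s) (j_hom coxW repr two_neq0 xvP s).
have h2 := castB_hom g rho (cat_rcons s (tag e) (s :: u)).
have h3 := whisker_hom [::] (s :: u) (pathM (tagged e)) (path_hom fP (tagged e)).
have := hom_comp h1 (hom_comp h2 h3); rewrite addr0 add0r; exact.
Qed.

Lemma node_hom su t u L : node su t u L -> exists e, hom_deg e L.
Proof.
elim=> {t u L} [|t s u L _ _ [e he]|t s u L _ _ [e he]|t s u L ht hs e' _ [e he]|t s u L ht hs e' _ [e he]].
- by exists 0; apply: hom_id.
- by exists (e + 1); apply: (hom_comp _ he); apply: (whisker_hom t u (mM s) (m_hom g rho s)).
- by exists (e + 0); apply: (hom_comp _ he); apply: castB_hom.
- exists (e + (-1 + 1)); apply: (hom_comp _ he); apply: (hom_comp _ (phi_hom u e')).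
  exact: (whisker_hom (tag e') u (mM s) (m_hom g rho s)).
- exists (e + (-1 + 0)); apply: (hom_comp _ he); apply: (hom_comp _ (phi_hom u e')).
  exact: castB_hom.
Qed.

Lemma nodeM su t u L : node su t u L -> bimod_morphism L.
Proof. by move=> /node_hom[e []]. Qed.

Lemma node_suffix su t u L : node su t u L -> exists p, su = p ++ u.
Proof.
elim=> {t u L} [|t s u L _ _ [p ->]|t s u L _ _ [p ->]|t s u L ht hs e' _ [p ->]|t s u L ht hs e' _ [p ->]];
  by [exists [::] | exists (rcons p s); rewrite cat_rcons].
Qed.

(** Every edge consumes a letter, so a node with all letters unread is the root; the equalities of
    words absorb the dependent type of L. *)
Lemma node_top su t u L : node su t u L -> size u = size su ->
  exists (et : [::] = t) (e : su = t ++ u), L = castB e.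
Proof.
have no s u' t' L' : node su t' (s :: u') L' -> size u' = size su -> False.
  move=> /node_suffix[p es] e; have := leq_addl (size p) (size u').
  by move: e; rewrite es size_cat /= addnS => e; rewrite -ltnS -e ltnn.
by case=> {t u L} [_|t s u L _ /no//|t s u L _ /no//|t s u L ht hs e' /no//|t s u L ht hs e' /no//];
  exists erefl, erefl.
Qed.

Section Extension.
Variables (pre : seq S) (s : S) (t u su : seq S).
Variables (l : B pre -> B t) (e1 : pre ++ (s :: u) = su) (e : (pre ++ [:: s]) ++ u = su).
Variable L : B su -> B (t ++ s :: u).
Hypotheses (lM : bimod_morphism l) (LM : bimod_morphism L).
Hypothesis LE : forall b c, L (castB e1 (catB b c)) = catB (l b) c.

(** A node map leaves unread factors untouched, which is what [LE] says; for one more letter of the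
    prefix, l is therefore replaced by l ⊗ id. *)
Lemma ext_tens (w : B (pre ++ [:: s])) (c : B u) :
  L (castB e (catB w c)) = castB (esym (catA t [:: s] u)) (catB (tens_id l w) c).
Proof.
have [LD _ _] := LM; have [iD _ _] := tens_idM s lM.
move: w; apply: (catB_ext (h := fun w => L (castB e (catB w c)))
  (h' := fun w => castB (esym (catA t [:: s] u)) (catB (tens_id l w) c))) => [x y|x y|b c1].
- by rewrite catBDl castBD LD.
- by rewrite iD catBDl castBD.
- rewrite (tens_idE _ _ lM) (@catB_assoc _ _ g _ _ rho t [:: s] u) -LE; congr L.
  rewrite -(@catB_assoc _ _ g _ _ rho pre [:: s] u (esym (catA pre [:: s] u))) castB_trans.
  exact: castB_irr.
Qed.

Lemma ext_up0 (w : B (pre ++ [:: s])) (c : B u) :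
  whisker (t := t) (u := u) (m s) (L (castB e (catB w c))) = catB (close (tens_id l w)) c.
Proof.
rewrite ext_tens; have [wD _ _] := whisker_mor t u (mM s); have [cD _ _] := closeM g rho s t.
move: (tens_id l w); apply: (catB_ext
  (h := fun w => whisker (t := t) (u := u) (m s) (castB (esym (catA t [:: s] u)) (catB w c)))
  (h' := fun w => catB (close w) c)) => [x y|x y|b c1].
- by rewrite catBDl castBD wD.
- by rewrite cD catBDl.
- by rewrite (@catB_assoc _ _ g _ _ rho t [:: s] u); apply: close_node.
Qed.

Lemma ext_up1 (w : B (pre ++ [:: s])) (c : B u) :
  castB (esym (cat_rcons s t u)) (L (castB e (catB w c))) =
  catB (castB (cats1 t s) (tens_id l w)) c.
Proof.
rewrite ext_tens castB_trans.
by rewrite -(castB_catl (cats1 t s) (congr1 (cat^~ u) (cats1 t s))); apply: castB_irr.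
Qed.

Variable q : {t' : seq S & bpath g t (rcons t' s)}.
Local Notation P := (path_mor f (tagged q)).

Lemma ext_phi (w : B (pre ++ [:: s])) (c : B u) :
  phi xs f (u := u) q (L (castB e (catB w c))) =
  castB (esym (catA (tag q) [:: s] u)) (catB (fuse xs (tens_id (P \o l) w)) c).
Proof.
have [phD _ _] := (phi_hom u q).1; have [LD _ _] := LM.
have PM := pathM (tagged q); have PlM := mor_comp PM lM.
have [iD _ _] := tens_idM s PlM; have [fD _ _] := fuseM coxW repr two_neq0 xvP s (tag q).
move: w; apply: (catB_ext (h := fun w => phi xs f (u := u) q (L (castB e (catB w c))))
  (h' := fun w => castB (esym (catA (tag q) [:: s] u)) (catB (fuse xs (tens_id (P \o l) w)) c)))
  => [x y|x y|b c1].
- by rewrite catBDl castBD LD phD.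
- by rewrite iD fD catBDl castBD.
rewrite (tens_idE _ _ PlM).
have -> : L (castB e (catB (catB b c1) c)) = catB (l b) (catB c1 c : B (s :: u)).
  rewrite -LE; congr L.
  rewrite -(@catB_assoc _ _ g _ _ rho pre [:: s] u (esym (catA pre [:: s] u))) castB_trans.
  exact: castB_irr.
rewrite /phi /= (@whisker_catl _ _ g _ _ rho t (s :: u) (rcons (tag q) s) P (l b) (catB c1 c) PM).
exact: (fuse_node coxW repr two_neq0 xvP).
Qed.

Lemma ext_dn0 (w : B (pre ++ [:: s])) (c : B u) :
  whisker (t := tag q) (u := u) (m s) (phi xs f (u := u) q (L (castB e (catB w c)))) =
  catB (close (fuse xs (tens_id (P \o l) w))) c.
Proof.
rewrite ext_phi; have [wD _ _] := whisker_mor (tag q) u (mM s); have [cD _ _] := closeM g rho s (tag q).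
move: (fuse _ _); apply: (catB_ext
  (h := fun w => whisker (t := tag q) (u := u) (m s) (castB (esym (catA (tag q) [:: s] u)) (catB w c)))
  (h' := fun w => catB (close w) c)) => [x y|x y|b c1].
- by rewrite catBDl castBD wD.
- by rewrite cD catBDl.
- by rewrite (@catB_assoc _ _ g _ _ rho (tag q) [:: s] u); apply: close_node.
Qed.

Lemma ext_dn1 (w : B (pre ++ [:: s])) (c : B u) :
  castB (esym (cat_rcons s (tag q) u)) (phi xs f (u := u) q (L (castB e (catB w c)))) =
  catB (castB (cats1 (tag q) s) (fuse xs (tens_id (P \o l) w))) c.
Proof.
rewrite ext_phi castB_trans.
by rewrite -(castB_catl (cats1 (tag q) s) (congr1 (cat^~ u) (cats1 (tag q) s))); apply: castB_irr.
Qed.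

End Extension.

(** A node seen from the prefix alone: the reduced expression reached and the map on B_pre, before
    tensoring with unread letters. *)
Definition state pre := {t : seq S & B pre -> B t}.

Definition up_child pre s (q : state pre) (b : bool) : state (pre ++ [:: s]) :=
  if b then Tagged (fun t => B (pre ++ [:: s]) -> B t)
    (castB (cats1 (tag q) s) \o tens_id (s := s) (tagged q))
  else Tagged (fun t => B (pre ++ [:: s]) -> B t)
    (close (t := tag q) \o tens_id (s := s) (tagged q)).

Definition down_child pre s (q : state pre)
    (e : {t' : seq S & bpath g (tag q) (rcons t' s)}) (b : bool) : state (pre ++ [:: s]) :=
  let l := fuse xs (t' := tag e) \o tens_id (s := s) (path_mor f (tagged e) \o tagged q) in
  if b then Tagged (fun t => B (pre ++ [:: s]) -> B t) (castB (cats1 (tag e) s) \o l)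
  else Tagged (fun t => B (pre ++ [:: s]) -> B t) (close (t := tag e) \o l).

(** The cases are split through [idP] because [Fs] takes the proofs of reducedness and descent as
    arguments; irrelevance of boolean proofs frees [child_down] from the particular ones chosen. *)
Definition child pre s (q : state pre) (b : bool) : state (pre ++ [:: s]) :=
  match @idP (rexpr (tag q)), @idP (len (wd (tag q) * g s)%g < len (wd (tag q)))%N with
  | ReflectT ht, ReflectT hs => down_child (Fs ht hs) b
  | _, _ => up_child s q b
  end.

Lemma child_up pre s (q : state pre) b :
  (len (wd (tag q)) < len (wd (tag q) * g s)%g)%N -> child s q b = up_child s q b.
Proof.
move=> up; rewrite /child; case: {-}_ / idP => // ht; case: {-}_ / idP => // hs.
by move: (ltn_trans up hs); rewrite ltnn.
Qed.

Lemma child_down pre s (q : state pre) b (ht : rexpr (tag q))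
    (hs : (len (wd (tag q) * g s)%g < len (wd (tag q)))%N) :
  child s q b = down_child (Fs ht hs) b.
Proof.
rewrite /child; case: {-}_ / idP => [ht'|/(_ ht)//]; case: {-}_ / idP => [hs'|/(_ hs)//].
by rewrite (bool_irrelevance ht' ht) (bool_irrelevance hs' hs).
Qed.

(** [fam_node] and [fam_all] tie the indices to the nodes of every tree whose sequence begins with
    [pre]. Spanning and freeness are asked for all relevant x at once, since the step at x uses the
    prefix at both x and x s. [fam_sub] keeps each weight the product of a subword, the form in
    which separation is assumed. *)
Record fam_ok pre (I : finType) (q : I -> state pre) : Prop := FamOk {
  fam_rexpr : forall i, rexpr (tag (q i));
  fam_sub : forall i, exists2 t', subseq t' pre & wd t' = wd (tag (q i));
  fam_mor : forall i, bimod_morphism (tagged (q i));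
  fam_node : forall u su (e : pre ++ u = su) i, exists2 L,
    node su (tag (q i)) u L &
    forall b c, L (castB e (catB b c)) = catB (tagged (q i) b) c;
  fam_all : forall u su (e : pre ++ u = su) t' L, node su t' u L ->
    exists i (et : tag (q i) = t'), forall b c,
      L (castB e (catB b c)) = catB (castB et (tagged (q i) b)) c;
  fam_span : forall x, (forall t', subseq t' pre -> rho (wd t') = rho x -> wd t' = x) ->
    forall h : B pre -> R, mor_to x h -> exists c : I -> R, forall b,
      h b = \sum_(i | wd (tag (q i)) == x) (beta (tagged (q i) b) : R) * act x (c i);
  fam_free : forall x (c : I -> R),
    (forall b, \sum_(i | wd (tag (q i)) == x)
       (beta (tagged (q i) b) : R) * act x (c i) = 0) ->
    forall i, wd (tag (q i)) = x -> c i = 0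
}.

Lemma fam_nil : fam_ok (fun _ : unit => Tagged (fun t => B [::] -> B t) (@id (B [::]))).
Proof.
have s1 w (G : unit -> R) : \sum_(i | wd [::] == w) G i = if 1%g == w then G tt else 0.
  rewrite wd_nil; case: ifP => _; last by rewrite big_pred0.
  by rewrite (big_pred1 tt) //; case.
split => /=.
- by move=> _; rewrite /Defs.rexpr wd_nil (len1 g).
- by move=> _; exists [::].
- by [].
- move=> u su e _; case: su / e; exists id; last by [].
  exact: node_root.
- move=> u su e t' L H; exists tt.
  have [et [e' ->]] := node_top H (congr1 size e); exists et.
  case: t' / et e' {H L} => e' b c; rewrite castB_trans castB_id.
  by rewrite castB_id.
- move=> x hx h hM; exists (fun=> act (x^-1)%g (h 1)) => b.
  rewrite s1; case: eqP => [<-|ne].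
    by rewrite invg1 !(act_one repr); case: hM => _ hl _; rewrite -hl; congr h; rewrite /lact /= mulr1.
  apply: (mor_to_nil repr hM) => e; apply: ne.
  by have := hx [::] isT; rewrite wd_nil (repr1 repr) e; apply.
- move=> x c c0 [] e; have := c0 (1 : R); rewrite s1 -e wd_nil eqxx.
  by rewrite (act_one repr); exact: (etrans (esym (mul1r (c tt : R)))).
Qed.

(** The boolean says that the new expression ends in s. This multiplies the element by s at an
    ascent and leaves it unchanged at a descent, whence the exclusive or. *)
Lemma wd_child pre s (q : state pre) b : rexpr (tag q) ->
  rexpr (tag (child s q b)) /\ wd (tag (child s q b)) =
  if b (+) (len (wd (tag q) * g s)%g < len (wd (tag q)))%N then (wd (tag q) * g s)%g else wd (tag q).
Proof.
move=> ht; case: (len_updown coxW (wd (tag q)) s) => [up|dn].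
  rewrite child_up // ltnNge (ltnW up) /= addbF; case: b => //=.
  by rewrite wd_rcons; split=> //; apply: rexpr_rcons.
rewrite (child_down _ ht dn) dn addbT.
have p := tagged (Fs ht dn).
have r1 := bpath_rexpr coxW p ht; have w1 := bpath_wd coxW p.
case: b => /=; first by split.
split; first by move: r1; rewrite -cats1; apply: rexpr_catl.
by rewrite -w1 wd_rcons genK.
Qed.

Lemma childM pre s (q : state pre) b : bimod_morphism (tagged q) ->
  rexpr (tag q) -> bimod_morphism (tagged (child s q b)).
Proof.
move=> lM ht; case: (len_updown coxW (wd (tag q)) s) => [up|dn].
  rewrite child_up //; case: b.
  - exact: (mor_comp (castM _) (tens_idM s lM)).
  - exact: (mor_comp (closeM g rho s _) (tens_idM s lM)).
rewrite (child_down _ ht dn).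
have PM := mor_comp (pathM (tagged (Fs ht dn))) lM.
have fM := mor_comp (fuseM coxW repr two_neq0 xvP s (tag (Fs ht dn))) (tens_idM s PM).
case: b.
- exact: (mor_comp (castM _) fM).
- exact: (mor_comp (closeM g rho s _) fM).
Qed.

Section FamStep.
Variables (pre : seq S) (I : finType) (q : I -> state pre) (s : S).
Hypothesis ok : fam_ok q.
Hypothesis sepP : forall t', subseq t' pre -> sep (wd t').
Local Notation q' := (fun ib : I * bool => child s (q ib.1) ib.2).

Let e1 u su (e : (pre ++ [:: s]) ++ u = su) : pre ++ (s :: u) = su.
Proof. by rewrite -e -catA. Qed.

Lemma fam_step_node u su (e : (pre ++ [:: s]) ++ u = su) ib : exists2 L,
    node su (tag (q' ib)) u L &
    forall b c, L (castB e (catB b c)) = catB (tagged (q' ib) b) c.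
Proof.
case: ib => i b /=.
have [L LN LE] := fam_node ok (e1 e) i.
have lM := fam_mor ok i; have LM := nodeM LN; have ht := fam_rexpr ok i.
case: (len_updown coxW (wd (tag (q i))) s) => [up|dn].
  rewrite child_up //; case: b => /=.
  - exists (castB (esym (cat_rcons s (tag (q i)) u)) \o L); first exact: node_up1.
    by move=> w c; apply: (ext_up1 e lM LM LE).
  - exists (whisker (t := tag (q i)) (u := u) (m s) \o L); first exact: node_up0.
    by move=> w c; apply: (ext_up0 e lM LM LE).
rewrite (child_down _ ht dn); case: b => /=.
- eexists; first exact: (node_down1 ht dn LN).
  by move=> w c; apply: (ext_dn1 e lM LM LE).
- eexists; first exact: (node_down0 ht dn LN).
  by move=> w c; apply: (ext_dn0 e lM LM LE).
Qed.

Lemma fam_step_all u su (e : (pre ++ [:: s]) ++ u = su) t' L : node su t' u L ->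
  exists ib (et : tag (q' ib) = t'), forall b c,
      L (castB e (catB b c)) = catB (castB et (tagged (q' ib) b)) c.
Proof.
move=> H.
have key s0 u' t0 (L0 : B su -> B (t0 ++ s0 :: u')) :
    (pre ++ [:: s]) ++ u' = su -> node su t0 (s0 :: u') L0 -> s0 = s.
  move=> e0 /node_suffix[p]; rewrite -e0 cats1 -(cat_rcons s0 p u') => e'.
  have /eqP : size (rcons pre s) = size (rcons p s0).
    by apply: (@addIn (size u')); rewrite -!size_cat e'.
  by move: e' => /eqP + sz; rewrite eqseq_cat ?(eqP sz) // => /andP[/eqP/rcons_inj[_ ->]].
case: t' u L / H e => [|t s0 u L up N|t s0 u L up N|t s0 u L ht dn e' N|t s0 u L ht dn e' N] e.
- by have /eqP := congr1 size e; rewrite !size_cat -[X in _ == X]add0n eqn_add2r addn1.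
- have es := key _ _ _ _ e N; subst s0.
  have [i [et]] := fam_all ok (e1 e) N; case: t / et L up N => L up N LE.
  exists (i, false); rewrite /= (child_up _ up); exists erefl => w c /=.
  exact: (ext_up0 e (fam_mor ok i) (nodeM N) LE).
- have es := key _ _ _ _ e N; subst s0.
  have [i [et]] := fam_all ok (e1 e) N; case: t / et L up N => L up N LE.
  exists (i, true); rewrite /= (child_up _ up); exists erefl => w c /=.
  exact: (ext_up1 e (fam_mor ok i) (nodeM N) LE).
- have es := key _ _ _ _ e N; subst s0.
  have [i [et]] := fam_all ok (e1 e) N; case: t / et L ht dn @e' N => L ht dn e' N LE.
  exists (i, false); rewrite /= (child_down _ ht dn); exists erefl => w c /=.
  exact: (ext_dn0 e (fam_mor ok i) (nodeM N) LE).
- have es := key _ _ _ _ e N; subst s0.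
  have [i [et]] := fam_all ok (e1 e) N; case: t / et L ht dn @e' N => L ht dn e' N LE.
  exists (i, true); rewrite /= (child_down _ ht dn); exists erefl => w c /=.
  exact: (ext_dn1 e (fam_mor ok i) (nodeM N) LE).
Qed.


Local Notation wt i := (wd (tag (q i))).
Let lM i : bimod_morphism (tagged (q i)). Proof. exact: fam_mor ok i. Qed.
Let rt i : rexpr (tag (q i)). Proof. exact: fam_rexpr ok i. Qed.
Let sept i : sep (wt i).
Proof. by have [t' t's <-] := fam_sub ok i; apply: sepP. Qed.

Section Target.
Variable x : W.
Local Notation xg := (x * g s)%g.
Let bx := (len xg < len x)%N.

Let xgK w : (w * g s == x)%g = (w == xg).
Proof.
apply/eqP/eqP => [<-|->]; [exact/esym/(genK coxW) | exact: (genK coxW)].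
Qed.

(** A child whose expression ends in s has s as a right descent and the other child does not, so x
    determines the boolean; the parent has weight x or x s. *)
Lemma child_target i b :
  (wd (tag (child s (q i) b)) == x) = (b == bx) && ((wt i == x) || (wt i == xg)).
Proof.
rewrite (wd_child s b (rt i)).2.
have bN : (len x < len xg)%N = ~~ bx.
  by rewrite /bx; case: (len_updown coxW x s) => h; rewrite h ltnNge (ltnW h).
have [e|n1] := eqVneq (wt i) x.
  rewrite e -/bx andbT; case: (b) (bx) => -[] /=; rewrite ?eqxx // xgK;
  apply/negbTE/eqP => e'; case: (coxeter_order2 coxW s) => ne _; apply: ne;
  by apply: (mulgI x); rewrite mulg1.
have [e|n2] := eqVneq (wt i) xg.
  rewrite e (genK coxW) bN /= andbT; rewrite e in n1.
  by case: (b) (bx) => -[] /=; rewrite ?eqxx // (negbTE n1).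
by rewrite andbF; case: ifP => _; rewrite ?xgK ?(negbTE n1) ?(negbTE n2).
Qed.

Lemma child_sum (G : I * bool -> R) :
  \sum_(ib | wd (tag (q' ib)) == x) G ib =
  \sum_(i | (wt i == x) || (wt i == xg)) G (i, bx).
Proof.
rewrite (reindex_onto (fun i => (i, bx)) fst) /=.
  by apply: eq_bigl => i; rewrite child_target !eqxx andbT.
by case=> i b /=; rewrite child_target => /andP[/eqP-> _].
Qed.

Let h0 i b := (beta (tagged (q i) b) : R).
Let h1 i b := (beta (tagged (child s (q i) bx) b) : R).

Let h1M i : wt i = x \/ wt i = xg -> mor_to x (h1 i).
Proof.
move=> hi; have -> : x = wd (tag (child s (q i) bx)).
  by apply/esym/eqP; rewrite child_target eqxx; case: hi => ->; rewrite eqxx ?orbT.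
exact: (mor_comp_to (beta_mor g repr _) (childM s bx (lM i) (rt i))).
Qed.

Local Notation X := (x_ s).
Local Notation Etw y := (Etw g rho xs s y).
Local Notation Eone := (Eone g rho s).

(** Nodes of weight z have s as a descent, and their [fuse] edge undoes the twisted element. Nodes
    of weight z s are in the ascending case, where m_s (if x s is longer) or beta (if x is) sends
    the twisted element to x_s - x_s = 0 and 1 ⊗ 1 to 1. *)
Lemma child_basis : exists z y,
  [/\ twisted g xs s x z y,
   forall v, (v == z) || (v == z * g s)%g = (v == x) || (v == xg),
   forall i, wt i = z -> forall b, h1 i (catB b (Etw y)) = h0 i b &
   forall i, wt i = (z * g s)%g ->
     forall b, h1 i (catB b (Etw y)) = 0 /\ h1 i (catB b Eone) = h0 i b].
Proof.
case: (len_updown coxW x s) => [up|dn].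
- have bF : bx = false by rewrite /bx ltnNge (ltnW up).
  exists xg, (- X); split; [by right | by move=> v; rewrite (genK coxW) orbC | move=> i e b | move=> i].
  + have dn : (len (wt i * g s)%g < len (wt i))%N by rewrite e (genK coxW).
    rewrite /h1 /h0 bF (child_down _ (rt i) dn) /=.
    have PlM := mor_comp (pathM (tagged (Fs (rt i) dn))) (lM i).
    rewrite (tens_idE _ _ PlM) (beta_fuse_minus coxW repr two_neq0 xvP).
    exact: (path_beta coxW repr two_neq0 xvP fP (tagged (Fs (rt i) dn)) (rt i) (@sept i)).
  + rewrite (genK coxW) => e b.
    have up' : (len (wt i) < len (wt i * g s)%g)%N by rewrite e.
    rewrite /h1 /h0 bF (child_up _ up') /= !(tens_idE _ _ (lM i)) !(beta_close repr).
    by rewrite m_Eone m_Etw act_1 mulr1 subrr act0 mulr0.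
- have bT : bx = true by [].
  exists x, X; split; [by left | by [] | move=> i e b | move=> i e b].
  + have dn' : (len (wt i * g s)%g < len (wt i))%N by rewrite e.
    rewrite /h1 /h0 bT (child_down _ (rt i) dn') /=.
    have PlM := mor_comp (pathM (tagged (Fs (rt i) dn'))) (lM i).
    rewrite (tens_idE _ _ PlM) (beta_fuse_plus coxW repr two_neq0 xvP).
    exact: (path_beta coxW repr two_neq0 xvP fP (tagged (Fs (rt i) dn')) (rt i) (@sept i)).
  + have up' : (len (wt i) < len (wt i * g s)%g)%N by rewrite e (genK coxW).
    rewrite /h1 /h0 bT (child_up _ up') /= !(tens_idE _ _ (lM i)) !beta_castB !(beta_catB repr).
    rewrite (beta_Eone g repr) (beta_Etw g repr) act_1 mulr1.
    by rewrite (act_xs coxW xvP) subrr act0 mulr0.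
Qed.

Lemma fam_step_span : (forall t', subseq t' (pre ++ [:: s]) -> rho (wd t') = rho x -> wd t' = x) ->
  forall h : B (pre ++ [:: s]) -> R, mor_to x h -> exists c : I * bool -> R, forall b,
    h b = \sum_(ib | wd (tag (q' ib)) == x) (beta (tagged (q' ib) b) : R) * act x (c ib).
Proof.
move=> hx h hM; have [z [y [tw hz h1z h1z']]] := child_basis.
have hzP v : v = z \/ v = (z * g s)%g -> v = x \/ v = xg.
  move=> H; have : (v == x) || (v == xg) by rewrite -hz; case: H => ->; rewrite eqxx ?orbT.
  by case/orP => /eqP; [left | right].
have h1M' i : wt i = z \/ wt i = (z * g s)%g -> mor_to x (h1 i).
  by move=> /(hzP _)/h1M.
have sp w h' : w = z \/ w = (z * g s)%g -> mor_to w h' -> exists c : I -> R,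
    forall b : B pre, h' b = \sum_(i | wt i == w) h0 i b * act w (c i).
  move=> hw; apply: (fam_span ok) => t' t's e.
  case: (hzP _ hw) e => -> e; first by apply: hx e; apply: subseq_trans t's (prefix_subseq _ _).
  (* Separation of x s over [pre] follows from that of x over [pre] followed by s, by appending s to
     the subword. *)
  apply/eqP; rewrite -xgK -wd_rcons -cats1; apply/eqP; apply: hx.
    exact: cat_subseq t's (subseq_refl _).
  by rewrite cats1 wd_rcons (reprM repr) e -(reprM repr) (genK coxW).
have [c cP] := span_step coxW repr two_neq0 xvP tw h1M' h1z h1z' sp hM.
exists (fun ib => c ib.1) => b; rewrite child_sum cP /=.
by apply: eq_bigl => i; rewrite hz.
Qed.

Lemma fam_step_free (c : I * bool -> R) :
  (forall b, \sum_(ib | wd (tag (q' ib)) == x)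
     (beta (tagged (q' ib) b) : R) * act x (c ib) = 0) ->
  forall ib, wd (tag (q' ib)) = x -> c ib = 0.
Proof.
move=> c0; have [z [y [tw hz h1z h1z']]] := child_basis.
have fr w (e : I -> R) : w = z \/ w = (z * g s)%g ->
    (forall b : B pre, \sum_(i | wt i == w) h0 i b * act w (e i) = 0) ->
     forall i, wt i = w -> e i = 0.
  by move=> _; apply: (fam_free ok).
have c0' b : \sum_(i | (wt i == z) || (wt i == (z * g s)%g)) h1 i b * act x (c (i, bx)) = 0.
  apply: (etrans _ (c0 b)); rewrite child_sum.
  by apply: eq_bigl => i; rewrite hz.
have c0'' := free_step coxW repr h1z h1z' fr (c := fun i => c (i, bx)) c0'.
case=> i b /= /eqP; rewrite child_target => /andP[/eqP-> hi]; apply: c0''.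
by move: hi; rewrite -hz => /orP[]/eqP; [left | right].
Qed.

End Target.

Lemma fam_step : fam_ok q'.
Proof.
split.
- by case=> i b; case: (wd_child s b (rt i)).
- case=> i b; have [t' t's e] := fam_sub ok i.
  rewrite (wd_child s b (rt i)).2; case: ifP => _.
    exists (t' ++ [:: s]); first exact: cat_subseq t's (subseq_refl _).
    by rewrite cats1 wd_rcons e.
  by exists t' => //; apply: subseq_trans t's (prefix_subseq _ _).
- by case=> i b; apply: childM.
- exact: fam_step_node.
- exact: fam_step_all.
- exact: fam_step_span.
- exact: fam_step_free.
Qed.

End FamStep.

Lemma fam_ex pre : (forall t', subseq t' pre -> sep (wd t')) ->
  exists (I : finType) (q : I -> state pre), fam_ok q.
Proof.
elim/last_ind: pre => [_|pre s IH sepP]; first by exists unit; eexists; apply: fam_nil.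
have sepP' t' : subseq t' pre -> sep (wd t').
  by move=> t's; apply: sepP; apply: subseq_trans t's (subseq_rcons _ _).
have [I [q ok]] := IH sepP'.
by rewrite -cats1; exists (I * bool)%type; eexists; apply: (fam_step s ok sepP').
Qed.

End Family.

(** * From the family of nodes to the set of leaves *)

Section LeafBasis.
Variables (W : groupType) (S : finType) (g : S -> W).
Hypothesis coxW : coxeter_system g.
Variables (k : fieldType) (d : nat) (rho : W -> 'M[k]_d).
Hypothesis repr : representation rho.
Local Notation R := (mpoly d k).
Local Notation act := (act rho).
Local Notation B := (B g rho).
Local Notation wd := (wd g).
Local Notation len := (len g).
Local Notation rexpr := (rexpr g).
Local Notation mord := (mord g).
Variables (xs : S -> 'rV[k]_d) (xv : S -> 'cV[k]_d).
Hypothesis two_neq0 : 2%:R != 0 :> k.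
Hypothesis xvP : forall s, rho (g s) = 1%:M - xv s *m xs s /\ xs s *m xv s = 2%:R%:M.
Variable f : forall s r, B (alt s r (mord s r)) -> B (alt r s (mord s r)).
Hypothesis fP : braid_morphisms f.
Variable sx : W -> seq S.
Variable F : forall t, rexpr t -> bpath g t (sx (wd t)).
Variable Fs : forall t s, rexpr t -> (len (wd t * g s)%g < len (wd t))%N ->
  {t' : seq S & bpath g t (rcons t' s)}.
Variable su : seq S.
Hypothesis sepP : forall t', subseq t' su -> rho_separated g rho (wd t').
Local Notation leafx x h := (beta_leaf xs f F Fs (su := su) (x := x) h).

(* Stated for R-valued functions, because the conversion of Rx (wd (sx x)) into
   Rx x, needed to compare the types otherwise, is very slow. *)
Lemma beta_leafE x (h : B su -> R) : leafx x h =
  (exists2 l : B su -> B (sx x), leaf xs f F Fs l & h = (fun b => (beta (l b) : R))).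
Proof. exact: erefl. Qed.

Section Leaves.
Variables (I : finType) (q : I -> state g rho su).
Hypothesis ok : fam_ok xs f Fs q.

Let closing i L : (forall b (c : B [::]), L (castB (cats0 su) (catB b c)) = catB (tagged (q i) b) c) ->
  forall b, castB (cats0 (tag (q i))) (L b) = tagged (q i) b.
Proof.
move=> LE b.
have eb : castB (cats0 su) (catB b (1 : B [::])) = b by rewrite catB_nil ract1.
by rewrite -{1}eb LE catB_nil ract1.
Qed.

Let path_F t (ht : rexpr t) (b : B t) : (exists2 t', subseq t' su & wd t' = wd t) ->
  (beta (path_mor f (F ht) b) : R) = beta b.
Proof.
move=> [t' t's e]; apply: (path_beta coxW repr two_neq0 xvP fP) => //.
by rewrite -e; apply: sepP.
Qed.

Let leaf_ex i x : wd (tag (q i)) = x -> exists2 l : B su -> B (sx x),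
  leaf xs f F Fs l & forall b, (beta (l b) : R) = beta (tagged (q i) b).
Proof.
move=> e; case: x / e; have [L LN LE] := fam_node ok (cats0 su) i.
have ht := fam_rexpr ok i.
eexists; first exact: (leaf_intro F ht LN).
by move=> b /=; rewrite (path_F ht _ (fam_sub ok i)) (closing LE).
Qed.

Lemma fam_leaf i x : wd (tag (q i)) = x ->
  exists2 h : B su -> R, leafx x h & forall b, h b = beta (tagged (q i) b).
Proof.
move=> e; have [l lf le] := leaf_ex e.
pose h : B su -> R := fun b => (beta (l b) : R).
have lh : leafx x h by rewrite (beta_leafE x h); exact: (ex_intro2 _ _ l lf erefl).
exact: (ex_intro2 _ _ h lh le).
Qed.

Let leaf_all x (l : B su -> B (sx x)) : leaf xs f F Fs l ->
  exists2 i, wd (tag (q i)) = x & forall b, (beta (l b) : R) = beta (tagged (q i) b).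
Proof.
move=> lf; case: x l / lf => t L ht LN.
have [i [et LE]] := fam_all ok (cats0 su) LN.
case: t / et L ht LN LE => L ht LN LE.
by exists i => // b /=; rewrite (path_F ht _ (fam_sub ok i)) (closing LE).
Qed.

Lemma leaf_fam x (h : B su -> R) : leafx x h ->
  exists2 i, wd (tag (q i)) = x & forall b, h b = beta (tagged (q i) b).
Proof. by rewrite beta_leafE => -[l /leaf_all[i ei e] ->]; exists i. Qed.

Let leaf_hom x (l : B su -> B (sx x)) : leaf xs f F Fs l -> exists e, hom_deg e l.
Proof.
move=> lf; case: x l / lf => t L ht LN.
have [e Le] := node_hom coxW repr two_neq0 xvP fP LN.
eexists; exact: (hom_comp (hom_comp (path_hom fP (F ht)) (castB_hom g rho (cats0 t))) Le).
Qed.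

Let bet_gr t e (b : B t) : gr e b -> poly_gr (e + (size t)%:Z) (beta b : R).
Proof. exact: (beta_hom g repr t).2. Qed.

Lemma beta_leaf_Hom x (h : B su -> R) : leafx x h -> Defs.Hom (h : B su -> Rx rho x).
Proof.
move=> lh; have [i ei hE] := leaf_fam lh.
move: lh; rewrite (beta_leafE x h) => -[l /leaf_hom[e [lM le]] eh].
apply: (hom_degP (d := e + (size (sx x))%:Z)); split.
  apply/mor_toP; rewrite -ei.
  have [h1 h2 h3] := mor_comp_to (beta_mor g repr _) (fam_mor ok i).
  by split=> [a b|a b|a b]; rewrite !hE; [apply: h1 | apply: h2 | apply: h3].
move=> j b gb; have eb : h b = (beta (l b) : R) by exact: (congr1 (fun h => h b) eh).
have : poly_gr (j + e + (size (sx x))%:Z) (h b) by rewrite eb; apply/bet_gr/le.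
by rewrite -addrA.
Qed.

End Leaves.

Lemma leaf_basis x :
  (forall t', subseq t' su -> rho (wd t') = rho x -> wd t' = x) ->
  right_basis (fun h : B su -> Rx rho x => leafx x h).
Proof.
move=> hx; have [I [q ok]] := fam_ex coxW repr two_neq0 xvP fP Fs sepP.
split.
- by move=> h; apply: (beta_leaf_Hom ok).
- move=> h /Hom_mor/mor_toP hM; have [c cP] := fam_span ok hx hM.
  pose A := [pred i | wd (tag (q i)) == x].
  have Ai (j : 'I_#|A|) : wd (tag (q (enum_val j))) = x by apply/eqP; apply: (enum_valP j).
  have /boolp.choice[H HP] (j : 'I_#|A|) : exists h : B su -> R,
      leafx x h /\ forall b, h b = beta (tagged (q (enum_val j)) b).
    by have [h' h1 h2] := fam_leaf ok (Ai j); exists h'.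
  exists #|A|, H, (fun j => c (enum_val j)); split=> [j|b]; first by case: (HP j).
  apply: (etrans (cP b)); rewrite (big_enum_val (A := A)) /=.
  apply: eq_bigr => j _; rewrite -(HP j).2; exact: erefl.
- move=> n h c hX hinj h0 i0.
  have /boolp.choice[sg sgP] (i : 'I_n) : exists j : I, wd (tag (q j)) = x /\
      forall b, (h i b : R) = beta (tagged (q j) b).
    by have [j j1 j2] := leaf_fam ok (hX i); exists j.
  have sg_inj : injective sg.
    move=> i j e; apply: hinj; apply/funext => b.
    have := (sgP i).2 b; rewrite e -(sgP j).2; exact.
  (* Freeness is known for the full family; the given coefficients are extended by 0 to the indices
     not met, in the form of sums over the fibres of the injection [sg]. *)
  have := fam_free ok (x := x) (c := fun j => \sum_(i | sg i == j) c i).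
  move=> /(_ _ (sg i0) (sgP i0).1); rewrite (big_pred1 i0) => [|i]; last exact: inj_eq.
  apply=> b; apply: (etrans _ (h0 b)).
  rewrite (partition_big sg (fun j => wd (tag (q j)) == x)) /=; last first.
    by move=> i _; apply/eqP; case: (sgP i).
  apply: eq_bigr => j _.
  rewrite /act raddf_sum mulr_sumr; apply: eq_bigr => i /eqP <-.
  rewrite -(sgP i).2; exact: erefl.
Qed.
End LeafBasis.

(** * Faithfulness of reflection representations *)

Section Alternating.
Variable K0 : realDomainType.

(* The coefficients on e_s and e_r of ... s r s r e_s, n reflections being
   applied, when r e_s = e_s + Y e_r and s e_r = e_r + X e_s. *)
Fixpoint alt_coef (X Y : K0) n : K0 * K0 :=
  if n is n'.+1 then
    let: (P, Q) := alt_coef X Y n' in if odd n' then (X * Q - P, Q) else (P, Y * P - Q)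
  else (1, 0).

End Alternating.

Section Faithful.
Variables (W : groupType) (S : finType) (g : S -> W).
Hypothesis coxW : coxeter_system g.
Variables (k : fieldType) (d : nat) (rho : W -> 'M[k]_d).
Hypothesis repr : representation rho.
Variables (K0 : realDomainType) (io : {rmorphism K0 -> k}).
Hypothesis io_inj : injective io.
Variables (alv : S -> 'cV[k]_d) (al : S -> 'rV[k]_d) (a : S -> S -> K0).
Hypothesis rho_gen : forall s, rho (g s) = 1%:M - alv s *m al s.
Hypothesis al_alv : forall s r, al s *m alv r = (io (a s r))%:M.
Hypothesis a_diag : forall s, a s s = 2%:R.
Hypothesis alv_free : forall c : S -> k, \sum_s c s *: alv s = 0 -> forall s, c s = 0.
Hypothesis a_rank2 : forall s r n, s != r -> mord g s r = 0%N \/ (n < mord g s r)%N ->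
  0 <= (alt_coef (- a s r) (- a r s) n).1 /\ 0 <= (alt_coef (- a s r) (- a r s) n).2.

Local Notation wd := (wd g).
Local Notation len := (len g).

Let reprM x y : rho (x * y)%g = rho x *m rho y.
Proof. by case: repr. Qed.

(** Signs live in the ordered ring [K0], mapped into k by [io] (the integers for a realization, the
    reals for the rootic representation), since k itself carries no order. *)
Definition pos_comb (v : 'cV[k]_d) : Prop :=
  exists2 c : S -> K0, (forall r, 0 <= c r) & v = \sum_r io (c r) *: alv r.

Lemma pos_combD u v : pos_comb u -> pos_comb v -> pos_comb (u + v).
Proof.
move=> [c c0 ->] [e e0 ->]; exists (fun r => c r + e r) => [r|]; first exact: addr_ge0.
by rewrite -big_split; apply: eq_bigr => r _; rewrite rmorphD scalerDl.
Qed.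

Lemma pos_combZ x v : 0 <= x -> pos_comb v -> pos_comb (io x *: v).
Proof.
move=> x0 [c c0 ->]; exists (fun r => x * c r) => [r|]; first exact: mulr_ge0.
by rewrite scaler_sumr; apply: eq_bigr => r _; rewrite rmorphM scalerA.
Qed.

Lemma pos_comb_alv s : pos_comb (alv s).
Proof.
exists (fun r => (r == s)%:R) => [r|]; first exact: ler0n.
rewrite (bigD1 s) //= eqxx rmorph1 scale1r big1 ?addr0 // => r /negbTE->.
by rewrite rmorph0 scale0r.
Qed.

Lemma rho_gen_alv s r : rho (g s) *m alv r = alv r - io (a s r) *: alv s.
Proof.
by rewrite rho_gen mulmxBl mul1mx -mulmxA al_alv mul_mx_scalar.
Qed.

Lemma rho_gen_alv_self s : rho (g s) *m alv s = - alv s.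
Proof. by rewrite rho_gen_alv a_diag rmorph_nat scaler_nat mulr2n opprD addNKr // addrA subrr add0r. Qed.

Lemma rho_alt s r n : rho (wd (rev (alt r s n))) *m alv s =
  io (alt_coef (- a s r) (- a r s) n).1 *: alv s +
  io (alt_coef (- a s r) (- a r s) n).2 *: alv r.
Proof.
elim: n => [|n IH].
  by rewrite wd_nil /=; case: repr => -> _; rewrite mul1mx rmorph1 rmorph0 scale1r scale0r addr0.
rewrite altS rev_rcons wd_cons reprM -mulmxA IH /=.
case: (alt_coef _ _ n) => P Q /=; rewrite mulmxDr -!scalemxAr.
case: (odd n); rewrite rho_gen_alv_self rho_gen_alv /=.
  rewrite !scalerN scalerBr rmorphB rmorphM rmorphN scalerBl mulNr scaleNr !scalerA.
  by rewrite [_ * io Q]mulrC addrCA [RHS]addrC; congr (_ + _); rewrite addrC.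
rewrite !scalerN scalerBr rmorphB rmorphM rmorphN scalerBl mulNr scaleNr !scalerA.
by rewrite [_ * io P]mulrC addrA.
Qed.

Lemma alt_shorten s r n : (0 < mord g s r <= n)%N ->
  (len (g s * wd (alt r s n))%g < n)%N.
Proof.
case/andP => m0 mn; set m := mord g s r in m0 mn.
have -> : n = (m.-1.+1 + (n - m))%N by rewrite prednK // subnKC.
rewrite wd_alt_cat prednK // -/m -(wd_alt_mord coxW m0) -/m -{1}(prednK m0) /= wd_cons.
rewrite -mulgA (genKl coxW).
set t := if _ then _ else _; apply: (@leq_ltn_trans (m.-1 + (n - m))).
  apply: leq_trans (lenM coxW _ _) _; apply: leq_add.
    by apply: leq_trans (len_wd _ _) _; rewrite size_alt.
  by apply: leq_trans (len_wd _ _) _; rewrite /t; case: ifP; rewrite size_alt.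
by rewrite ltn_add2r prednK.
Qed.

(** Induction on the length. Let r be the last letter of a reduced expression of w, and write w = v
    u with u the longest possible alternating tail in s and r. Both s and r are ascents of v, so v
    sends alv s and alv r to nonnegative combinations, while u sends alv s to a nonnegative
    combination of these two by [a_rank2]. *)
Theorem pos_up w s : (len w < len (w * g s)%g)%N -> pos_comb (rho w *m alv s).
Proof.
have [N] := ubnP (len w); elim: N w s => // N IH w s; rewrite ltnS => wN up.
have [t st wt] := lenP coxW w.
case/lastP: t => [|t r] in st wt.
  by rewrite -wt wd_nil; case: repr => -> _; rewrite mul1mx; apply: pos_comb_alv.
have wr : (len (w * g r)%g < len w)%N.
  rewrite -wt wd_rcons (genK coxW) -wd_rcons wt -st size_rcons ltnS; exact: len_wd.
have sr : s != r by apply/eqP => e; move: wr; rewrite -e ltnNge (ltnW up).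
pose P n := `[< exists2 v, w = (v * wd (rev (alt r s n)))%g & len w = (len v + n)%N >].
have P1 : P 1%N.
  apply/asboolP; exists (w * g r)%g; first by rewrite /= wd1 (genK coxW).
  by rewrite (len_down coxW wr) addn1.
have Pb n : P n -> (n <= len w)%N by move=> /asboolP[v _ ->]; apply: leq_addl.
case: (ex_maxnP (ex_intro _ 1%N P1) Pb) => n /asboolP[v ew lw] nmax.
have n0 : (0 < n)%N by apply: nmax.
(* [up1] is the maximality of n. [up2] concerns the first letter of u: as a descent of v it would
   cancel against u and shorten w. *)
have up1 : (len v < len (v * g (if odd n then s else r))%g)%N.
  case: (len_updown coxW v (if odd n then s else r)) => // dn.
  have : P n.+1.
    apply/asboolP; exists (v * g (if odd n then s else r))%g.
      by rewrite altS rev_rcons wd_cons mulgA (genK coxW).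
    by rewrite lw (len_down coxW dn) addSnnS.
  by move/nmax; rewrite ltnn.
have up2 : (len v < len (v * g (if odd n then r else s))%g)%N.
  case: (len_updown coxW v (if odd n then r else s)) => // dn.
  have : (len w <= len (v * g (if odd n then r else s))%g + n.-1)%N.
    rewrite {1}ew -(prednK n0) altS rev_rcons wd_cons mulgA.
    have -> : (if odd n.-1 then s else r) = (if odd n.-1.+1 then r else s) by rewrite /=; case: (odd _).
    apply: leq_trans (lenM coxW _ _) _; rewrite leq_add2l.
    by apply: leq_trans (len_wd _ _) _; rewrite size_rev size_alt.
  by rewrite lw (len_down coxW dn) addSnnS leq_add2l leqNgt ltnS leq_pred.
have vw : (len v < N)%N.
  by apply: leq_trans wN; rewrite lw -[X in (X < _)%N]addn0 ltn_add2l.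
have [us ur] : pos_comb (rho v *m alv s) /\ pos_comb (rho v *m alv r).
  by move: up1 up2; case: (odd n) => h1 h2; split; apply: IH.
(* If n reached the order of g s g r, then u s could be written with fewer than n letters and w s
   would be shorter than w. *)
have hn : mord g s r = 0%N \/ (n < mord g s r)%N.
  case: (ltnP n (mord g s r)) => [|mn]; [by right | left].
  apply/eqP; rewrite -leqn0 leqNgt; apply/negP => m0.
  have := @alt_shorten s r n; rewrite m0 mn => /(_ isT) sh.
  have : (len (w * g s)%g <= len v + len (g s * wd (alt r s n))%g)%N.
    rewrite -[X in (_ <= _ + X)%N](lenV coxW) invgM (genV coxW) -(wd_rev coxW) ew -mulgA.
    exact: lenM.
  move=> h; have := leq_ltn_trans h; rewrite -(ltn_add2l (len v)) in sh.
  by move/(_ _ sh); rewrite -lw ltnNge (ltnW up).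
have [p1 p2] := a_rank2 sr hn.
rewrite ew reprM -mulmxA rho_alt mulmxDr -!scalemxAr.
by apply: pos_combD; apply: pos_combZ.
Qed.

(** If s is the last letter of a reduced expression of w, then w s sends alv s to a nonnegative
    combination; when w acts trivially this vector is - alv s. *)
Theorem rho_faithful w : rho w = 1%:M -> w = 1%g.
Proof.
move=> w1; have [t st wt] := lenP coxW w.
case/lastP: t => [|t s] in st wt; first by rewrite -wt wd_nil.
have wr : (len (w * g s)%g < len w)%N.
  rewrite -wt wd_rcons (genK coxW) -wd_rcons wt -st size_rcons ltnS; exact: len_wd.
have [|c c0 e] := @pos_up (w * g s)%g s; first by rewrite (genK coxW).
have : io (1 + c s) = io 0.
  rewrite rmorph0; have := alv_free (c := fun r => io ((r == s)%:R + c r)) _ s.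
  rewrite eqxx; apply.
  under eq_bigr => r _ do rewrite rmorphD scalerDl.
  rewrite big_split /= -e reprM -mulmxA rho_gen_alv_self w1 mul1mx.
  rewrite (bigD1 s) //= eqxx rmorph1 scale1r big1 ?addr0 ?subrr // => r /negbTE->.
  by rewrite rmorph0 scale0r.
move/io_inj => e1; have := ltr_wpDr (c0 s) (ltr01 : 0 < 1 :> K0).
by rewrite e1 ltxx.
Qed.

End Faithful.

Section Rank2.
Variable K0 : realDomainType.
Implicit Types X Y : K0.

Lemma alt_coef_int (X Y : int) (n : nat) : 0 <= X -> 0 <= Y -> (X = 0 <-> Y = 0) ->
  weyl_order (X * Y) = 0%N \/ (n < weyl_order (X * Y))%N ->
  0 <= (alt_coef X Y n).1 /\ 0 <= (alt_coef X Y n).2.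
Proof.
move=> X0 Y0 XY0 h.
have [XY4|XY4] := lerP 4 (X * Y).
  (* The inequality added to the induction says that the next coefficient, X Q - P or Y P - Q, is at
     least the one it replaces; X Y >= 4 makes it hereditary. The case X Y < 4 is a finite check. *)
  suff : [/\ 0 <= (alt_coef X Y n).1, 0 <= (alt_coef X Y n).2 &
      if odd n then X * (alt_coef X Y n).2 >= 2 * (alt_coef X Y n).1
      else Y * (alt_coef X Y n).1 >= 2 * (alt_coef X Y n).2] by case.
  elim: n {h} => [|n] /=; first by rewrite mulr1 mulr0.
  case: (alt_coef X Y n) => P Q /= [P0 Q0]; case: (odd n) => h /=; split => //; nia.
case: X X0 XY0 XY4 h => // x _; case: Y Y0 => // y _ XY0 XY4 h.
have xy : (x * y < 4)%N by [].
move: XY0 h; rewrite -PoszM; case: x y xy {XY4} => [|[|[|[|x]]]] [|[|[|[|y]]]] //= xy;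
  rewrite ?muln0 ?mul0n ?muln1 ?mul1n //=; try lia; move=> XY0 h.
all: try (exfalso; clear -XY0; case: XY0 => h1 h2; first [have := h1 erefl | have := h2 erefl]; done).
all: case: h => // h; move: n h; do 6?[case=> //].
Qed.

End Rank2.

(** * Reflection representations and the choice of hyperplane equations *)

Section ReflectionRep.
Variables (W : groupType) (S : finType) (g : S -> W).
Hypothesis coxW : coxeter_system g.
Variables (k : fieldType) (d : nat) (rho : W -> 'M[k]_d).
Variables (alv : S -> 'cV[k]_d) (al : S -> 'rV[k]_d).
Hypothesis rhoP : reflection_representation g rho alv al.
Hypothesis two_neq0 : 2%:R != 0 :> k.
Hypothesis al_alv : forall s, al s *m alv s = 2%:R%:M.
Variable xs : S -> 'rV[k]_d.
Hypothesis xsP : forall s, hyperplane_equation g rho s (xs s).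

(** [xs s] and [al s] have the same kernel, hence are proportional; the vector [xv s] is [alv s]
    with the inverse scaling. *)
Lemma hyperplane_coroot : exists xv : S -> 'cV[k]_d,
  forall s, rho (g s) = 1%:M - xv s *m xs s /\ xs s *m xv s = 2%:R%:M.
Proof.
have ker s (v : 'cV[k]_d) : xs s *m v = 0 <-> al s *m v = 0.
  have alv0 : alv s != 0.
    apply/eqP => e; have /matrixP/(_ 0 0) := al_alv s.
    by rewrite e mulmx0 !mxE mulr1n => /esym/eqP; rewrite (negbTE two_neq0).
  suff main : rho (g s) *m v = v <-> al s *m v = 0 by split=> h; [exact: (main.1 ((xsP s v).1 h)) | exact: ((xsP s v).2 (main.2 h))].
  rewrite rhoP.2 mulmxBl mul1mx -mulmxA; split=> [h|->]; last first.
    by rewrite mulmx0 subr0.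
  have {h} : alv s *m (al s *m v) = 0 by apply: oppr_inj; apply: (addrI v); rewrite h oppr0 addr0.
  rewrite [al s *m v]mx11_scalar mul_mx_scalar => /eqP.
  by rewrite scaler_eq0 (negbTE alv0) orbF => /eqP ->; rewrite raddf0.
pose y s := (xs s *m alv s) 0 0.
have y0 s : y s != 0.
  apply/eqP => e; have /ker : xs s *m alv s = 0 by rewrite [LHS]mx11_scalar -/(y s) e raddf0.
  rewrite al_alv => /matrixP/(_ 0 0); rewrite !mxE mulr1n => /eqP.
  by rewrite (negbTE two_neq0).
have xsE s : xs s = (y s / 2%:R) *: al s.
  apply/rowP => j; pose v : 'cV[k]_d := delta_mx j 0.
  have ee (w : 'cV[k]_d) : (xs s *m w) 0 0 = (y s / 2%:R) * (al s *m w) 0 0.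
    have /ker : al s *m (w - ((al s *m w) 0 0 / 2%:R) *: alv s) = 0.
      by rewrite mulmxBr -scalemxAr al_alv scale_scalar_mx divfK // -mx11_scalar subrr.
    rewrite mulmxBr -scalemxAr => /eqP; rewrite subr_eq0 => /eqP ->.
    by rewrite mxE -/(y s) mulrC mulrAC mulrA.
  have := ee v; rewrite -!colE !mxE //.
exists (fun s => (2%:R / y s) *: alv s) => s; rewrite rhoP.2 xsE; split.
  by rewrite -scalemxAr -scalemxAl scalerA -[y s / _]invf_div mulVf ?scale1r // mulf_neq0 // invr_neq0.
by rewrite -scalemxAr -scalemxAl scalerA al_alv -[y s / _]invf_div mulfV ?scale1r // mulf_neq0 // invr_neq0.
Qed.

Variable f : forall s r, B g rho (alt s r (mord g s r)) -> B g rho (alt r s (mord g s r)).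
Hypothesis fP : braid_morphisms f.
Variable sx : W -> seq S.
Variable F : forall t, rexpr g t -> bpath g t (sx (wd g t)).
Variable Fs : forall t s, rexpr g t -> (len g (wd g t * g s)%g < len g (wd g t))%N ->
  {t' : seq S & bpath g t (rcons t' s)}.
Variables (su : seq S) (x : W).

Theorem reflection_basis :
  (forall t', subseq t' su -> rho_separated g rho (wd g t')) ->
  (forall t', subseq t' su -> rho (wd g t') = rho x -> wd g t' = x) ->
  right_basis (fun h : B g rho su -> Rx rho x => beta_leaf xs f F Fs h).
Proof.
move=> h1 h2; have [xv xvP] := hyperplane_coroot.
exact: (leaf_basis coxW rhoP.1 two_neq0 xvP fP F Fs h1 h2).
Qed.

Theorem faithful_basis : (forall w, rho w = 1%:M -> w = 1%g) ->
  right_basis (fun h : B g rho su -> Rx rho x => beta_leaf xs f F Fs h).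
Proof.
move=> rho1; have rho_inj u v : rho u = rho v -> u = v.
  move=> e; apply: (mulIg v^-1%g); rewrite mulgV; apply: rho1.
  by rewrite rhoP.1.2 e -rhoP.1.2 mulgV rhoP.1.1.
by apply: reflection_basis => [t' _ t _ _ t'' _|t' _] /rho_inj.
Qed.

End ReflectionRep.
Section Cases.
Variables (W : groupType) (S : finType) (g : S -> W).
Hypothesis coxW : coxeter_system g.

Lemma mord_sym s r : mord g s r = mord g r s.
Proof.
suff le u v : (0 < mord g u v)%N -> (0 < mord g v u <= mord g u v)%N.
  have h1 := @le s r; have h2 := @le r s.
  have [e|h] := posnP (mord g s r); have [e'|h'] := posnP (mord g r s).
  - by rewrite e e'.
  - by move: (h2 h'); rewrite e.
  - by move: (h1 h); rewrite e'.
  - by apply/eqP; rewrite eqn_leq; case/andP: (h1 h) (h2 h') => _ -> /andP[_ ->].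
move=> m0; apply: mord_min => //.
have e : (g v * g u = (g u * g v)^-1)%g by rewrite invgM !(genV coxW).
by rewrite e expVgn (mordP m0) invg1.
Qed.

Lemma mord_diag s : mord g s s = 1%N.
Proof.
have /andP[h1 h2] := @mord_min _ _ g s s 1 isT (congr1 (fun x => x ^+ 1)%g (gen_sq coxW s)).
by apply/eqP; rewrite eqn_leq h2.
Qed.

Lemma mord_gt1 s r : s != r -> mord g s r != 1%N.
Proof.
move=> sr; apply/eqP => m1; have := @mordP _ _ g s r; rewrite m1 expg1 => /(_ isT) e.
case/eqP: sr; apply: (coxeter_inj coxW).
by rewrite -(mul1g (g r)) -e (genK coxW).
Qed.

Lemma lieT_pairing (k : fieldType) r (Phi : root_datum r S) s :
  root_system Phi -> lieT_root k Phi s *m basis_vector k s = 2%:R%:M.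
Proof.
move=> RS; apply/matrixP => i j; rewrite [i]ord1 [j]ord1 -colE !mxE enum_rankK.
by rewrite /cartan (roots_pair2 RS (simple_roots RS s)).
Qed.

Lemma basis_vector_free (k : fieldType) (c : S -> k) :
  \sum_s c s *: basis_vector k s = 0 -> forall s, c s = 0.
Proof.
move=> e s; have /matrixP/(_ (enum_rank s) 0) := e; rewrite summxE (bigD1 s) //= !mxE !eqxx mulr1.
rewrite big1 ?addr0 // => r rs; rewrite !mxE.
by rewrite (inj_eq enum_rank_inj) eq_sym (negbTE rs) mulr0.
Qed.

Lemma realization_faithful (k : fieldType) d (A : S -> S -> int) (rho : W -> 'M[k]_d) alv al :
  affine_weyl_group g A -> [pchar k] =i pred0 ->
  realization A alv al -> reflection_representation g rho alv al ->
  forall w, rho w = 1%:M -> w = 1%g.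
Proof.
move=> [Aff mA] ch0 R [repr rg].
apply: (@rho_faithful _ _ g coxW _ _ rho repr int (intr : {rmorphism int -> k}) _
  alv al (fun s r => A r s)) => //.
- have ch x : (x%:~R == 0 :> k) = (x == 0).
    have c0 := (pcharf0P k).1 ch0.
    by case: x => n; rewrite ?NegzE ?rmorphN ?oppr_eq0 /= -pmulrn c0.
  by move=> x y /= /eqP; rewrite -subr_eq0 -rmorphB ch subr_eq0 => /eqP.
- by move=> s r; rewrite (real_pairing R).
- by move=> s; rewrite (gcm_diag Aff).
- move=> c e s; apply: (real_coroots R (c := c)).
  by rewrite -[RHS](trmx0 k d 1) -e raddf_sum; apply: eq_bigr => r _; rewrite /= linearZ.
- move=> s r n sr; rewrite mA // => h; apply: alt_coef_int.
  + by rewrite oppr_ge0; apply: (gcm_off Aff); rewrite eq_sym.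
  + by rewrite oppr_ge0; apply: (gcm_off Aff).
  + by split=> /eqP; rewrite oppr_eq0 => /eqP /(gcm_sym0 Aff) ->; rewrite oppr0.
  + by rewrite mulrNN mulrC.
Qed.

Lemma alt_coef2 (K : realType) n :
  alt_coef (2%:R : K) 2%:R n = if odd n then (n%:R, n.+1%:R) else (n.+1%:R, n%:R).
Proof.
elim: n => [|n IH] //=; rewrite IH.
by case: (odd n) => /=; congr (_, _); rewrite -[n.+2%:R]natr1 -[n.+1%:R]natr1; ring.
Qed.

(** The Chebyshev recursion: the coefficients are sin (j t) / sin t with j = n or n + 1. For t = pi
    / m they are nonnegative while n < m. *)
Lemma alt_coef_sin (K : realType) (t : K) n :
  sin t * (alt_coef (2%:R * cos t) (2%:R * cos t) n).1 =
    (if odd n then sin (n%:R * t) else sin (n.+1%:R * t)) /\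
  sin t * (alt_coef (2%:R * cos t) (2%:R * cos t) n).2 =
    (if odd n then sin (n.+1%:R * t) else sin (n%:R * t)).
Proof.
have rec m : sin (m.+2%:R * t) = 2%:R * cos t * sin (m.+1%:R * t) - sin (m%:R * t).
  have e2 : m.+2%:R * t = m.+1%:R * t + t by rewrite -[m.+2]addn1 natrD mulrDl mul1r.
  have e0 : m%:R * t = m.+1%:R * t - t by rewrite -[m.+1]addn1 natrD mulrDl mul1r addrK.
  by rewrite e2 e0 sinD sinB; ring.
elim: n => [|n [IH1 IH2]] /=; first by rewrite mulr1 mulr0 mul1r mul0r sin0.
case: (alt_coef _ _ n) IH1 IH2 => P Q /=; case: (odd n) => /= h1 h2; split=> //; rewrite rec -h1 -h2; ring.
Qed.

Lemma rootic_faithful (K : realType) (rho : W -> 'M[K]_#|S|) :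
  reflection_representation g rho (@basis_vector S K) (rootic_root g K) ->
  forall w, rho w = 1%:M -> w = 1%g.
Proof.
move=> [repr rg].
apply: (@rho_faithful _ _ g coxW _ _ rho repr K (idfun : {rmorphism K -> K}) _
  (@basis_vector S K) (rootic_root g K) (fun s r => 2%:R * rootic_form g K s r)) => //.
- move=> s r; apply/matrixP => i j; rewrite [i]ord1 [j]ord1 -colE !mxE enum_rankK.
  by rewrite mulr1n.
- by move=> s; rewrite /rootic_form mord_diag divr1 cospi opprK mulr1.
- exact: basis_vector_free.
- move=> s r n sr h; rewrite /rootic_form (mord_sym r s).
  case: (mord g s r) (mord_gt1 sr) h => [|[|m]] // _ h.
    by rewrite mulrN1 opprK alt_coef2; case: (odd n) => /=; rewrite !ler0n.
  case: h => // nm; rewrite mulrN opprK; set t := pi / _.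
  have [h1 h2] := alt_coef_sin t n.
  have s0 : 0 < sin t.
    apply: sin_gt0_pi; rewrite divr_gt0 ?pi_gt0 ?ltr0n //=.
    by rewrite ltr_pdivrMr ?ltr0n // ltr_pMr ?pi_gt0 // ltr1n.
  have sk j : (j <= m.+2)%N -> 0 <= sin (j%:R * t).
    move=> jm; apply: sin_ge0_pi; rewrite mulr_ge0 ?ler0n ?divr_ge0 ?pi_ge0 //=.
    by rewrite mulrCA ler_piMr ?pi_ge0 // ler_pdivrMr ?ltr0n // mul1r ler_nat.
  by split; rewrite -(pmulr_rge0 _ s0) ?h1 ?h2; case: (odd n); apply: sk => //; apply: ltnW.
Qed.

End Cases.

(** * Root systems *)

Section RootSystem.
Variables (r : nat) (I : finType) (Phi : root_datum r I).
Hypothesis RS : root_system Phi.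
Local Notation E := 'rV[rat]_r.
Local Notation "<| b , a |>" := (pairing Phi b a).
Local Notation roots := (roots Phi).
Local Notation refl := (refl Phi).

Lemma pairingD b b' a : <|b + b', a|> = <|b, a|> + <|b', a|>.
Proof. by rewrite /pairing mulmxDl mxE. Qed.
Lemma pairingZ c b a : <|c *: b, a|> = c * <|b, a|>.
Proof. by rewrite /pairing -scalemxAl mxE. Qed.
Lemma pairingN b a : <|- b, a|> = - <|b, a|>.
Proof. by rewrite /pairing mulNmx mxE. Qed.
Lemma pairingB b b' a : <|b - b', a|> = <|b, a|> - <|b', a|>.
Proof. by rewrite pairingD pairingN. Qed.
Lemma pairing0 a : <|0, a|> = 0.
Proof. by rewrite /pairing mul0mx mxE. Qed.
Lemma pairing_sum (J : Type) (s : seq J) (P : pred J) (F : J -> E) a :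
  <|\sum_(j <- s | P j) F j, a|> = \sum_(j <- s | P j) <|F j, a|>.
Proof. exact: (big_morph (fun b => <|b, a|>) (fun b b' => pairingD b b' a) (pairing0 a)). Qed.

Lemma reflE a b : refl a b = b - <|b, a|> *: a. Proof. by []. Qed.
Lemma reflD a b b' : refl a (b + b') = refl a b + refl a b'.
Proof. by rewrite !reflE pairingD scalerDl opprD addrACA. Qed.
Lemma reflZ a c b : refl a (c *: b) = c *: refl a b.
Proof. by rewrite !reflE pairingZ scalerBr scalerA. Qed.
Lemma reflN a b : refl a (- b) = - refl a b.
Proof. by rewrite -scaleN1r reflZ scaleN1r. Qed.
Lemma refl0 a : refl a 0 = 0.
Proof. by rewrite reflE pairing0 scale0r subr0. Qed.
Lemma refl_sum (J : Type) (s : seq J) (P : pred J) (F : J -> E) a :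
  refl a (\sum_(j <- s | P j) F j) = \sum_(j <- s | P j) refl a (F j).
Proof. exact: (big_morph (refl a) (reflD a) (refl0 a)). Qed.

Lemma refl_self a : a \in roots -> refl a a = - a.
Proof. by move=> ha; rewrite reflE (roots_pair2 RS ha) scaler_nat mulr2n opprD addrA subrr add0r. Qed.

Lemma reflK a : a \in roots -> involutive (refl a).
Proof.
move=> ha b; rewrite {1}reflE pairingB pairingZ (roots_pair2 RS ha) reflE -addrA -opprD -scalerDl.
have -> : <|b, a|> + (<|b, a|> - <|b, a|> * 2%:R) = 0 by ring.
by rewrite scale0r subr0.
Qed.

Lemma refl_root a b : a \in roots -> b \in roots -> refl a b \in roots.
Proof. by move=> ha hb; apply: (roots_refl RS). Qed.

Lemma root_neq0 a : a \in roots -> a != 0.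
Proof. by move=> ha; apply: contraTneq ha => ->; apply: (roots_neq0 RS). Qed.

Lemma rootN a : a \in roots -> - a \in roots.
Proof. by move=> ha; rewrite -(refl_self ha); apply: refl_root. Qed.

Lemma perm_roots (h : E -> E) : injective h -> (forall b, b \in roots -> h b \in roots) ->
  perm_eq [seq h b | b <- roots] roots.
Proof.
move=> hi hr; have sub : {subset [seq h b | b <- roots] <= roots} by move=> _ /mapP[b hb ->]; apply: hr.
have u : uniq [seq h b | b <- roots] by rewrite map_inj_uniq // (roots_uniq RS).
apply: uniq_perm => //; first exact: (roots_uniq RS).
by have [] := uniq_min_size u sub; rewrite ?size_map.
Qed.

Lemma refl_inj a : a \in roots -> injective (refl a).
Proof. by move=> ha; apply: inv_inj; apply: reflK. Qed.

Lemma sum_roots (V : nmodType) (h : E -> E) (F : E -> V) :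
  injective h -> (forall b, b \in roots -> h b \in roots) ->
  \sum_(b <- roots) F (h b) = \sum_(b <- roots) F b.
Proof. by move=> hi hr; rewrite -[RHS](perm_big _ (perm_roots hi hr)) big_map. Qed.

Lemma roots_span_ind (P : E -> Prop) : (forall a, a \in roots -> P a) ->
  (forall c x y, P x -> P y -> P (c *: x + y)) -> P 0 -> forall x, P x.
Proof.
move=> Pr PD P0 x; have : x \in (<<roots>>)%VS by rewrite (roots_span RS) memvf.
move=> /(coord_span (X := in_tuple roots)) ->.
apply: big_ind => // [u v Pu Pv|i _]; first by rewrite -[u]scale1r; apply: (PD).
rewrite -[_ *: _]addr0; apply: (PD) => //; apply: Pr; exact: mem_nth.
Qed.

(** An invariant positive definite form on the dual space; its inverse is the invariant inner
    product on E. A [root_datum] records coroots as bare linear forms, and invariance is what forces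
    <x, a> = 2 (x, a) / (a, a) in [pairingE]. *)
Definition gram : 'M[rat]_r := \sum_(a <- roots) a^T *m a.

Lemma gramE (y : 'cV[rat]_r) : (y^T *m gram *m y) 0 0 = \sum_(a <- roots) (a *m y) 0 0 ^+ 2.
Proof.
rewrite /gram mulmx_sumr mulmx_suml summxE; apply: eq_bigr => a _.
rewrite mulmxA -mulmxA -trmx_mul mxE big_ord1 mxE expr2 //.
Qed.

Lemma gram_tr : gram^T = gram.
Proof.
by rewrite /gram raddf_sum; apply: eq_bigr => a _; rewrite /= trmx_mul trmxK.
Qed.

Lemma gram_def (y : 'cV[rat]_r) : (y^T *m gram *m y) 0 0 = 0 -> y = 0.
Proof.
rewrite gramE => /eqP; rewrite psumr_eq0 => [/allP h|a _]; last exact: sqr_ge0.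
have h' (x : E) : (x *m y) 0 0 = 0.
  apply: (roots_span_ind (P := fun x => (x *m y) 0 0 = 0)) => [a /h|c u v hu hv|].
  - by rewrite sqrf_eq0 => /eqP.
  - by rewrite mulmxDl mxE -scalemxAl mxE hu hv mulr0 addr0.
  - by rewrite mul0mx mxE.
apply/colP => i; rewrite mxE -[RHS](h' (delta_mx 0 i)) -rowE !mxE //.
Qed.

Lemma gram_unit : gram \in unitmx.
Proof.
rewrite -row_free_unit; apply/row_freeP; apply/row_freeP.
rewrite -kermx_eq0; apply/rowV0P => v /sub_kermxP hv.
apply/trmx_inj; rewrite trmx0; apply: gram_def.
by rewrite trmxK hv mul0mx mxE.
Qed.

Definition inner_product (x y : E) : rat := (x *m invmx gram *m y^T) 0 0.
Local Notation ip := inner_product.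

Lemma ipC x y : ip x y = ip y x.
Proof.
rewrite /inner_product -[LHS]trace_mx11 -mxtrace_tr !trmx_mul trmxK trmx_inv gram_tr trace_mx11 mulmxA //.
Qed.

Lemma ipDl x x' y : ip (x + x') y = ip x y + ip x' y.
Proof. by rewrite /inner_product !mulmxDl mxE. Qed.
Lemma ipZl c x y : ip (c *: x) y = c * ip x y.
Proof. by rewrite /inner_product -!scalemxAl mxE. Qed.
Lemma ipNl x y : ip (- x) y = - ip x y.
Proof. by rewrite -scaleN1r ipZl mulN1r. Qed.
Lemma ipDr x y y' : ip x (y + y') = ip x y + ip x y'.
Proof. by rewrite !(ipC x) ipDl. Qed.
Lemma ipZr c x y : ip x (c *: y) = c * ip x y.
Proof. by rewrite !(ipC x) ipZl. Qed.
Lemma ipNr x y : ip x (- y) = - ip x y.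
Proof. by rewrite !(ipC x) ipNl. Qed.
Lemma ip0l y : ip 0 y = 0.
Proof. by rewrite /inner_product !mul0mx mxE. Qed.
Lemma ip_suml (J : Type) (s : seq J) (P : pred J) (F : J -> E) y :
  ip (\sum_(j <- s | P j) F j) y = \sum_(j <- s | P j) ip (F j) y.
Proof. exact: (big_morph (fun b => ip b y) (fun b b' => ipDl b b' y) (ip0l y)). Qed.
Lemma ip_sumr (J : Type) (s : seq J) (P : pred J) (F : J -> E) y :
  ip y (\sum_(j <- s | P j) F j) = \sum_(j <- s | P j) ip y (F j).
Proof. by rewrite ipC ip_suml; apply: eq_bigr => j _; rewrite ipC. Qed.

Let ipE x : ip x x = \sum_(a <- roots) (a *m (invmx gram *m x^T)) 0 0 ^+ 2.
Proof.
rewrite -gramE trmx_mul trmxK trmx_inv gram_tr -!mulmxA (mulKVmx gram_unit) !mulmxA //.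
Qed.

Lemma ip_ge0 x : 0 <= ip x x.
Proof. by rewrite ipE; apply: sumr_ge0 => a _; apply: sqr_ge0. Qed.

Lemma ip_eq0 x : ip x x = 0 -> x = 0.
Proof.
rewrite ipE -gramE => /gram_def h.
have : gram *m (invmx gram *m x^T) = 0 by rewrite h mulmx0.
by rewrite mulKVmx ?gram_unit // => /(congr1 trmx); rewrite trmxK trmx0.
Qed.

Lemma ip_gt0 x : x != 0 -> 0 < ip x x.
Proof.
by move=> x0; rewrite lt_neqAle ip_ge0 andbT eq_sym; apply: contra_neq x0; apply: ip_eq0.
Qed.

Definition reflmx a : 'M[rat]_r := 1%:M - coroot Phi a *m a.

Lemma reflmxE a b : refl a b = b *m reflmx a.
Proof.
rewrite reflE /reflmx mulmxBr mulmx1 mulmxA; congr (_ - _).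
by rewrite [b *m _]mx11_scalar mul_scalar_mx.
Qed.

Lemma ip_refl a x y : a \in roots -> ip (refl a x) (refl a y) = ip x y.
Proof.
move=> ha; have MM : reflmx a *m reflmx a = 1%:M.
  by apply/row_matrixP => i; rewrite rowE mulmxA -!reflmxE reflK // rowE mulmx1.
have MG : (reflmx a)^T *m gram *m reflmx a = gram.
  rewrite /gram mulmx_sumr mulmx_suml.
  rewrite -(sum_roots (fun b => b^T *m b) (refl_inj ha) (fun b => refl_root ha (b := b))).
  by apply: eq_bigr => b _; rewrite reflmxE trmx_mul !mulmxA.
have MI : reflmx a *m invmx gram *m (reflmx a)^T = invmx gram.
  have e : gram *m reflmx a = (reflmx a)^T *m gram.
    by rewrite -[in LHS]MG -!mulmxA MM mulmx1.
  apply: (can_inj (mulKmx gram_unit)); rewrite !mulmxA e mulmxV ?gram_unit //.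
  by rewrite -[_ *m gram *m _]mulmxA mulmxV ?gram_unit // mulmx1 -trmx_mul MM trmx1.
by rewrite /inner_product !reflmxE trmx_mul !mulmxA -[x *m _ *m _]mulmxA -[x *m _ *m _]mulmxA MI.
Qed.

Lemma pairing_ip x a : a \in roots -> 2%:R * ip x a = <|x, a|> * ip a a.
Proof.
move=> ha; have := ip_refl (refl a x) a ha; rewrite reflK // refl_self // ipNr reflE.
rewrite ipDl ipNl ipZl => h; lra.
Qed.

Lemma pairingE x a : a \in roots -> <|x, a|> = 2%:R * ip x a / ip a a.
Proof. by move=> ha; rewrite pairing_ip // mulfK // gt_eqF // ip_gt0 // root_neq0. Qed.

Lemma pairing_refl b x a : b \in roots -> a \in roots -> <|refl b x, refl b a|> = <|x, a|>.
Proof. by move=> hb ha; rewrite !pairingE ?refl_root // !ip_refl. Qed.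

Lemma pairingNr x a : a \in roots -> <|x, - a|> = - <|x, a|>.
Proof. by move=> ha; rewrite !pairingE ?rootN // !ipNr ipNl opprK mulrN mulNr. Qed.

Lemma pairing_sg a b : a \in roots -> b \in roots -> 0 <= <|a, b|> * <|b, a|>.
Proof.
move=> ha hb; rewrite !pairingE // [ip b a]ipC mulf_div mulr_ge0 //.
  by rewrite -expr2 sqr_ge0.
by rewrite invr_ge0 mulr_ge0 ?ip_ge0.
Qed.

Lemma pairing_eq0C a b : a \in roots -> b \in roots -> (<|a, b|> == 0) = (<|b, a|> == 0).
Proof.
move=> ha hb; have n0 c : c \in roots -> ip c c != 0 by move=> hc; rewrite gt_eqF // ip_gt0 // root_neq0.
rewrite !pairingE // !mulf_eq0 !invr_eq0 (negbTE (n0 a ha)) (negbTE (n0 b hb)) !orbF ipC //.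
Qed.

End RootSystem.

Section PositiveRoots.
Variables (r : nat) (I : finType) (Phi : root_datum r I).
Hypothesis RS : root_system Phi.
Local Notation E := 'rV[rat]_r.
Local Notation "<| b , a |>" := (pairing Phi b a).
Local Notation roots := (roots Phi).
Local Notation simple := (simple Phi).
Local Notation refl := (refl Phi).
Local Notation pos := (nonneg_root Phi).

Let simple_in i : simple i \in roots. Proof. exact: simple_roots. Qed.

Definition simple_mx : 'M[rat]_(#|I|, r) := \matrix_(i < #|I|) simple (enum_val i).

Lemma mul_simple_mx (v : 'rV[rat]_#|I|) : v *m simple_mx = \sum_i v 0 (enum_rank i) *: simple i.
Proof.
rewrite mulmx_sum_row (reindex_onto enum_rank enum_val) /=; last by move=> i _; rewrite enum_valK.
by apply: eq_big => [i|i _]; rewrite ?enum_rankK ?eqxx // rowK enum_rankK.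
Qed.

Lemma simple_mx_free : row_free simple_mx.
Proof.
rewrite -kermx_eq0; apply/rowV0P => v /sub_kermxP; rewrite mul_simple_mx => h.
apply/rowP => i; rewrite mxE -[i]enum_valK.
exact: (simple_free RS (c := fun i => v 0 (enum_rank i)) h).
Qed.

Lemma simple_sub (x : E) : (x <= simple_mx)%MS.
Proof.
have sim i : (simple i <= simple_mx)%MS.
  by apply/submxP; exists (delta_mx 0 (enum_rank i)); rewrite -rowE rowK enum_rankK.
have posP a : pos a -> (a <= simple_mx)%MS.
  by move=> [c ->]; apply: summx_sub => i _; apply: scalemx_sub.
apply: (roots_span_ind RS (P := fun x => (x <= simple_mx)%MS)) => [a ha|c x' y hx hy|].
- by case: (simple_base RS ha) => /posP //; rewrite (eqmx_opp a).
- by apply: addmx_sub => //; apply: scalemx_sub.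
- exact: sub0mx.
Qed.

Lemma card_simple : #|I| = r.
Proof.
have /eqP e := simple_mx_free; apply/eqP; rewrite -e eqn_leq rank_leq_col /=.
rewrite -{1}(mxrank1 rat r); apply: mxrankS; apply/row_subP => i; exact: simple_sub.
Qed.

Definition simple_coord (i : I) (x : E) : rat := (x *m pinvmx simple_mx) 0 (enum_rank i).

Local Notation coord := simple_coord.

Lemma coordD i x y : coord i (x + y) = coord i x + coord i y.
Proof. by rewrite /simple_coord mulmxDl mxE. Qed.
Lemma coordZ i c x : coord i (c *: x) = c * coord i x.
Proof. by rewrite /simple_coord -scalemxAl mxE. Qed.
Lemma coordN i x : coord i (- x) = - coord i x.
Proof. by rewrite /simple_coord mulNmx mxE. Qed.
Lemma coord0 i : coord i 0 = 0.
Proof. by rewrite /simple_coord mul0mx mxE. Qed.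
Lemma coordE x : x = \sum_i coord i x *: simple i.
Proof. by rewrite -mul_simple_mx mulmxKpV // simple_sub. Qed.

Lemma coord_comb (c : I -> rat) i : coord i (\sum_j c j *: simple j) = c i.
Proof.
apply/eqP; rewrite -subr_eq0; apply/eqP.
apply: (simple_free RS (c := fun i => coord i (\sum_j c j *: simple j) - c i)).
under eq_bigr => j _ do rewrite scalerBl.
by rewrite big_split /= sumrN -coordE subrr.
Qed.

Lemma coord_simple i j : coord i (simple j) = (i == j)%:R.
Proof.
have -> : simple j = \sum_l (l == j)%:R *: simple l.
  by rewrite (bigD1 j) //= eqxx scale1r big1 ?addr0 // => l /negbTE->; rewrite scale0r.
exact: coord_comb.
Qed.

Lemma coord_pos a i : pos a -> 0 <= coord i a.
Proof. by move=> [c ->]; rewrite coord_comb ler0n. Qed.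

Lemma coord_eq0 x : (forall i, coord i x = 0) -> x = 0.
Proof. by move=> h; rewrite [x]coordE big1 // => i _; rewrite h scale0r. Qed.

Lemma pos_coord a i : a \in roots -> 0 < coord i a -> pos a.
Proof.
move=> ha h; case: (simple_base RS ha) => // /(coord_pos i).
by rewrite coordN oppr_ge0 leNgt h.
Qed.

Lemma posN a : a \in roots -> pos a -> ~ pos (- a).
Proof.
move=> ha pa na; case/negP: (root_neq0 RS ha); apply/eqP/coord_eq0 => i.
apply/eqP; rewrite eq_le coord_pos // andbT -oppr_ge0 -coordN; exact: coord_pos.
Qed.

Lemma pos_simple i : pos (simple i).
Proof. by apply: (@pos_coord _ i) => //; rewrite coord_simple eqxx. Qed.

Definition height (x : E) : rat := \sum_i coord i x.

Lemma heightD x y : height (x + y) = height x + height y.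
Proof. by rewrite /height -big_split; apply: eq_bigr => i _; rewrite coordD. Qed.
Lemma heightN x : height (- x) = - height x.
Proof. by rewrite /height -sumrN; apply: eq_bigr => i _; rewrite coordN. Qed.
Lemma height0 : height 0 = 0.
Proof. by rewrite /height big1 // => i _; rewrite coord0. Qed.
Lemma height_sum (J : Type) (s : seq J) (P : pred J) (F : J -> E) :
  height (\sum_(j <- s | P j) F j) = \sum_(j <- s | P j) height (F j).
Proof. exact: (big_morph height heightD height0). Qed.

Lemma height_gt0 a : a \in roots -> pos a -> 0 < height a.
Proof.
move=> ha pa; rewrite lt_neqAle eq_sym sumr_ge0 ?andbT => [|i _]; last exact: coord_pos.
apply/eqP => h; case/negP: (root_neq0 RS ha); apply/eqP/coord_eq0 => i.
move/eqP: h; rewrite psumr_eq0 => [/allP/(_ i)|j _]; last exact: coord_pos.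
by rewrite mem_index_enum => /(_ isT)/eqP.
Qed.

Lemma root_scale a c : a \in roots -> c *: a \in roots -> c = 1 \/ c = -1.
Proof. exact: roots_reduced. Qed.

Lemma refl_simple_pos i a : a \in roots -> pos a -> a != simple i ->
  pos (refl (simple i) a).
Proof.
move=> ha pa ne; have [j ji cj] : exists2 j, j != i & coord j a != 0.
  apply/exists_inP; apply: contraT; rewrite negb_exists_in => /forall_inP h.
  have e : a = coord i a *: simple i.
    by rewrite {1}[a]coordE (bigD1 i) //= big1 ?addr0 // => j /h; rewrite negbK => /eqP->; rewrite scale0r.
  have hc : coord i a *: simple i \in roots by rewrite -e.
  case: (root_scale (simple_in i) hc) => e1.
    by case/eqP: ne; rewrite e e1 scale1r.
  by have := coord_pos i pa; rewrite e1.
apply: (@pos_coord _ j); first exact: (refl_root RS).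
rewrite reflE coordD coordN coordZ coord_simple (negbTE ji) mulr0 subr0.
by rewrite lt_neqAle eq_sym cj coord_pos.
Qed.

Local Notation rho := (half_sum Phi).
Let posb : pred E := fun a => `[< pos a >].

Lemma posbN a : a \in roots -> posb (- a) = ~~ posb a.
Proof.
move=> ha; apply/idP/idP => [/asboolP na|].
  by apply/negP => /asboolP pa; apply: (posN ha pa na).
by move/asboolP => h; apply/asboolP; case: (simple_base RS ha).
Qed.

Lemma sum_posE (V : zmodType) (F : E -> V) :
  \sum_(a <- roots) F a = \sum_(a <- roots | posb a) (F a + F (- a)).
Proof.
rewrite big_split /= (bigID posb) /=; congr (_ + _).
transitivity (\sum_(a <- roots) (if posb (- a) then F a else 0)).
  by rewrite big_mkcond; apply: eq_big_seq => a ha /=; rewrite posbN.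
rewrite -(sum_roots RS (h := -%R) (fun a => if posb (- a) then F a else 0) oppr_inj (rootN RS)).
by rewrite [RHS]big_mkcond; apply: eq_bigr => a _; rewrite opprK.
Qed.

(** The reflection in [simple i] permutes the positive roots other than [simple i], so it fixes
    their sum, which therefore pairs to 0 with that root. *)
Lemma rho_simple i : <|rho, simple i|> = 1.
Proof.
pose G a := if posb a && (a != simple i) then a else 0.
have eS : \sum_(a <- roots | posb a) a = simple i + \sum_(a <- roots) G a.
  have pi : posb (simple i) by apply/asboolP; apply: pos_simple.
  rewrite big_mkcond (bigD1_seq (simple i)) ?simple_in ?(roots_uniq RS) //= pi; congr (_ + _).
  by rewrite big_mkcond; apply: eq_bigr => a _; rewrite /G; case: (posb a); case: (a != _).
have H b : b \in roots -> posb b && (b != simple i) ->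
    posb (refl (simple i) b) && (refl (simple i) b != simple i).
  move=> hb /andP[/asboolP pb nb]; apply/andP; split.
    by apply/asboolP; apply: refl_simple_pos.
  apply/eqP => e; apply: (posN hb pb).
  by rewrite -(reflK RS (simple_in i) b) e refl_self // opprK; exact: pos_simple.
have eG : refl (simple i) (\sum_(a <- roots) G a) = \sum_(a <- roots) G a.
  rewrite (refl_sum Phi) -[RHS](sum_roots RS G (refl_inj RS (simple_in i))
     (fun b => refl_root RS (simple_in i) (b := b))).
  apply: eq_big_seq => a ha; rewrite /G.
  case: ifPn => h1; first by rewrite (H _ ha h1).
  case: ifPn => [h2|_]; last by rewrite (refl0 Phi).
  by case/negP: h1; have := H _ (refl_root RS (simple_in i) ha) h2; rewrite reflK.
have := eG; rewrite reflE => /eqP; rewrite subr_eq addrC -subr_eq subrr => /eqP/esym/eqP.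
rewrite scaler_eq0 (negbTE (root_neq0 RS (simple_in i))) orbF => /eqP e0.
by rewrite /half_sum pairingZ eS pairingD e0 addr0 (roots_pair2 RS (simple_in i)) mulVf.
Qed.

End PositiveRoots.

(** * The Coxeter element and the number of roots *)

Section CoxeterElement.
Variables (r : nat) (I : finType) (Phi : root_datum r I).
Hypothesis RS : root_system Phi.
Local Notation E := 'rV[rat]_r.
Local Notation "<| b , a |>" := (pairing Phi b a).
Local Notation roots := (roots Phi).
Local Notation simple := (simple Phi).
Local Notation refl := (refl Phi).
Local Notation pos := (nonneg_root Phi).
Local Notation ip := (inner_product Phi).
Local Notation coord := (simple_coord Phi).

Let simple_in i : simple i \in roots. Proof. exact: simple_roots. Qed.

Definition refls (l : seq E) (b : E) : E := foldr refl b l.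

Lemma reflsD l b b' : refls l (b + b') = refls l b + refls l b'.
Proof. by elim: l => //= a l ->; rewrite reflD. Qed.
Lemma reflsZ l c b : refls l (c *: b) = c *: refls l b.
Proof. by elim: l => //= a l ->; rewrite reflZ. Qed.
Lemma reflsN l b : refls l (- b) = - refls l b.
Proof. by rewrite -scaleN1r reflsZ scaleN1r. Qed.
Lemma refls_cat l l' b : refls (l ++ l') b = refls l (refls l' b).
Proof. exact: foldr_cat. Qed.

Lemma refls_rev l b : all (mem roots) l -> refls (rev l) (refls l b) = b.
Proof.
elim: l b => //= a l IH b /andP[ha hl].
by rewrite rev_cons -cats1 refls_cat /= reflK // IH.
Qed.

Lemma refls_inj l : all (mem roots) l -> injective (refls l).
Proof. by move=> hl; apply: (can_inj (g := refls (rev l))) => b; apply: refls_rev. Qed.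

Lemma refls_root l b : all (mem roots) l -> b \in roots -> refls l b \in roots.
Proof. by elim: l => //= a l IH /andP[ha hl] hb; apply: refl_root => //; apply: IH. Qed.

Lemma pairing_refls l x a : all (mem roots) l -> a \in roots ->
  <|refls l x, refls l a|> = <|x, a|>.
Proof.
elim: l => //= b l IH /andP[hb hl] ha.
by rewrite pairing_refl ?IH // refls_root.
Qed.

Lemma ip_refls l x y : all (mem roots) l -> ip (refls l x) (refls l y) = ip x y.
Proof. by elim: l => //= b l IH /andP[hb hl]; rewrite ip_refl // IH. Qed.

Lemma refl_conj l a x : all (mem roots) l -> a \in roots ->
  refl (refls l a) x = refls l (refl a (refls (rev l) x)).
Proof.
move=> hl ha; have hl' : all (mem roots) (rev l) by rewrite all_rev.
rewrite [in RHS]reflE reflsD reflsN reflsZ.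
have e : refls l (refls (rev l) x) = x by rewrite -{1}[l]revK refls_rev.
by rewrite e reflE -{2}e pairing_refls.
Qed.

Lemma simples_roots (l : seq I) : all (mem roots) [seq simple i | i <- l].
Proof. by apply/allP => _ /mapP[i _ ->]; apply: simple_in. Qed.

Local Notation srefls l := (refls [seq simple i | i <- l]).

Lemma coord_srefls j l b : j \notin l -> coord j (srefls l b) = coord j b.
Proof.
elim: l => //= i l IH; rewrite in_cons negb_or => /andP[ji jl].
by rewrite reflE coordD coordN coordZ coord_simple // (negbTE ji) mulr0 subr0 IH.
Qed.

(** The letters being distinct, only the outermost reflection changes the coordinate along its own
    root. A fixed vector thus pairs to 0 with that root, and the reflection can be peeled off. *)
Lemma srefls_fix l b : uniq l -> srefls l b = b -> forall i, i \in l -> <|b, simple i|> = 0.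
Proof.
elim: l => //= i l IH /andP[il ul]; set u := srefls l b => e.
have z : <|u, simple i|> = 0.
  have := congr1 (coord i) e; rewrite reflE coordD coordN coordZ coord_simple // eqxx mulr1.
  by rewrite /u coord_srefls // => h; lra.
have eu : u = b by rewrite -[RHS]e reflE z scale0r subr0.
by move=> j; rewrite in_cons => /orP[/eqP->|]; [rewrite -eu | apply: IH].
Qed.

Lemma pairing_simple_eq0 b : (forall i, <|b, simple i|> = 0) -> b = 0.
Proof.
move=> h; apply: (ip_eq0 RS); rewrite {2}(coordE RS b) ip_sumr big1 // => i _.
rewrite ipZr; have := pairing_ip RS b (simple_in i); rewrite h mul0r => /eqP.
by rewrite mulf_eq0 pnatr_eq0 /= => /eqP ->; rewrite mulr0.
Qed.

Definition cox (b : E) : E := srefls (enum I) b.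

Lemma coxE b : cox b = foldr (fun i => refl (simple i)) b (enum I).
Proof. by rewrite /cox; elim: (enum I) => //= i l ->. Qed.

Lemma cox_fix b : cox b = b -> b = 0.
Proof.
move=> /(srefls_fix (enum_uniq I)) h; apply: pairing_simple_eq0 => i; apply: h.
by rewrite mem_enum.
Qed.

Lemma iter_coxD n b b' : iter n cox (b + b') = iter n cox b + iter n cox b'.
Proof. by elim: n => //= n ->; rewrite /cox reflsD. Qed.
Lemma iter_coxZ n c b : iter n cox (c *: b) = c *: iter n cox b.
Proof. by elim: n => //= n ->; rewrite /cox reflsZ. Qed.
Lemma cox_inj : injective cox.
Proof. by apply: refls_inj; apply: simples_roots. Qed.
Lemma cox_root b : b \in roots -> cox b \in roots.
Proof. by apply: refls_root; apply: simples_roots. Qed.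
Lemma iter_cox_root n b : b \in roots -> iter n cox b \in roots.
Proof. by move=> hb; elim: n => //= n IH; apply: cox_root. Qed.

(** The Coxeter element permutes the finite spanning set of roots. This excludes the default value 0
    of [least] in [coxeter_number]. *)
Lemma cox_order : exists n, (0 < n)%N /\ forall b, iter n cox b = b.
Proof.
pose T := seq_sub roots.
pose c (a : T) : T := SeqSub (cox_root (valP a)).
have ci : injective c by move=> a b /(congr1 val)/cox_inj/val_inj.
pose s := perm ci; exists #[s]%g; split; first exact: order_gt0.
have iv (a : T) n : val (iter n s a) = iter n cox (val a).
  by elim: n => //= n <-; rewrite permE.
apply: (roots_span_ind RS) => [a ha|x u v hu hv|].
- by have := iv (SeqSub ha) #[s]%g; rewrite -permX expg_order perm1 /= => <-.
- by rewrite iter_coxD iter_coxZ hu hv.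
- by rewrite -(scale0r 0) iter_coxZ !scale0r.
Qed.

Local Notation h := (coxeter_number Phi).

Lemma coxeter_numberP : (0 < h)%N /\ forall b, iter h cox b = b.
Proof.
have ei n b : iter n (fun c => foldr (fun i => refl (simple i)) c (enum I)) b = iter n cox b.
  by elim: n => //= n ->; rewrite coxE.
have [|h0 hb] := @leastP (fun n => (0 < n)%N /\ forall b, iter n
    (fun c => foldr (fun i => refl (simple i)) c (enum I)) b = b).
  by have [n [n0 hn]] := cox_order; exists n; split=> // b; rewrite ei.
by split=> // b; rewrite -[RHS]hb ei.
Qed.

(** The sum over a period is fixed by the Coxeter element, which has no nonzero fixed vector. *)
Lemma sum_cox b : \sum_(0 <= m < h) iter m cox b = 0.
Proof.
have [h0 hb] := coxeter_numberP; apply: cox_fix.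
have -> : cox (\sum_(0 <= m < h) iter m cox b) = \sum_(0 <= m < h) iter m.+1 cox b.
  by apply: (big_morph cox) => [x y|]; rewrite /cox ?reflsD // -(scale0r 0) reflsZ !scale0r.
rewrite -(big_add1 _ _ 0%N h.+1 xpredT (fun m => iter m cox b)).
by rewrite big_nat_recr //= hb [RHS]big_ltn // addrC.
Qed.

Lemma srefls_inversion l a : a \in roots -> pos a -> ~ pos (srefls l a) ->
  exists i l1 l2, l = l1 ++ i :: l2 /\ srefls l2 a = simple i.
Proof.
move=> ha pa; elim: l => //= i l IH np.
have hu : srefls l a \in roots by apply: refls_root => //; apply: simples_roots.
have [pu|/IH [j [l1 [l2 [-> e]]]]] := pselect (pos (srefls l a)); last first.
  by exists j, (i :: l1), l2.
exists i, [::], l; split=> //; apply/eqP; apply: contra_notT np => ne.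
exact: refl_simple_pos.
Qed.

Definition cox_inversion (i : I) : E := srefls (rev (drop (index i (enum I)).+1 (enum I))) (simple i).

Lemma cox_inversionP a : a \in roots -> pos a -> ~ pos (cox a) -> exists i, a = cox_inversion i.
Proof.
move=> ha pa /(srefls_inversion ha pa) [i [l1 [l2 [e e2]]]]; exists i.
rewrite /cox_inversion; have u := enum_uniq I; rewrite e cat_uniq /= in u; case/and3P: u => _ u1 u2.
have -> : drop (index i (enum I)).+1 (enum I) = l2.
  rewrite e index_cat; case: ifP => [il|_]; first by rewrite il in u1.
  by rewrite /= eqxx addn0 -cat_rcons drop_size_cat ?size_rcons.
by rewrite map_rev -e2 refls_rev // simples_roots.
Qed.

(** Heights sum to 0 over a period, so every orbit contains roots of both signs, hence a positive
    root made negative at the next step. There is at most one such root for each simple reflection,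
    and an orbit has at most h elements. *)
Lemma card_roots : (size roots <= #|I| * h)%N.
Proof.
have [h0 hb] := coxeter_numberP.
have per k b : iter (k * h) cox b = b.
  by elim: k => //= k IH; rewrite mulSn iterD IH hb.
pose s := [seq iter m cox (cox_inversion i) | i <- enum I, m <- iota 0 h].
have -> : (#|I| * h)%N = size s by rewrite size_allpairs size_iota -cardE.
apply: (uniq_leq_size (roots_uniq RS)) => a ha.
suff [m [pm npm]] : exists m, pos (iter m cox a) /\ ~ pos (iter m.+1 cox a).
  have [i e] := cox_inversionP (iter_cox_root m ha) pm npm.
  (* This is the power - m of the Coxeter element, written with a natural exponent. *)
  have {}e : a = iter (m * h - m) cox (cox_inversion i).
    by rewrite -e -iterD subnK ?per // leq_pmulr.
  apply/allpairsP; exists (i, (m * h - m) %% h)%N; rewrite /= mem_enum mem_iota ltn_mod h0; split=> //.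
  by rewrite {1}e {1}(divn_eq (m * h - m) h) addnC iterD per.
apply: contrapT => nex.
have stay m n : pos (iter m cox a) -> pos (iter (n + m) cox a).
  move=> pm; elim: n => //= n IH; apply: contrapT => np; apply: nex.
  by exists (n + m)%N.
have [m pm] : exists m, pos (iter m cox a).
  apply: contrapT => hn; have := congr1 (height Phi) (sum_cox a).
  rewrite (height_sum) (height0 Phi) => e.
  have : \sum_(0 <= m < h) height Phi (iter m cox a) < 0.
    rewrite -oppr_gt0 -sumrN big_ltn // ltr_pwDl //.
      rewrite -heightN; apply: (height_gt0 RS); first by rewrite rootN.
      by case: (simple_base RS ha) => // p0; case: hn; exists 0%N.
    apply: sumr_ge0 => j _; rewrite -heightN ltW // (height_gt0 RS) ?rootN ?iter_cox_root //.
    by case: (simple_base RS (iter_cox_root j ha)) => // p0; case: hn; exists j.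
  by rewrite e ltxx.
have := congr1 (height Phi) (sum_cox (iter m cox a)); rewrite height_sum height0 => e.
have : 0 < \sum_(0 <= j < h) height Phi (iter j cox (iter m cox a)).
  rewrite big_ltn // ltr_pwDl ?(height_gt0 RS) ?iter_cox_root //.
  apply: sumr_ge0 => j _; rewrite ltW // (height_gt0 RS) ?iter_cox_root // -iterD; exact: stay.
by rewrite e ltxx.
Qed.

End CoxeterElement.

(** * Bounds on pairings by the Coxeter number *)

Section Bounds.
Variables (r : nat) (I : finType) (Phi : root_datum r I).
Hypothesis RS : root_system Phi.
Hypothesis irr : irreducible_roots Phi.
Local Notation E := 'rV[rat]_r.
Local Notation "<| b , a |>" := (pairing Phi b a).
Local Notation roots := (roots Phi).
Local Notation simple := (simple Phi).
Local Notation refl := (refl Phi).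
Local Notation pos := (nonneg_root Phi).
Local Notation ip := (inner_product Phi).
Local Notation h := (coxeter_number Phi).
Local Notation rho := (half_sum Phi).

Let simple_in i : simple i \in roots. Proof. exact: simple_roots. Qed.

Lemma exists_root : exists a, a \in roots.
Proof. by case: irr; case: (Defs.roots Phi) => // a0 s0 _ _; exists a0; apply: mem_head. Qed.

Definition root_endo (x : E) : E := \sum_(a <- roots) <|x, a|> *: a.

Lemma root_endoZ c x : root_endo (c *: x) = c *: root_endo x.
Proof. by rewrite scaler_sumr; apply: eq_bigr => a _; rewrite pairingZ scalerA. Qed.

Lemma root_endoD x y : root_endo (x + y) = root_endo x + root_endo y.
Proof. by rewrite -big_split; apply: eq_bigr => a _; rewrite pairingD scalerDl. Qed.

Lemma root_endo_refl b x : b \in roots -> root_endo (refl b x) = refl b (root_endo x).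
Proof.
move=> hb; rewrite refl_sum.
apply: etrans (esym (sum_roots RS (fun a => <|refl b x, a|> *: a) (refl_inj RS hb)
  (fun a => refl_root RS hb (b := a)))) _.
by apply: eq_big_seq => a ha; rewrite pairing_refl // reflZ.
Qed.

Lemma root_endo_root b : b \in roots -> root_endo b = (<|root_endo b, b|> / 2%:R) *: b.
Proof.
move=> hb; have := root_endo_refl b hb; rewrite refl_self // reflE.
have -> : root_endo (- b) = - root_endo b by rewrite -!scaleN1r root_endoZ.
move=> /eqP; rewrite eq_sym subr_eq addrC -subr_eq opprK -mulr2n -scaler_nat => /eqP e.
by rewrite mulrC -scalerA -e scalerA mulVf // scale1r.
Qed.

Lemma root_endo_sym x y : ip (root_endo x) y = ip x (root_endo y).
Proof.
rewrite ip_suml ip_sumr; apply: eq_big_seq => a ha.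
by rewrite ipZl ipZr !pairingE // [ip a y]ipC; ring.
Qed.

(** Commuting with the reflection in a makes each root a an eigenvector. Self-adjointness equates
    the eigenvalues of two non-orthogonal roots, and irreducibility connects all roots. *)
Lemma root_endo_scalar : exists lam, forall x, root_endo x = lam *: x.
Proof.
have [_ hQ] := irr; have [a0 ha0] := exists_root.
pose lam a := <|root_endo a, a|> / 2%:R.
have lamE b : b \in roots -> lam b = lam a0.
  move=> hb; apply: contrapT => /eqP ne.
  have [||a [c [ha hc /eqP qa qc p]]] := hQ (fun a => lam a == lam a0); first by exists a0.
    by exists b.
  case/negP: qc; rewrite -qa eq_sym; apply/eqP.
  have := root_endo_sym a c; rewrite (root_endo_root ha) (root_endo_root hc) ipZl ipZr.
  move/eqP; rewrite -subr_eq0 -mulrBl mulf_eq0 subr_eq0 => /orP[/eqP //|/eqP e].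
  by case: p; rewrite pairingE // e mulr0 mul0r.
exists (lam a0); apply: (roots_span_ind RS) => [a ha|c x y hx hy|].
- by rewrite (root_endo_root ha) -/(lam a) lamE.
- by rewrite root_endoD root_endoZ hx hy scalerDr !scalerA mulrC.
- by rewrite -(scale0r 0) root_endoZ !scale0r scaler0.
Qed.

Lemma dim_gt0 : (0 < r)%N.
Proof.
have [a0 /(root_neq0 RS)] := exists_root.
case: (posnP r) => // r0; apply: contra_neqT => _; apply/rowP => -[i hi].
by exfalso; rewrite r0 in hi.
Qed.

(** The left side is 2 lam for the scalar lam of [root_endo]. Its trace gives lam r = 2 |roots|, and
    |roots| <= r h by [card_roots]. *)
Lemma sum_pairing2 th : th \in roots -> \sum_(a <- roots) <|th, a|> * <|a, th|> <= 4%:R * h%:R.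
Proof.
move=> ht; have [lam hl] := root_endo_scalar.
have -> : \sum_(a <- roots) <|th, a|> * <|a, th|> = <|root_endo th, th|>.
  by rewrite pairing_sum; apply: eq_bigr => a _; rewrite pairingZ.
rewrite hl pairingZ (roots_pair2 RS ht).
have tr : lam * r%:R = 2%:R * (size roots)%:R.
  pose M := \sum_(a <- roots) coroot Phi a *m a.
  have : M = lam%:M.
    apply/row_matrixP => i; rewrite !rowE -[RHS]/(delta_mx 0 i *m lam%:M) mul_mx_scalar -hl mulmx_sumr.
    apply: eq_bigr => a _; rewrite mulmxA [_ *m coroot Phi a]mx11_scalar mul_scalar_mx //.
  move/(congr1 mxtrace); rewrite mxtrace_scalar mulr_natr => <-.
  rewrite raddf_sum /= (eq_big_seq (fun=> 2%:R)) => [|a ha].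
    by rewrite big_const_seq count_predT iter_addr_0 mulr_natr.
  by rewrite mxtrace_mulC trace_mx11 -/(pairing _ _ _) (roots_pair2 RS).
have := card_roots RS; rewrite (card_simple RS) -(ler_nat rat) natrM => hc.
have r0 : 0 < r%:R :> rat by rewrite ltr0n dim_gt0.
have : lam * r%:R <= (2%:R * h%:R) * r%:R by rewrite tr; nra.
by rewrite ler_pM2r // => hlam; lra.
Qed.

Lemma pairing_abs a b : a \in roots -> b \in roots -> `|<|a, b|>| <= <|b, a|> * <|a, b|>.
Proof.
move=> ha hb; have := pairing_sg RS ha hb; have := pairing_eq0C RS ha hb.
have /intrP[m ->] := roots_int RS ha hb; have /intrP[n ->] := roots_int RS hb ha.
rewrite -!intrM -intr_norm ler0z ler_int !intr_eq0.
case: (eqVneq m 0) => [->|m0]; first by case: (eqVneq n 0) => // ->.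
move=> _ hp; rewrite mulrC -[leRHS]ger0_norm // normrM.
by rewrite ler_peMr // -gtz0_ge1 normr_gt0.
Qed.

Lemma le_sum_roots (F : E -> rat) (s : seq E) : (forall a, a \in roots -> 0 <= F a) ->
  uniq s -> {subset s <= roots} -> \sum_(a <- s) F a <= \sum_(a <- roots) F a.
Proof.
move=> F0 us ss; rewrite [leRHS](bigID (mem s)) /= -[leLHS]addr0 lerD //; last first.
  by rewrite big_seq_cond; apply: sumr_ge0 => a /andP[ha _]; apply: F0.
rewrite le_eqVlt; apply/orP; left; apply/eqP; rewrite -[RHS]big_filter; apply: perm_big.
apply: uniq_perm => //; first by rewrite filter_uniq // (roots_uniq RS).
by move=> a; rewrite mem_filter /=; case: (boolP (a \in s)) => // /ss ->.
Qed.

Lemma root_neqN a : a \in roots -> a != - a.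
Proof.
move=> ha; apply: contraTneq (root_neq0 RS ha) => e.
by rewrite -(can_eq (scalerK (_ : 2%:R != 0 :> rat))) // scaler0 scaler_nat mulr2n {2}e subrr negbK.
Qed.

(** The sum of |<a, th>| over all roots is at least 4 <rho, th>. It is termwise below the sum of
    [sum_pairing2], with a gap of 2 at each of th and - th, so 4 <rho, th> <= 4 h - 4. *)
Lemma height_bound th : th \in roots -> <|rho, th|> <= h%:R - 1.
Proof.
move=> ht; have := sum_pairing2 ht; set f := fun a => <|th, a|> * <|a, th|>.
pose d a := f a - `|<|a, th|>|.
have d0 a : a \in roots -> 0 <= d a by move=> ha; rewrite subr_ge0 pairing_abs.
have p2 : <|th, th|> = 2%:R by rewrite (roots_pair2 RS).
have := le_sum_roots (s := [:: th; - th]) d0.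
rewrite /= inE root_neqN // => /(_ isT) H.
have {}H : 4%:R <= \sum_(a <- roots) d a.
  apply: le_trans (H _) => [|a]; last by rewrite !inE => /orP[] /eqP->; rewrite ?rootN.
  rewrite !big_cons big_nil /d /f pairingNr // pairingN p2 normrN.
  have -> : `|2%:R : rat| = 2%:R by apply: ger0_norm; rewrite ler0n.
  lra.
rewrite sumrB in H => hf.
have e : \sum_(a <- roots) `|<|a, th|>| = 2%:R * \sum_(a <- roots | `[< pos a >]) `|<|a, th|>|.
  rewrite (sum_posE RS) mulr_sumr; apply: eq_bigr => a _.
  by rewrite pairingN normrN mulr_natl mulr2n.
rewrite /half_sum pairingZ pairing_sum.
have le : \sum_(a <- roots | `[< pos a >]) <|a, th|> <= \sum_(a <- roots | `[< pos a >]) `|<|a, th|>|.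
  by apply: ler_sum => a _; apply: ler_norm.
rewrite mulrC ler_pdivrMr //; lra.
Qed.

Lemma coxeter_ge2 : 2%:R <= h%:R :> rat.
Proof.
have [a0 ht] := exists_root.
have := sum_pairing2 ht.
have F0 a : a \in roots -> 0 <= <|a0, a|> * <|a, a0|> by move=> ha; apply: pairing_sg.
have := le_sum_roots (s := [:: a0; - a0]) F0; rewrite /= inE root_neqN // => /(_ isT) H.
have {}H := H (fun a => _).
rewrite !big_cons big_nil pairingNr // pairingN (roots_pair2 RS ht) in H.
suff : {subset [:: a0; - a0] <= roots} by move=> /H; lra.
by move=> a; rewrite !inE => /orP[] /eqP->; rewrite ?rootN.
Qed.

(** The six distinct roots a, b, refl a b and their opposites contribute at least 8 + 4 |<b, a>| to
    a sum of nonnegative terms bounded by 4 h. *)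
Lemma pairing_bound a b : a \in roots -> b \in roots -> b != a -> b != - a -> <|b, a|> != 0 ->
  `|<|b, a|>| <= h%:R - 2%:R.
Proof.
move=> ha hb ba bNa ab0; have := sum_pairing2 ha.
set f := fun c => <|a, c|> * <|c, a|>; pose c := refl a b.
have hc : c \in roots by apply: refl_root.
have F0 x : x \in roots -> 0 <= f x by move=> hx; apply: pairing_sg.
have ca : c != a.
  by apply: contra_neq bNa => /(congr1 (refl a)); rewrite /c reflK // refl_self.
have cNa : c != - a.
  by apply: contra_neq ba => /(congr1 (refl a)); rewrite /c reflK // reflN refl_self // opprK.
have cb : c != b.
  rewrite /c reflE -subr_eq0 addrAC subrr sub0r oppr_eq0 scaler_eq0 negb_or ab0 /=.
  exact: root_neq0 ha.
have cNb : c != - b.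
  apply/eqP; rewrite /c reflE => e; have e2 : b = (<|b, a|> / 2%:R) *: a.
    have {}e : 2%:R *: b = <|b, a|> *: a.
      by rewrite scaler_nat mulr2n -{2}(opprK b) -e opprB addrC subrK.
    by rewrite mulrC -scalerA -e scalerA mulVf // scale1r.
  have h1 : (<|b, a|> / 2%:R) *: a \in roots by rewrite -e2.
  case: (roots_reduced RS ha h1) => e1; first by case/eqP: ba; rewrite e2 e1 scale1r.
  by case/eqP: bNa; rewrite e2 e1 scaleN1r.
have fb x : x \in roots -> `|<|x, a|>| = `|<|b, a|>| -> `|<|b, a|>| <= f x.
  by move=> hx <-; apply: pairing_abs.
have ec : `|<|c, a|>| = `|<|b, a|>|.
  by have := pairing_refl RS b ha ha; rewrite refl_self // pairingNr // => <-; rewrite normrN.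
have p2 := roots_pair2 RS ha.
have := le_sum_roots (s := [:: a; - a; b; - b; c; - c]) F0.
rewrite /= !inE !negb_or !eqr_opp ?(eqr_oppLR _ b) ?(eqr_oppLR _ c) !root_neqN //.
rewrite (eq_sym a b) (eq_sym a c) (eq_sym a (- b)) (eq_sym a (- c)) !(eqr_oppLR _ a) ba bNa ca cNa.
rewrite (eq_sym b c) (eq_sym b (- c)) (eqr_oppLR _ b) cb cNb => /(_ isT) H hf.
have {}H : \sum_(x <- [:: a; - a; b; - b; c; - c]) f x <= \sum_(x <- roots) f x.
  by apply: H => x; rewrite !inE => /or4P[|||/or3P[]] /eqP->; rewrite ?rootN.
rewrite !big_cons big_nil in H.
have e1 : f a = 4%:R by rewrite /f p2 -natrM.
have e2 : f (- a) = 4%:R by rewrite /f pairingNr // pairingN p2 mulrNN -natrM.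
have g1 := fb b hb erefl; have g2 := fb c hc ec.
have g3 : `|<|b, a|>| <= f (- b) by apply: fb; rewrite ?rootN // pairingN normrN.
have g4 : `|<|b, a|>| <= f (- c) by apply: fb; rewrite ?rootN // pairingN normrN.
lra.
Qed.

End Bounds.

(** * Dominance and the root lattice *)

Section Lattice.
Variables (r : nat) (I : finType) (Phi : root_datum r I).
Hypothesis RS : root_system Phi.
Local Notation E := 'rV[rat]_r.
Local Notation "<| b , a |>" := (pairing Phi b a).
Local Notation roots := (roots Phi).
Local Notation simple := (simple Phi).
Local Notation refl := (refl Phi).
Local Notation refls := (refls Phi).
Local Notation pos := (nonneg_root Phi).
Local Notation ip := (inner_product Phi).
Local Notation coord := (simple_coord Phi).
Local Notation h := (coxeter_number Phi).
Local Notation rho := (half_sum Phi).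
Local Notation lattice := (in_root_lattice Phi).
Local Notation srefls l := (refls [seq simple i | i <- l]).

Let simple_in i : simple i \in roots. Proof. exact: simple_roots. Qed.

(** This expands the coroot of th in simple coroots; for positive th the coefficients are
    nonnegative, so bounds on simple coroots pass to all positive ones. *)
Lemma pairing_coord x th : th \in roots ->
  <|x, th|> = \sum_i coord i th * (ip (simple i) (simple i) / ip th th) * <|x, simple i|>.
Proof.
move=> ht; rewrite (pairingE RS) // {1}(coordE RS th) ip_sumr mulr_sumr mulr_suml.
apply: eq_bigr => i _; rewrite ipZr.
transitivity (coord i th * (2%:R * ip x (simple i)) / ip th th); first by ring.
by rewrite pairing_ip //; ring.
Qed.

Let coef_ge0 i th : th \in roots -> pos th -> 0 <= coord i th * (ip (simple i) (simple i) / ip th th).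
Proof. by move=> ht pt; rewrite mulr_ge0 ?(coord_pos RS) // divr_ge0 ?ip_ge0. Qed.

Lemma pairing_le x th c : th \in roots -> pos th ->
  (forall i, <|x, simple i|> <= c) -> <|x, th|> <= c * <|rho, th|>.
Proof.
move=> ht pt hx; rewrite !(pairing_coord _ ht) mulr_sumr; apply: ler_sum => i _.
by rewrite rho_simple // mulr1 mulrC ler_wpM2r // coef_ge0.
Qed.

Lemma pairing_ge0 x th : th \in roots -> pos th ->
  (forall i, 0 <= <|x, simple i|>) -> 0 <= <|x, th|>.
Proof.
move=> ht pt hx; rewrite (pairing_coord _ ht); apply: sumr_ge0 => i _.
by rewrite mulr_ge0 // coef_ge0.
Qed.

Lemma pairing_gt0 x th i : th \in roots -> pos th -> coord i th != 0 ->
  (forall j, 0 <= <|x, simple j|>) -> 0 < <|x, simple i|> -> 0 < <|x, th|>.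
Proof.
move=> ht pt ci hx hi; rewrite (pairing_coord _ ht) (bigD1 i) //= ltr_pwDl //; last first.
  by apply: sumr_ge0 => j _; rewrite mulr_ge0 // coef_ge0.
rewrite mulr_gt0 // mulr_gt0 ?divr_gt0 ?(ip_gt0 RS) ?(root_neq0 RS) //.
by rewrite lt_neqAle eq_sym ci (coord_pos RS).
Qed.

Lemma rho_gt0 th : th \in roots -> pos th -> 0 < <|rho, th|>.
Proof.
move=> ht pt; have [i ci] : exists i, coord i th != 0.
  apply/existsP; apply: contraT; rewrite negb_exists => /forallP hc.
  case/negP: (root_neq0 RS ht); apply/eqP/(coord_eq0 RS) => i; apply/eqP; have := hc i.
  by rewrite negbK.
by apply: (pairing_gt0 ht pt ci) => [j|]; rewrite rho_simple.
Qed.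

(** A positive root pairs positively with some simple root; unless it is that simple root, the
    reflection keeps it positive and lowers its height. *)
Lemma root_conj_simple a : a \in roots -> exists l i, srefls l (simple i) = a.
Proof.
suff H n b : b \in roots -> pos b -> height Phi b < n%:R -> exists l i, srefls l (simple i) = b.
  have Hp b : b \in roots -> pos b -> exists l i, srefls l (simple i) = b.
    move=> hb pb; apply: (H (Num.bound (height Phi b))) => //.
    by apply: archi_boundP; rewrite ltW // (height_gt0 RS).
  move=> ha; case: (simple_base RS ha) => [/(Hp _ ha) //|].
  move/(Hp _ (rootN RS ha)) => [l [i e]]; exists (rcons l i), i.
  by rewrite map_rcons -cats1 refls_cat /= refl_self // reflsN e opprK.
elim: n b => [|n IH] b hb pb hn.
  by have := height_gt0 RS hb pb; move=> /lt_trans/(_ hn); rewrite ltxx.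
have [i pi] : exists i, 0 < <|b, simple i|>.
  apply/existsP; apply: contraT; rewrite negb_exists => /forallP hc.
  have := pairing_ge0 (x := - b) hb pb; rewrite pairingN (roots_pair2 RS hb) => h0.
  have : 0 <= - 2%:R :> rat by apply: h0 => i; rewrite pairingN oppr_ge0 leNgt.
  by [].
have [e|ne] := eqVneq b (simple i); first by exists [::], i.
have pp := refl_simple_pos RS hb pb ne.
have hr : refl (simple i) b \in roots by apply: refl_root.
have hh : height Phi (refl (simple i) b) < n%:R.
  have -> : height Phi (refl (simple i) b) = height Phi b - <|b, simple i|>.
    rewrite reflE heightD heightN; congr (_ - _); rewrite /height (bigD1 i) //= coordZ coord_simple // eqxx mulr1.
    by rewrite big1 ?addr0 // => j ji; rewrite coordZ coord_simple // (negbTE ji) mulr0.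
  have : 1 <= <|b, simple i|>.
    by have /intrP[m em] := roots_int RS (simple_in i) hb; move: pi; rewrite em ltr0z ler1z gtz0_ge1.
  by move: hn; rewrite -natr1; lra.
have [l [j e]] := IH _ hr pp hh; exists (i :: l), j.
by rewrite /= e reflK.
Qed.

Lemma lattice_root a : a \in roots -> lattice a.
Proof.
move=> ha; exists (fun b => (b == a)%:R); rewrite (bigD1_seq a) ?(roots_uniq RS) //= eqxx scale1r.
by rewrite big1 ?addr0 // => b /negbTE ->; rewrite scale0r.
Qed.

Lemma lattice0 : lattice 0.
Proof. by exists (fun=> 0); rewrite big1 // => a _; rewrite scale0r. Qed.

Lemma latticeD x y : lattice x -> lattice y -> lattice (x + y).
Proof.
move=> [z ->] [z' ->]; exists (fun a => z a + z' a); rewrite -big_split.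
by apply: eq_bigr => a _; rewrite intrD scalerDl.
Qed.

Lemma latticeZ (n : int) x : lattice x -> lattice (n%:~R *: x).
Proof.
move=> [z ->]; exists (fun a => n * z a); rewrite scaler_sumr.
by apply: eq_bigr => a _; rewrite intrM scalerA.
Qed.

Lemma latticeN x : lattice x -> lattice (- x).
Proof. by move=> hx; rewrite -scaleN1r -[- 1]/((-1)%:~R); apply: latticeZ. Qed.

Lemma lattice_sum (J : Type) (s : seq J) (F : J -> E) :
  (forall j, lattice (F j)) -> lattice (\sum_(j <- s) F j).
Proof. by move=> hF; apply: big_ind => //; [apply: lattice0 | apply: latticeD]. Qed.

Lemma lattice_pairing x a : lattice x -> a \in roots -> <|x, a|> \is a Num.int.
Proof.
move=> [z ->] ha; rewrite pairing_sum big_seq; apply: rpred_sum => b hb.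
by rewrite pairingZ rpredM ?intr_int // (roots_int RS).
Qed.

Lemma lattice_seq x : lattice x -> exists2 s, all (mem roots) s & x = \sum_(a <- s) a.
Proof.
pose P x := exists2 s, all (mem roots) s & x = \sum_(a <- s) a.
have PD u v : P u -> P v -> P (u + v).
  by move=> [s hs ->] [t ht ->]; exists (s ++ t); rewrite ?all_cat ?hs // big_cat.
have P0 : P 0 by exists [::]; rewrite // big_nil.
have PM n u : P u -> P (u *+ n) by move=> hu; elim: n => // n IH; rewrite mulrS; apply: PD.
move=> [z ->]; rewrite big_seq; apply: (big_ind P) => // a ha.
have Pa b : b \in roots -> P b by move=> hb; exists [:: b]; rewrite ?big_seq1 //= hb.
rewrite scaler_int; case: (z a) => n; first by apply: PM; apply: Pa.
by rewrite NegzE mulrNz -mulNrz; apply: PM; apply: Pa; rewrite rootN.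
Qed.

(** Induction on the number of roots in an expression of x. If x is nonzero, some summand b has <x,
    b> > 0, hence equal to 1, and the reflection in b removes b from the sum while keeping the
    bound. *)
Lemma pairing_le1_eq0 x : lattice x -> (forall a, a \in roots -> `|<|x, a|>| <= 1) -> x = 0.
Proof.
move=> /lattice_seq [s]; move: {2}(size s) (erefl (size s)) => n.
elim: n s x => [|n IH] s x sn hs ex hx; first by rewrite ex (size0nil sn) big_nil.
have [//|x0] := eqVneq x 0.
have [b bs pb] : exists2 b, b \in s & 0 < <|x, b|>.
  apply: contrapT => hn; have : ip x x <= 0.
    rewrite {2}ex ip_sumr big_seq; apply: sumr_le0 => b bs.
    have hb : b \in roots by apply: (allP hs).
    have : <|x, b|> <= 0 by rewrite leNgt; apply/negP => h1; apply: hn; exists b.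
    have := pairing_ip RS x hb; have := ip_gt0 RS (root_neq0 RS hb); nra.
  by rewrite leNgt (ip_gt0 RS).
have hb : b \in roots by apply: (allP hs).
have e1 : <|x, b|> = 1.
  have lx : lattice x by rewrite ex big_seq; apply: big_ind => [||a ha]; [apply: lattice0|apply: latticeD|apply/lattice_root/(allP hs)].
  have := hx b hb; have /intrP[m e] := lattice_pairing lx hb; move: pb; rewrite e -intr_norm.
  by rewrite ltr0z lerz1 => m0 m1; suff -> : m = 1 by []; lia.
have : refl b x = 0.
  apply: (IH (rem b s)) => //; first by rewrite size_rem // sn.
  - by apply/allP => a /mem_rem /(allP hs).
  - by rewrite reflE e1 scale1r ex (big_rem b) //= addrC addrK.
  - by move=> a ha; rewrite -(reflK RS hb a) pairing_refl ?refl_root // hx // refl_root.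
by move/(congr1 (refl b)); rewrite reflK // refl0.
Qed.

(** For a weight x each difference cox^m x - x lies in the root lattice, while the cox^m x sum to 0
    over m < h; so h x is minus the sum of the differences. *)
Lemma lattice_coxeter x : (forall i, <|x, simple i|> \is a Num.int) -> lattice (h%:R *: x).
Proof.
move=> hx.
have L1 l y : (forall i, <|y, simple i|> \is a Num.int) ->
    lattice (srefls l y - y).
  move=> hy; elim: l => [|i l IH] /=; first by rewrite subrr; apply: lattice0.
  rewrite reflE addrAC; apply: latticeD => //; apply: latticeN.
  have /intrP[m ->] : <|srefls l y, simple i|> \is a Num.int.
    by rewrite -(subrK y (srefls l y)) pairingD rpredD // (lattice_pairing IH).
  by apply: latticeZ; apply: lattice_root.
have L2 m : lattice (iter m (cox Phi) x - x).
  elim: m => [|m IH] /=; first by rewrite subrr; apply: lattice0.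
  rewrite -(subrK (iter m (cox Phi) x) (cox Phi _)) -addrA; apply: latticeD => //.
  apply: L1 => i; rewrite -(subrK x (iter m _ x)) pairingD rpredD //.
  exact: lattice_pairing.
have := latticeN (lattice_sum (iota 0 h) L2); rewrite sumrB.
have := sum_cox RS x; rewrite /index_iota subn0 => ->.
by rewrite sub0r opprK big_const_seq count_predT size_iota iter_addr_0 scaler_nat.
Qed.

Lemma lattice_divp p x : prime p -> (h < p)%N -> lattice (p%:R *: x) ->
  (forall i, <|x, simple i|> \is a Num.int) -> lattice x.
Proof.
move=> pp hp lp hx; have lh := lattice_coxeter hx.
have h0 : (0 < h)%N by case: (coxeter_numberP RS).
have cop : coprime p h by rewrite prime_coprime // gtnNdvd.
have [[u v] /= e] : exists uv : int * int, uv.1 * p%:Z + uv.2 * h%:Z = 1.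
  case: (egcdnP h (prime_gt0 pp)) => u v e _; exists (u%:Z, - v%:Z); rewrite /=.
  by rewrite mulNr -!PoszM e (eqP cop); lia.
rewrite -[x]scale1r -[1]/(1%:~R) -e intrD !intrM scalerDl -!scalerA.
by apply: latticeD; apply: latticeZ.
Qed.

End Lattice.

(** * Affine Weyl groups *)

Lemma int_between (a j : int) : a - 1 < j -> j < a + 1 -> j = a.
Proof. lia. Qed.

Section Affine.
Variables (r : nat) (I : finType) (Phi : root_datum r I).
Hypothesis RS : root_system Phi.
Hypothesis irr : irreducible_roots Phi.
Local Notation E := 'rV[rat]_r.
Local Notation "<| b , a |>" := (pairing Phi b a).
Local Notation roots := (roots Phi).
Local Notation simple := (simple Phi).
Local Notation refl := (refl Phi).
Local Notation refls := (refls Phi).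
Local Notation pos := (nonneg_root Phi).
Local Notation h := (coxeter_number Phi).
Local Notation rho := (half_sum Phi).
Local Notation lattice := (in_root_lattice Phi).
Variable p : nat.
Hypothesis hp : (h < p)%N.
Variables (W : groupType) (S : finType) (g : S -> W).
Hypothesis coxW : coxeter_system g.
Variable tau : W -> E -> E.
Hypothesis AI : affine_identification Phi p g tau.

Let simple_in i : simple i \in roots. Proof. exact: simple_roots. Qed.

(** The dot action recentred at - rho: the finite Weyl group becomes linear and rho stands for the
    fundamental alcove. *)
Definition shifted (x : W) (b : E) : E := tau x (b - rho) + rho.
Local Notation T := shifted.

Lemma shifted_mul x y b : T (x * y)%g b = T x (T y b).
Proof. by rewrite /shifted addrK (aff_mul AI). Qed.

Lemma shifted_faithful x : (forall b, T x b = b) -> x = 1%g.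
Proof.
move=> hx; apply: (aff_faithful AI) => b; have := hx (b + rho); rewrite /shifted addrK.
exact: addIr.
Qed.

(** Multiplicativity only makes T 1 idempotent; it is the identity because it is injective. *)
Lemma shifted1 b : T 1%g b = b.
Proof.
have e1 : T 1%g (T 1%g b) = T 1%g b by rewrite -shifted_mul mulg1.
have [w0 [c [[l [hl hw]] _ hb]]] := aff_elt AI 1%g.
have inj : injective (T 1%g).
  move=> u v; rewrite /shifted => /addIr; rewrite !hb /dot !subrK => /addIr/addIr.
  by rewrite !hw => /(refls_inj RS hl).
exact: inj.
Qed.

Lemma shifted_inj x y : T x =1 T y -> x = y.
Proof.
move=> e; have : (x^-1 * y)%g = 1%g by apply: shifted_faithful => b; rewrite shifted_mul -e -shifted_mul mulVg shifted1.
by move/(congr1 (mulg x)); rewrite mulKVg mulg1.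
Qed.

Lemma shifted_affine x : exists l c, [/\ all (mem roots) l, lattice c &
  forall b, T x b = refls l b + p%:R *: c].
Proof.
have [w0 [c [[l [hl hw]] hc hb]]] := aff_elt AI x; exists l, c; split=> // b.
by rewrite /shifted hb /dot subrK hw addrAC subrK.
Qed.

Lemma shifted_surj l c : all (mem roots) l -> lattice c ->
  exists x, forall b, T x b = refls l b + p%:R *: c.
Proof.
move=> hl hc; have [|x hx] := @aff_surj _ _ _ _ _ _ _ _ AI (fun b => dot Phi (refls l) b + p%:R *: c).
  by exists (refls l), c; split=> //; exists l.
by exists x => b; rewrite /shifted hx /dot subrK addrAC subrK.
Qed.

Definition affine_form (a : E) (m : int) (x : E) : rat := <|x, a|> - m%:~R * p%:R.

Definition is_refl (t : W) (a : E) (m : int) : Prop :=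
  a \in roots /\ forall x, T t x = x - affine_form a m x *: a.

Lemma is_refl_eq t t' a m : is_refl t a m -> is_refl t' a m -> t = t'.
Proof. by move=> [_ e] [_ e']; apply: shifted_inj => x; rewrite e e'. Qed.

Lemma is_refl_inv t a m x : is_refl t a m -> affine_form a m (T t x) = - affine_form a m x.
Proof.
by move=> [ha e]; rewrite {1}/affine_form e pairingB pairingZ (roots_pair2 RS ha) /affine_form; ring.
Qed.

Lemma is_reflK t a m : is_refl t a m -> (t * t)%g = 1%g.
Proof.
move=> H; apply: shifted_faithful => b; rewrite shifted_mul; have [_ e] := H.
by rewrite e (is_refl_inv _ H) e scaleNr opprK subrK.
Qed.

Lemma is_refl_conj t a m y : is_refl t a m ->
  exists a' m', is_refl (y * t * y^-1)%g a' m' /\ forall x, affine_form a' m' (T y x) = affine_form a m x.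
Proof.
move=> [ha e]; have [l [c [hl hc hy]]] := shifted_affine y.
have hla : refls l a \in roots by apply: refls_root.
have /intrP[n en] := lattice_pairing RS hc hla.
have H x : affine_form (refls l a) (m + n) (T y x) = affine_form a m x.
  by rewrite /affine_form hy pairingD pairingZ (pairing_refls RS) // en intrD; ring.
exists (refls l a), (m + n); split=> //; split=> // x.
have ex : T y (T y^-1%g x) = x by rewrite -shifted_mul mulgV shifted1.
have h1 : affine_form (refls l a) (m + n) x = affine_form a m (T y^-1%g x) by rewrite -H ex.
by rewrite h1 !shifted_mul e hy reflsD reflsN reflsZ addrAC -hy ex.
Qed.

Lemma is_refl_gen s : exists a m, is_refl (g s) a m.
Proof.
have [a [n [[[ha _] _ _] e]]] := aff_simple AI s; exists a, n%:Z; split=> // x.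
by rewrite /shifted e /wall_refl subrK /affine_form addrAC subrK natrM.
Qed.

Lemma is_refl_reflection t : reflection_conj g t -> exists a m, is_refl t a m.
Proof.
move=> [y [s ->]]; have [a [m H]] := is_refl_gen s.
by have [a' [m' [H' _]]] := is_refl_conj y H; exists a', m'.
Qed.

Let hpr : h%:R < p%:R :> rat. Proof. by rewrite ltr_nat. Qed.

Lemma p_gt0 : 0 < p%:R :> rat.
Proof. by apply: le_lt_trans hpr; rewrite ler0n. Qed.

(** The assumption h < p enters here, through <rho, a> <= h - 1. *)
Lemma rho_alcove a : a \in roots -> pos a -> 0 < <|rho, a|> < p%:R.
Proof.
move=> ha pa; rewrite rho_gt0 //=; have := height_bound RS irr ha; move: hpr; lra.
Qed.

Lemma rho_abs a : a \in roots -> `|<|rho, a|>| < p%:R.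
Proof.
move=> ha; case: (simple_base RS ha) => pa.
  by have /andP[h1 h2] := rho_alcove ha pa; rewrite gtr0_norm.
have /andP[h1 h2] := rho_alcove (rootN RS ha) pa.
by rewrite -normrN -pairingNr // gtr0_norm.
Qed.

Lemma strip_neq0 (m : int) (x : rat) : 0 < x < p%:R -> x - m%:~R * p%:R != 0.
Proof.
move=> /andP[x0 xp]; rewrite subr_eq0; apply/eqP => e.
have m0 : 0 < m by rewrite -(ltr0z rat) -(pmulr_lgt0 _ p_gt0) -e.
have m1 : m < 1 by rewrite -(ltr_int rat) -(ltr_pM2r p_gt0) -e mul1r.
by rewrite ltNge -gtz0_ge1 m0 in m1.
Qed.

Lemma affine_form_rho_neq0 a m : a \in roots -> affine_form a m rho != 0.
Proof.
move=> ha; case: (simple_base RS ha) => pa; first exact/strip_neq0/rho_alcove.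
have := strip_neq0 (- m) (rho_alcove (rootN RS ha) pa).
by rewrite pairingNr // intrN mulNr opprK -oppr_eq0 opprD opprK.
Qed.

Lemma strip_same_side (m : int) (x y : rat) : 0 < x < p%:R -> 0 < y < p%:R ->
  0 < (x - m%:~R * p%:R) * (y - m%:~R * p%:R).
Proof.
move=> /andP[x0 xp] /andP[y0 yp]; have [m0|m1] := lerP m 0.
  have : m%:~R * p%:R <= 0 :> rat by rewrite pmulr_lle0 ?p_gt0 // lerz0.
  by move=> hm; rewrite mulr_gt0 //; lra.
have : p%:R <= m%:~R * p%:R :> rat by rewrite ler_peMl ?(ltW p_gt0) // ler1z -gtz0_ge1.
by move=> hm; rewrite nmulr_rgt0; lra.
Qed.

(** An inner point c of the wall is fixed by the reflection, so <c, b> = <c, b'> + j p. The known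
    strips for both pairings force j = 0 or j = 1 according to the sign of b'; the same identity for
    rho then places its mirror image. *)
Lemma strip_beyond_wall a n b : wall Phi p a n -> b \in roots -> pos b -> b != a ->
  0 < <|rho - affine_form a n rho *: a, b|> < p%:R.
Proof.
move=> [[ha pa] hn [c0 [hc hoth]]] hb pb ba; set c := c0 + rho in hc hoth.
pose b' := refl a b; have hb' : b' \in roots by apply: refl_root.
have bNa : b != - a by apply: contraPneq (posN RS ha pa) => <-.
have b'a : b' != a.
  by apply: contraPneq (posN RS hb pb) => e; rewrite -(reflK RS ha b) -/b' e refl_self // opprK.
have b'Na : - b' != a.
  apply: contra_neq ba => e; rewrite -(reflK RS ha b) -/b' -(opprK b') e reflN refl_self // opprK //.
have ex x : <|x - affine_form a n x *: a, b|> = <|x, b'|> + (n%:~R * p%:R) * <|a, b|>.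
  have -> : <|x, b'|> = <|refl a x, b|> by rewrite -(pairing_refl RS _ ha hb') reflK.
  by rewrite reflE !pairingB !pairingZ /affine_form; ring.
have ec : <|c, b|> = <|c, b'|> + (n%:~R * p%:R) * <|a, b|>.
  have <- := ex c; have -> : affine_form a n c = 0 by rewrite /affine_form hc natrM subrr.
  by rewrite scale0r subr0.
have /andP[cb0 cbp] := hoth b (conj hb pb) (elimN eqP ba).
have /intrP[k ek] := roots_int RS hb ha.
rewrite ex; have rb' := rho_abs hb'; rewrite ek in ec *.
have [j ej] : exists j : int, n%:~R * p%:R * k%:~R = j%:~R * p%:R :> rat.
  by exists (n%:Z * k); rewrite intrM; ring.
rewrite ej in ec *; have pp := p_gt0.
have jlt (u v : int) : u%:~R * p%:R < v%:~R * p%:R :> rat -> u < v.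
  by rewrite ltr_pM2r // ltr_int.
case: (simple_base RS hb') => pb'.
  have [] := hoth b' (conj hb' pb') (elimN eqP b'a) => /andP[h1 h2].
  have j0 : j = 0 by apply: int_between; apply: jlt; lra.
  by rewrite j0 mul0r addr0; apply: rho_alcove.
have := hoth _ (conj (rootN RS hb') pb') (elimN eqP b'Na); rewrite pairingNr // => /andP[h1 h2].
have := rho_alcove (rootN RS hb') pb'; rewrite pairingNr // => /andP[h3 h4].
have j1 : j = 1 by apply: int_between; apply: jlt; lra.
by rewrite j1; apply/andP; split; lra.
Qed.

(* The only wall between rho and its image under a simple reflection is the wall of that reflection. *)
Lemma crossed_wall s a m : a \in roots -> affine_form a m rho * affine_form a m (T (g s) rho) < 0 ->
  is_refl (g s) a m.
Proof.
move=> ha; have [b [n [hw e]]] := aff_simple AI s.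
have [[hb pb] hn _] := hw.
have R : is_refl (g s) b n.
  by split=> // x; rewrite /shifted e /wall_refl subrK /affine_form addrAC subrK natrM.
have aux c k : c \in roots -> pos c -> affine_form c k rho * affine_form c k (T (g s) rho) < 0 -> c = b /\ k = n%:Z.
  move=> hc pc; have [->|cb] := eqVneq c b; last first.
    rewrite /affine_form R.2 ltNge => /negP[]; apply/ltW/strip_same_side; first exact: rho_alcove.
    exact: strip_beyond_wall.
  move=> hl; split=> //; have /andP[h1 h2] := rho_alcove hb pb; have pp := p_gt0.
  have jlt (u v : int) : u%:~R * p%:R < v%:~R * p%:R :> rat -> u < v.
    by rewrite ltr_pM2r // ltr_int.
  move: hl; rewrite R.2 /affine_form pairingB pairingZ (roots_pair2 RS hb) => hl.
  have bnd (u v : int) : u <= v -> u%:~R * p%:R <= v%:~R * p%:R :> rat.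
    by rewrite ler_pM2r // ler_int.
  have [k0|k0|->//] := ltgtP k n%:Z; exfalso; move: hl; apply/negP; rewrite -leNgt.
    have hk : k%:~R * p%:R <= (n%:Z - 1)%:~R * p%:R :> rat by apply: bnd; rewrite lerBrDr lezD1.
    rewrite intrB mulrBl mul1r in hk.
    by case: (n) hn hk => [|[|//]] _ hk; rewrite mulr_ge0 //; lra.
  have hk : (n%:Z + 1)%:~R * p%:R <= k%:~R * p%:R :> rat by apply: bnd; rewrite lezD1.
  rewrite intrD mulrDl mul1r in hk.
  by case: (n) hn hk => [|[|//]] _ hk; rewrite mulr_le0 //; lra.
case: (simple_base RS ha) => pa hl; first by have [-> ->] := aux _ _ ha pa hl.
have levN x : affine_form (- a) (- m) x = - affine_form a m x by rewrite /affine_form pairingNr // intrN; ring.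
have [|e1 e2] := aux (- a) (- m) (rootN RS ha) pa; first by rewrite !levN mulrNN.
by split=> // x; rewrite R.2 -e1 -e2 levN scaleNr scalerN opprK.
Qed.

End Affine.

(** * Strong exchange, Bruhat order and bounds for alcoves *)

Section Bruhat.
Variables (r : nat) (I : finType) (Phi : root_datum r I).
Hypothesis RS : root_system Phi.
Hypothesis irr : irreducible_roots Phi.
Local Notation E := 'rV[rat]_r.
Local Notation "<| b , a |>" := (pairing Phi b a).
Local Notation roots := (roots Phi).
Local Notation simple := (simple Phi).
Local Notation refl := (refl Phi).
Local Notation refls := (refls Phi).
Local Notation pos := (nonneg_root Phi).
Local Notation h := (coxeter_number Phi).
Local Notation rho := (half_sum Phi).
Variable p : nat.
Hypothesis hp : (h < p)%N.
Variables (W : groupType) (S : finType) (g : S -> W).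
Hypothesis coxW : coxeter_system g.
Variable tau : W -> E -> E.
Hypothesis AI : affine_identification Phi p g tau.
Local Notation wd := (wd g).
Local Notation len := (len g).

Let simple_in i : simple i \in roots. Proof. exact: simple_roots. Qed.
Local Notation T := (shifted Phi tau).
Local Notation affine_form := (affine_form Phi p).
Local Notation is_refl := (is_refl Phi p tau).

(** The alcoves of the prefixes of u form a gallery. If the hyperplane of t separates the first two
    alcoves, it is their common wall and the first letter is deleted; otherwise t is conjugated by
    that letter and the gallery loses its first step. *)
Lemma strong_exchange t a m u : is_refl t a m -> affine_form a m rho * affine_form a m (T (wd u) rho) < 0 ->
  exists u1 s u2, u = u1 ++ s :: u2 /\ (t * wd u)%g = wd (u1 ++ u2).
Proof.
elim: u t a m => [|s u IH] t a m H.
  by rewrite wd_nil (shifted1 RS AI) -expr2 ltNge sqr_ge0.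
have [ha _] := H.
have [a' [m' [H' e']]] := is_refl_conj RS AI (g s) H; rewrite genV // in H'.
have eT x : affine_form a m (T (g s) x) = affine_form a' m' x.
  by rewrite -e' -(shifted_mul AI) gen_sq // (shifted1 RS AI).
rewrite wd_cons (shifted_mul AI) eT => hl.
have [lt|ge] := ltrP (affine_form a m rho * affine_form a m (T (g s) rho)) 0.
  have R := crossed_wall RS irr hp AI ha lt.
  exists [::], s, u; split=> //=; rewrite (is_refl_eq RS AI H R).
  by rewrite genKl.
have [|u1 [s' [u2 [-> e]]]] := IH _ _ _ H'.
  have n1 := affine_form_rho_neq0 RS irr hp m ha; have n2 := affine_form_rho_neq0 RS irr hp m' H'.1.
  move: ge hl; rewrite eT; move: n1 n2; set x := affine_form a m rho; set y := affine_form a' m' rho.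
  set z := affine_form a' m' _ => x0 y0 xy xz.
  have x2 : 0 < x ^+ 2 by rewrite exprn_even_gt0.
  have y2 : 0 < y ^+ 2 by rewrite exprn_even_gt0.
  have xy' : 0 < x * y by rewrite lt_neqAle eq_sym mulf_neq0.
  have : (y * z) * x ^+ 2 < 0.
    have -> : (y * z) * x ^+ 2 = (x * y) * (x * z) by ring.
    by rewrite pmulr_rlt0.
  by rewrite pmulr_llt0.
exists (s :: u1), s', u2; split=> //; rewrite cat_cons wd_cons -e.
by rewrite !mulgA gen_sq // mul1g.
Qed.

(** Separation gives a shorter word by exchange. Otherwise t y rho lies on the far side from rho,
    and the same argument for t y shows that y is the shorter one. *)
Lemma len_refl t a m y : is_refl t a m ->
  (len (t * y)%g < len y)%N = (affine_form a m rho * affine_form a m (T y rho) < 0).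
Proof.
move=> H; have aux z : affine_form a m rho * affine_form a m (T z rho) < 0 -> (len (t * z) < len z)%N.
  have [u ru <-] := rexpr_ex coxW z => hl.
  have [u1 [s [u2 [e ->]]]] := strong_exchange H hl.
  move/eqP: ru => ->; rewrite e size_cat /= addnS ltnS -size_cat; exact: len_wd.
apply/idP/idP; last exact: aux.
apply: contraTT; rewrite -leNgt -leqNgt => h0.
have [ty|] := eqVneq (affine_form a m (T y rho)) 0.
  have [a' [m' [H' e']]] := is_refl_conj RS AI y^-1%g H.
  have := affine_form_rho_neq0 RS irr hp m' H'.1.
  by rewrite -[X in affine_form a' m' X](shifted1 RS AI) -(mulVg y) (shifted_mul AI) e' ty eqxx.
move=> n2; have n1 := affine_form_rho_neq0 RS irr hp m H.1.
have := aux (t * y)%g; rewrite mulgA (is_reflK RS AI H) mul1g => h1; apply/ltnW/h1.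
rewrite (shifted_mul AI) (is_refl_inv RS _ H) mulrN oppr_lt0 lt_neqAle h0 andbT eq_sym mulf_neq0 //.
Qed.

Lemma conj_reflection t x : reflection_conj g t -> reflection_conj g (x * t * x^-1)%g.
Proof. by move=> [y [s ->]]; exists (x * y)%g, s; rewrite invMg !mulgA. Qed.

Lemma bruhat_trans x y z : bruhat g x y -> bruhat g y z -> bruhat g x z.
Proof. by move=> xy; elim=> // u v _ IH; apply: bruhat_step. Qed.

Lemma bruhat_up w s : (len w < len (w * g s)%g)%N -> bruhat g w (w * g s)%g.
Proof.
move=> hl; apply: bruhat_step hl; first exact: bruhat_refl.
by exists 1%g, s; rewrite mul1g invg1 mulg1 mulKg.
Qed.

Lemma bruhat_lift z w s : bruhat g z w ->
  bruhat g (z * g s)%g w \/ bruhat g (z * g s)%g (w * g s)%g.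
Proof.
elim=> [|y {}w zy IH ry hl]; first by right; apply: bruhat_refl.
case: IH => IH; first by left; apply: bruhat_step hl.
have [lt|ge] := ltnP (len (y * g s)%g) (len (w * g s)%g).
  right; apply: bruhat_step IH _ lt.
  have := conj_reflection (g s) ry; rewrite (genV coxW) invMg (genV coxW).
  by rewrite !mulgA.
left; apply: bruhat_trans IH _.
have [up|dn] := len_updown coxW y s; last first.
  apply: bruhat_step hl => //; rewrite -{2}[y](genK coxW s); apply: bruhat_up.
  by rewrite genK.
(* By exchange y arises from a reduced expression u s of w by deleting a letter. A letter of u is
   excluded, because y s would then be shorter than w s; so the last letter goes. *)
suff -> : (y * g s)%g = w by apply: bruhat_refl.
have eup := len_up coxW up.
have wdn : (len (w * g s)%g < len w)%N.
  have [/(len_up coxW) h1|//] := len_updown coxW w s.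
  by rewrite h1 eup ltnS leqNgt hl in ge.
have ewd := len_down coxW wdn.
have [u ru eu] := rexpr_ex coxW (w * g s)%g.
have ew : w = wd (rcons u s) by rewrite wd_rcons eu genK.
have [a [m H]] := is_refl_reflection RS AI (conj_reflection y ry).
set t := (y * _ * _)%g in H.
have et : (t * w)%g = y.
  have H2 := is_reflK RS AI H; have -> : w = (t * y)%g by rewrite /t mulgKV mulKVg.
  by rewrite mulgA H2 mul1g.
have hl' : affine_form a m rho * affine_form a m (T w rho) < 0 by rewrite -(len_refl _ H) et.
rewrite {1}ew in hl'; have [u1 [s1 [u2 [e]]]] := strong_exchange H hl'.
rewrite -ew et; case/lastP: u2 e => [|u2 s2].
  by rewrite cats1 => /rcons_inj[<- _]; rewrite cats0 eu => ->; rewrite genK.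
rewrite -rcons_cons -rcons_cat => /rcons_inj[eu1 <-]; rewrite -rcons_cat wd_rcons => ey.
have := len_wd g (u1 ++ u2); rewrite -(genK coxW s (wd _)) -ey.
have := congr1 size eu1; rewrite !size_cat /=; move/eqP: ru => <-; rewrite eu; lia.
Qed.

Lemma subword_bruhat t t' : rexpr g t -> subseq t' t -> bruhat g (wd t') (wd t).
Proof.
elim/last_ind: t t' => [|u s IH] t'; first by rewrite subseq0 => _ /eqP ->; apply: bruhat_refl.
move=> ru st; have ru' : rexpr g u by move: ru; rewrite -cats1; apply: rexpr_catl.
have up : (len (wd u) < len (wd u * g s)%g)%N.
  by move: ru ru'; rewrite /rexpr wd_rcons size_rcons => /eqP -> /eqP ->.
rewrite wd_rcons; case/lastP: t' st => [|t' s'] st.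
  by apply: bruhat_trans (bruhat_up up); apply: IH => //; apply: sub0seq.
have [su|[su e]] : subseq (rcons t' s') u \/ subseq t' u /\ s' = s.
  move: st; rewrite -subseq_rev !rev_rcons /=; case: eqP => [e|_] h0; [right|left].
    by rewrite -subseq_rev.
  by rewrite -subseq_rev rev_rcons.
  by apply: bruhat_trans (bruhat_up up); apply: IH.
rewrite e wd_rcons; case: (bruhat_lift s (IH _ ru' su)) => // h0.
exact: bruhat_trans h0 (bruhat_up up).
Qed.

Lemma hatWo_subword t t' : rexpr g t -> subseq t' t ->
  in_hatWo Phi p g tau (wd t) -> in_hatWo Phi p g tau (wd t').
Proof.
move=> rt st [hh hw hb]; exists hh => //; apply: bruhat_trans hb.
exact: subword_bruhat.
Qed.

(** For restricted x the point T x rho pairs with simple coroots within [1, p + 1), hence with a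
    positive coroot b at most to (p + 1) <rho, b> <= (p + 1) (h - 1). *)
Definition bounded (x : E) : Prop :=
  forall b, b \in roots -> `|<|x, b|>| <= (p%:R + 1) * (h%:R - 1).

(** Since |<rho, a>| < p and the hyperplane separates x from rho, the value of its affine form at x
    lies between 0 and <x, a>. The reflected point is thus on the segment from x to the linear
    reflection of x, and both ends satisfy the bound. *)
Lemma bounded_refl t a m x : is_refl t a m -> affine_form a m rho * affine_form a m x < 0 ->
  bounded x -> bounded (T t x).
Proof.
move=> [ha e] hl hx b hb; rewrite e pairingB pairingZ.
have h1 := hx b hb; have h2 := hx (refl a b) (refl_root RS ha hb).
have eb : <|x, refl a b|> = <|x, b|> - <|x, a|> * <|a, b|>.
  by rewrite -(pairing_refl RS _ ha) ?refl_root // reflK // reflE pairingB pairingZ.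
have hr := rho_abs RS irr hp ha; rewrite ltr_norml in hr; rewrite !ler_norml eb in h1 h2 *.
move: hr h1 h2 hl => /andP[r1 r2] /andP[b1 b2] /andP[b3 b4]; rewrite /affine_form.
set u := <|x, a|> in b3 b4 *; set v := <|rho, a|> in r1 r2 *; set w := <|a, b|> in b3 b4 *.
have pp := p_gt0 hp.
set c := m%:~R * p%:R => hl.
have K : 0 <= u - c <= u \/ u <= u - c <= 0.
  have [m0|m0|m0] := ltgtP m 0.
  - have hc : c <= - p%:R by rewrite /c -mulN1r ler_pM2r // -[-1]/((-1)%:~R) ler_int; lia.
    have : 0 < v - c by lra.
    by move=> h0; rewrite pmulr_rlt0 // in hl; right; apply/andP; split; lra.
  - have hc : p%:R <= c by rewrite /c ler_peMl ?(ltW pp) // ler1z -gtz0_ge1.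
    have : v - c < 0 by lra.
    by move=> h0; rewrite nmulr_rlt0 // in hl; left; apply/andP; split; lra.
  have -> : c = 0 by rewrite /c m0 mul0r.
  by rewrite subr0; case: (lerP 0 u) => h0; [left|right]; rewrite lexx ?h0 ?ltW.
have {}K : 0 <= (u - c) * w <= u * w \/ u * w <= (u - c) * w <= 0.
  have [w0|w0] := lerP 0 w; [case: K => /andP[k1 k2]; [left|right]|case: K => /andP[k1 k2]; [right|left]].
  - by rewrite mulr_ge0 //= ler_wpM2r.
  - by rewrite mulr_le0_ge0 // ler_wpM2r.
  - by rewrite mulr_ge0_le0 ?(ltW w0) // ler_wnM2r ?(ltW w0).
  - by rewrite mulr_le0 ?(ltW w0) //= ler_wnM2r ?(ltW w0).
by case: K => /andP[k1 k2]; apply/andP; split; lra.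
Qed.

Lemma bounded_bruhat x z : bruhat g x z -> bounded (T z rho) -> bounded (T x rho).
Proof.
elim=> // y {}z xy IH ry hl hz; apply: IH.
have [a [m H]] := is_refl_reflection RS AI (conj_reflection y ry).
set t := (y * _ * _)%g in H; have et : z = (t * y)%g by rewrite /t mulgKV mulKVg.
have et' : (t * z)%g = y by rewrite et mulgA (is_reflK RS AI H) mul1g.
rewrite -et' (shifted_mul AI); apply: (bounded_refl H) hz.
by rewrite -(len_refl _ H) et'.
Qed.

Lemma bounded_hatWo x : in_hatWo Phi p g tau x -> bounded (T x rho).
Proof.
move=> [hh [w0 [[w1 [l [hl ew]] e0] _] [[w hw eh] _]] hb]; apply: bounded_bruhat hb _.
rewrite eh (shifted_mul AI); have -> z : T w0 z = refls l z by rewrite /T e0 /dot subrK ew subrK.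
move=> b hb; pose b' := refls (rev l) b.
have hl' : all (mem roots) (rev l) by rewrite all_rev.
have hb' : b' \in roots by apply: refls_root.
have -> : <|refls l (T w rho), b|> = <|T w rho, b'|>.
  by rewrite -(pairing_refls RS _ hl hb') /b' -{3}(revK l) refls_rev.
have ht i : 0 <= <|T w rho, simple i|> <= p%:R + 1.
  have /andP[h1 h2] := hw i; rewrite /T subrr pairingD rho_simple //.
  by apply/andP; split; lra.
have aux c : c \in roots -> pos c -> `|<|T w rho, c|>| <= (p%:R + 1) * (h%:R - 1).
  move=> hc pc; rewrite ger0_norm; last by apply: pairing_ge0 => // i; case/andP: (ht i).
  have h1 : <|T w rho, c|> <= (p%:R + 1) * <|rho, c|>.
    by apply: pairing_le => // i; case/andP: (ht i).
  apply: le_trans h1 _; rewrite ler_wpM2l ?addr_ge0 //; exact: height_bound.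
case: (simple_base RS hb') => pb; first exact: aux.
by rewrite -normrN -pairingNr //; apply: aux => //; rewrite rootN.
Qed.

End Bruhat.

(** * The walls of the fundamental alcove and their inward normals *)

Section Walls.
Variables (r : nat) (I : finType) (Phi : root_datum r I).
Hypothesis RS : root_system Phi.
Hypothesis irr : irreducible_roots Phi.
Local Notation E := 'rV[rat]_r.
Local Notation "<| b , a |>" := (pairing Phi b a).
Local Notation roots := (roots Phi).
Local Notation simple := (simple Phi).
Local Notation refl := (refl Phi).
Local Notation pos := (nonneg_root Phi).
Local Notation h := (coxeter_number Phi).
Local Notation rho := (half_sum Phi).
Variable p : nat.
Hypothesis hp : (h < p)%N.
Variables (W : groupType) (S : finType) (g : S -> W).
Hypothesis coxW : coxeter_system g.
Variable tau : W -> E -> E.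
Hypothesis AI : affine_identification Phi p g tau.

Let simple_in i : simple i \in roots. Proof. exact: simple_roots. Qed.
Local Notation T := (shifted Phi tau).
Variables (wa : S -> E) (wn : S -> nat).
Hypothesis wallP : forall s, wall Phi p (wa s) (wn s).
Hypothesis gP : forall s, tau (g s) =1 wall_refl Phi p (wa s) (wn s).

(** The inward normal, up to scaling: the affine wall gives p - <x, a> > 0, hence the sign. With
    [wall_form], walls of both kinds take the form ell = 0 with the alcove on the positive side. *)
Definition normal (s : S) : E := if wn s == 0%N then wa s else - wa s.
Local Notation bn := normal.
Definition wall_form (s : S) (x : E) : rat := <|x, bn s|> + (wn s * p)%:R.

Let pp : 0 < p%:R :> rat. Proof. exact: p_gt0 hp. Qed.

Let wa_root s : wa s \in roots. Proof. by have [[]] := wallP s. Qed.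
Let wa_pos s : pos (wa s). Proof. by have [[]] := wallP s. Qed.
Let wn_le1 s : (wn s <= 1)%N. Proof. by have [] := wallP s. Qed.

Lemma normal_root s : bn s \in roots.
Proof. by rewrite /normal; case: ifP => _; rewrite ?rootN. Qed.

Local Notation ell := wall_form.

Lemma shifted_gen s x : T (g s) x = x - ell s x *: bn s.
Proof.
rewrite /shifted gP /wall_refl subrK addrAC subrK /wall_form /normal.
case: (wn s) (wn_le1 s) => [|[|//]] _ /=; first by rewrite mul0n mulr0n subr0.
by rewrite pairingNr // scalerN -scaleNr; congr (_ - _ *: _); ring.
Qed.

Lemma gen_inj s q : (forall x, T (g s) x = T (g q) x) -> s = q.
Proof. by move=> h0; apply: (coxeter_inj coxW); apply: (shifted_inj RS AI). Qed.

Lemma normal_inj : injective bn.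
Proof.
move=> s q e; apply: gen_inj => x; rewrite !shifted_gen e /wall_form e.
have -> // : wn s = wn q.
move: e (wn_le1 s) (wn_le1 q); rewrite /normal.
case: (wn s) => [|[|//]]; case: (wn q) => [|[|//]] //= e _ _.
  by case: (posN RS (wa_root q) (wa_pos q)); rewrite -e; apply: wa_pos.
by case: (posN RS (wa_root s) (wa_pos s)); rewrite e; apply: wa_pos.
Qed.

Lemma wall_point s : exists c, [/\ ell s c = 0, forall t, t != s -> 0 < ell t c &
  forall a, a \in roots -> a != wa s -> pos a -> 0 < <|c, a|> < p%:R].
Proof.
have [_ _ [c0 [hc hoth]]] := wallP s; set c := c0 + rho in hc hoth.
have wE t : ell t c = if wn t == 0%N then <|c, wa t|> else p%:R - <|c, wa t|>.
  rewrite /wall_form /normal; case: (wn t) (wn_le1 t) => [|[|//]] _ /=; first by rewrite mul0n mulr0n addr0.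
  by rewrite pairingNr // mul1n addrC.
exists c; split.
- by rewrite wE hc; case: (wn s) (wn_le1 s) => [|[|//]] _ //=; rewrite mul1n subrr.
- move=> t ts; rewrite wE; have [e|ne] := eqVneq (wa t) (wa s); last first.
    have /andP[h1 h2] := hoth _ (conj (wa_root t) (wa_pos t)) (elimN eqP ne).
    by case: ifP => _ //; rewrite subr_gt0.
  rewrite e hc; have : wn t != wn s.
    apply: contra_neq ts => en; apply: normal_inj; by rewrite /normal e en.
  case: (wn s) (wn_le1 s) => [|[|//]] _; case: (wn t) (wn_le1 t) => [|[|//]] _ //= _.
    by rewrite subr0.
  by rewrite mul1n.
- by move=> a ha ne pa; apply: hoth => //; apply/eqP.
Qed.

Lemma proportional_roots (a b : E) c : a \in roots -> b \in roots -> b = c *: a -> b = a \/ b = - a.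
Proof.
move=> ha hb e; rewrite e in hb *.
by case: (roots_reduced RS ha hb) => ->; [left; rewrite scale1r | right; rewrite scaleN1r].
Qed.

(** If the pairing were positive, the affine form ell_q - <b_s, b_q> ell_s, whose root is the
    reflection b' of b_q, would be positive at an inner point of wall s and negative at one of wall
    q. No hyperplane of b' separates these points, as b' is proportional to neither normal. *)
Lemma normal_obtuse s q : s != q -> <|bn s, bn q|> <= 0.
Proof.
move=> sr; rewrite leNgt; apply/negP => m0.
have hs := normal_root s; have hr := normal_root q.
pose b' := refl (bn s) (bn q); have hb' : b' \in roots by apply: refl_root.
have [cs [cs0 cs1 cs2]] := wall_point s; have [cr [cr0 cr1 cr2]] := wall_point q.
have bsr : bn q != bn s by apply: contra_neq sr => /normal_inj.
have bsNr : bn q != - bn s.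
  by apply: contraTneq m0 => ->; rewrite pairingNr // (roots_pair2 RS hs).
have nprop c : bn q <> c *: bn s.
  by case/(proportional_roots hs hr) => e; [case/eqP: bsr | case/eqP: bsNr].
have prop t c : (t = s \/ t = q) -> b' <> c *: bn t.
  case=> -> e; move: (erefl b'); rewrite {1}/b' reflE e.
    by move/eqP; rewrite subr_eq -scalerDl => /eqP/nprop.
  have n0 : <|bn q, bn s|> != 0 by rewrite -(pairing_eq0C RS) // gt_eqF.
  move/eqP; rewrite subr_eq addrC -subr_eq -{1}[bn q]scale1r -scalerBl => /eqP e2.
  have [c1|c1] := eqVneq c 1.
    move: e2; rewrite c1 subrr scale0r => /esym/eqP; rewrite scaler_eq0 (negbTE n0) /=.
    by rewrite (negbTE (root_neq0 RS hs)).
  apply: (nprop ((1 - c)^-1 * <|bn q, bn s|>)).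
  by rewrite -scalerA -e2 scalerA mulVf ?scale1r // subr_eq0 eq_sym.
have pt t a : (t = s \/ t = q) -> a = b' \/ a = - b' -> a != wa t.
  move=> tt [->|->]; apply/eqP => e.
    apply: (prop t (if wn t == 0%N then 1 else -1) tt).
    by rewrite /normal e; case: ifP => _; rewrite ?scale1r // scaleN1r opprK.
  apply: (prop t (if wn t == 0%N then -1 else 1) tt); rewrite -(opprK b') e.
  by rewrite /normal; case: ifP => _; rewrite ?scale1r // scaleN1r.
have /intrP[m em] := roots_int RS hr hs.
pose k : int := (wn q)%:Z - m * (wn s)%:Z.
have psi x : ell q x - <|bn s, bn q|> * ell s x = <|x, b'|> + k%:~R * p%:R.
  have -> : <|x, b'|> = <|x, bn q|> - <|x, bn s|> * <|bn s, bn q|>.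
    by rewrite -(pairing_refl RS _ hs hb') reflK // reflE pairingB pairingZ.
  by rewrite /wall_form em /k intrB intrM !natrM; ring.
have h1 : 0 < <|cs, b'|> + k%:~R * p%:R by rewrite -psi cs0 mulr0 subr0 cs1 // eq_sym.
have h2 : <|cr, b'|> + k%:~R * p%:R < 0.
  by rewrite -psi cr0 sub0r oppr_lt0 mulr_gt0 // cr1.
have h3 : (<|cs, b'|> + k%:~R * p%:R) * (<|cr, b'|> + k%:~R * p%:R) < 0 by rewrite pmulr_rlt0.
case: (simple_base RS hb') => pb'.
  have := strip_same_side hp (- k) (cs2 b' hb' _ pb') (cr2 b' hb' _ pb').
  rewrite intrN mulNr !opprK => h4.
  have {}h4 := h4 (pt s b' (or_introl erefl) (or_introl erefl)) (pt q b' (or_intror erefl) (or_introl erefl)).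
  by have := lt_trans h3 h4; rewrite ltxx.
have := strip_same_side hp k (cs2 (- b') (rootN RS hb') _ pb') (cr2 (- b') (rootN RS hb') _ pb').
rewrite !pairingNr // -!opprD mulrNN => h4.
have {}h4 := h4 (pt s _ (or_introl erefl) (or_intror erefl)) (pt q _ (or_intror erefl) (or_intror erefl)).
by have := lt_trans h3 h4; rewrite ltxx.
Qed.

End Walls.

(** * Orders of products of two wall reflections *)

Section Order.
Variables (r : nat) (I : finType) (Phi : root_datum r I).
Hypothesis RS : root_system Phi.
Hypothesis irr : irreducible_roots Phi.
Local Notation E := 'rV[rat]_r.
Local Notation "<| b , a |>" := (pairing Phi b a).
Local Notation roots := (roots Phi).
Local Notation simple := (simple Phi).
Local Notation refl := (refl Phi).
Local Notation h := (coxeter_number Phi).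
Variable p : nat.
Hypothesis hp : (h < p)%N.
Variables (W : groupType) (S : finType) (g : S -> W).
Hypothesis coxW : coxeter_system g.
Variable tau : W -> E -> E.
Hypothesis AI : affine_identification Phi p g tau.

Let simple_in i : simple i \in roots. Proof. exact: simple_roots. Qed.
Local Notation T := (shifted Phi tau).
Variables (wa : S -> E) (wn : S -> nat).
Hypothesis wallP : forall s, wall Phi p (wa s) (wn s).
Hypothesis gP : forall s, tau (g s) =1 wall_refl Phi p (wa s) (wn s).
Local Notation bn := (normal wa wn).
Local Notation ell := (wall_form Phi p wa wn).

Let pp : 0 < p%:R :> rat. Proof. exact: p_gt0 hp. Qed.
Let br s : bn s \in roots. Proof. exact: (normal_root RS wallP). Qed.
Let TG s x : T (g s) x = x - ell s x *: bn s. Proof. exact: (shifted_gen RS wallP gP). Qed.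

Lemma shifted_exp x n z : T (x ^+ n)%g z = iter n (T x) z.
Proof. by elim: n z => [|n IH] z; rewrite ?expg0 ?(shifted1 RS AI) // expgS (shifted_mul AI) IH. Qed.

Section Pair.
Variables (s q : S) (a c : int).
Hypothesis sq : s != q.
Hypothesis pa : <|bn s, bn q|> = a%:~R.
Hypothesis pc : <|bn q, bn s|> = c%:~R.
Local Notation n := (a * c).
Local Notation U := (g s * g q)%g.
Let u (x : E) : E := refl (bn s) (refl (bn q) x).

Let T_iterD m z v : T (U ^+ m)%g (z + v) = T (U ^+ m)%g z + iter m u v.
Proof.
have hU z' v' : T U (z' + v') = T U z' + u v'.
  by rewrite /u !(shifted_mul AI) !TG !reflE /wall_form !pairingD !pairingN !pairingZ; apply/rowP => i; rewrite !mxE; ring.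
rewrite !shifted_exp; elim: m => //= m ->; exact: hU.
Qed.

Let us : u (bn s) = (n - 1)%:~R *: bn s - a%:~R *: bn q.
Proof.
rewrite /u !reflE pairingB pairingZ (roots_pair2 RS (br s)) pa pc intrB intrM.
by apply/rowP => i; rewrite !mxE; ring.
Qed.

Let uq : u (bn q) = c%:~R *: bn s - bn q.
Proof.
rewrite /u !reflE pairingB pairingZ (roots_pair2 RS (br q)) pc.
by apply/rowP => i; rewrite !mxE; ring.
Qed.

Let plane x : Prop := exists k l, x = k *: bn s + l *: bn q.

Let uD y z : u (y + z) = u y + u z.
Proof. by rewrite /u (reflD _ _ y) (reflD _ _ (refl _ y)). Qed.
Let uZ e y : u (e *: y) = e *: u y.
Proof. by rewrite /u (reflZ _ _ e y) (reflZ _ _ e (refl _ y)). Qed.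

(** Cayley-Hamilton on the plane of the two normals, where u has trace n - 2 and determinant 1. *)
Let rec x : plane x -> u (u x) = (n - 2)%:~R *: u x - x.
Proof.
move=> [k [l ->]]; have := us; have := uq; have := uD; have := uZ.
generalize u => v vZ vD vq vs; rewrite !vD !vZ vs vq.
have vB y z : v (y - z) = v y - v z by rewrite -!(scaleN1r z) -(scaleN1r (v z)) vD vZ.
rewrite !vB !vZ vs vq !intrB intrM.
by apply/rowP => i; rewrite !mxE; ring.
Qed.

Let plane_u x : plane x -> plane (u x).
Proof.
move=> [k [l ->]]; exists (k * (n - 1)%:~R + l * c%:~R), (- (k * a%:~R) - l).
by rewrite uD !uZ us uq; apply/rowP => i; rewrite !mxE; ring.
Qed.

Let plane_iter m x : plane x -> plane (iter m u x).
Proof. by move=> hx; elim: m => //= m; apply: plane_u. Qed.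

Let recn m x : plane x -> iter m.+2 u x = (n - 2)%:~R *: iter m.+1 u x - iter m u x.
Proof. by move=> hx; rewrite -(rec (plane_iter m hx)). Qed.

Let plane_s : plane (bn s). Proof. by exists 1, 0; rewrite scale1r scale0r addr0. Qed.

Let bsq : bn q != bn s. Proof. by apply: contra_neq sq => /(normal_inj RS coxW AI wallP gP). Qed.

(** For n < 4 both wall forms vanish somewhere on z + plane: [al] and [be] solve the linear system
    of determinant 4 - n. That point is fixed by U, so U^m = 1 follows from its linear part on the
    plane. *)
Let upper m : n < 4 -> (forall x, plane x -> iter m u x = x) -> (U ^+ m = 1)%g.
Proof.
move=> n4 hm; apply: (shifted_faithful AI) => z.
have d0 : 4%:R - n%:~R != 0 :> rat by rewrite subr_eq0 gt_eqF // (ltr_int _ n 4).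
pose al := (c%:~R * ell q z - 2%:R * ell s z) / (4%:R - n%:~R).
pose be := (a%:~R * ell s z - 2%:R * ell q z) / (4%:R - n%:~R).
pose v := al *: bn s + be *: bn q.
have f0 : T U (z + v) = z + v.
  have es : ell s (z + v) = 0.
    rewrite /wall_form pairingD {1}/v pairingD !pairingZ (roots_pair2 RS (br s)) pc /al /be.
    have -> : <|z, bn s|> = ell s z - (wn s * p)%:R by rewrite /wall_form addrK.
    by field; rewrite -intrM.
  have eq : ell q (z + v) = 0.
    rewrite /wall_form pairingD {1}/v pairingD !pairingZ (roots_pair2 RS (br q)) pa /al /be.
    have -> : <|z, bn q|> = ell q z - (wn q * p)%:R by rewrite /wall_form addrK.
    by field; rewrite -intrM.
  by rewrite (shifted_mul AI) !TG eq scale0r subr0 es scale0r subr0.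
have f1 : T (U ^+ m)%g (z + v) = z + v by rewrite shifted_exp; elim: m {hm} => //= m ->.
have /eqP := T_iterD m z v; rewrite f1 hm; last by exists al, be.
by rewrite eq_sym (inj_eq (addIr _)) => /eqP.
Qed.

Let lower m : (U ^+ m = 1)%g -> <|iter m u (bn s), bn s|> = 2%:R.
Proof.
move=> e; have := T_iterD m 0 (bn s); rewrite e !(shifted1 RS AI) !add0r => <-.
exact: roots_pair2.
Qed.

Let x0 : <|iter 0 u (bn s), bn s|> = 2%:R. Proof. exact: (roots_pair2 RS (br s)). Qed.
Let x1 : <|iter 1 u (bn s), bn s|> = (n - 2)%:~R.
Proof.
rewrite /iter us pairingB !pairingZ (roots_pair2 RS (br s)) pc !intrB intrM; ring.
Qed.
Let xrec m : <|iter m.+2 u (bn s), bn s|> =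
  (n - 2)%:~R * <|iter m.+1 u (bn s), bn s|> - <|iter m u (bn s), bn s|>.
Proof. by rewrite recn // pairingB pairingZ. Qed.

(** The numbers <u^j b_s, b_s> satisfy the recurrence and equal 2 whenever U^j = 1, so a check of
    the values below m gives the exact order. *)
Let mord_eq m : (0 < m)%N -> n < 4 -> (forall x, plane x -> iter m u x = x) ->
  (forall (X : nat -> rat), X 0%N = 2%:R -> X 1%N = (n - 2)%:~R ->
    (forall j, X j.+2 = (n - 2)%:~R * X j.+1 - X j) ->
    forall j, (0 < j < m)%N -> X j != 2%:R) -> mord g s q = m.
Proof.
move=> m0 n4 hm hj; have e := upper n4 hm.
have /andP[h1 h2] := mord_min m0 e; apply/eqP; rewrite eqn_leq h2 leqNgt; apply/negP => h3.
have /eqP[] := hj _ x0 x1 xrec (mord g s q) (introT andP (conj h1 h3)).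
by apply: lower; apply: mordP.
Qed.

Lemma mord_normal : 0 <= n <= 4 -> mord g s q = weyl_order n.
Proof.
move=> /andP[n0 n4].
have [e|[e|[e|[e|e]]]] : n = 0 \/ n = 1 \/ n = 2 \/ n = 3 \/ n = 4 by lia.
- have a0 : a = 0 /\ c = 0.
    have := pairing_eq0C RS (br s) (br q); rewrite pa pc !intr_eq0.
    by move/eqP: e; rewrite mulf_eq0 => /orP[] h0; rewrite h0; [move/esym|]; move=> /eqP ?; split=> //; apply/eqP.
  rewrite e /=; apply: mord_eq => //; first by rewrite e.
    have uN x : plane x -> u x = - x.
      move=> [k [l ->]]; rewrite uD !uZ us uq e a0.1 a0.2.
      by apply/rowP => i; rewrite !mxE; ring.
    by move=> x hx; change (u (u x) = x); rewrite (uN _ (plane_u hx)) uN // opprK.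
  by move=> X _ e1 _ j hj; have -> : j = 1%N; [by clear -hj; lia|by rewrite e1 e].
- rewrite e /=; apply: mord_eq => //; first by rewrite e.
    by move=> x hx; rewrite !recn // e /=; apply/rowP => i; rewrite !mxE; ring.
  move=> X e0 e1 eR j hj; have {hj} : j = 1%N \/ j = 2%N by clear -hj; lia.
  by case=> [->|->]; rewrite ?eR e1 ?e0 e.
- rewrite e /=; apply: mord_eq => //; first by rewrite e.
    by move=> x hx; rewrite !recn // e /=; apply/rowP => i; rewrite !mxE; ring.
  move=> X e0 e1 eR j hj; have {hj} : j = 1%N \/ j = 2%N \/ j = 3%N by clear -hj; lia.
  by case=> [->|[->|->]]; rewrite ?eR e1 ?e0 e.
- rewrite e /=; apply: mord_eq => //; first by rewrite e.
    by move=> x hx; rewrite !recn // e /=; apply/rowP => i; rewrite !mxE; ring.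
  move=> X e0 e1 eR j hj; have {hj} : j = 1%N \/ j = 2%N \/ j = 3%N \/ j = 4%N \/ j = 5%N by clear -hj; lia.
  by case=> [->|[->|[->|[->|->]]]]; rewrite ?eR e1 ?e0 e.
(* For n = 4, u is unipotent on the plane, so a finite order forces 2 b_s = a b_q and the normals
   are opposite. Then U is a translation, which is nonzero because two positive roots cannot be
   opposite normals of walls through 0. *)
rewrite e /=; apply/eqP; rewrite -leqn0 leqNgt; apply/negP => m0.
have em := mordP m0; set m := mord g s q in m0 em.
have yj j : iter j u (bn s) = bn s + j%:R *: (2%:R *: bn s - a%:~R *: bn q).
  suff [] : iter j u (bn s) = bn s + j%:R *: (2%:R *: bn s - a%:~R *: bn q) /\
    iter j.+1 u (bn s) = bn s + j.+1%:R *: (2%:R *: bn s - a%:~R *: bn q) by [].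
  elim: j => [|j [IH1 IH2]]; split=> //.
  - by rewrite scale0r addr0.
  - by rewrite /iter us e; apply/rowP => i; rewrite !mxE; ring.
  - rewrite recn // IH1 IH2 e -!natr1; apply/rowP => i; rewrite !mxE; ring.
have ym : iter m u (bn s) = bn s.
  by have := T_iterD m 0 (bn s); rewrite em !(shifted1 RS AI) !add0r => <-.
have d : 2%:R *: bn s - a%:~R *: bn q = 0.
  apply/eqP; have /eqP := yj m; rewrite ym -{1}[bn s]addr0 (inj_eq (addrI _)) eq_sym scaler_eq0.
  by rewrite pnatr_eq0 => /orP[/eqP m00|//]; rewrite m00 in m0.
have hsn : bn s = - bn q.
  have h1 : bn s = (a%:~R / 2%:R) *: bn q.
    by move/eqP: d; rewrite subr_eq0 mulrC -scalerA => /eqP <-; rewrite scalerA mulVf // scale1r.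
  by case: (proportional_roots RS (br q) (br s) h1) => // e1; case/eqP: bsq; rewrite e1.
pose k : rat := ((wn s + wn q) * p)%:R.
have TU z : T U z = z - k *: bn s.
  have hq z' : <|z', bn q|> = - <|z', bn s|> by rewrite hsn pairingNr // opprK.
  rewrite (shifted_mul AI) !TG /wall_form pairingB pairingZ !hq (_ : bn q = - bn s); last by rewrite hsn opprK.
  rewrite pairingN (roots_pair2 RS (br s)) /k !natrM natrD.
  by apply/rowP => i; rewrite !mxE; ring.
have TUm z j : iter j (T U) z = z - (j%:R * k) *: bn s.
  elim: j => [|j IH] /=; first by rewrite mul0r scale0r subr0.
  by rewrite IH TU -natr1; apply/rowP => i; rewrite !mxE; ring.
have := TUm 0 m; rewrite -shifted_exp em (shifted1 RS AI) sub0r => /esym/eqP; rewrite oppr_eq0 scaler_eq0.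
rewrite (negbTE (root_neq0 RS (br s))) orbF mulf_eq0 pnatr_eq0 gtn_eqF //= pnatr_eq0 muln_eq0.
have -> : (p == 0)%N = false by apply/negbTE; rewrite -lt0n -(ltr0n rat).
rewrite orbF addn_eq0 => /andP[w1 w2].
have [[[h1 p1] _ _] [[h2 p2] _ _]] := (wallP s, wallP q).
by move: hsn; rewrite /normal w1 w2 => h3; case: (posN RS h2 p2); rewrite -h3.
Qed.

End Pair.
End Order.

(** * Affine Cartan matrices *)

(** Row u of M c = 0 gives - M u v c v <= 2 c u, the other off-diagonal terms being nonpositive; the
    inequalities for (s, q) and (q, s) are multiplied. *)
Lemma cartan_prod_bound (S : finType) (M : S -> S -> rat) (c : S -> rat) :
  (forall s, M s s = 2%:R) -> (forall s q, s != q -> M s q <= 0) ->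
  (forall s, 0 < c s) -> (forall s, \sum_q M s q * c q = 0) ->
  forall s q, s != q -> 0 <= M s q * M q s <= 4%:R.
Proof.
move=> M2 M0 c0 Mc s q sq; have qs : q != s by rewrite eq_sym.
have bnd u v : u != v -> - M u v * c v <= 2%:R * c u.
  move=> uv; have := Mc u; rewrite (bigD1 u) //= (bigD1 v) 1?eq_sym //= M2.
  have : \sum_(i | (i != u) && (i != v)) M u i * c i <= 0.
    apply: sumr_le0 => i /andP[iu _]; rewrite mulr_le0_ge0 ?(ltW (c0 i)) // M0 // eq_sym //.
  lra.
have b1 := bnd _ _ sq; have b2 := bnd _ _ qs; have m1 := M0 _ _ sq; have m2 := M0 _ _ qs.
have cs := c0 s; have cq := c0 q; apply/andP; split; first by rewrite mulr_le0.
have cc : 0 < c s * c q by rewrite mulr_gt0.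
rewrite -(ler_pM2r cc).
have -> : M s q * M q s * (c s * c q) = (- M s q * c q) * (- M q s * c s) by ring.
have -> : 4%:R * (c s * c q) = (2%:R * c s) * (2%:R * c q) by ring.
by apply: ler_pM => //; rewrite mulr_ge0 ?oppr_ge0 // ltW.
Qed.

Lemma amgm_eq (a b m : rat) : 0 <= a -> 0 <= b -> 0 <= m -> a * b = m ^+ 2 ->
  2%:R * m <= a + b /\ (a + b = 2%:R * m -> a = m).
Proof.
move=> a0 b0 m0 e; split.
  rewrite -(ler_sqr (x := _ * m)) ?nnegrE ?mulr_ge0 ?addr_ge0 //.
  have := sqr_ge0 (a - b); nra.
move=> e2; have : (a - b) ^+ 2 = 0.
  have -> : (a - b) ^+ 2 = (a + b) ^+ 2 - 4%:R * (a * b) by ring.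
  by rewrite e e2; ring.
by move/eqP; rewrite sqrf_eq0 subr_eq0 => /eqP ab; lra.
Qed.

Lemma weyl_order_inj (m n : int) : 0 <= m <= 4 -> 0 <= n <= 4 -> weyl_order m = weyl_order n -> m = n.
Proof. by case: m => [[|[|[|[|[|m]]]]]|m] //; case: n => [[|[|[|[|[|n]]]]]|n]. Qed.

(** * Comparison of the Cartan matrix with the wall normals *)

Section Kappa.
Variables (r : nat) (I : finType) (Phi : root_datum r I).
Hypothesis RS : root_system Phi.
Hypothesis irr : irreducible_roots Phi.
Local Notation E := 'rV[rat]_r.
Local Notation "<| b , a |>" := (pairing Phi b a).
Local Notation roots := (roots Phi).
Local Notation simple := (simple Phi).
Local Notation refl := (refl Phi).
Local Notation h := (coxeter_number Phi).
Local Notation rho := (half_sum Phi).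
Variable p : nat.
Hypothesis hp : (h < p)%N.
Variables (W : groupType) (S : finType) (g : S -> W).
Hypothesis coxW : coxeter_system g.
Variable tau : W -> E -> E.
Hypothesis AI : affine_identification Phi p g tau.
Local Notation wd := (wd g).

Let simple_in i : simple i \in roots. Proof. exact: simple_roots. Qed.
Local Notation T := (shifted Phi tau).
Variables (wa : S -> E) (wn : S -> nat).
Hypothesis wallP : forall s, wall Phi p (wa s) (wn s).
Hypothesis gP : forall s, tau (g s) =1 wall_refl Phi p (wa s) (wn s).
Local Notation bn := (normal wa wn).
Local Notation ell := (wall_form Phi p wa wn).

Let pp : 0 < p%:R :> rat. Proof. exact: p_gt0 hp. Qed.
Let br s : bn s \in roots. Proof. exact: (normal_root RS wallP). Qed.
Let TG s x : T (g s) x = x - ell s x *: bn s. Proof. exact: (shifted_gen RS wallP gP). Qed.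
Variable A : S -> S -> int.
Hypothesis AW : affine_weyl_group g A.

Let wn_le1 s : (wn s <= 1)%N. Proof. by have [] := wallP s. Qed.

Lemma simple_wall i : exists s, bn s = simple i /\ wn s = 0%N.
Proof.
have si := simple_roots RS i; have ps := pos_simple RS i.
have wi : wall Phi p (simple i) 0.
  (* The midpoint of rho and its mirror image lies on the hyperplane, and every other positive root
     takes values between 0 and p at both ends. *)
  split=> //; exists (2%:R^-1 *: (rho + refl (simple i) rho) - rho); rewrite subrK; split.
    rewrite pairingZ pairingD -[X in _ + <|_, X|>](opprK (simple i)) pairingNr ?rootN //.
    by rewrite -(refl_self RS si) pairing_refl // subrr mulr0 mul0n.
  move=> a [ha pa] /eqP ne; rewrite pairingZ pairingD.
  have pr := refl_simple_pos RS ha pa ne; have hr := refl_root RS si ha.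
  have -> : <|refl (simple i) rho, a|> = <|rho, refl (simple i) a|>.
    by rewrite -[in LHS](reflK RS si a) pairing_refl.
  have /andP[h1 h2] := rho_alcove RS irr hp ha pa; have /andP[h3 h4] := rho_alcove RS irr hp hr pr.
  by rewrite mulrC ltr_pdivlMr // ltr_pdivrMr //; apply/andP; split; lra.
have [s hs] := aff_walls AI wi; exists s.
have H x : ell s x *: bn s = <|x, simple i|> *: simple i.
  have := TG s x; rewrite /shifted hs /wall_refl subrK mul0n subr0 addrAC subrK => /addrI/oppr_inj.
  by move->.
have n0 : wn s = 0%N.
  have := H 0; rewrite /wall_form !pairing0 scale0r add0r => /eqP; rewrite scaler_eq0 (negbTE (root_neq0 RS (br s))) orbF.
  rewrite pnatr_eq0 muln_eq0 => /orP[/eqP //|/eqP p0].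
  by move: pp; rewrite p0 ltxx.
split=> //; have := H (simple i); rewrite (roots_pair2 RS si) => e.
have e2 : simple i = (ell s (simple i) / 2%:R) *: bn s.
  by rewrite mulrC -scalerA e scalerA mulVf // scale1r.
case: (proportional_roots RS (br s) si e2) => // e3.
have [[ha pa] _ _] := wallP s; case: (posN RS ha pa).
by move: e3; rewrite /normal n0 => <-.
Qed.

(** If every wall passed through 0, all of W would fix 0, but W contains nonzero translations. *)
Lemma affine_wall : exists s, wn s = 1%N.
Proof.
apply: contrapT => hn; have n0 s : wn s = 0%N.
  by case: (wn s) (wn_le1 s) (fun e => hn (ex_intro _ s e)) => [|[|//]] // _ /(_ erefl).
have T0 t : T (wd t) 0 = 0.
  elim: t => [|s t IH]; first by rewrite wd_nil (shifted1 RS AI).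
  by rewrite wd_cons (shifted_mul AI) IH TG /wall_form pairing0 n0 mul0n addr0 scale0r subr0.
have [a ha] := exists_root irr.
have [x hx] := shifted_surj AI (l := [::]) isT (lattice_root RS ha).
have [t e] := coxeter_gen coxW x.
have := hx 0; rewrite e T0 /= add0r => /esym/eqP; rewrite scaler_eq0 (negbTE (root_neq0 RS ha)) orbF.
by move=> /eqP e0; move: pp; rewrite e0 ltxx.
Qed.

Let obt s q : s != q -> <|bn s, bn q|> <= 0.
Proof. exact: (normal_obtuse RS hp coxW AI wallP gP). Qed.

Lemma cartan_adj s q : s != q -> A s q <> 0 -> <|bn q, bn s|> != 0.
Proof.
move=> sq nA; apply/negP => /eqP z; have [AC Am] := AW.
have /intrP[a ea] := roots_int RS (br q) (br s).
have a0 : a = 0.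
  by apply/eqP; rewrite -(intr_eq0 rat) -ea -(pairing_eq0C RS) ?br // z eqxx.
have c0 : <|bn q, bn s|> = 0%:~R by [].
have := mord_normal RS hp coxW AI wallP gP sq ea c0; rewrite mulr0 => /(_ isT); rewrite Am //=.
have : A s q * A q s <> 0.
  by move/eqP; rewrite mulf_eq0 => /orP[] /eqP // /(gcm_sym0 AC).
by case: (A s q * A q s) => [[|[|[|[|n]]]]|n].
Qed.

(** Expanding the root of an affine wall in simple roots gives a nonnegative relation. If the
    coefficient at v is 0, pairing with b_v leaves a sum of nonpositive terms equal to 0, so the
    zero set is closed under adjacency, against indecomposability. *)
Lemma normal_relation : exists2 x : S -> rat, forall s, 0 < x s & \sum_s x s *: bn s = 0.
Proof.
have [s0 n1] := affine_wall; have [sw hsw] := choice simple_wall.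
have [[h0 p0] _ _] := wallP s0; have b0 : bn s0 = - wa s0 by rewrite /normal n1.
pose x s := (s == s0)%:R + \sum_(i | sw i == s) simple_coord Phi i (wa s0).
have x0 s : 0 <= x s by rewrite addr_ge0 ?ler0n ?sumr_ge0 // => i _; apply: coord_pos.
have ex : \sum_s x s *: bn s = 0.
  under eq_bigr => s _ do rewrite scalerDl.
  rewrite big_split /= (bigD1 s0) //= eqxx scale1r big1 ?addr0; last first.
    by move=> s /negbTE ->; rewrite scale0r.
  under eq_bigr => s _ do rewrite scaler_suml.
  rewrite (exchange_big_dep xpredT) //= b0; apply/eqP; rewrite addrC subr_eq0; apply/eqP.
  rewrite [RHS](coordE RS); apply: eq_bigr => i _.
  by rewrite (big_pred1 (sw i)) ?(hsw i).1 // => s; rewrite /= eq_sym.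
exists x => // s; rewrite lt_neqAle x0 andbT eq_sym; apply: contrapT => /negP/negPn/eqP xs.
have [AC _] := AW; have [_ ind] := gcm_indec AC.
have [||u [v [xu /negPn/eqP xv nA]]] := ind (fun s => x s != 0).
- exists s0; rewrite gt_eqF // ltr_pwDl // ?eqxx // sumr_ge0 // => i _; exact: coord_pos.
- by exists s; rewrite xs eqxx.
have uv : u != v by apply: contraNneq xu => ->; rewrite xv.
have /eqP := congr1 (fun y => <|y, bn v|>) ex; rewrite pairing_sum pairing0.
under eq_bigr => q _ do rewrite pairingZ.
rewrite (bigD1 v) //= xv mul0r add0r -oppr_eq0 -sumrN psumr_eq0 => [/allP/(_ u)|q qv]; last first.
  by rewrite oppr_ge0 mulr_ge0_le0 // obt.
rewrite mem_index_enum uv oppr_eq0 mulf_eq0 (negbTE xu) /= => /(_ isT).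
by rewrite (pairing_eq0C RS) ?br // => /negPn; rewrite (cartan_adj uv nA).
Qed.

(** The orders of the products of generators determine the products of opposite entries of both
    matrices ([prodE]). The positive null vectors c of A and x of the normals supply the rest; kap
    is their quotient. *)
Lemma kappa_ex : exists2 kap : S -> rat, forall s, 0 < kap s &
  forall s q, (A s q)%:~R = kap s * <|bn q, bn s|> / kap q.
Proof.
have [x x0 ex] := normal_relation; have [AC Am] := AW; have [c c0 ec] := gcm_affine AC.
have ex' s : \sum_q <|bn q, bn s|> * x q = 0.
  have := congr1 (fun y => <|y, bn s|>) ex; rewrite pairing_sum pairing0 => e; rewrite -[RHS]e; apply: eq_bigr => q _.
  by rewrite pairingZ mulrC.
have prodE s q : s != q -> (A s q)%:~R * (A q s)%:~R = <|bn q, bn s|> * <|bn s, bn q|> :> rat.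
  move=> sq; have /intrP[a ea] := roots_int RS (br q) (br s).
  have /intrP[b eb] := roots_int RS (br s) (br q).
  have h1 : (0 : rat) <= (A s q)%:~R * (A q s)%:~R <= (4%:R : rat).
    have Md u : (A u u)%:~R = 2%:R :> rat by rewrite (gcm_diag AC).
    have Mo u v : u != v -> (A u v)%:~R <= (0 : rat) by move=> uv; rewrite lerz0; apply: gcm_off.
    exact: (@cartan_prod_bound S (fun s q => (A s q)%:~R) c Md Mo c0 ec s q sq).
  have h2 : 0 <= <|bn q, bn s|> * <|bn s, bn q|> <= 4%:R.
    have Md u := roots_pair2 RS (br u).
    have Mo u v : u != v -> <|bn v, bn u|> <= 0 by rewrite eq_sym; apply: obt.
    exact: (@cartan_prod_bound S (fun s q => <|bn q, bn s|>) x Md Mo x0 ex' s q sq).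
  rewrite ea eb -!intrM in h1 h2 *; congr (_%:~R).
  have {}h1 : 0 <= A s q * A q s <= 4 by move: h1; rewrite ler0z (ler_int _ _ 4).
  have {}h2 : 0 <= a * b <= 4 by move: h2; rewrite mulrC ler0z (ler_int _ _ 4).
  rewrite [RHS]mulrC; apply: weyl_order_inj => //.
  by rewrite -Am // -(mord_normal RS hp coxW AI wallP gP sq ea eb).
pose ips s := inner_product Phi (bn s) (bn s).
have ips0 s : 0 < ips s by apply: (ip_gt0 RS); apply: (root_neq0 RS); apply: br.
(* Scaled so that the off-diagonal rows of [al] and of the symmetric [m] both sum to 2 x_s^2 (b_s,
   b_s). As al s q * al q s = (m s q)^2, each al s q + al q s - 2 m s q is nonnegative; their total
   is 0, so all vanish. *)
pose al s q := - (x s ^+ 2 * ips s * (A s q)%:~R * c q / c s).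
pose m s q := - (2%:R * x s * x q * inner_product Phi (bn q) (bn s)).
have mE s q : m s q = - (x s * x q * <|bn q, bn s|> * ips s).
  by rewrite /m -!mulrA -(pairing_ip RS) ?br //; ring.
have cN s : c s != 0 by rewrite gt_eqF.
have alm s q : s != q -> al s q * al q s = m s q ^+ 2.
  move=> sq; have -> : al s q * al q s =
      x s ^+ 2 * ips s * (x q ^+ 2 * ips q) * ((A s q)%:~R * (A q s)%:~R).
    by rewrite /al; field; rewrite !cN.
  have -> : m s q ^+ 2 = m s q * - (2%:R * x s * x q * inner_product Phi (bn q) (bn s)) by rewrite expr2.
  rewrite prodE // mE ipC.
  have := pairing_ip RS (bn s) (br q) => e2.
  transitivity (x s ^+ 2 * x q ^+ 2 * ips s * <|bn q, bn s|> * (<|bn s, bn q|> * ips q)); first by ring.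
  by rewrite /ips -e2; ring.
have msym s q : m s q = m q s by rewrite /m ipC; ring.
have al0 s q : s != q -> 0 <= al s q.
  move=> sq; have -> : al s q = x s ^+ 2 * ips s * (- (A s q)%:~R) * c q / c s by rewrite /al; ring.
  have h1 : 0 <= - (A s q)%:~R :> rat by rewrite oppr_ge0 lerz0; apply: gcm_off.
  by rewrite !mulr_ge0 ?invr_ge0 ?(ltW (c0 _)) ?(ltW (ips0 _)) ?exprn_ge0 ?(ltW (x0 _)).
have m0 s q : s != q -> 0 <= m s q.
  move=> sq; have -> : m s q = x s * x q * (- <|bn q, bn s|>) * ips s by rewrite mE; ring.
  have h1 : 0 <= - <|bn q, bn s|> by rewrite oppr_ge0; apply: obt; rewrite eq_sym.
  by rewrite !mulr_ge0 ?(ltW (x0 _)) ?(ltW (ips0 _)).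
have sal s : \sum_(q | s != q) al s q = 2%:R * x s ^+ 2 * ips s.
  have := ec s; rewrite (bigD1 s) //= (gcm_diag AC) => /eqP; rewrite addrC addr_eq0 => /eqP e.
  transitivity (- (x s ^+ 2 * ips s / c s) * \sum_(q | q != s) (A s q)%:~R * c q).
    rewrite mulr_sumr; apply: eq_big => [q|q _]; first by rewrite eq_sym.
    by rewrite /al; ring.
  by rewrite e; field.
have sm s : \sum_(q | s != q) m s q = 2%:R * x s ^+ 2 * ips s.
  have := ex' s; rewrite (bigD1 s) //= (roots_pair2 RS (br s)) => /eqP; rewrite addrC addr_eq0 => /eqP e.
  transitivity (- (x s * ips s) * \sum_(q | q != s) <|bn q, bn s|> * x q).
    rewrite mulr_sumr; apply: eq_big => [q|q _]; first by rewrite eq_sym.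
    by rewrite mE; ring.
  by rewrite e; ring.
have tot : \sum_s \sum_(q | s != q) (al s q + al q s - 2%:R * m s q) = 0.
  have e1 : \sum_s \sum_(q | s != q) al q s = \sum_s \sum_(q | s != q) al s q.
    by rewrite (exchange_big_dep xpredT) //=; apply: eq_bigr => s _; apply: eq_bigl => q; rewrite eq_sym.
  under eq_bigr => s _ do rewrite sumrB big_split /=.
  rewrite sumrB big_split /= e1; apply/eqP; rewrite subr_eq0; apply/eqP.
  rewrite -big_split /=; apply: eq_bigr => s _; rewrite -mulr_sumr sal sm; ring.
have neq_sym (u v : S) : u != v -> v != u by rewrite eq_sym.
have eqm s q : s != q -> al s q = m s q.
  have AG (u v : S) (uv : u != v) := amgm_eq (al0 u v uv) (al0 v u (neq_sym u v uv)) (m0 u v uv) (alm u v uv).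
  move=> sq; have [_] := AG s q sq.
  apply; apply/eqP; rewrite -subr_eq0; move/eqP: tot; rewrite psumr_eq0 => [/allP/(_ s)|u _].
    rewrite mem_index_enum => /(_ isT) /=; rewrite psumr_eq0 => [/allP/(_ q)|v sv].
      by rewrite mem_index_enum sq => /(_ isT).
    by rewrite subr_ge0; have [] := AG s v sv.
  by apply: sumr_ge0 => v sv; rewrite subr_ge0; have [] := AG u v sv.
exists (fun s => c s / x s) => [s|s q]; first by rewrite divr_gt0.
have xN s' : x s' != 0 by rewrite gt_eqF.
have [<-|sq] := eqVneq s q.
  by rewrite (gcm_diag AC) (roots_pair2 RS (br s)); field; rewrite xN cN.
have := eqm s q sq; rewrite mE /al => /oppr_inj e.
have iN : ips s != 0 by rewrite gt_eqF.
have -> : (A s q)%:~R = (x s ^+ 2 * ips s * (A s q)%:~R * c q / c s) * (c s / (x s ^+ 2 * ips s * c q)).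
  by field; rewrite iN xN !cN.
by rewrite e; field; rewrite iN !xN !cN.
Qed.

End Kappa.

(** * The kernel of a realization in characteristic p *)

Section Kernel.
Variables (r : nat) (I : finType) (Phi : root_datum r I).
Hypothesis RS : root_system Phi.
Hypothesis irr : irreducible_roots Phi.
Local Notation E := 'rV[rat]_r.
Local Notation "<| b , a |>" := (pairing Phi b a).
Local Notation roots := (roots Phi).
Local Notation simple := (simple Phi).
Local Notation refl := (refl Phi).
Local Notation refls := (refls Phi).
Local Notation h := (coxeter_number Phi).
Local Notation lattice := (in_root_lattice Phi).
Variable p : nat.
Hypothesis hp : (h < p)%N.
Variables (W : groupType) (S : finType) (g : S -> W).
Hypothesis coxW : coxeter_system g.
Variable tau : W -> E -> E.
Hypothesis AI : affine_identification Phi p g tau.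
Local Notation wd := (wd g).

Let simple_in i : simple i \in roots. Proof. exact: simple_roots. Qed.
Local Notation T := (shifted Phi tau).
Variables (wa : S -> E) (wn : S -> nat).
Hypothesis wallP : forall s, wall Phi p (wa s) (wn s).
Hypothesis gP : forall s, tau (g s) =1 wall_refl Phi p (wa s) (wn s).
Local Notation bn := (normal wa wn).
Local Notation ell := (wall_form Phi p wa wn).

Let pp : 0 < p%:R :> rat. Proof. exact: p_gt0 hp. Qed.
Let br s : bn s \in roots. Proof. exact: (normal_root RS wallP). Qed.
Let TG s x : T (g s) x = x - ell s x *: bn s. Proof. exact: (shifted_gen RS wallP gP). Qed.
Variable A : S -> S -> int.
Hypothesis AW : affine_weyl_group g A.
Variables (k : fieldType) (d : nat) (rh : W -> 'M[k]_d).
Variables (alv : S -> 'cV[k]_d) (al : S -> 'rV[k]_d).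
Hypothesis real : realization A alv al.
Hypothesis repr : reflection_representation g rh alv al.
Hypothesis pk : p \in [pchar k].
Local Notation winv w x := (refls (rev [seq bn t | t <- w]) x).

Let wn_le1 s : (wn s <= 1)%N. Proof. by have [] := wallP s. Qed.
Let rhM x y : rh (x * y)%g = rh x *m rh y. Proof. by case: repr => [[]]. Qed.
Let rh1 : rh 1%g = 1%:M. Proof. by case: repr => [[]]. Qed.
Let rhg s : rh (g s) = 1%:M - alv s *m al s. Proof. by case: repr. Qed.
Let alE s q : al q *m alv s = (A s q)%:~R%:M. Proof. exact: real_pairing. Qed.
Let pr : prime p. Proof. exact: pcharf_prime pk. Qed.

Let bns l : all (mem roots) [seq bn t | t <- l].
Proof. by apply/allP => _ /mapP[t _ ->]; apply: br. Qed.
Let bnsr l : all (mem roots) (rev [seq bn t | t <- l]).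
Proof. by rewrite all_rev. Qed.

Let h2 : (2 <= h)%N. Proof. by rewrite -(ler_nat rat); apply: coxeter_ge2. Qed.
Let p3 : (3 <= p)%N. Proof. exact: leq_ltn_trans h2 hp. Qed.

Let int_eq0 (m : int) : (m%:~R == 0 :> k) = (p %| `|m|)%N.
Proof. by rewrite (dvdn_pcharf pk); case: m => n //=; rewrite NegzE mulrNz oppr_eq0. Qed.

(** An integer that links the two worlds: its image in k is a matrix coefficient of w on V, and over
    the rationals it is, up to a quotient of kap, a pairing of roots. *)
Fixpoint cartan_word (w : seq S) (q s : S) : int :=
  if w is t :: w' then cartan_word w' q s - A t q * cartan_word w' t s else A s q.

Lemma rep_cartan_word w q s : al q *m rh (wd w) *m alv s = (cartan_word w q s)%:~R%:M.
Proof.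
elim: w q => [|t w IH] q; first by rewrite wd_nil rh1 mulmx1 alE.
rewrite wd_cons rhM rhg mulmxA mulmxBr mulmx1 !mulmxBl IH mulmxA alE.
by rewrite mul_scalar_mx -!scalemxAl IH /= intrB intrM raddfB /= -[(_ * _)%:M]scale_scalar_mx.
Qed.

Lemma cartan_wordE kap w q s : (forall s, 0 < kap s) ->
  (forall s q, (A s q)%:~R = kap s * <|bn q, bn s|> / kap q) ->
  (cartan_word w q s)%:~R = kap s / kap q * <|winv w (bn q), bn s|>.
Proof.
move=> k0 hk; have kN u : kap u != 0 by rewrite gt_eqF.
elim: w q => [|t w IH] q /=; first by rewrite hk; ring.
rewrite rev_cons -cats1 refls_cat /= intrB intrM !IH hk reflE -scaleN1r scalerA mulN1r.
by rewrite reflsD reflsZ pairingD pairingZ; field; rewrite !kN.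
Qed.

Lemma shifted_linear w x : T (wd w) x = T (wd w) 0 + refls [seq bn t | t <- w] x.
Proof.
elim: w x => [|s w IH] x; first by rewrite wd_nil !(shifted1 RS AI) add0r.
rewrite wd_cons !(shifted_mul AI) (IH x) !TG /= reflE /wall_form pairingD.
by apply/rowP => i; rewrite !mxE; ring.
Qed.

(** Unless a = b or a = - b, equal lengths give |u| < 2, so p <= |u - 2| <= 3, which leaves p = 3
    and h = 2. Then [pairing_bound] forces u = 0, but 3 does not divide 2. The case a = - b would
    make p divide 4. *)
Lemma same_length_root a b : a \in roots -> b \in roots ->
  inner_product Phi a a = inner_product Phi b b -> forall u : int, <|a, b|> = u%:~R -> (p %| `|u - 2|)%N -> a = b.
Proof.
move=> ha hb L u eu pu; have [//|ab] := eqVneq a b.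
have b0 : 0 < inner_product Phi b b by apply: (ip_gt0 RS); apply: root_neq0 hb.
have [e|aNb] := eqVneq a (- b).
  move: eu; rewrite e pairingN (roots_pair2 RS hb) => /esym/eqP.
  rewrite -[- 2%:R]/((-2)%:~R) eqr_int => /eqP u2; move: pu; rewrite u2 /= => p4.
  have {}p4 : (p %| 4)%N by [].
  by move: p3 pr p4 (dvdn_leq (isT : (0 < 4)%N) p4); case: (p) => [|[|[|[|[|n]]]]].
have e1 := pairing_ip RS a hb; rewrite eu in e1.
have l1 : 0 < inner_product Phi (a - b) (a - b) by apply: (ip_gt0 RS); rewrite subr_eq0.
have l2 : 0 < inner_product Phi (a + b) (a + b) by apply: (ip_gt0 RS); rewrite addr_eq0.
rewrite !(ipDl, ipDr, ipNl, ipNr) [inner_product Phi b a]ipC L in l1 l2.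
have u1 : u < 2.
  rewrite -(ltr_int rat) ltNge; apply/negP => h0; move: l1; apply/negP; rewrite -leNgt; nra.
have u3 : -2 < u.
  rewrite -(ltr_int rat) ltNge; apply/negP => h0; move: l2; apply/negP; rewrite -leNgt; nra.
have lep : (p <= `|u - 2|)%N by apply: dvdn_leq pu; clear -u1; lia.
have ub : (`|u - 2| <= 3)%N by clear -u1 u3; lia.
have hb2 : h%:R - 2%:R <= 0 :> rat.
  by rewrite subr_le0 ler_nat; have := leq_trans hp (leq_trans lep ub).
have u0 : <|a, b|> != 0.
  rewrite eu intr_eq0; clear -u1 u3 lep p3; apply/eqP => e; rewrite e in lep; have := leq_trans p3 lep; by [].
have := pairing_bound RS irr hb ha ab aNb u0; rewrite leNgt => /negP[].
by apply: le_lt_trans hb2 _; rewrite normr_gt0.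
Qed.

Definition ker_translation (c : E) : Prop := lattice c /\
  exists2 x, rh x = 1%:M & forall z, T x z = z + p%:R *: c.
Local Notation K := ker_translation.

(** In the entries with q = s the kap cancel, so triviality on V says that <w^-1 b_q, b_q> is 2
    modulo p; [same_length_root] turns this into w^-1 b_q = b_q, and the normals span. *)
Lemma kernel_translation x : rh x = 1%:M -> exists2 c, K c & forall z, T x z = z + p%:R *: c.
Proof.
move=> hx; have [w ew] := coxeter_gen coxW x.
have [kap k0 hk] := kappa_ex RS irr hp coxW AI wallP gP AW.
have fixb q : winv w (bn q) = bn q.
  have hr : winv w (bn q) \in roots by apply: refls_root.
  have := cartan_wordE w q q k0 hk; rewrite divff ?gt_eqF // mul1r => /esym e.
  apply: (same_length_root hr (br q) _ e); first by rewrite ip_refls.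
  rewrite -int_eq0 intrB subr_eq0; apply/eqP.
  have := rep_cartan_word w q q; rewrite -ew hx mulmx1 alE (gcm_diag AW.1) => /(congr1 (fun M : 'M_1 => M 0 0)).
  by rewrite !mxE eqxx !mulr1n => <-.
have fixz z : refls [seq bn t | t <- w] z = z.
  have f1 : winv w z = z.
    rewrite (coordE RS z); elim/big_ind: _ => [|u v eu ev|i _].
    - by rewrite -(scale0r 0) reflsZ !scale0r.
    - by rewrite reflsD eu ev.
    - by have [s [<- _]] := simple_wall RS irr hp AI wallP gP i; rewrite reflsZ fixb.
  by rewrite -[in LHS]f1 -{1}(revK [seq bn t | t <- w]) refls_rev.
have [l [c [hl hc hT]]] := shifted_affine AI x.
have e0 : T x 0 = p%:R *: c.
  rewrite hT; suff -> : refls l 0 = 0 by rewrite add0r.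
  by rewrite -(scale0r 0) reflsZ !scale0r.
have hz z : T x z = z + p%:R *: c by rewrite ew shifted_linear fixz -ew e0 addrC.
by exists c => //; split=> //; exists x.
Qed.

Lemma rhV x : rh x *m rh x^-1%g = 1%:M.
Proof. by rewrite -rhM mulgV. Qed.

Lemma ker_translationB c c' : K c -> K c' -> K (c - c').
Proof.
move=> [lc [x hx ex]] [lc' [y hy ey]]; split; first by apply: latticeD => //; apply: latticeN.
exists (x * y^-1)%g => [|z].
  by rewrite rhM hx mul1mx -[LHS]mul1mx -hy rhV.
rewrite (shifted_mul AI) ex; have : T y (T y^-1%g z) = z by rewrite -(shifted_mul AI) mulgV (shifted1 RS AI).
by rewrite ey => e; rewrite -[in RHS]e; apply/rowP => i; rewrite !mxE; ring.
Qed.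

Lemma exists_shifted_refl a : a \in roots -> exists y, forall z, T y z = refl a z.
Proof.
move=> ha; have [y hy] := shifted_surj AI (l := [:: a]) (eq_ind_r is_true ha (andbT _)) (lattice0 Phi).
by exists y => z; rewrite hy scaler0 addr0.
Qed.

Lemma ker_translation_refl a c : a \in roots -> K c -> K (refl a c).
Proof.
move=> ha [lc [x hx ex]]; have [y hy] := exists_shifted_refl ha; split.
  rewrite reflE; apply: latticeD => //; apply: latticeN.
  have /intrP[m ->] := lattice_pairing RS lc ha.
  by apply: latticeZ; apply: lattice_root.
exists (y * x * y^-1)%g => [|z]; first by rewrite !rhM hx mulmx1 rhV.
have e : T y^-1%g z = refl a z.
  by rewrite -{2}(shifted1 RS AI z) -(mulgV y) (shifted_mul AI) hy reflK.
by rewrite !(shifted_mul AI) e ex hy reflD reflK // reflZ.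
Qed.

(** The vector is c - refl a c, and the kernel is stable under conjugation by reflections. *)
Lemma ker_translation_root a c : a \in roots -> K c -> K (<|c, a|> *: a).
Proof.
move=> ha hc; have -> : <|c, a|> *: a = c - refl a c by rewrite reflE opprB addrC subrK.
by apply: ker_translationB => //; apply: ker_translation_refl.
Qed.

(** Reflections other than that of s0 never introduce [al s0]; with the independence of the [al q]
    this keeps the vector z of [affine_root_translation] from vanishing. *)
Lemma rep_gen_expand s0 s w : s != s0 -> s0 \notin w ->
  exists2 c : S -> k, c s0 = 0 & al s *m rh (wd w) = \sum_q c q *: al q.
Proof.
move=> ss0; elim: w s ss0 => [|t w IH] s ss0.
  move=> _; exists (fun q => (q == s)%:R); first by rewrite eq_sym (negbTE ss0).
  rewrite wd_nil rh1 mulmx1 (bigD1 s) //= eqxx scale1r big1 ?addr0 // => q /negbTE ->.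
  by rewrite scale0r.
rewrite in_cons negb_or => /andP[ts0 hw]; rewrite eq_sym in ts0.
have [c1 c10 e1] := IH s ss0 hw; have [c2 c20 e2] := IH t ts0 hw.
exists (fun q => c1 q - (A t s)%:~R * c2 q); first by rewrite c10 c20 mulr0 subr0.
rewrite wd_cons rhM rhg mulmxA mulmxBr mulmx1 mulmxBl e1 mulmxA alE mul_scalar_mx -scalemxAl e2.
by rewrite scaler_sumr -sumrB; apply: eq_bigr => q _; rewrite scalerA scalerBl.
Qed.

Let two_neq0 : 2%:R != 0 :> k.
Proof. by rewrite -(dvdn_pcharf pk) gtnNdvd. Qed.

Lemma shifted_translation_exp x v j : (forall z, T x z = z + v) -> forall z, T (x ^+ j)%g z = z + j%:R *: v.
Proof.
move=> hx; elim: j => [|j IH] z; first by rewrite expg0 (shifted1 RS AI) scale0r addr0.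
by rewrite expgS (shifted_mul AI) hx IH -natr1 scalerDl scale1r addrA.
Qed.

(* The affine simple root of the wall s0 is moved by the translation along its wall root
   by a nonzero vector fixed under the translation. *)
Lemma affine_root_translation s0 (j : int) : wn s0 = 1%N ->
  K (j%:~R *: wa s0) -> (p %| `|j|)%N.
Proof.
move=> n1 [_ [x hx ex]]; set th := wa s0 in ex *.
have b0 : bn s0 = - th by rewrite /normal n1.
have hth : th \in roots by rewrite -(opprK th) rootN // -b0 br.
have [l [i el]] := root_conj_simple RS hth.
have [sw hsw] := choice (simple_wall RS irr hp AI wallP gP).
(* A word carrying a simple root to th, spelled with walls through 0 and therefore without s0. *)
pose w := [seq sw i | i <- l]; pose si := sw i.
have bw : [seq bn t | t <- w] = [seq simple i | i <- l].
  by rewrite -map_comp; apply: eq_map => i'; rewrite /= (hsw i').1.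
have bsi : bn si = simple i by rewrite (hsw i).1.
have nsi : si != s0 by apply/eqP => e; have := (hsw i).2; rewrite -/si e n1.
have nw : s0 \notin w.
  by apply/mapP => -[i' _ e]; have := (hsw i').2; rewrite -e n1.
have Tw t z : s0 \notin t -> (forall q, q \in t -> wn q = 0%N) -> T (wd t) z = refls [seq bn q | q <- t] z.
  move=> _; elim: t z => [|q t IH] z hq; first by rewrite wd_nil (shifted1 RS AI).
  rewrite wd_cons (shifted_mul AI) IH => [|q' hq']; last by apply: hq; rewrite in_cons hq' orbT.
  by rewrite TG /wall_form hq ?mem_head // mul0n addr0.
have w0 q : q \in w -> wn q = 0%N by move=> /mapP[i' _ ->]; rewrite (hsw i').2.
pose rt := (wd w * g si * wd (rev w))%g.
have Trt z : T rt z = refl th z.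
  rewrite !(shifted_mul AI) !Tw ?mem_rev // => [|q]; last by rewrite mem_rev; apply: w0.
  rewrite TG /wall_form (hsw i).2 mul0n addr0 -reflE bsi map_rev bw -el refl_conj //.
  exact: simples_roots.
(* Two reflections in parallel hyperplanes, whose product is the translation by p th. *)
pose t := (g s0 * rt)%g.
have Tt z : T t z = z + p%:R *: th.
  rewrite (shifted_mul AI) Trt TG /wall_form n1 mul1n b0 pairingNr // scalerN opprK.
  rewrite reflE pairingB pairingZ (roots_pair2 RS hth).
  by apply/rowP => i'; rewrite !mxE; ring.
have rhj : rh (t ^+ `|j|)%g = 1%:M.
  have [j0|j0] := lerP 0 j.
    suff -> : (t ^+ `|j|)%g = x by [].
    apply: (shifted_inj RS AI) => z; rewrite (shifted_translation_exp _ Tt) ex scalerA mulrC -scalerA.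
    by rewrite natr_absz ger0_norm.
  suff -> : (t ^+ `|j|)%g = x^-1%g by have := rhV x; rewrite hx mul1mx.
  apply: (shifted_inj RS AI) => z; rewrite (shifted_translation_exp _ Tt).
  have : T x (T x^-1%g z) = z by rewrite -(shifted_mul AI) mulgV (shifted1 RS AI).
  rewrite ex => e; rewrite -{1}e natr_absz ltr0_norm //.
  by apply/rowP => i'; rewrite !mxE intrN; ring.
pose be : 'rV[k]_d := al si *m rh (wd (rev w)).
pose bv : 'cV[k]_d := rh (wd w) *m alv si.
pose X := cartan_word w s0 si; pose Y := cartan_word (rev w) si s0.
have rwv : rh (wd (rev w)) *m rh (wd w) = 1%:M by rewrite wd_rev // -rhM mulVg.
have rwv' : rh (wd w) *m rh (wd (rev w)) = 1%:M by rewrite wd_rev // rhV.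
have rrt : rh rt = 1%:M - bv *m be.
  rewrite !rhM rhg mulmxBr mulmx1 mulmxBl rwv'; congr (_ - _).
  by rewrite /bv /be !mulmxA.
have e1 : al s0 *m bv = X%:~R%:M by rewrite mulmxA rep_cartan_word.
have e2 : be *m alv s0 = Y%:~R%:M by rewrite rep_cartan_word.
have e3 : be *m bv = 2%:R%:M.
  by rewrite /be /bv -mulmxA (mulmxA (rh _)) rwv mul1mx alE (gcm_diag AW.1).
have e4 : al s0 *m alv s0 = 2%:R%:M by rewrite alE (gcm_diag AW.1).
(* The quotients of kap in X and Y are inverse to each other, and each pairing is - 2. *)
have XY : X * Y = 4.
  have [kap k0 hk] := kappa_ex RS irr hp coxW AI wallP gP AW.
  have kN u : kap u != 0 by rewrite gt_eqF.
  have g1 : winv w (bn s0) = - simple i.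
    rewrite bw b0 -el reflsN refls_rev //; exact: simples_roots.
  have g2 : winv (rev w) (bn si) = th by rewrite map_rev revK bw bsi.
  apply/eqP; rewrite -(eqr_int rat) intrM /X /Y !(cartan_wordE _ _ _ k0 hk) g1 g2 bsi b0.
  rewrite pairingN pairingNr // (roots_pair2 RS hth) (roots_pair2 RS (simple_roots RS i)).
  by apply/eqP; field; rewrite !kN.
have XYk : X%:~R * Y%:~R = 4%:R :> k by rewrite -intrM XY.
(* The linear form by which t moves [al s0]. It vanishes on [alv s0] and [bv], so t fixes it and t^n
   adds n z. *)
pose z : 'rV[k]_d := X%:~R *: be - 2%:R *: al s0.
have act1 (v b : 'rV[k]_d) (a : 'cV[k]_d) : v *m (1%:M - a *m b) = v - (v *m a) *m b.
  by rewrite mulmxBr mulmx1 mulmxA.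
have u0 : al s0 *m rh t = al s0 + z.
  rewrite rhM rrt rhg mulmxA !act1 e4 mul_scalar_mx mulmxBl e1 -scalemxAl e1.
  rewrite scale_scalar_mx -raddfB /= mul_scalar_mx /z.
  by apply/rowP => i'; rewrite !mxE; ring.
have uz : z *m rh t = z.
  have za : z *m alv s0 = 0.
    rewrite /z mulmxBl -!scalemxAl e2 e4 !scale_scalar_mx XYk -raddfB /= -natrM.
    by rewrite subrr raddf0.
  have zb : z *m bv = 0.
    rewrite /z mulmxBl -!scalemxAl e3 e1 !scale_scalar_mx -raddfB /= mulrC.
    by rewrite subrr raddf0.
  by rewrite rhM rrt rhg mulmxA !act1 za mul0mx subr0 zb mul0mx subr0.
have un n : al s0 *m rh (t ^+ n)%g = al s0 + n%:R *: z.
  elim: n => [|n IH]; first by rewrite expg0 rh1 mulmx1 scale0r addr0.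
  by rewrite expgSr rhM mulmxA IH mulmxDl u0 -scalemxAl uz -natr1 scalerDl scale1r -addrA [z + _]addrC.
(* [be] is a combination of the other [al q], so [al s0] occurs in z with coefficient - 2. *)
have z0 : z != 0.
  apply/eqP => z0; have nrw : s0 \notin rev w by rewrite mem_rev.
  have [c c0 ec] := rep_gen_expand nsi nrw.
  have fr := real_roots real (c := fun q => X%:~R * c q - 2%:R * (q == s0)%:R).
  have := fr _ s0; rewrite c0 eqxx mulr0 sub0r mulr1 => h0.
  case/negP: two_neq0; rewrite -oppr_eq0; apply/eqP/h0.
  rewrite -[RHS]z0 /z /be ec scaler_sumr.
  under eq_bigr => q _ do rewrite scalerBl -!scalerA.
  rewrite sumrB; congr (_ - _); rewrite -scaler_sumr; congr (_ *: _).
  by rewrite (bigD1 s0) //= eqxx scale1r big1 ?addr0 // => q /negbTE ->; rewrite scale0r.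
have := un `|j|%N; rewrite rhj mulmx1 -{1}[al s0]addr0 => /addrI/esym/eqP.
by rewrite scaler_eq0 (negbTE z0) orbF -(dvdn_pcharf pk).
Qed.

(** For the root of an affine wall this is [affine_root_translation]. It spreads along
    non-orthogonal roots a1, a2: the kernel contains the translation for m a2, where m = <c, a2>,
    and divisibility at a1 gives p | m n with n = <a2, a1> nonzero and |n| < p. *)
Lemma ker_translation_divp c a : K c -> a \in roots -> exists m : int, <|c, a|> = p%:R * m%:~R.
Proof.
pose good a := forall c, K c -> exists m : int, <|c, a|> = p%:R * m%:~R.
suff H a' : a' \in roots -> good a' by move=> hc ha; apply: (H a ha).
have [s0 n1] := affine_wall RS irr hp coxW AI wallP gP.
have hth : wa s0 \in roots by have [[]] := wallP s0.
have g0 : good (wa s0).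
  move=> c' hc'; have /intrP[j ej] := lattice_pairing RS hc'.1 hth.
  have := ker_translation_root hth hc'; rewrite ej => /(affine_root_translation n1) /dvdnP[m em].
  exists (sgz j * m%:Z); rewrite {1}(intEsg j) em PoszM !intrM; ring.
move=> ha'; apply: contrapT => ng.
have [_ hQ] := irr.
have [||a1 [a2 [h1 h2' /asboolP q1 /asboolP q2 ne]]] := hQ (fun a => `[< good a >]).
- by exists (wa s0) => //; apply/asboolP.
- by exists a' => //; apply/asboolP.
apply: q2 => c' hc'; have /intrP[m em] := lattice_pairing RS hc'.1 h2'.
have := q1 _ (ker_translation_root h2' hc'); rewrite em pairingZ => -[m' e].
have /intrP[n en] := roots_int RS h1 h2'.
have n0 : n != 0 by rewrite -(intr_eq0 rat) -en -(pairing_eq0C RS) //; apply/eqP.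
have np : `|n%:~R| < p%:R :> rat.
  have pr3 : 3%:R <= p%:R :> rat by rewrite ler_nat.
  rewrite -en; have [e1|ne1] := eqVneq a2 a1.
    by rewrite e1 (roots_pair2 RS h1) ger0_norm //; lra.
  have [e1|ne2] := eqVneq a2 (- a1).
    by rewrite e1 pairingN (roots_pair2 RS h1) normrN ger0_norm //; lra.
  apply: le_lt_trans (pairing_bound RS irr h1 h2' ne1 ne2 _) _; first by rewrite en intr_eq0.
  have : h%:R < p%:R :> rat by rewrite ltr_nat.
  lra.
have pm : (p %| `|m|)%N.
  have : (p %| absz (m * n)%R)%N.
    have -> : m * n = p%:Z * m' by apply/eqP; rewrite -(eqr_int rat) !intrM -en e.
    by rewrite abszM dvdn_mulr.
  rewrite abszM Euclid_dvdM // => /orP[//|/dvdn_leq]; rewrite absz_gt0 => /(_ n0).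
  by rewrite leqNgt -(ltr_nat rat) natr_absz intr_norm np.
have [m1 em1] := dvdnP pm; exists (sgz m * m1%:Z).
by rewrite {1}(intEsg m) em1 PoszM !intrM; ring.
Qed.

Lemma lattice_refls l c : all (mem roots) l -> lattice c -> lattice (refls l c).
Proof.
elim: l => //= a l IH /andP[ha hl] hc; have {}IH := IH hl hc.
rewrite reflE; apply: latticeD => //; apply: latticeN.
have /intrP[m ->] := lattice_pairing RS IH ha.
by apply: latticeZ; apply: lattice_root.
Qed.

(** Elements equal on V differ by a translation by p c with c = p mu, and h < p puts mu in the root
    lattice. Two bounded points cannot differ by p^2 times the transform of mu unless its pairings
    are at most 1 in absolute value, which leaves 0. *)
Lemma rep_hatWo_inj x y : in_hatWo Phi p g tau x -> in_hatWo Phi p g tau y -> rh x = rh y -> x = y.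
Proof.
move=> hx hy e; have bx := bounded_hatWo RS irr hp coxW AI hx.
have by' := bounded_hatWo RS irr hp coxW AI hy.
have e1 : rh (x^-1 * y)%g = 1%:M by rewrite rhM -e -rhM mulVg.
have [c hc ec] := kernel_translation e1.
pose mu := (p%:R : rat)^-1 *: c; have p0 : p%:R != 0 :> rat by rewrite gt_eqF.
have cE : c = p%:R *: mu by rewrite scalerA mulfV // scale1r.
have muint a : a \in roots -> <|mu, a|> \is a Num.int.
  move=> ha; have [m em] := ker_translation_divp hc ha.
  by rewrite pairingZ em mulKf // intr_int.
have lmu : lattice mu.
  apply: (lattice_divp RS pr hp) => [|i]; first by rewrite -cE; case: hc.
  by apply: muint; apply: simple_roots.
have [l [v [hl _ hT]]] := shifted_affine AI x.
have ey z : T y z = T x z + p%:R ^+ 2 *: refls l mu.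
  have -> : y = (x * (x^-1 * y))%g by rewrite mulKVg.
  rewrite (shifted_mul AI) ec !hT reflsD cE !reflsZ scalerA expr2 addrAC //.
have l0 : refls l mu = 0.
  apply: (pairing_le1_eq0 RS (lattice_refls hl lmu)) => a ha.
  have /intrP[m em] := lattice_pairing RS (lattice_refls hl lmu) ha.
  have b1 := bx a ha; have b2 := by' a ha; rewrite ey pairingD pairingZ em in b2.
  (* From h + 1 <= p, the bound is at most (p + 1) (p - 2) < p^2, so two pairings within it differ
     by less than 2 p^2 and the integer m satisfies |m| <= 1. *)
  have [B1 B2] : (p%:R + 1) * (h%:R - 1) < p%:R ^+ 2 :> rat /\ 0 < p%:R ^+ 2 :> rat.
    have hh : h%:R + 1 <= p%:R :> rat by rewrite natr1 ler_nat.
    have hl2 : (p%:R + 1) * (h%:R - 1) <= (p%:R + 1) * (p%:R - 2%:R) :> rat.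
      by rewrite ler_wpM2l ?addr_ge0 ?ler0n //; lra.
    split; last by rewrite exprn_gt0.
    apply: le_lt_trans hl2 _; have -> : (p%:R + 1) * (p%:R - 2%:R) = p%:R ^+ 2 - (p%:R + 2%:R) :> rat by ring.
    by rewrite ltrBlDr ltrDl; have := ler0n rat p; lra.
  have q2 : `|p%:R ^+ 2 * m%:~R| < p%:R ^+ 2 * 2%:R :> rat.
    move: b1 b2 B1; set X := pairing _ _ _; set C := (_ + 1) * _; set Q := p%:R ^+ 2.
    rewrite ltr_norml !ler_norml; set M := Q * _ => /andP[b1 b3] /andP[b2 b4] B1.
    by apply/andP; split; lra.
  rewrite normrM (gtr0_norm B2) ltr_pM2l // in q2.
  by rewrite em -intr_norm; move: q2; rewrite -intr_norm (ltr_int rat _ 2) (ler_int rat _ 1) ltzD1.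
have hw z : T (x^-1 * y)%g z = z.
  by rewrite ec cE -[mu](refls_rev RS _ hl) l0 -(scale0r 0) reflsZ !scale0r !scaler0 addr0.
have := shifted_faithful AI hw => e2; by rewrite -[y](mulKVg x) e2 mulg1.
Qed.

End Kernel.

(** * The four classes of representations *)

Theorem proposition4
  (W : groupType) (S : finType) (g : S -> W)
  (coxW : coxeter_system g)
  (k : fieldType) (d : nat) (rho : W -> 'M[k]_d)
  (su : seq S) (x : W)
  (standingV : standing g rho su x)
  (xs : S -> 'rV[k]_d)
  (xsP : forall s : S, hyperplane_equation g rho s (xs s))
  (f : forall s r : S,
     B g rho (alt s r (mord g s r)) -> B g rho (alt r s (mord g s r)))
  (fP : braid_morphisms f)
  (sx : W -> seq S)
  (sxP : forall w : W, rexpr g (sx w) /\ wd g (sx w) = w)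
  (F : forall t : seq S, rexpr g t -> bpath g t (sx (wd g t)))
  (Fs : forall (t : seq S) (s : S), rexpr g t ->
     (len g (wd g t * g s)%g < len g (wd g t))%N ->
     {t' : seq S & bpath g t (rcons t' s)}) :
  right_basis (fun h : B g rho su -> Rx rho x =>
    beta_leaf xs f F Fs h).
Proof.
(* Reverted before the case analysis, which instantiates k, d and rho, on which these data
   depend. *)
move: xs xsP f fP sx sxP F Fs.
case: standingV => [k' r Phi rh su' x' [RS _] ch2 repr [rho1 _]|k' d' A rh su' x' AW ch0 [alv [al [R repr]]]
  |k' d' A p r I Phi tau rh su' x' AW pk RS irr hp AI [alv [al [R repr]]] rsu hsu hx|K rh su' x' _ _ repr]
  xs' xsP' f' fP' sx' sxP' F' Fs'.
- have two : 2%:R != 0 :> k' by apply: contra ch2 => e; rewrite inE e.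
  exact: (faithful_basis coxW repr two (fun s => lieT_pairing k' s RS) xsP' fP' F' Fs' _ _ rho1).
- have two : 2%:R != 0 :> k' by rewrite ((pcharf0P k').1 ch0).
  apply: (faithful_basis coxW repr two _ xsP' fP' F' Fs' _ _) => [s|].
    by rewrite (real_pairing R) (gcm_diag AW.1).
  exact: realization_faithful AW ch0 R repr.
- have /choice[wan hwan] s : exists an : 'rV[rat]_r * nat,
      wall Phi p an.1 an.2 /\ tau (g s) =1 wall_refl Phi p an.1 an.2.
    by have [a [n h]] := aff_simple AI s; exists (a, n).
  have inj := rep_hatWo_inj RS irr hp coxW AI (fun s => (hwan s).1) (fun s => (hwan s).2) AW R repr pk.
  have sub t : subseq t su' -> in_hatWo Phi p g tau (wd g t).
    by move=> tsu; apply: hatWo_subword hsu.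
  have two : 2%:R != 0 :> k'.
    rewrite -(dvdn_pcharf pk) gtnNdvd //; have := coxeter_ge2 RS irr; rewrite ler_nat => h2.
    exact: leq_ltn_trans h2 hp.
  apply: (reflection_basis coxW repr two _ xsP' fP') => [s|t' tsu t rt et t'' tt|t' tsu e].
  - by rewrite (real_pairing R) (gcm_diag AW.1).
  - move=> e; apply: inj => //; last exact: sub.
    by apply: hatWo_subword tt _ => //; rewrite et; apply: sub.
  - by apply: inj => //; apply: sub.
- have two : 2%:R != 0 :> K by rewrite pnatr_eq0.
  apply: (faithful_basis coxW repr two _ xsP' fP' F' Fs' _ _) => [s|].
    apply/matrixP => i j; rewrite [i]ord1 [j]ord1 -colE !mxE enum_rankK /rootic_form (mord_diag coxW).
    by rewrite divr1 cospi opprK mulr1.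
  exact: rootic_faithful repr.
Qed.
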